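(* Let $d\ge1$, $\sigma,\sigma_0\ge0$, and let $V,W:\mathbb{R}^d\to\mathbb{R}$ be twice differentiable functions such that: $\nabla^2V\ge\beta\,\mathrm{Id}$ for some $\beta>0$; $\nabla V$ is Lipschitz continuous; $W$ is symmetric ($W(x)=W(-x)$) and convex; $\nabla W$ is globally Lipschitz continuous with constant $L_W$. Let $P,Q\in\mathcal{P}_2(\mathcal{P}_2(\mathbb{R}^d))$. For $N\ge2$, consider the two particle systems $\boldsymbol{X}=(X^1,\dots,X^N)$ and $\boldsymbol{X}^N=(X^{1,N},\dots,X^{N,N})$ with dynamics, for $i\in\{1,\dots,N\}$, $$\mathrm{d}X^i_t=-\nabla V(X^i_t)\,\mathrm{d}t-\nabla W*m_t(X^i_t)\,\mathrm{d}t+\sigma\,\mathrm{d}B^i_t+\sigma_0\,\mathrm{d}B^0_t,$$ where $m_t=\mathcal{L}(X^i_t|\mathcal{F}^0_t)$, and $$\mathrm{d}X^{i,N}_t=-\nabla V(X^{i,N}_t)\,\mathrm{d}t-\frac1N\sum_{j=1}^N\nabla W(X^{i,N}_t-X^{j,N}_t)\,\mathrm{d}t+\sigma\,\mathrm{d}B^i_t+\sigma_0\,\mathrm{d}B^0_t,$$ where $(X^i_0)_{i\in\{1,\dots,N\}}$ are conditionally i.i.d. given $\mathcal{F}^0_0$ with $\mathcal{L}(X^1_0)=P$, and $(X^{i,N}_0)_{i\in\{1,\dots,N\}}$ are conditionally i.i.d. given $\mathcal{F}^0_0$ with $\mathcal{L}(X^{1,N}_0)=Q$ (both in the sense defined in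 the context). Then, for the given coefficients $V,W,\sigma,\sigma_0$, there exists a constant $C>0$ depending only on the dimension $d$ and the probability measures $P$ and $Q$ (in particular not on $t$ or $N$) such that, for all $t\ge0$ and $N\ge2$, $$\mathbb{E}\Big[\mathrm{d}_2^{\mathbb{R}^d}\big(m^{P,N}_{\boldsymbol{X}_t},m^{Q,N}_{\boldsymbol{X}^N_t}\big)\Big]\le C\Big(e^{-\beta t}+\frac{1}{2\beta\sqrt{N-1}}\Big),$$ where $m^{P,N}_{\boldsymbol{X}_t}=\frac1N\sum_{i=1}^N\delta_{X^i_t}$ and $m^{Q,N}_{\boldsymbol{X}^N_t}=\frac1N\sum_{i=1}^N\delta_{X^{i,N}_t}$.
   Context: Probabilistic setting: $(\Omega^0,\mathcal{F}^0,\mathbb{F}^0=(\mathcal F^0_t)_{t\ge0},\mathbb{P}^0)$ is a filtered probability space carrying a $d$-dimensional $\mathbb{F}^0$-Brownian motion $B^0$ (the common noise); $(\Omega^1,\mathcal{F}^1,\mathbb{F}^1,\mathbb{P}^1)$ is a filtered probability space carrying independent $d$-dimensional $\mathbb{F}^1$-Brownian motions $B^1,B^2,\dots$; $(\Omega,\mathcal{F},\mathbb{F},\mathbb{P})$ is the completed product space with $\Omega=\Omega^0\times\Omega^1$ and $\mathbb F$ the right-continuous augmentation of $(\mathcal F^0_t\otimes\mathcal F^1_t)_{t\ge0}$, so the $B^i$ are independent of $\mathbb{F}^0$. For a random variable $X$ on $\Omega$, $\mathcal{L}^1(X)$ denotes the random measure $\Omega^0\ni\omega_0\mapsto\mathcal{L}(X(\omega_0,\cdot))\in\mathcal{P}(\mathbb{R}^d)$,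 which is a conditional law of $X$ given $\mathcal{F}^0$. For $P\in\mathcal{P}_2(\mathcal{P}_2(\mathbb{R}^d))$, one writes $\mathcal{L}(X)=P$ when the random measure $\mathcal{L}^1(X)$ has law $P$; for initial conditions, this means the conditional law of $X_0$ given $\mathcal{F}^0_0$ is an $\mathcal{F}_0^0$-measurable random measure with law $P$. For a metric space $(E,d)$ and $p\ge1$, $\mathcal{P}_p(E)$ is the set of Borel probability measures on $E$ with finite $p$-th moment and $\mathrm{d}_p^E$ is the $p$-Wasserstein distance on it. $\mathcal{P}_2(\mathcal{P}_2(\mathbb{R}^d))$ uses the base metric $\mathrm{d}_2^{\mathbb{R}^d}$ on $\mathcal{P}_2(\mathbb{R}^d)$. *)

(* Defs.v *)
From HB Require Import structures.
From mathcomp Require Import all_boot all_order all_algebra.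
From mathcomp Require Import interval_inference.
From mathcomp Require Import all_classical all_reals all_analysis measurable_realfun.
Set Implicit Arguments.
Unset Strict Implicit.
Unset Printing Implicit Defensive.
Import Order.TTheory GRing.Theory Num.Theory.
Import numFieldNormedType.Exports.
Local Open Scope classical_set_scope.
Local Open Scope ring_scope.

(* The library norm on 'rV[R]_d is the sup norm; the Euclidean structure is
   therefore introduced separately.  Both norms induce the same topology, so the
   library's topology and (Frechet) derivatives on 'rV[R]_d are used as is. *)
Section euclidean.
Context {R : realType} {d : nat}.
Implicit Types (u v x : 'rV[R]_d) (f : 'rV[R]_d -> R).

Definition dot u v : R := (u *m v^T) 0 0.

Definition eucl_norm v : R := Num.sqrt (dot v v).

Definition eucl_dist u v : R := eucl_norm (u - v).

Definition grad f x : 'rV[R]_d := \row_k 'D_(delta_mx 0 k) f x.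

Definition hess f x : 'M[R]_d := jacobian (grad f) x.

Definition twice_differentiable f :=
  (forall x, differentiable f x) /\ (forall x, differentiable (grad f) x).

Definition hess_ge f (beta : R) :=
  forall x v, beta * dot v v <= dot (v *m hess f x) v.

Definition eucl_lipschitz (L : R) (F : 'rV[R]_d -> 'rV[R]_d) :=
  forall x y, eucl_norm (F x - F y) <= L * eucl_norm (x - y).

End euclidean.

Definition Rd (R : realType) (d : nat) :=
  g_sigma_algebraType (@open 'rV[R]_d).

Section integral_dirac_le.
Context {R : realType} {disp : measure_display} {E : measurableType disp}.
Import HBNNSimple.
Local Open Scope ereal_scope.

Lemma integral_dirac_le (a : E) (f : E -> \bar R) :
  (forall x, 0 <= f x) -> \int[\d_a]_x f x <= f a.
Proof.
move=> f0; rewrite ge0_integralTE//; apply: ge_ereal_sup => _ [h /= hf <-].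
rewrite -integralT_nnsfun integral_dirac//=; first by rewrite diracT mul1e.
exact/measurable_EFinP/measurable_funP.
Qed.

End integral_dirac_le.

(* The order-2 Wasserstein distance is defined for an arbitrary function
   [dist : E -> E -> R] on a measurable space, so that it can be used first with
   the Euclidean distance on R^d and then with the Wasserstein distance itself.
   [wasserstein2] is real-valued: on measures with finite second moments the
   infimum is finite, so that [fine] only removes the constructor. *)
Section wasserstein.
Context {R : realType} {disp : measure_display} {E : measurableType disp}.
Variable dist : E -> E -> R.

Definition couplings (mu nu : {measure set E -> \bar R}) :
    set (probability (E * E)%type R) :=
  [set pi | forall A, measurable A ->
     pi (A `*` [set: E]) = mu A /\ pi ([set: E] `*` A) = nu A].

Definition wasserstein2 (mu nu : {measure set E -> \bar R}) : R :=
  Num.sqrt (fine (ereal_inf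
    [set (\int[pi]_z ((dist z.1 z.2) ^+ 2)%:E)%E | pi in couplings mu nu])).

Definition finite_moment2 (mu : probability E R) :=
  exists x0 : E, (\int[mu]_x ((dist x0 x) ^+ 2)%:E < +oo)%E.

Record P2 := MkP2 {
  P2_prob :> probability E R ;
  P2_moment : finite_moment2 P2_prob }.

HB.instance Definition _ := gen_eqMixin P2.
HB.instance Definition _ := gen_choiceMixin P2.

Lemma finite_moment2_dirac (a : E) :
  finite_moment2 (dirac a : probability E R).
Proof.
exists a; apply: le_lt_trans (integral_dirac_le _ _) _ => [x|];
  by rewrite ?ltry// lee_fin sqr_ge0.
Qed.

HB.instance Definition _ :=
  isPointed.Build P2 (MkP2 (finite_moment2_dirac point)).

Definition d2 (mu nu : P2) : R := wasserstein2 (P2_prob mu) (P2_prob nu).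

Definition d2_open : set (set P2) :=
  [set U | forall mu, U mu ->
     exists2 e : R, 0 < e & forall nu, d2 mu nu < e -> U nu].

Definition borelP2 := g_sigma_algebraType d2_open.

End wasserstein.

Section P2_spaces.
Context (R : realType) (d : nat).

Definition P2Rd := borelP2 (E := Rd R d) (@eucl_dist R d).

Definition P2P2Rd := P2 (E := P2Rd) (@d2 R _ (Rd R d) (@eucl_dist R d)).

End P2_spaces.

Section empirical.
Context {R : realType} {disp : measure_display} {E : measurableType disp}.
Context {N : nat} (x : 'I_N -> E).
Local Open Scope ereal_scope.

Definition empirical (A : set E) : \bar R :=
  (N%:R^-1)%R%:E * \sum_(i < N) \d_(x i) A.

Let empiricalE : empirical =
  mscale (N%:R^-1%:nng : {nonneg R})%R
    (msum (fun i => \d_(oapp x point (insub i))) N).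
Proof.
apply/funext => A; rewrite /empirical /mscale/= /msum; congr (_ * _).
by apply: eq_bigr => i _; rewrite valK.
Qed.

Let empirical0 : empirical set0 = 0.
Proof. by rewrite empiricalE measure0. Qed.

Let empirical_ge0 A : 0 <= empirical A.
Proof. by rewrite empiricalE. Qed.

Let empirical_sigma_additive : semi_sigma_additive empirical.
Proof. by rewrite empiricalE; exact: measure_semi_sigma_additive. Qed.

HB.instance Definition _ := isMeasure.Build _ _ _ empirical
  empirical0 empirical_ge0 empirical_sigma_additive.

End empirical.

(* The completion of a probability space: the Caratheodory sigma-algebra of the
   induced outer measure. *)
Section completion.
Context {R : realType} {disp : measure_display} {T : measurableType disp}.
Variable mu : probability T R.

Definition completed_type := caratheodory_type (mu^*)%mu.

Definition completed : set completed_type -> \bar R :=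
  @completed_measure_extension _ _ _ mu.

HB.instance Definition _ := Measure.on completed.

Let completed_setT : completed setT = 1%E.
Proof.
rewrite /completed /completed_measure_extension measurable_mu_extE//.
exact: probability_setT.
Qed.

HB.instance Definition _ :=
  Measure_isProbability.Build _ _ _ completed completed_setT.

End completion.

Arguments completed_type {R disp T} mu.
Arguments completed {R disp T} mu.

Section processes.
Context {R : realType} {disp : measure_display} {T : measurableType disp}.

Definition filtration (F : R -> set (set T)) :=
  (forall t, 0 <= t -> sigma_algebra setT (F t) /\ F t `<=` measurable) /\
  (forall s t, 0 <= s -> s <= t -> F s `<=` F t).

Definition measurable_wrt {T' : Type} {disp' : measure_display}
    {E : measurableType disp'} (G : set (set T')) (f : T' -> E) :=
  forall C, measurable C -> G (f @^-1` C).

(* A process Y that is adapted to F, with continuous paths and Y_0 = 0, and whose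
   increments Y_t - Y_s are N(0, (t - s) Id)-distributed and independent of F_s. *)
Definition brownian_motion {d : nat} (P : probability T R)
    (F : R -> set (set T)) (B : R -> T -> 'rV[R]_d) :=
  [/\ forall t, 0 <= t -> measurable_wrt (F t) (B t : T -> Rd R d),
      {ae P, forall w, B 0 w = 0},
      {ae P, forall w, {within `[0, +oo[, continuous (B ^~ w)}} &
      forall s t, 0 <= s -> s < t -> forall A, F s A ->
      forall C : 'I_d -> set R, (forall k, measurable (C k)) ->
        P (A `&` [set w | forall k, C k (B t w 0 k - B s w 0 k)]) =
        (P A *
          (\prod_(k < d) fine (normal_prob 0 (Num.sqrt (t - s)) (C k)))%:E)%E].

Definition sigma_process {d : nat} (B : R -> T -> 'rV[R]_d) : set (set T) :=
  <<s [set A | exists t (C : set (Rd R d)),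
         [/\ 0 <= t, measurable C & A = B t @^-1` C]] >>.

(* Initial segments of the index set suffice: take A i = setT for the others. *)
Definition independent_sigma (P : probability T R)
    (G : nat -> set (set T)) :=
  forall (n : nat) (A : nat -> set T), (forall i, (i < n)%N -> G i (A i)) ->
    P (\bigcap_(i in `I_n) A i) = (\prod_(i < n) fine (P (A i)))%:E.

End processes.

Section common_noise.
Context {R : realType} {d : nat} {disp0 disp1 : measure_display}.
Context {T0 : measurableType disp0} {T1 : measurableType disp1}.
Variables (P0 : probability T0 R) (P1 : probability T1 R).
Variables (F0 : R -> set (set T0)) (F1 : R -> set (set T1)).

Definition product_prob : probability (T0 * T1)%type R := (P0 \x P1)%E.

Definition product_completed : probability (completed_type product_prob) R :=
  completed product_prob.

Definition augmented_filtration (t : R) : set (set (T0 * T1)) :=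
  \bigcap_(s in `]t, +oo[)
    <<s [set A `*` B | A in F0 s & B in F1 s] `|` product_prob.-negligible >>.

(* Joint law, for fixed w0, of a family of random vectors on T0 * T1, evaluated
   on boxes.  As X is only measurable for the completed product, its sections
   are only measurable for the completion of P1, and only for almost every w0. *)
Definition condlaw {n : nat} (X : 'I_n -> T0 * T1 -> 'rV[R]_d) (w0 : T0)
    (C : 'I_n -> set 'rV[R]_d) : \bar R :=
  completed P1 [set w1 | forall i, C i (X i (w0, w1))].

(* (X_i)_i is conditionally i.i.d. given G and the conditional law of the X_i is
   a G-measurable random element of P_2(R^d) with law Q. *)
Definition conditionally_iid {n : nat} (G : set (set T0))
    (X : 'I_n -> T0 * T1 -> 'rV[R]_d) (Q : P2P2Rd R d) :=
  exists mu : T0 -> P2Rd R d,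
    [/\ measurable_wrt G mu,
        forall U, measurable U -> P0 (mu @^-1` U) = P2_prob Q U &
        {ae P0, forall w0, forall C : 'I_n -> set (Rd R d),
          (forall i, measurable (C i)) ->
          condlaw X w0 C = (\prod_(i < n) fine (P2_prob (mu w0) (C i)))%:E}].

(* m_t is a version of the conditional law of X_t given F0_t.  The exceptional
   set is common to all times, so that time integrals of functionals of m are
   determined by X. *)
Definition conditional_flow (X : R -> T0 * T1 -> 'rV[R]_d)
    (m : R -> T0 -> P2Rd R d) :=
  (forall t, 0 <= t -> measurable_wrt (F0 t) (m t)) /\
  {ae P0, forall w0, forall t, 0 <= t -> forall C : set (Rd R d), measurable C ->
    condlaw (fun _ : 'I_1 => X t) w0 (fun=> C) = P2_prob (m t w0) C}.

(* dX^i_t = b^i_t dt + sigma dB^i_t + sigma0 dB^0_t; the noise being additive,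
   the stochastic integrals are the Brownian motions themselves. *)
Definition solves {n : nat} (sigma sigma0 : R) (B0 : R -> T0 -> 'rV[R]_d)
    (B : 'I_n -> R -> T1 -> 'rV[R]_d)
    (b X : 'I_n -> R -> T0 * T1 -> 'rV[R]_d) :=
  [/\ forall i t, 0 <= t ->
        measurable_wrt (augmented_filtration t) (X i t : T0 * T1 -> Rd R d),
      {ae product_completed, forall w, forall i,
        {within `[0, +oo[, continuous (fun t => X i t w)}} &
      {ae product_completed, forall w, forall i t, 0 <= t ->
        (forall k, lebesgue_measure.-integrable `[0, t]
                     (fun s => (b i s w 0 k)%:E)) /\
        X i t w = X i 0 w
          + \row_k \int[lebesgue_measure]_(s in `[0, t]) b i s w 0 k
          + sigma *: B i t w.2 + sigma0 *: B0 t w.1}].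

End common_noise.

Section drifts.
Context {R : realType} {d : nat}.
Implicit Types (F : 'rV[R]_d -> 'rV[R]_d).

Definition vconv F (mu : probability (Rd R d) R) (x : 'rV[R]_d) : 'rV[R]_d :=
  \row_k \int[mu]_y F (x - y) 0 k.

Definition mckean_vlasov_drift {T0 T1 : Type} {n : nat} (V W : 'rV[R]_d -> R)
    (m : R -> T0 -> P2Rd R d) (X : 'I_n -> R -> T0 * T1 -> 'rV[R]_d)
    (i : 'I_n) (t : R) (w : T0 * T1) : 'rV[R]_d :=
  - grad V (X i t w) - vconv (grad W) (P2_prob (m t w.1)) (X i t w).

Definition particle_drift {T : Type} {n : nat} (V W : 'rV[R]_d -> R)
    (X : 'I_n -> R -> T -> 'rV[R]_d) (i : 'I_n) (t : R) (w : T) : 'rV[R]_d :=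
  - grad V (X i t w) - n%:R^-1 *: \sum_(j < n) grad W (X i t w - X j t w).

End drifts.

(* Main.v *)
(* For almost every realisation of the common noise, [sigma0 *: B0] is a
   deterministic forcing and the [X i] are McKean-Vlasov paths driven by the
   [B i]; the bound is proved for such a frozen noise and then integrated over
   the noise.

   Synchronous coupling: as V is beta-convex and W is even and convex, the root
   mean square of the [X i - XN i] decays at rate beta up to the root mean square
   of the fluctuation [N^-1 \sum_j gradW (X i - X j) - (gradW * m) (X i)].  If the
   [X i] are independent with law [m], the latter is at most
   [LW (E |X 1 - X 2| ^ 2 / N) ^ (1/2)].  For a frozen noise [E |X 1| ^ 2] is in
   general unbounded in time, but [E |X 1 - X 2| ^ 2] is not: the forcing cancels
   in the difference, and the energy inequality of [X 1 - X 2 - sigma (B 1 - B 2)]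
   over time steps of length one gives a uniform bound.

   Independence of the [X i]: they are limits of Euler schemes, hence functions
   of [X i 0] and of the increments of [B i], so the increments of all the [B i]
   must be jointly independent of the initial values.  Each [B i] is only known
   to be Brownian for the filtration, separately, and the [B i] to be mutually
   independent.  For an initial event A, [E (1_A cos (sum of increments))] is
   computed on a grid by replacing the increments one time step at a time; the
   errors are sines of single increments, whose mean is zero against the past of
   the filtration, and terms orthogonal to each other, whose sum is of order
   [n ^ (-1/2)]. *)

(* The noise is additive, so after subtraction of Brownian increments every difference of solutions
   is an absolutely continuous path: each estimate is a deterministic inequality for one path,
   averaged afterwards, and no stochastic integral occurs. Freezing the common noise costs
   regularity. The processes are measurable for the completed product only, so a section is
   measurable for almost every [w0], with an exceptional set that depends on the time and the event.
   Countably many times and events are therefore kept, and continuity of paths supplies the others.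
   The law [m] is not assumed continuous in time, yet the Euler scheme and the energy estimates need
   a continuous drift. It comes from second moments bounded on compact time intervals, found by
   comparing all paths with the path of one outcome. The moments of [P] and [Q] control the mean of
   the second moments of the random initial laws, so each [sqrt u] is replaced by [1 + u], which
   makes the bound affine in these moments. *)
Require Import Defs.
From HB Require Import structures.
From mathcomp Require Import all_boot all_order all_algebra.
From mathcomp Require Import all_classical all_reals all_analysis.
From mathcomp Require Import measurable_realfun.
From mathcomp Require Import ring lra.
Set Implicit Arguments.
Unset Strict Implicit.
Unset Printing Implicit Defensive.
Import Order.TTheory GRing.Theory Num.Theory.
Import numFieldNormedType.Exports.
Local Open Scope classical_set_scope.
Local Open Scope ring_scope.

(** * Bounded random variables and independence *)

Section bounded_expectation.
Context {R : realType} {dT : measure_display} {T : measurableType dT}.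
Variable P : probability T R.
Implicit Types (f g h : T -> R) (A B : set T) (c M : R).

(** Boundedness reduces integrability to closure properties; the functions treated this way are
    indicators, trigonometric polynomials of increments and truncations. *)
Definition bdm f := measurable_fun setT f /\ exists M, forall x, `|f x| <= M.

Definition Ex f : R := \int[P]_x f x.

Definition pr A : R := fine (P A).

Lemma prE A : measurable A -> P A = (pr A)%:E.
Proof. by move=> mA; rewrite /pr fineK// fin_num_measure. Qed.

Lemma pr_ge0 A : 0 <= pr A.
Proof. by rewrite /pr fine_ge0. Qed.

Lemma prT : pr setT = 1.
Proof. by rewrite /pr probability_setT. Qed.

Lemma bdm_integrable f : bdm f -> P.-integrable setT (EFin \o f).
Proof.
move=> [mf [M fM]]; apply: measurable_bounded_integrable => //.
- by rewrite [X in (X < _)%E]probability_setT ltry.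
- exists M; split; first exact: num_real.
  by move=> N MN x _; apply: (le_trans (fM x)); exact: ltW.
Qed.

Lemma bdm_bound f : bdm f -> exists2 M, 0 < M & forall x, `|f x| <= M.
Proof.
move=> [_ [M fM]]; exists (`|M| + 1); first by rewrite ltr_wpDl.
move=> x; rewrite (le_trans (fM x))// (le_trans (ler_norm M))//.
by rewrite lerDl.
Qed.

Lemma bdm_cst c : bdm (cst c).
Proof. by split=> //; exists `|c|. Qed.

Lemma bdmD f g : bdm f -> bdm g -> bdm (fun x => f x + g x).
Proof.
move=> [mf [M fM]] [mg [N gN]]; split; first exact: measurable_funD.
by exists (M + N) => x; rewrite (le_trans (ler_normD _ _))// lerD.
Qed.

Lemma bdmM f g : bdm f -> bdm g -> bdm (fun x => f x * g x).
Proof.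
move=> [mf [M fM]] [mg [N gN]]; split; first exact: measurable_funM.
by exists (M * N) => x; rewrite normrM ler_pM.
Qed.

Lemma bdmZ c f : bdm f -> bdm (fun x => c * f x).
Proof. by move=> bf; apply: (bdmM (bdm_cst c)). Qed.

Lemma bdmN f : bdm f -> bdm (fun x => - f x).
Proof.
by move=> bf; under eq_fun do rewrite -mulN1r; exact: bdmZ.
Qed.

Lemma bdmB f g : bdm f -> bdm g -> bdm (fun x => f x - g x).
Proof. by move=> bf bg; apply: bdmD => //; exact: bdmN. Qed.

Lemma bdmBc c f : bdm f -> bdm (fun x => f x - c).
Proof. by move=> bf; apply: bdmB => //; exact: bdm_cst. Qed.

Lemma bdm_sqr f : bdm f -> bdm (fun x => f x ^+ 2).
Proof. by move=> bf; under eq_fun do rewrite expr2; exact: bdmM. Qed.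

Lemma bdm_indic A : measurable A -> bdm (\1_A : T -> R).
Proof.
move=> mA; split; first exact: measurable_indic.
exists 1 => x; rewrite indicE; case: (_ \in _); rewrite ?normr1 ?normr0//.
Qed.

Lemma bdm_sum (I : Type) (r : seq I) (p : pred I) (F : I -> T -> R) :
  (forall i, p i -> bdm (F i)) -> bdm (fun x => \sum_(i <- r | p i) F i x).
Proof.
move=> bF; elim: r => [|i r IH].
  by under eq_fun do rewrite big_nil; exact: bdm_cst.
under eq_fun do rewrite big_cons.
by case pi: (p i) => //; apply: bdmD => //; exact: bF.
Qed.

Lemma bdm_cos f : measurable_fun setT f -> bdm (fun x => cos (f x)).
Proof.
move=> mf; split.
  by apply: measurableT_comp => //; apply: continuous_measurable_fun; exact: continuous_cos.
by exists 1 => x; rewrite ler_norml cos_geN1 cos_le1.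
Qed.

Lemma bdm_sin f : measurable_fun setT f -> bdm (fun x => sin (f x)).
Proof.
move=> mf; split.
  by apply: measurableT_comp => //; apply: continuous_measurable_fun; exact: continuous_sin.
by exists 1 => x; rewrite ler_norml sin_geN1 sin_le1.
Qed.

Lemma Ex_cst c : Ex (cst c) = c.
Proof.
rewrite /Ex Rintegral_cst//.
by rewrite [X in _ * fine X](_ : _ = 1%E) ?mulr1//; exact: probability_setT.
Qed.

Lemma ExD f g : bdm f -> bdm g -> Ex (fun x => f x + g x) = Ex f + Ex g.
Proof. by move=> /bdm_integrable ? /bdm_integrable ?; exact: RintegralD. Qed.

Lemma ExB f g : bdm f -> bdm g -> Ex (fun x => f x - g x) = Ex f - Ex g.
Proof. by move=> /bdm_integrable ? /bdm_integrable ?; exact: RintegralB. Qed.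

Lemma ExBc c f : bdm f -> Ex (fun x => f x - c) = Ex f - c.
Proof. by move=> bf; rewrite ExB ?Ex_cst//; exact: bdm_cst. Qed.

Lemma ExZ c f : bdm f -> Ex (fun x => c * f x) = c * Ex f.
Proof. by move=> /bdm_integrable ?; exact: RintegralZl. Qed.

Lemma Ex_sum (I : Type) (r : seq I) (p : pred I) (F : I -> T -> R) :
  (forall i, p i -> bdm (F i)) ->
  Ex (fun x => \sum_(i <- r | p i) F i x) = \sum_(i <- r | p i) Ex (F i).
Proof.
move=> bF; elim: r => [|i r IH].
  by under eq_fun do rewrite big_nil; rewrite big_nil; exact: Ex_cst.
under eq_fun do rewrite big_cons; rewrite big_cons.
by case pi: (p i) => //; rewrite ExD ?IH//; [exact: bF | exact: bdm_sum].
Qed.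

Lemma Ex_indic A : measurable A -> Ex \1_A = pr A.
Proof. by move=> mA; rewrite /Ex /Rintegral integral_indic// setIT. Qed.

Lemma Ex_le f g : bdm f -> bdm g -> (forall x, f x <= g x) -> Ex f <= Ex g.
Proof.
by move=> /bdm_integrable ? /bdm_integrable ? fg; apply: le_Rintegral => // x _.
Qed.

Lemma Ex_ge0 f : (forall x, 0 <= f x) -> 0 <= Ex f.
Proof. by move=> f0; apply: Rintegral_ge0. Qed.

Lemma bdm_norm f : bdm f -> bdm (fun x => `|f x|).
Proof.
move=> [mf [M fM]]; split; first exact: measurableT_comp.
by exists M => x; rewrite normr_id.
Qed.

Lemma Ex_norm f : bdm f -> `|Ex f| <= Ex (fun x => `|f x|).
Proof. by move=> /bdm_integrable fi; apply: le_normr_Rintegral. Qed.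

Lemma Ex_norm_le f g : bdm f -> bdm g -> (forall x, `|f x| <= g x) ->
  `|Ex f| <= Ex g.
Proof.
by move=> bf bg fg; rewrite (le_trans (Ex_norm bf))// Ex_le//; exact: bdm_norm.
Qed.

Lemma eq_Ex f g : (forall x, f x = g x) -> Ex f = Ex g.
Proof. by move=> fg; congr Ex; exact/funext. Qed.

Lemma cvg_le_bound (u : nat -> R) l M :
  u n @[n --> \oo] --> l -> (forall n, u n <= M) -> l <= M.
Proof.
move=> ul uM; rewrite -(cvg_lim _ ul)//.
by apply: limr_le; [exact: cvgP ul | exact: nearW].
Qed.

(** Bounded convergence, with a fixed factor [g] because the limit is later taken against a centred
    indicator. *)
Lemma Ex_lim (F : nat -> T -> R) f g M : (forall n, bdm (F n)) -> bdm g ->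
  (forall n x, `|F n x| <= M) -> (forall x, F n x @[n --> \oo] --> f x) ->
  bdm f /\ Ex (fun x => F n x * g x) @[n --> \oo] --> Ex (fun x => f x * g x).
Proof.
move=> bF bg FM Ff.
have bf : bdm f.
  split.
    by apply: (@measurable_fun_cvg _ _ _ _ F) => // n; case: (bF n).
  exists M => x; apply: (@cvg_le_bound (fun n => `|F n x|)) => //.
  by apply: cvg_norm; exact: Ff.
split=> //.
have [N N0 gN] := bdm_bound bg.
have mh h : bdm h -> measurable_fun setT (EFin \o h).
  by move=> [mh _]; exact/measurable_EFinP.
have h : (\int[P]_x (F n x * g x)%:E @[n --> \oo] --> \int[P]_x (f x * g x)%:E)%E.
  have [||||| _ _ //] := @dominated_convergence _ T R P setT measurableT
    (fun n x => (F n x * g x)%:E) (fun x => (f x * g x)%:E) (cst (M * N)%:E).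
  - by move=> n; exact: mh (bdmM (bF n) bg).
  - exact: mh (bdmM bf bg).
  - apply: aeW => x _; apply: cvg_EFin; first exact: nearW.
    by apply: cvgMl; exact: Ff.
  - exact: finite_measure_integrable_cst.
  - by apply: aeW => x n _; rewrite /= lee_fin normrM ler_pM.
apply: fine_cvg.
rewrite (_ : (Ex (fun x => f x * g x))%:E = (\int[P]_x (f x * g x)%:E)%E); last first.
  by rewrite /Ex /Rintegral fineK//; apply: integrable_fin_num => //; exact: bdm_integrable (bdmM bf bg).
exact: h.
Qed.

#[local] Hint Resolve bdmD bdmB bdmM bdmZ bdm_cst bdm_indic bdm_norm bdmN : core.

Definition measurable_sys (G : set (set T)) := forall A, G A -> measurable A.

Definition indep2 (G H : set (set T)) :=
  forall A B, G A -> H B -> pr (A `&` B) = pr A * pr B.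

Lemma indep2_sym G H : indep2 G H -> indep2 H G.
Proof. by move=> i A B GA HB; rewrite setIC i// mulrC. Qed.

(** For fixed [B], the finite measures [P (. & B)] and [P B] times [P] agree on a pi-system, hence
    on the sigma-algebra that it generates. *)
Lemma indep2_sigma G H : setI_closed G -> measurable_sys G -> measurable_sys H ->
  indep2 G H -> indep2 <<s G >> H.
Proof.
move=> GI mG mH GH A B sA HB.
have mB := mH _ HB.
pose m1 := mrestr P mB.
pose r : {nonneg R} := NngNum (pr_ge0 B).
pose m2 := mscale r P.
have mGs A' : <<s G >> A' -> measurable A'.
  by move=> h; apply: (smallest_sub (sigma_algebra_measurable T) mG h).
have mA := mGs _ sA.
(* Uniqueness of measures asks for a covering sequence inside the generator, hence [setT] is
   adjoined. *)
have GU : setI_closed (G `|` [set setT]).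
  by move=> C D [GC|->] [GD|->]; rewrite ?setIT ?setTI; [left; exact: GI|left|left|right].
have e : m1 A = m2 A.
  apply: (g_sigma_algebra_measure_unique (G `|` [set setT]) _ (fun=> setT)) => //.
  - by move=> C [/mG//|->].
  - by move=> _; right.
  - by rewrite bigcup_const.
  - move=> C [GC|->].
    + rewrite [LHS]/= [RHS]/= /mrestr /mscale/= prE; last exact: measurableI (mG _ GC) mB.
      by rewrite GH// (prE (mG _ GC)) mulrC.
    + rewrite [LHS]/= [RHS]/= /mrestr /mscale/= setTI (prE mB).
      by rewrite [X in (_ * X)%E]probability_setT mule1.
  - by move=> _; rewrite [X in (X < _)%E]/= /mrestr setTI (prE mB) ltry.
  - by apply: sub_sigma_algebra2 sA => C GC; left.
move: e; rewrite /m1 /m2 /mrestr /mscale/= prE; last exact: measurableI.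
by rewrite (prE mA) -EFinM => -[->]; rewrite mulrC.
Qed.

Lemma indep2_sigma2 G H : setI_closed G -> measurable_sys G ->
  setI_closed H -> measurable_sys H ->
  indep2 G H -> indep2 <<s G >> <<s H >>.
Proof.
move=> GI mG HI mH GH; apply: indep2_sigma => //.
  by move=> A h; apply: (smallest_sub (sigma_algebra_measurable T) mH h).
by apply/indep2_sym/indep2_sigma => //; exact: indep2_sym.
Qed.

(* [f] is a uniform limit of combinations of indicators of its superlevel sets. *)
Lemma layer_approx (y : R) (n : nat) : 0 <= y <= 1 ->
  `|y - n.+1%:R^-1 * \sum_(j < n.+1) ((j.+1%:R / n.+1%:R <= y)%R : nat)%:R| <= n.+1%:R^-1.
Proof.
move=> /andP[y0 y1].
have n0 : 0 < n.+1%:R :> R by rewrite ltr0n.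
pose k := Num.truncn (y * n.+1%:R).
have /andP[k1 k2] : k%:R <= y * n.+1%:R < k.+1%:R.
  by apply: truncn_itv; rewrite mulr_ge0// ltW.
have kn : (k <= n.+1)%N.
  rewrite -(ler_nat R) (le_trans k1)// -[leRHS]mul1r ler_wpM2r//.
have -> : \sum_(j < n.+1) ((j.+1%:R / n.+1%:R <= y)%R : nat)%:R = k%:R :> R.
  rewrite (eq_bigr (fun j : 'I_n.+1 => ((j < k)%N : nat)%:R)); last first.
    move=> j _; congr (_%:R); congr nat_of_bool.
    rewrite ler_pdivrMr//; apply/idP/idP => [h|h].
      by rewrite -ltnS -(ltr_nat R) (le_lt_trans h).
    by rewrite (le_trans _ k1)// ler_nat.
  rewrite -natr_sum -(big_mkord xpredT (fun j => ((j < k)%N : nat))).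
  rewrite (big_cat_nat (n := k))//= big_nat (eq_bigr (fun=> 1%N)); last first.
    by move=> i /andP[_ ->].
  rewrite -big_nat sum_nat_const_nat muln1 subn0 big_nat big1 ?addn0//.
  by move=> i /andP[ki _]; rewrite ltnNge ki.
rewrite -(ler_pM2r n0) mulVf ?gt_eqF// -[X in _ * X](ger0_norm (ltW n0)) -normrM.
rewrite mulrBl mulrAC mulVf ?gt_eqF// mul1r ler_norml.
rewrite -natr1 in k2.
by apply/andP; split; lra.
Qed.

Lemma Ex_mul_eq0_unit (G : set (set T)) h f : bdm h -> bdm f ->
  (forall x, 0 <= f x <= 1) ->
  (forall a, G [set x | a <= f x]) -> measurable_sys G ->
  (forall A, G A -> Ex (fun x => \1_A x * h x) = 0) ->
  Ex (fun x => f x * h x) = 0.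
Proof.
move=> bh bf f01 fG mG h0.
have [M M0 hM] := bdm_bound bh.
apply/eqP; rewrite -normr_le0; apply/ler_addgt0Pl => e e0; rewrite addr0.
pose n := Num.truncn (M / e).
have nM : M / e < n.+1%:R.
  by rewrite /n truncnS_gt// num_real.
pose A j := [set x | j.+1%:R / n.+1%:R <= f x].
pose g x : R := n.+1%:R^-1 * \sum_(j < n.+1) \1_(A j) x.
have mA j : measurable (A j) by apply: mG; exact: fG.
have bg : bdm g by apply: bdmZ; apply: bdm_sum => j _; auto.
have g0 : Ex (fun x => g x * h x) = 0.
  rewrite (eq_Ex (g := fun x => n.+1%:R^-1 * \sum_(j < n.+1) \1_(A j) x * h x)).
    rewrite ExZ ?Ex_sum; try by [move=> *; auto|apply: bdm_sum => *; auto].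
    by rewrite big1 ?mulr0// => i _; apply: h0; exact: fG.
  by move=> x; rewrite /g -mulrA mulr_suml.
have -> : Ex (fun x => f x * h x) = Ex (fun x => (f x - g x) * h x).
  rewrite -[LHS]subr0 -g0 -ExB; auto.
  by apply: eq_Ex => x; ring.
have le1 x : `|(f x - g x) * h x| <= n.+1%:R^-1 * M.
  rewrite normrM ler_pM//.
  rewrite (_ : g x = n.+1%:R^-1 * \sum_(j < n.+1) ((j.+1%:R / n.+1%:R <= f x)%R : nat)%:R).
    exact: layer_approx.
  congr (_ * _); apply: eq_bigr => j _; rewrite indicE; congr (_%:R).
  by congr nat_of_bool; apply/idP/idP => [/set_mem//|hj]; apply/mem_set.
apply: (le_trans (Ex_norm_le (g := cst (n.+1%:R^-1 * M)) _ _ le1)); auto.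
rewrite Ex_cst mulrC ler_pdivrMr ?ltr0n//.
by rewrite -ler_pdivrMl// mulrC ltW.
Qed.

(** An affine map brings [f] into [[0, 1]]; the constant part contributes a multiple of [Ex h],
    which vanishes by the case [A = setT]. *)
Lemma Ex_mul_eq0 (G : set (set T)) h f : bdm h -> bdm f ->
  (forall a, G [set x | a <= f x]) -> measurable_sys G -> G setT ->
  (forall A, G A -> Ex (fun x => \1_A x * h x) = 0) ->
  Ex (fun x => f x * h x) = 0.
Proof.
move=> bh bf fG mG GT h0.
have [M M0 fM] := bdm_bound bf.
have hE : Ex h = 0.
  rewrite -(h0 _ GT); apply: eq_Ex => x.
  by rewrite indicE in_setT mul1r.
pose g x := (2 * M)^-1 * (f x + M).
have bg : bdm g by apply: bdmZ; apply: bdmD => //; exact: bdm_cst.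
have g0 : Ex (fun x => g x * h x) = 0.
  apply: (Ex_mul_eq0_unit (G := G)) => //.
  - move=> x; have := fM x; rewrite ler_norml => /andP[h1 h2].
    rewrite /g mulr_ge0 ?invr_ge0 ?mulr_ge0 ?(ltW M0)//=; last by lra.
    by rewrite ler_pdivrMl ?mulr_gt0// mulr1; lra.
  - move=> a; have := fG (2 * M * a - M); congr G; apply/seteqP.
    split=> x /=; rewrite /g ler_pdivlMl ?mulr_gt0//; lra.
have -> : Ex (fun x => f x * h x) = 2 * M * Ex (fun x => g x * h x) - M * Ex h.
  rewrite -!ExZ -?ExB; auto.
  apply: eq_Ex => x; rewrite /g; field.
  by rewrite gt_eqF.
by rewrite g0 hE !mulr0 subrr.
Qed.

(** Two applications of [Ex_mul_eq0]: [g] is orthogonal to the centred indicators of [G], which says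
    that the centred [g] is orthogonal to the indicators of [G], hence to [f]. *)
Lemma indep2_Ex G H f g : indep2 G H -> G setT -> H setT ->
  measurable_wrt G f -> measurable_wrt H g ->
  measurable_sys G -> measurable_sys H -> bdm f -> bdm g ->
  Ex (fun x => f x * g x) = Ex f * Ex g.
Proof.
move=> GH GT HT Gf Hg mG mH bf bg.
have Hg0 A : G A -> Ex (fun x => g x * (\1_A x - pr A)) = 0.
  move=> GA; have mA := mG _ GA.
  have bA : bdm (fun x => \1_A x - pr A) by apply: bdmB (bdm_cst _); exact: bdm_indic.
  apply: (@Ex_mul_eq0 H) => //.
    by move=> a; have := Hg _ (measurable_itv `[a, +oo[); congr H; apply/seteqP; split => x /=; rewrite in_itv/= andbT.
  move=> B HB; have mB := mH _ HB.
  rewrite (eq_Ex (g := fun x => \1_(A `&` B) x - pr A * \1_B x)); last first.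
    by move=> x; rewrite setIC indicI/= mulrBr [X in _ - X]mulrC.
  have mAB := measurableI _ _ mA mB.
  by rewrite ExB ?ExZ ?Ex_indic ?GH ?subrr; auto.
have bg' : bdm (fun x => g x - Ex g) by apply: bdmB bg (bdm_cst _).
apply/eqP; rewrite -subr_eq0; apply/eqP.
rewrite [X in _ - X]mulrC -ExZ// -ExB; auto.
rewrite (eq_Ex (g := fun x => f x * (g x - Ex g))); last by move=> x; ring.
apply: (@Ex_mul_eq0 G) => //.
  by move=> a; have := Gf _ (measurable_itv `[a, +oo[); congr G; apply/seteqP; split => x /=; rewrite in_itv/= andbT.
move=> A GA; have mA := mG _ GA; have bA := bdm_indic mA.
have := Hg0 _ GA.
rewrite (eq_Ex (g := fun x => \1_A x * g x - pr A * g x)); last by move=> x; ring.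
rewrite ExB; auto; rewrite ExZ// => e.
rewrite (eq_Ex (g := fun x => \1_A x * g x - Ex g * \1_A x)); last by move=> x; ring.
rewrite ExB; auto; rewrite ExZ// Ex_indic//.
by rewrite (mulrC (Ex g)).
Qed.

Lemma indep2_sub G H G' H' : G' `<=` G -> H' `<=` H -> indep2 G H ->
  indep2 G' H'.
Proof. by move=> GG HH i A B /GG GA /HH HB; exact: i. Qed.

End bounded_expectation.

#[export] Hint Resolve bdmBc bdm_sqr bdmD bdmB bdmM bdmZ bdm_cst bdm_indic bdm_norm bdmN
  bdm_cos bdm_sin : core.

Section sub_sigma_algebra.
Context {dT : measure_display} {T : measurableType dT}.

(** Moves to the type that carries the sub-sigma-algebra, where the closure lemmas for measurable
    functions apply. *)
Lemma measurable_wrtP (G : set (set T)) dE (E : measurableType dE) (f : T -> E) :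
  sigma_algebra setT G ->
  measurable_wrt G f <-> measurable_fun (setT : set (g_sigma_algebraType G)) f.
Proof.
move=> sG; split => [h _ C mC|h C mC].
  by rewrite setTI; apply: sub_sigma_algebra; exact: h.
have := h measurableT C mC; rewrite setTI => hC.
by rewrite -(sigma_algebra_id sG).
Qed.

End sub_sigma_algebra.

(* Iterates of [y |-> (3 y - y^3) / 2], which converge to the sign of [y]. *)
Section sign_iterates.
Context {R : realType}.
Implicit Types y : R.

Fixpoint sgn_iter n y := if n is n'.+1 then
  let z := sgn_iter n' y in 3/2 * z - 1/2 * (z * z * z) else y.

Lemma sgn_iterN n y : sgn_iter n (- y) = - sgn_iter n y.
Proof. by elim: n => //= n ->; ring. Qed.

Lemma sgn_iter_itv n y : 0 <= y <= 1 -> y <= sgn_iter n y <= 1.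
Proof.
move=> /andP[y0 y1]; elim: n => [|n /=]; first by rewrite /= lexx.
set z := sgn_iter n y => /andP[h1 h2].
have z0 : 0 <= z by lra.
apply/andP; split.
  have : 0 <= z * (1 - z * z) by rewrite mulr_ge0// subr_ge0 mulr_ile1.
  lra.
have : 0 <= (1 - z) * (1 - z) * (2 + z) by rewrite !mulr_ge0//; lra.
lra.
Qed.

Lemma sgn_iter_norm n y : `|y| <= 1 -> `|sgn_iter n y| <= 1.
Proof.
wlog y0 : y / 0 <= y.
  move=> h; have [|/ltW] := leP 0 y; first exact: h.
  by rewrite -oppr_ge0 => /h; rewrite sgn_iterN !normrN.
rewrite ger0_norm// => y1.
have /andP[h1 h2] : y <= sgn_iter n y <= 1 by apply: sgn_iter_itv; rewrite y0.
by rewrite ger0_norm//; lra.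
Qed.

Lemma sgn_iter_cvg_pos y : 0 < y <= 1 -> sgn_iter n y @[n --> \oo] --> (1 : R).
Proof.
move=> /andP[y0 y1].
have key n : `|1 - sgn_iter n y| <= (1 - y / 2) ^+ n.
  elim: n => [|n IH]; first by rewrite expr0 ger0_norm//=; lra.
  have /andP[] := sgn_iter_itv n (y := y) ltac:(lra).
  have /andP[] := sgn_iter_itv n.+1 (y := y) ltac:(lra).
  rewrite exprS /= in IH *; set z := sgn_iter n y in IH * => h1 h2 h3 h4.
  rewrite ger0_norm ?subr_ge0// in IH; rewrite ger0_norm ?subr_ge0//.
  (* One iteration multiplies the distance to the fixed point 1 by [(1 - z) (2 + z) / 2], which is
     at most [1 - y / 2] because [y <= z]. *)
  rewrite (_ : 1 - _ = (1 - z) * (2 + z) / 2 * (1 - z)); last by field.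
  rewrite ler_pM//; try lra.
    by rewrite mulr_ge0// mulr_ge0; lra.
  have : 0 <= (z - y) + z * z by rewrite addr_ge0 ?mulr_ge0//; lra.
  lra.
suff : (1 - sgn_iter n y) @[n --> \oo] --> (0 : R).
  move=> h; have : (1 - (1 - sgn_iter n y)) @[n --> \oo] --> (1 - 0 : R).
    by apply: cvgB => //; exact: cvg_cst.
  by rewrite subr0; under eq_fun do rewrite opprB addrC subrK.
apply/norm_cvg0P; apply: (squeeze_cvgr (f := cst 0) (h := fun n => (1 - y / 2) ^+ n)).
- by apply: nearW => n; rewrite normr_ge0 key.
- exact: cvg_cst.
- by apply: cvg_expr; rewrite ger0_norm; lra.
Qed.

Lemma sgn_iter0 n : sgn_iter n (0 : R) = 0.
Proof. by elim: n => //= n ->; rewrite !mulr0 subrr. Qed.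

(** The polynomial [(s + s^2) / 2] sends the possible limits -1, 0, 1 to 0, 0, 1, which turns the
    sign into the indicator of a strict inequality. *)
Lemma sgn_iter_cvg y : `|y| <= 1 ->
  (sgn_iter n y + sgn_iter n y * sgn_iter n y) / 2 @[n --> \oo]
    --> (((0 < y)%R : nat)%:R : R).
Proof.
move=> y1; have [y0|y0|y0] := ltgtP 0 y; last rewrite -y0.
- have h : sgn_iter n y @[n --> \oo] --> (1 : R).
    by apply: sgn_iter_cvg_pos; rewrite y0 -(ger0_norm (ltW y0)).
  rewrite [X in _ --> X](_ : _ = (1 + 1 * 1) / 2 :> R); last by rewrite /=; lra.
  by apply: cvgM; [exact: cvgD h (cvgM h h)|exact: cvg_cst].
- have h : sgn_iter n y @[n --> \oo] --> (- 1 : R).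
    rewrite -[y]opprK; under eq_fun do rewrite sgn_iterN; apply: cvgN.
    by apply: sgn_iter_cvg_pos; rewrite oppr_gt0 y0 -(ltr0_norm y0).
  rewrite [X in _ --> X](_ : _ = (- 1 + - 1 * - 1) / 2 :> R); last by rewrite /=; lra.
  by apply: cvgM; [exact: cvgD h (cvgM h h)|exact: cvg_cst].
- under eq_fun do rewrite sgn_iter0 mulr0 addr0 mul0r; exact: cvg_cst.
Qed.

End sign_iterates.

(** * A monotone class theorem for algebras of bounded functions *)

Section multiplicative_system.
Context {R : realType} {dT : measure_display} {T : measurableType dT}.
Variable P : probability T R.
Variable V : set (T -> R).
Hypothesis Vb : forall f, V f -> bdm f.
Hypothesis V1 : V (cst 1).
Hypothesis VD : forall f g, V f -> V g -> V (fun x => f x + g x).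
Hypothesis VM : forall f g, V f -> V g -> V (fun x => f x * g x).
Hypothesis VZ : forall c f, V f -> V (fun x => c * f x).

Definition bdd_lim (f : T -> R) := exists (F : nat -> T -> R) (M : R),
  [/\ forall n, V (F n), forall n x, `|F n x| <= M &
      forall x, F n x @[n --> \oo] --> f x].

(** A pi-system because [V] is an algebra: products of approximations approximate the indicator of
    an intersection. *)
Definition lim_sets : set (set T) := [set A | bdd_lim \1_A].

Lemma lim_setsI : setI_closed lim_sets.
Proof.
move=> A B [F [M [VF FM Ff]]] [G [N [VG GN Gg]]].
exists (fun n x => F n x * G n x), (M * N); split.
- by move=> n; exact: VM.
- by move=> n x; rewrite normrM ler_pM.
- by move=> x; rewrite indicI/=; exact: cvgM (Ff x) (Gg x).
Qed.

Lemma bdd_lim_bdm f : bdd_lim f -> bdm f.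
Proof.
move=> [F [M [VF FM Ff]]].
by have [] := Ex_lim P (fun n => Vb (VF n)) (bdm_cst 1) FM Ff.
Qed.

Lemma lim_sets_measurable : measurable_sys lim_sets.
Proof.
move=> A /bdd_lim_bdm [mA _].
have := mA measurableT _ (measurable_set1 1); rewrite setTI.
congr measurable; apply/seteqP; split => x /=; rewrite indicE.
  by case: (boolP (x \in A)) => [/set_mem//|_ /eqP]; rewrite eq_sym oner_eq0.
by move=> /mem_set ->.
Qed.

(* The sign iterates are polynomials, so they preserve [V]; applied to a multiple
   of [f - a] they converge to its sign. *)
Lemma lim_sets_gt f a : V f -> lim_sets [set x | a < f x].
Proof.
move=> Vf; have Vg : V (fun x => f x + (- a) * cst 1 x) by apply: VD; [|exact: VZ].
have [M M0 gM] := bdm_bound (Vb Vg).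
pose g x := M^-1 * (f x + (- a) * cst 1 x).
have g1 x : `|g x| <= 1.
  by rewrite /g normrM gtr0_norm ?invr_gt0// ler_pdivrMl// (le_trans (gM x))// mulr1.
have Vs n : V (fun x => sgn_iter n (g x)).
  elim: n => [|n IH] /=; first exact: VZ.
  rewrite (_ : (fun x => _) = fun x => 3/2 * sgn_iter n (g x) +
    (- (1/2)) * (sgn_iter n (g x) * sgn_iter n (g x) * sgn_iter n (g x))); last first.
    by apply/funext => x; rewrite mulNr.
  by apply: VD; apply: VZ => //; apply: (VM (VM IH IH)).
exists (fun n x => 2^-1 * (sgn_iter n (g x) + sgn_iter n (g x) * sgn_iter n (g x))), 1.
split.
- by move=> n; apply: VZ; apply: VD; [|exact: VM].
- move=> n x; rewrite normrM gtr0_norm ?invr_gt0// ler_pdivrMl// mulr1.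
  have h := sgn_iter_norm n (g1 x).
  rewrite (le_trans (ler_normD _ _))// normrM.
  have : `|sgn_iter n (g x)| * `|sgn_iter n (g x)| <= 1 by rewrite mulr_ile1.
  lra.
- move=> x; under eq_fun do rewrite mulrC.
  have -> : \1_[set x | a < f x] x = ((0 < g x)%R : nat)%:R :> R.
    rewrite indicE; congr (_%:R); congr nat_of_bool.
    rewrite /g/= mulr1 pmulr_rgt0 ?invr_gt0// subr_gt0.
    by apply/idP/idP => [/set_mem//|h]; exact/mem_set.
  exact: sgn_iter_cvg.
Qed.

(** Orthogonality to the centred indicator of [B] passes from [V] to bounded pointwise limits, in
    particular to indicators of [lim_sets], and from this pi-system to its sigma-algebra. *)
Lemma multiplicative_system (B : set T) : measurable B ->
  (forall f, V f -> Ex P (fun x => f x * (\1_B x - pr P B)) = 0) ->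
  indep2 P <<s lim_sets >> [set B].
Proof.
move=> mB h; apply: indep2_sigma; [exact: lim_setsI|exact: lim_sets_measurable|by move=> _ ->|].
move=> A _ lA ->; have mA := lim_sets_measurable lA.
have bA := bdm_indic (R := R) mA; have bB := bdm_indic (R := R) mB.
have h0 : Ex P (fun x => \1_A x * (\1_B x - pr P B)) = 0.
  have [F [M [VF FM Ff]]] := lA.
  have bg : bdm (fun x => \1_B x - pr P B) by apply: bdmB => //; exact: bdm_cst.
  have [_ c] := Ex_lim P (fun n => Vb (VF n)) bg FM Ff.
  apply/esym; apply: (cvg_unique _ _ c) => //.
  rewrite (_ : (fun n => _) = cst 0); first exact: cvg_cst.
  by apply/funext => n; rewrite h.
apply/eqP; rewrite -subr_eq0 -h0.
rewrite (@eq_Ex _ _ _ _ _ (fun x => \1_(A `&` B) x - pr P B * \1_A x)); last first.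
  by move=> x; rewrite indicI/=; ring.
rewrite ExB ?ExZ ?Ex_indic//; first by rewrite mulrC.
- exact: measurableI.
- by apply: bdm_indic; exact: measurableI.
- exact: bdmZ.
Qed.

End multiplicative_system.

(** * Independence of a family of Brownian motions from the initial sigma-algebra *)

Section trigonometric_bounds.
Context {R : realType}.
Implicit Types x y : R.

Lemma cos_sub1_le x : `|cos x - 1| <= `|x|.
Proof.
have [->|x0] := eqVneq x 0; first by rewrite cos0 subrr normr0.
wlog xp : x x0 / 0 < x.
  move=> h; have [|] := ltP 0 x; first exact: h.
  rewrite le_eqVlt (negbTE x0)/= => xn; rewrite -cosN -(normrN x).
  by apply: h; rewrite ?oppr_eq0 ?oppr_gt0.
have [c _] := @MVT R cos (fun x => - sin x) 0 x xp (fun y _ => is_derive_cos y)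
  (continuous_subspaceT (@continuous_cos R)).
rewrite cos0 subr0 => ->; rewrite normrM normrN ler_piMl//.
by rewrite ler_norml sin_geN1 sin_le1.
Qed.

Lemma sin_subx_le x : `|sin x - x| <= x ^+ 2.
Proof.
have [->|x0] := eqVneq x 0; first by rewrite sin0 subrr normr0 expr0n.
wlog xp : x x0 / 0 < x.
  move=> h; have [|] := ltP 0 x; first exact: h.
  rewrite le_eqVlt (negbTE x0)/= => xn; rewrite -normrN -sqrrN opprB addrC.
  by rewrite -sinN -[X in _ + X]opprK; apply: h; rewrite ?oppr_eq0 ?oppr_gt0.
have ds (y : R) : y \in `]0, x[ -> is_derive y 1 (fun z => sin z - z) (cos y - 1).
  by move=> _; apply: is_deriveB.
have cs : {within `[0, x], continuous (fun z : R => sin z - z)}.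
  apply: continuous_subspaceT => z; apply: cvgB; last exact: cvg_id.
  exact: continuous_sin.
have [c] := MVT xp ds cs.
rewrite sin0 !subr0 in_itv/= => /andP[c0 cx] ->.
rewrite normrM [leRHS]expr2 (ger0_norm (ltW xp)) ler_pM2r//.
by rewrite (le_trans (cos_sub1_le c))// gtr0_norm// ltW.
Qed.

Lemma cos_sub1_le2 x : `|cos x - 1| <= x ^+ 2.
Proof.
have [->|x0] := eqVneq x 0; first by rewrite cos0 subrr normr0 expr0n.
wlog xp : x x0 / 0 < x.
  move=> h; have [|] := ltP 0 x; first exact: h.
  rewrite le_eqVlt (negbTE x0)/= => xn; rewrite -cosN -sqrrN.
  by apply: h; rewrite ?oppr_eq0 ?oppr_gt0.
have [c] := @MVT R cos (fun x => - sin x) 0 x xp (fun y _ => is_derive_cos y)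
  (continuous_subspaceT (@continuous_cos R)).
rewrite in_itv/= => /andP[c0 cx].
rewrite cos0 subr0 => ->; rewrite normrM normrN expr2 (ger0_norm (ltW xp)) ler_pM2r//.
have [c' _] := @MVT R sin cos 0 c c0 (fun y _ => is_derive_sin y)
  (continuous_subspaceT (@continuous_sin R)).
rewrite sin0 !subr0 => ->; rewrite normrM (ger0_norm (ltW c0)).
rewrite (le_trans _ (ltW cx))// ler_piMl ?(ltW c0)//.
by rewrite ler_norml cos_geN1 cos_le1.
Qed.

Lemma sqr_sum_le (I : finType) (a : I -> R) :
  (\sum_i a i) ^+ 2 <= #|I|%:R * \sum_i a i ^+ 2.
Proof.
rewrite expr2 mulr_suml.
under eq_bigr do rewrite mulr_sumr.
have h i : \sum_j a i * a j <= \sum_j (a i ^+ 2 + a j ^+ 2) / 2.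
  apply: ler_sum => j _; have := sqr_ge0 (a i - a j); rewrite sqrrB; lra.
apply: (le_trans (ler_sum _ (fun i _ => h i))).
under eq_bigr do rewrite -mulr_suml big_split/= sumr_const -mulr_natl.
rewrite -mulr_suml big_split/= sumr_const sumrMnl.
set q := _ *+ _; have -> : q = #|I|%:R * \sum_i a i ^+ 2.
  by rewrite /q mulr_natl; congr (_ *+ _); exact: eq_card.
lra.
Qed.

End trigonometric_bounds.

(** * A telescoping estimate for the cosine of a sum of increments *)

Section levy_telescoping.
Context {R : realType} {dT : measure_display} {T : measurableType dT}.
Variable P : probability T R.
Context {C : finType}.
Variables (n : nat) (delta : nat -> C -> T -> R) (u : nat -> C -> R).
(** Two kinds of independence are available. The joint past of all motions ([Past]) is independent
    of all their next increments together ([Fut]). The larger [Fil], which contains [A], is only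
    known to be independent of one scalar increment at a time ([Fut1]). *)
Variables (Past Fut Fil : nat -> set (set T)) (Fut1 : nat -> C -> set (set T)).
Variable A : set T.
Variables (U kappa : R).
Hypothesis U0 : 0 <= U.
Hypothesis mdelta : forall k c, measurable_fun setT (delta k c).
Hypothesis mA : measurable A.
Hypothesis sPast : forall k, sigma_algebra setT (Past k).
Hypothesis sFut : forall k, sigma_algebra setT (Fut k).
Hypothesis sFil : forall k, sigma_algebra setT (Fil k).
Hypothesis sFut1 : forall k c, sigma_algebra setT (Fut1 k c).
Hypothesis mPast : forall k, measurable_sys (Past k).
Hypothesis mFut : forall k, measurable_sys (Fut k).
Hypothesis mFil : forall k, measurable_sys (Fil k).
Hypothesis mFut1 : forall k c, measurable_sys (Fut1 k c).
Hypothesis delta_past : forall j k c, (j < k)%N -> (k <= n)%N ->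
  measurable_wrt (Past k) (delta j c).
Hypothesis delta_fut : forall k c, (k < n)%N ->
  measurable_wrt (Fut k) (delta k c).
Hypothesis delta_fil : forall j k c, (j < k)%N -> (k <= n)%N ->
  measurable_wrt (Fil k) (delta j c).
Hypothesis delta_fut1 : forall k c, (k < n)%N ->
  measurable_wrt (Fut1 k c) (delta k c).
Hypothesis past_fut : forall k, (k < n)%N -> indep2 P (Past k) (Fut k).
Hypothesis fil_fut1 : forall k c, (0 < k < n)%N -> indep2 P (Fil k) (Fut1 k c).
(** Step 0 is left out: an initial event of a right-continuous filtration is known to lie in the
    original one at positive times only. *)
Hypothesis A_fil : forall k, (0 < k < n)%N -> Fil k A.
Hypothesis u_le : forall k c, `|u k c| <= U.
(** A fourth moment bound tested on bounded minorants, since [Ex] is handled for bounded functions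
    and [delta ^ 4] is unbounded. *)
Hypothesis delta4 : forall k (f : T -> R), (k < n)%N -> bdm f ->
  (forall w, 0 <= f w <= \sum_c delta k c w ^+ 4) -> Ex P f <= kappa.

Let D k w := \sum_c u k c * delta k c w.
Let theta k w := \sum_(j < k) D j w.
(** Comes from squaring [(#|C| + 1) U^2 S2] and from [S2^2 <= #|C| S4]. *)
Let K0 : R := (#|C|%:R + 1) ^+ 3 * U ^+ 4.
(** The error of replacing the sine of the sum by the sum of the sines. It is quadratic in the
    increments, and the sum of sines involves one scalar increment per term, as independence from
    [Fil] requires. *)
Let rho k w := sin (D k w) - \sum_c sin (u k c * delta k c w).
Let Z w : R := \1_A w - pr P A.

Let S2 k w := \sum_c delta k c w ^+ 2.
Let S4 k w := \sum_c delta k c w ^+ 4.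

Let S2_ge0 k w : 0 <= S2 k w.
Proof. by apply: sumr_ge0 => c _; exact: sqr_ge0. Qed.

Let ud_le k c w : (u k c * delta k c w) ^+ 2 <= U ^+ 2 * delta k c w ^+ 2.
Proof.
rewrite exprMn ler_wpM2r ?sqr_ge0// -real_normK ?num_real//.
by rewrite ler_pXn2r ?nnegrE// U0.
Qed.

Let sumud_le k w : \sum_c (u k c * delta k c w) ^+ 2 <= U ^+ 2 * S2 k w.
Proof. by rewrite mulr_sumr; apply: ler_sum => c _; exact: ud_le. Qed.

Let D2_le k w : D k w ^+ 2 <= #|C|%:R * (U ^+ 2 * S2 k w).
Proof. by rewrite (le_trans (sqr_sum_le _))// ler_wpM2l. Qed.

Let S2S4 k w : S2 k w ^+ 2 <= #|C|%:R * S4 k w.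
Proof.
rewrite (le_trans (sqr_sum_le _))// ler_wpM2l//.
by apply: ler_sum => c _; rewrite -exprM.
Qed.

Let quad_le k w y : `|y| <= (#|C|%:R + 1) * (U ^+ 2 * S2 k w) ->
  y ^+ 2 <= K0 * S4 k w.
Proof.
move=> h; rewrite -real_normK ?num_real//.
have h1 : 0 <= (#|C|%:R + 1) * (U ^+ 2 * S2 k w).
  exact: le_trans (normr_ge0 _) h.
rewrite (le_trans (y := ((#|C|%:R + 1) * (U ^+ 2 * S2 k w)) ^+ 2))//.
  by rewrite ler_pXn2r ?nnegrE.
rewrite (_ : _ ^+ 2 = (#|C|%:R + 1) ^+ 2 * U ^+ 4 * S2 k w ^+ 2); last by ring.
rewrite (_ : K0 * _ = (#|C|%:R + 1) ^+ 2 * U ^+ 4 * ((#|C|%:R + 1) * S4 k w)); last by rewrite /K0; ring.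
rewrite ler_wpM2l ?mulr_ge0 ?exprn_ge0 ?addr_ge0//.
apply: (le_trans (S2S4 k w)); rewrite ler_wpM2r//.
  by apply: sumr_ge0 => c _; rewrite exprn_even_ge0.
by rewrite lerDl.
Qed.

Let K0_ge0 : 0 <= K0.
Proof. by rewrite /K0 mulr_ge0 ?exprn_ge0 ?addr_ge0. Qed.

Let mD k : measurable_fun setT (D k).
Proof. by apply: measurable_sum => c; apply: measurable_funM. Qed.

Let mtheta k : measurable_fun setT (theta k).
Proof. by apply: measurable_sum => j; exact: mD. Qed.

Let cosD1_le k w : (cos (D k w) - 1) ^+ 2 <= K0 * S4 k w.
Proof.
apply: quad_le; rewrite (le_trans (cos_sub1_le2 _))// (le_trans (D2_le k w))//.
by rewrite ler_wpM2r ?lerDl// mulr_ge0 ?sqr_ge0.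
Qed.

Let rho_le k w : rho k w ^+ 2 <= K0 * S4 k w.
Proof.
apply: quad_le; rewrite (_ : rho k w = (sin (D k w) - D k w) -
    \sum_c (sin (u k c * delta k c w) - u k c * delta k c w)); last first.
  by rewrite sumrB /rho /D; ring.
rewrite (le_trans (ler_normB _ _))// mulrDl mul1r lerD//.
  by rewrite (le_trans (sin_subx_le _))// D2_le.
rewrite (le_trans (ler_norm_sum _ _ _))// (le_trans _ (sumud_le k w))//.
by apply: ler_sum => c _; exact: sin_subx_le.
Qed.

Let Ex_delta4 k f : (k < n)%N -> bdm f -> (forall w, 0 <= f w <= K0 * S4 k w) ->
  Ex P f <= K0 * kappa.
Proof.
move=> kn bf h; have [K00|K00] := eqVneq K0 0.
  rewrite K00 mul0r -(Ex_cst P 0); apply: Ex_le => // w.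
  by have := h w; rewrite K00 mul0r => /andP[].
have Kp : 0 < K0 by rewrite lt_neqAle eq_sym K00.
rewrite -ler_pdivrMl// -ExZ//; apply: (delta4 kn); first exact: bdmZ.
move=> w; have /andP[h1 h2] := h w.
by rewrite mulr_ge0 ?invr_ge0//= ler_pdivrMl.
Qed.

Let bcosD k : bdm (fun w => cos (D k w)). Proof. exact: bdm_cos. Qed.
Let bsinD k : bdm (fun w => sin (D k w)). Proof. exact: bdm_sin. Qed.
Let bsind k c : bdm (fun w => sin (u k c * delta k c w)).
Proof. by apply: bdm_sin; apply: measurable_funM. Qed.
Let brho k : bdm (rho k).
Proof. by apply: bdmB => //; apply: bdm_sum. Qed.

(** The mean minimises the quadratic error, so a variance is at most the second moment about a
    convenient constant: 1 for the cosine, 0 for [rho]. *)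
Let var_le (Y : T -> R) a : bdm Y ->
  Ex P (fun w => (Y w - Ex P Y) ^+ 2) <= Ex P (fun w => (Y w - a) ^+ 2).
Proof.
move=> bY; set e := Ex P Y.
have -> : Ex P (fun w => (Y w - a) ^+ 2) =
    Ex P (fun w => (Y w - e) ^+ 2) + (e - a) ^+ 2.
  rewrite -[X in _ + X](Ex_cst P) -[RHS]addr0.
  have -> : 0 = Ex P (fun w => (2 * (e - a)) * (Y w - e)).
    by rewrite ExZ ?ExBc ?subrr ?mulr0//; exact: bdmBc.
  have b1 : bdm (fun w => (Y w - e) ^+ 2) by apply: bdm_sqr; exact: bdmBc.
  rewrite -!ExD//; last 2 first.
  - by apply: bdmD => //; exact: bdm_cst.
  - by apply: bdmZ; exact: bdmBc.
  by apply: eq_Ex => w; rewrite /=; ring.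
by rewrite lerDl sqr_ge0.
Qed.

(* [x |-> a k * cos x + b k * sin x] is the expectation of
   [cos (x + D k + ... + D (n-1) + psi)]. *)
Let backward (psi : R) (c s : nat -> R) : (forall k, c k ^+ 2 + s k ^+ 2 <= 1) ->
  forall N (a0 b0 : R), a0 ^+ 2 + b0 ^+ 2 <= 1 ->
  exists a b : nat -> R, [/\ a N = a0, b N = b0,
    forall k, a k ^+ 2 + b k ^+ 2 <= 1 &
    forall k, (k < N)%N -> a k = a k.+1 * c k + b k.+1 * s k /\
                            b k = b k.+1 * c k - a k.+1 * s k].
Proof.
move=> cs; elim=> [|N IH] a0 b0 ab; first by exists (fun=> a0), (fun=> b0).
have /IH[a [b [aN bN ab1 rec]]] : (a0 * c N + b0 * s N) ^+ 2 + (b0 * c N - a0 * s N) ^+ 2 <= 1.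
  (* The modulus of a product of two complex numbers. *)
  rewrite (_ : _ + _ = (a0 ^+ 2 + b0 ^+ 2) * (c N ^+ 2 + s N ^+ 2)); last by ring.
    by rewrite mulr_ile1// addr_ge0 ?sqr_ge0.
exists (fun k => if (k <= N)%N then a k else a0), (fun k => if (k <= N)%N then b k else b0).
split; rewrite ?ltnn//; first by move=> k; case: ifP.
move=> k kN1; have [->|kN] := eqVneq k N; first by rewrite leqnn ltnn aN bN.
have {}kN : (k < N)%N by rewrite ltn_neqAle kN -ltnS.
by rewrite (ltnW kN) kN; exact: rec.
Qed.

(** A characteristic function has modulus at most one, by Jensen's inequality. *)
Let cs_le1 k : Ex P (fun w => cos (D k w)) ^+ 2 + Ex P (fun w => sin (D k w)) ^+ 2 <= 1.
Proof.
have h (Y : T -> R) : bdm Y -> Ex P Y ^+ 2 <= Ex P (fun w => Y w ^+ 2).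
  move=> bY; have := Ex_ge0 P (f := fun w => (Y w - Ex P Y) ^+ 2) (fun w => sqr_ge0 _).
  rewrite (@eq_Ex _ _ _ _ _ (fun w => Y w * Y w - ((2 * Ex P Y) * Y w - Ex P Y ^+ 2))); last by move=> w; ring.
  rewrite ExB//; last 2 first.
  - exact: bdmM.
  - by apply: bdmB; [exact: bdmZ|exact: bdm_cst].
  rewrite ExB//; last 2 first.
  - exact: bdmZ.
  - exact: bdm_cst.
  rewrite ExZ// Ex_cst (_ : (fun w => Y w ^+ 2) = (fun w => Y w * Y w))//.
  lra.
have -> : 1 = Ex P (fun w => cos (D k w) ^+ 2) + Ex P (fun w => sin (D k w) ^+ 2).
  rewrite -ExD.
    by rewrite -[LHS](Ex_cst P); apply: eq_Ex => w; rewrite /= cos2Dsin2.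
  by under eq_fun do rewrite expr2; exact: bdmM.
  by under eq_fun do rewrite expr2; exact: bdmM.
by rewrite lerD ?h.
Qed.

Let mF (G : set (set T)) (f : T -> R) :=
  measurable_fun (setT : set (g_sigma_algebraType G)) f.

Let mF_cos G f : mF G f -> mF G (fun w => cos (f w)).
Proof.
by move=> mf; apply: (measurableT_comp _ mf); apply: continuous_measurable_fun; exact: continuous_cos.
Qed.
Let mF_sin G f : mF G f -> mF G (fun w => sin (f w)).
Proof.
by move=> mf; apply: (measurableT_comp _ mf); apply: continuous_measurable_fun; exact: continuous_sin.
Qed.
Let mF_theta G k : (forall j c, (j < k)%N -> mF G (delta j c)) -> mF G (theta k).
Proof.
move=> h; apply: measurable_sum => j; apply: measurable_sum => c.
apply: measurable_funM; first exact: measurable_cst.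
exact: h.
Qed.
Let mF_D G k : (forall c, mF G (delta k c)) -> mF G (D k).
Proof.
move=> h; apply: measurable_sum => c.
apply: measurable_funM; first exact: measurable_cst.
exact: h.
Qed.

(** [H k (theta k)] plays the part of the conditional mean of the cosine given the first [k]
    increments. It starts from the constant [H 0 0], which the centred [Z] annihilates, and ends
    with the cosine itself. Each difference splits into a linear part [L k], treated with [Fil], and
    a second-order part [X k], treated with [Past]. *)
Lemma levy_telescoping psi eta : 0 < eta ->
  (0 < n)%N ->
  `|Ex P (fun w => Z w * cos (theta n w + psi))| <=
  (eta + n%:R * (16 * (K0 * kappa)) / eta) / 2 +
  4 * \sum_c Ex P (fun w => `|sin (u 0 c * delta 0 c w)|).
Proof.
move=> eta0 n0.
pose c k := Ex P (fun w => cos (D k w)); pose s k := Ex P (fun w => sin (D k w)).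
(* The terminal values are the coefficients of [cos (x + psi)] in terms of [cos x] and [sin x]. *)
have [a [b [an bn ab1 rec]]] := @backward psi c s cs_le1 n (cos psi) (- sin psi)
  ltac:(rewrite sqrrN cos2Dsin2//).
have a1 k : `|a k| <= 1.
  rewrite -(@ler_pXn2r _ 2)// ?nnegrE// real_normK ?num_real// expr1n.
  by rewrite (le_trans _ (ab1 k))// lerDl sqr_ge0.
have b1 k : `|b k| <= 1.
  rewrite -(@ler_pXn2r _ 2)// ?nnegrE// real_normK ?num_real// expr1n.
  by rewrite (le_trans _ (ab1 k))// lerDr sqr_ge0.
pose H k x := a k * cos x + b k * sin x.
pose al k w := a k.+1 * cos (theta k w) + b k.+1 * sin (theta k w).
pose ga k w := b k.+1 * cos (theta k w) - a k.+1 * sin (theta k w).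
(* Centred functions of the whole [k]-th increment, with weights depending on the earlier ones. *)
pose X k w := al k w * (cos (D k w) - c k) + ga k w * (rho k w - Ex P (rho k)).
(* First-order part, one scalar increment per summand. *)
pose L k w := \sum_c0 ga k w * (sin (u k c0 * delta k c0 w) - Ex P (fun w => sin (u k c0 * delta k c0 w))).
have bal k : bdm (al k) by apply: bdmD; apply: bdmZ; [exact: bdm_cos|exact: bdm_sin].
have bga k : bdm (ga k) by apply: bdmB; apply: bdmZ; [exact: bdm_cos|exact: bdm_sin].
have al2 k w : `|al k w| <= 2.
  rewrite (le_trans (ler_normD _ _))// !normrM (_ : 2 = 1 * 1 + 1 * 1); last by ring.
  by rewrite lerD// ler_pM// ler_norml ?cos_geN1 ?cos_le1 ?sin_geN1 ?sin_le1.
have ga2 k w : `|ga k w| <= 2.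
  rewrite (le_trans (ler_normB _ _))// !normrM (_ : 2 = 1 * 1 + 1 * 1); last by ring.
  by rewrite lerD// ler_pM// ler_norml ?cos_geN1 ?cos_le1 ?sin_geN1 ?sin_le1.
have bQ k : bdm (fun w => cos (D k w) - c k) by apply: bdmB (bdm_cst _).
have bQ' k : bdm (fun w => rho k w - Ex P (rho k)) by apply: bdmB (bdm_cst _).
have bX k : bdm (X k) by apply: bdmD; exact: bdmM.
have bl k c0 : bdm (fun w => sin (u k c0 * delta k c0 w) - Ex P (fun w => sin (u k c0 * delta k c0 w))).
  by apply: bdmB (bdm_cst _).
have bL k : bdm (L k) by apply: bdm_sum => c0 _; exact: bdmM.
have bZ : bdm Z by apply: bdmB (bdm_cst _); exact: bdm_indic.
have Es k : s k - \sum_c0 Ex P (fun w => sin (u k c0 * delta k c0 w)) = Ex P (rho k).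
  by rewrite ExB// ?Ex_sum//; exact: bdm_sum.
have step k w : (k < n)%N -> H k.+1 (theta k.+1 w) - H k (theta k w) = X k w + L k w.
  move=> kn; rewrite /H; have [-> ->] := rec _ kn.
  rewrite (_ : theta k.+1 w = theta k w + D k w); last by rewrite /theta big_ord_recr.
  rewrite cosD sinD /X /L -mulr_sumr sumrB -Es /rho /al /ga.
  by ring.
have main w : cos (theta n w + psi) = H 0 0 + \sum_(k < n) (X k w + L k w).
  rewrite -(big_mkord xpredT (fun k => X k w + L k w)).
  rewrite (eq_big_nat _ _ (F2 := fun k => H k.+1 (theta k.+1 w) - H k (theta k w))); last first.
    by move=> k /andP[_ kn]; rewrite step.
  rewrite (telescope_sumr (fun k => H k (theta k w)))//.
  rewrite [theta 0 w]big_ord0 [RHS]addrC subrK /H an bn cosD; ring.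
have EZ : Ex P Z = 0 by rewrite ExBc ?Ex_indic ?subrr//; exact: bdm_indic.
pose S k w := \sum_(j < k) X j w.
have bS k : bdm (S k) by apply: bdm_sum.
(* the increments [X k] are orthogonal *)
have key k : (k <= n)%N -> Ex P (fun w => S k w ^+ 2) <= k%:R * (16 * (K0 * kappa)).
  elim: k => [_|k IH kn].
    rewrite mul0r (@eq_Ex _ _ _ _ _ (cst 0)) ?Ex_cst//.
    by move=> w; rewrite /S big_ord0 expr0n.
  have mP j c0 : (j < k)%N -> mF (Past k) (delta j c0).
    by move=> jk; apply/measurable_wrtP => //; apply: delta_past => //; exact: ltnW.
  have mPj j c0 i : (j < i)%N -> (i <= k)%N -> mF (Past k) (delta j c0).
    by move=> ji ik; apply: mP; exact: leq_trans ik.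
  have mFu c0 : mF (Fut k) (delta k c0).
    by apply/measurable_wrtP => //; exact: delta_fut.
  have mth i : (i <= k)%N -> mF (Past k) (theta i).
    by move=> ik; apply: mF_theta => j c0 ji; exact: mPj ik.
  have mal i : (i <= k)%N -> mF (Past k) (al i).
    by move=> ik; apply: measurable_funD; apply: measurable_funM => //;
      [apply: mF_cos|apply: mF_sin]; exact: mth.
  have mga i : (i <= k)%N -> mF (Past k) (ga i).
    by move=> ik; apply: measurable_funB; apply: measurable_funM => //;
      [apply: mF_cos|apply: mF_sin]; exact: mth.
  have mrho G i : (forall c0, mF G (delta i c0)) -> mF G (rho i).
    move=> h; apply: measurable_funB; first by apply: mF_sin; exact: mF_D.
    apply: measurable_sum => c0; apply: mF_sin; apply: measurable_funM => //.
    exact: h.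
  have mS : mF (Past k) (S k).
    apply: measurable_sum => j; apply: measurable_funD; apply: measurable_funM.
    - by apply: mal; exact: ltnW.
    - by apply: measurable_funB => //; apply: mF_cos; apply: mF_D => c0; exact: mP.
    - by apply: mga; exact: ltnW.
    - by apply: measurable_funB => //; apply: mrho => c0; exact: mP.
  have orth : Ex P (fun w => S k w * X k w) = 0.
    rewrite (@eq_Ex _ _ _ _ _ (fun w => (S k w * al k w) * (cos (D k w) - c k) +
      (S k w * ga k w) * (rho k w - Ex P (rho k)))); last by move=> w; rewrite /X; ring.
    have wP f : mF (Past k) f -> measurable_wrt (Past k) f by move=> ?; apply/measurable_wrtP.
    have wF f : mF (Fut k) f -> measurable_wrt (Fut k) f by move=> ?; apply/measurable_wrtP.
    have T1 G : sigma_algebra setT G -> G (setT : set T).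
      by move=> sG; rewrite -setC0; case: sG => G0 GC _; rewrite -setTD; exact: GC.
    rewrite ExD; [|by apply: bdmM => //; exact: bdmM|by apply: bdmM => //; exact: bdmM].
    have e1 : Ex P (fun w => (S k w * al k w) * (cos (D k w) - c k)) = 0.
      rewrite (indep2_Ex (past_fut kn) (T1 _ (sPast k)) (T1 _ (sFut k)))//; last exact: bdmM.
      + by rewrite ExBc// subrr mulr0.
      + by apply: wP; apply: measurable_funM => //; exact: mal.
      + by apply: wF; apply: measurable_funB => //; apply: mF_cos; exact: mF_D.
    have e2 : Ex P (fun w => (S k w * ga k w) * (rho k w - Ex P (rho k))) = 0.
      rewrite (indep2_Ex (past_fut kn) (T1 _ (sPast k)) (T1 _ (sFut k)))//; last exact: bdmM.
      + by rewrite ExBc// subrr mulr0.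
      + by apply: wP; apply: measurable_funM => //; exact: mga.
      + by apply: wF; apply: measurable_funB => //; exact: mrho.
    by rewrite e1 e2 addr0.
  have X2 : Ex P (fun w => X k w ^+ 2) <= 16 * (K0 * kappa).
    have Q1 : Ex P (fun w => (cos (D k w) - c k) ^+ 2) <= K0 * kappa.
      apply: (le_trans (var_le 1 (bcosD k))); apply: (Ex_delta4 kn).
        by under eq_fun do rewrite expr2; apply: bdmM; exact: bdmB (bdm_cst _).
      by move=> w; rewrite sqr_ge0 cosD1_le.
    have Q2 : Ex P (fun w => (rho k w - Ex P (rho k)) ^+ 2) <= K0 * kappa.
      apply: (le_trans (var_le 0 (brho k))); apply: (Ex_delta4 kn).
        by under eq_fun do rewrite expr2; apply: bdmM; exact: bdmB (bdm_cst _).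
      by move=> w; rewrite sqr_ge0 subr0 rho_le.
    rewrite (le_trans (y := Ex P (fun w => 8 * (cos (D k w) - c k) ^+ 2 +
        8 * (rho k w - Ex P (rho k)) ^+ 2)))//.
      apply: Ex_le.
      + by under eq_fun do rewrite expr2; exact: bdmM.
      + by apply: bdmD; apply: bdmZ; under eq_fun do rewrite expr2; exact: bdmM.
      + move=> w; rewrite /X.
        set x := cos _ - _; set y := rho _ _ - _.
        have h1 : (al k w * x) ^+ 2 <= 4 * x ^+ 2.
          rewrite exprMn ler_wpM2r ?sqr_ge0// -real_normK ?num_real//.
          by rewrite (_ : 4 = 2 ^+ 2) ?ler_pXn2r ?nnegrE//; ring.
        have h2 : (ga k w * y) ^+ 2 <= 4 * y ^+ 2.
          rewrite exprMn ler_wpM2r ?sqr_ge0// -real_normK ?num_real//.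
          by rewrite (_ : 4 = 2 ^+ 2) ?ler_pXn2r ?nnegrE//; ring.
        have := sqr_ge0 (al k w * x - ga k w * y).
        rewrite sqrrB sqrrD; lra.
    rewrite ExD ?ExZ//; try (by do ?[apply: bdmZ]; under eq_fun do rewrite expr2; exact: bdmM).
    by lra.
  rewrite (@eq_Ex _ _ _ _ _ (fun w => (S k w ^+ 2 + X k w ^+ 2) + 2 * (S k w * X k w))); last first.
    by move=> w; rewrite /S big_ord_recr/=; ring.
  have bb f : bdm f -> bdm (fun w : T => f w ^+ 2) by move=> bf; under eq_fun do rewrite expr2; exact: bdmM.
  rewrite ExD; [|by apply: bdmD; exact: bb|by apply: bdmZ; exact: bdmM].
  rewrite ExD ?ExZ ?orth ?mulr0 ?addr0; [|exact: bdmM|exact: bb|exact: bb].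
  rewrite -natr1 mulrDl mul1r lerD// IH// ltnW//.
have Z1 w : `|Z w| <= 1.
  rewrite /Z indicE; have := pr_ge0 P A; have : pr P A <= 1.
    by rewrite -lee_fin -prE// probability_le1.
  by case: (_ \in _) => /= p1 p0; rewrite ler_norml; apply/andP; split; lra.
have EL k : (0 < k < n)%N -> Ex P (fun w => Z w * L k w) = 0.
  move=> k0n; have kn : (k < n)%N by case/andP: k0n.
  rewrite (@eq_Ex _ _ _ _ _ (fun w => \sum_c0 (Z w * ga k w) * (sin (u k c0 * delta k c0 w) - Ex P (fun w => sin (u k c0 * delta k c0 w))))); last first.
    by move=> w; rewrite /L mulr_sumr; apply: eq_bigr => c0 _; ring.
  rewrite Ex_sum; last by move=> c0 _; apply: bdmM => //; exact: bdmM.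
  rewrite big1// => c0 _.
  have mFk j c1 : (j < k)%N -> mF (Fil k) (delta j c1).
    by move=> jk; apply/measurable_wrtP => //; apply: delta_fil => //; exact: ltnW.
  have T1 G : sigma_algebra setT G -> G (setT : set T).
    by move=> sG; rewrite -setC0; case: sG => G0 GC _; rewrite -setTD; exact: GC.
  rewrite (indep2_Ex (fil_fut1 k0n) (T1 _ (sFil k)) (T1 _ (sFut1 k c0)))//.
  - by rewrite ExBc// subrr mulr0.
  - apply/measurable_wrtP => //; apply: measurable_funM.
      apply: measurable_funB => //; apply: measurable_indic.
      by apply: sub_sigma_algebra; exact: A_fil.
    by apply: measurable_funB; apply: measurable_funM => //;
      [apply: mF_cos|apply: mF_sin]; apply: mF_theta => j c1; exact: mFk.
  - apply/measurable_wrtP => //; apply: measurable_funB => //; apply: mF_sin.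
    apply: measurable_funM => //; apply/measurable_wrtP => //.
    exact: delta_fut1.
  - exact: bdmM.
(* For [k = 0] no independence from [A] is available; the 4 comes from [|ga| <= 2] and from
   centring, which at most doubles the mean of the absolute value. *)
have EL0 : `|Ex P (fun w => Z w * L 0%N w)| <=
    4 * \sum_c0 Ex P (fun w => `|sin (u 0 c0 * delta 0 c0 w)|).
  rewrite (@eq_Ex _ _ _ _ _ (fun w => \sum_c0 (Z w * ga 0 w) * (sin (u 0 c0 * delta 0 c0 w) - Ex P (fun w => sin (u 0 c0 * delta 0 c0 w))))); last first.
    by move=> w; rewrite /L mulr_sumr; apply: eq_bigr => c0 _; ring.
  rewrite Ex_sum; last by move=> c0 _; apply: bdmM => //; exact: bdmM.
  rewrite (le_trans (ler_norm_sum _ _ _))// mulr_sumr; apply: ler_sum => c0 _.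
  set e := Ex P (fun w => sin _); set e' := Ex P (fun w => `| _ |).
  have ee : `|e| <= e' by exact: Ex_norm.
  have bn' : bdm (fun w => `|sin (u 0 c0 * delta 0 c0 w)|) by exact: bdm_norm.
  apply: (le_trans (Ex_norm_le P (g := fun w => 2 * `|sin (u 0 c0 * delta 0 c0 w)| + 2 * e') _ _ _)).
  - by apply: bdmM => //; exact: bdmM.
  - by apply: (bdmD (g := cst (2 * e'))); [exact: bdmZ|exact: bdm_cst].
  - move=> w; rewrite -mulrDr !normrM ler_pM//.
      by rewrite -[2]mul1r ler_pM.
    by rewrite (le_trans (ler_normB _ _))// lerD.
  - have h1 : Ex P (fun w => 2 * `|sin (u 0 c0 * delta 0 c0 w)|) = 2 * e' by rewrite ExZ.
    have h2 : Ex P (fun=> 2 * e') = 2 * e' := Ex_cst P _.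
    have b1' : bdm (fun w => 2 * `|sin (u 0 c0 * delta 0 c0 w)|) by exact: bdmZ.
    by rewrite (ExD P b1' (bdm_cst _)) h1 h2; lra.
have -> : Ex P (fun w => Z w * cos (theta n w + psi)) =
    Ex P (fun w => Z w * S n w) + Ex P (fun w => Z w * L 0%N w).
  have -> : Ex P (fun w => Z w * cos (theta n w + psi)) =
      H 0%N 0 * Ex P Z + Ex P (fun w => Z w * S n w) + \sum_(k < n) Ex P (fun w => Z w * L k w).
    have c1 : bdm (fun w => H 0%N 0 * Z w) by exact: bdmZ.
    have c2 : bdm (fun w => Z w * S n w) by exact: bdmM.
    have c3 : bdm (fun w => \sum_(k < n) Z w * L k w).
      by apply: bdm_sum => k _; exact: bdmM.
    have c4 k : bdm (fun w => Z w * L k w) by exact: bdmM.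
    rewrite -(Ex_sum P _ (fun (k : 'I_n) _ => c4 k)) -ExZ// -(ExD P c1 c2) -(ExD P (bdmD c1 c2) c3).
    by apply: eq_Ex => w; rewrite main big_split/= -mulr_sumr /S; ring.
  rewrite EZ mulr0 add0r; congr (_ + _).
  rewrite -(big_mkord xpredT (fun k => Ex P (fun w => Z w * L k w))).
  rewrite big_ltn// big_nat big1 ?addr0//.
rewrite (le_trans (ler_normD _ _))// lerD//.
(* Young's inequality [|S| <= eta / 2 + S^2 / (2 eta)]; [eta] is chosen once the grid can be
   refined. *)
apply: (le_trans (Ex_norm_le P (g := fun w => 2^-1 * eta + (2 * eta)^-1 * (S n w ^+ 2)) _ _ _)).
- exact: bdmM.
- by apply: (bdmD (f := cst (2^-1 * eta))); [exact: bdm_cst|apply: bdmZ; exact: bdm_sqr].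
- move=> w; rewrite normrM (le_trans (y := `|S n w|))//.
    by rewrite -[leRHS]mul1r ler_wpM2r.
  rewrite -(@ler_pM2l _ (2 * eta)) ?mulr_gt0//.
  rewrite (_ : _ * (_ + _) = eta ^+ 2 + `|S n w| ^+ 2); last first.
    by rewrite real_normK ?num_real//; field; rewrite gt_eqF.
  have := sqr_ge0 (eta - `|S n w|); rewrite sqrrB; lra.
have bS2 : bdm (fun w => (2 * eta)^-1 * S n w ^+ 2) by apply: bdmZ; exact: bdm_sqr.
rewrite (ExD P (bdm_cst (2^-1 * eta)) bS2) Ex_cst ExZ; last exact: bdm_sqr.
rewrite (_ : (eta + _) / 2 = 2^-1 * eta + (2 * eta)^-1 * (n%:R * (16 * (K0 * kappa)))); last first.
  by field; rewrite gt_eqF.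
by rewrite lerD// ler_wpM2l ?invr_ge0 ?mulr_ge0 ?(ltW eta0)// key.
Qed.

End levy_telescoping.

(** * Borel measurability of row vectors *)

Section measurable_vectors.
Context {R : realType} {d : nat}.

Lemma measurable_coord (k : 'I_d) :
  measurable_fun (setT : set (Rd R d)) (fun x : Rd R d => (x : 'rV[R]_d) 0 k).
Proof.
apply: (measurability (RGenOpens.G (R := R))).
  exact: RGenOpens.measurableE.
move=> _ [_ [x [y ->]] <-]; rewrite setTI.
apply: sub_sigma_algebra; apply: open_comp; last exact: itv_open.
by move=> z _; exact: coord_continuous.
Qed.

Lemma continuous_measurable_Rd (f : 'rV[R]_d -> R) : continuous f ->
  measurable_fun (setT : set (Rd R d)) (f : Rd R d -> R).
Proof.
move=> cf; apply: (measurability (RGenOpens.G (R := R))).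
  exact: RGenOpens.measurableE.
move=> _ [_ [x [y ->]] <-]; rewrite setTI.
apply: sub_sigma_algebra; apply: open_comp; last exact: itv_open.
by move=> z _; exact: cf.
Qed.

(** An open set is the union of the countably many rational sup-norm balls that it contains, and the
    preimage of such a ball is a finite intersection of coordinate conditions. *)
Lemma measurable_Rd {dT} {T : measurableType dT} (f : T -> Rd R d) :
  (forall k, measurable_fun setT (fun w => (f w : 'rV[R]_d) 0 k)) ->
  measurable_fun setT f.
Proof.
move=> mf; apply: (@measurability _ _ T (Rd R d) setT f (@open 'rV[R]_d)) => //.
move=> _ [U oU <-]; rewrite setTI.
pose V (p : 'rV[rat]_d * nat) : set T :=
  \bigcap_(k : 'I_d) [set w | `|ratr (p.1 0 k) - (f w : 'rV[R]_d) 0 k| < p.2.+1%:R^-1].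
pose I := [set p : 'rV[rat]_d * nat |
  ball (map_mx ratr p.1 : 'rV[R]_d) (p.2.+1%:R^-1) `<=` U].
have -> : f @^-1` U = \bigcup_(p in I) V p.
  apply/seteqP; split => [w Ufw|w [[q n] /= Iqn Vw]]; last first.
    apply: Iqn; split; first by rewrite invr_gt0.
    by move=> i j; rewrite mxE ord1; exact: Vw.
  have /nbhs_ballP[e /= e0 eU] : nbhs (f w : 'rV[R]_d) U.
    by apply: open_nbhs_nbhs; split.
  (* With radius below [e / 2], a ball that contains [f w] stays within distance [e] of it. *)
  have [n en] : exists n : nat, n.+1%:R^-1 < e / 2.
    exists (Num.truncn (2 / e)).
    rewrite -[e / 2]invrK ltf_pV2 ?posrE ?invr_gt0 ?divr_gt0//.
    by rewrite invf_div truncnS_gt// num_real.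
  have qk (k : 'I_d) : exists q : rat, `|ratr q - (f w : 'rV[R]_d) 0 k| < n.+1%:R^-1.
    have [] := @dense_rat R (ball ((f w : 'rV[R]_d) 0 k) n.+1%:R^-1).
    - by exists ((f w : 'rV[R]_d) 0 k); apply: ballxx; rewrite invr_gt0.
    - exact: ball_open.
    - by move=> y [h [q _ qy]]; exists q; rewrite qy distrC.
  pose q := \row_k projT1 (cid (qk k)).
  have hq k : `|ratr (q 0 k) - (f w : 'rV[R]_d) 0 k| < n.+1%:R^-1.
    by rewrite mxE; case: cid.
  exists (q, n) => //=.
  move=> y [_ qy]; apply: eU; split => // i j.
  have := qy i j; rewrite mxE /ball/= !ord1 => h1.
  rewrite (_ : _ - _ = - (ratr (q 0 j) - (f w : 'rV[R]_d) 0 j) + (ratr (q 0 j) - y 0 j)); last by ring.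
  apply: (le_lt_trans (ler_normD _ _)); rewrite normrN.
  by rewrite [ltRHS](splitr e) ltrD// (lt_trans _ en)//; exact: hq.
  by move=> k _ /=; exact: hq.
rewrite bigcup_mkcond; apply: countable_bigcupT_measurable => [|p]; first exact: countableP.
case: ifP => // _.
apply: fin_bigcap_measurable => // k _.
have -> : [set w | `|ratr (p.1 0 k) - (f w : 'rV[R]_d) 0 k| < p.2.+1%:R^-1] =
    (fun w => (f w : 'rV[R]_d) 0 k) @^-1` (ball (ratr (p.1 0 k) : R) p.2.+1%:R^-1) by [].
rewrite -[X in measurable X]setTI; apply: mf => //.
by apply: open_measurable; exact: ball_open.
Qed.

End measurable_vectors.

(** * Augmentation by null sets *)

Section augmentation.
Context {R : realType} {dT : measure_display} {T : measurableType dT}.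
Variable P : probability T R.
Implicit Types (A B : set T) (G H : set (set T)).

Definition aeq A B := P.-negligible ((A `\` B) `|` (B `\` A)).

(** Sections of adapted events are identified only up to null sets; independence is insensitive to
    them, provided that the sets remain measurable. *)
Definition aug G : set (set T) :=
  [set A | measurable A /\ exists2 B, G B & aeq A B].

Lemma aeq_refl A : aeq A A.
Proof. by rewrite /aeq setDv setU0; exact: negligible_set0. Qed.

Lemma pr_aeq A B : measurable A -> measurable B -> aeq A B -> pr P A = pr P B.
Proof.
move=> mA mB /negligibleP h.
have {}h : P (A `\` B `|` B `\` A) = 0%E.
  by apply: h; apply: measurableU; exact: measurableD.
have h1 : P (A `\` B) = 0%E.
  apply/eqP; rewrite -measure_le0 -h; apply: le_measure.
  - by rewrite inE; exact: measurableD.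
  - by rewrite inE; apply: measurableU; exact: measurableD.
  - exact: subsetUl.
have h2 : P (B `\` A) = 0%E.
  apply/eqP; rewrite -measure_le0 -h; apply: le_measure.
  - by rewrite inE; exact: measurableD.
  - by rewrite inE; apply: measurableU; exact: measurableD.
  - exact: subsetUr.
have eA : P A = P (A `&` B).
  have -> : P A = P ((A `&` B) `|` (A `\` B)) by rewrite setUIDK.
  rewrite measureU//; [|exact: measurableI|exact: measurableD|].
    by rewrite [X in (_ + X)%E](_ : _ = 0%E) ?adde0.
  by rewrite setDE setIACA setICr setI0.
have eB : P B = P (A `&` B).
  have -> : P B = P ((B `&` A) `|` (B `\` A)) by rewrite setUIDK.
  rewrite measureU//; [|exact: measurableI|exact: measurableD|].
    by rewrite [X in (_ + X)%E](_ : _ = 0%E) ?adde0// setIC.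
  by rewrite setDE setIACA setICr setI0.
by rewrite /pr eA eB.
Qed.

Lemma aeqI A A' B B' : aeq A A' -> aeq B B' -> aeq (A `&` B) (A' `&` B').
Proof.
move=> h1 h2; apply: negligibleS (negligibleU h1 h2) => w /= [[[aw bw] nab]|[[aw bw] nab]].
- have [a'|na'] := pselect (A' w); last by left; left.
  by right; left; split=> // b'; exact: nab.
- have [a'|na'] := pselect (A w); last by left; right.
  by right; right; split=> // b'; exact: nab.
Qed.

Lemma aeq_bigcup (A B : (set T)^nat) : (forall n, aeq (A n) (B n)) ->
  aeq (\bigcup_n A n) (\bigcup_n B n).
Proof.
move=> h; apply: negligibleS (negligible_bigcup h) => w /= [[[n _ an] nb]|[[n _ bn] na]].
- by exists n => //; left; split=> // bn; apply: nb; exists n.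
- by exists n => //; right; split=> // an; apply: na; exists n.
Qed.

Lemma aug_sigma_algebra G : sigma_algebra setT G -> sigma_algebra setT (aug G).
Proof.
move=> [G0 GC GU]; split.
- by split=> //; exists set0 => //; exact: aeq_refl.
- move=> A [mA [B GB AB]]; split; first exact: measurableD.
  exists (setT `\` B); first exact: GC.
  by rewrite /aeq !setTD !setDE !setCK setUC setIC (setIC (~` A)).
- move=> A h; split; first by apply: bigcupT_measurable => n; case: (h n).
  have {}h n : {B | G B & aeq (A n) B} by apply: cid2; case: (h n).
  exists (\bigcup_n s2val (h n)); last by apply: aeq_bigcup => n; case: (h n).
  by apply: GU => n; case: (h n).
Qed.

Lemma sub_aug G : measurable_sys G -> G `<=` aug G.
Proof. by move=> mG A GA; split; [exact: mG|exists A => //; exact: aeq_refl]. Qed.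

Lemma aug_measurable G : measurable_sys (aug G).
Proof. by move=> A []. Qed.

Lemma indep2_aug G H : measurable_sys G -> measurable_sys H -> indep2 P G H ->
  indep2 P (aug G) H.
Proof.
move=> mG mH GH A B [mA [A' GA' AA']] HB.
rewrite (pr_aeq (B := A' `&` B)).
- by rewrite GH// (pr_aeq mA (mG _ GA') AA').
- by apply: measurableI => //; exact: mH.
- by apply: measurableI => //; [exact: mG|exact: mH].
- by apply: aeqI => //; exact: aeq_refl.
Qed.

End augmentation.

(** * Fourth moments of Gaussian variables *)

Section normal_fourth_moment.
Context {R : realType}.
Notation mu := (@lebesgue_measure R).

Lemma ge0_integral_normal_prob (m s : R) (f : R -> \bar R) :
  (forall x, 0 <= f x)%E -> measurable_fun setT f ->
  (\int[normal_prob m s]_x f x = \int[mu]_x (f x * (normal_pdf m s x)%:E))%E.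
Proof.
move=> f0 mf.
have dom := @normal_prob_dominates R m s.
rewrite -(Radon_Nikodym_SigmaFinite.change_of_variables dom f0 measurableT mf).
have mpdf : measurable_fun setT (fun x => (normal_pdf m s x)%:E).
  by apply/measurable_EFinP; exact: measurable_normal_pdf.
have iRN := Radon_Nikodym_SigmaFinite.f_integrable dom.
apply: ae_eq_integral => //.
- by apply: emeasurable_funM => //; exact: measurable_int iRN.
- exact: emeasurable_funM.
- apply: ae_eqe_mul2l; apply: integral_ae_eq => // E _ mE.
  by rewrite -(Radon_Nikodym_SigmaFinite.f_integral dom mE).
Qed.

Lemma expR_ge_sqr (z : R) : 0 <= z -> z ^+ 2 / 2 <= expR z.
Proof.
move=> z0; have := expR_ge1Dxn 1 z0; rewrite (_ : 2`! = 2)// => h.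
by apply: le_trans h; rewrite lerDr.
Qed.

(** From [z^2 / 2 <= expR z] with [z = x^2 / (4 v)] one gets [x^4 <= 32 v^2 expR z]. The exponential
    turns the density of variance [v] into at most twice that of variance [2 v], which has integral
    1; hence 64 in place of the exact 3. *)
Lemma normal_moment4 (v : R) : 0 < v ->
  (\int[normal_prob 0 (Num.sqrt v)]_x (x ^+ 4)%:E <= (64 * v ^+ 2)%:E)%E.
Proof.
move=> v0; have s0 : 0 < Num.sqrt v by rewrite sqrtr_gt0.
have s20 : 0 < Num.sqrt (2 * v) by rewrite sqrtr_gt0 mulr_gt0.
rewrite ge0_integral_normal_prob; last 2 first.
- by move=> x; rewrite lee_fin exprn_even_ge0.
- by apply/measurable_EFinP; exact: measurable_funX.
apply: (@le_trans _ _ (\int[mu]_x ((64 * v ^+ 2)%:E * (normal_pdf 0 (Num.sqrt (2 * v)) x)%:E))%E); last first.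
  rewrite ge0_integralZl//.
  - by rewrite integral_normal_pdf mule1.
  - by apply/measurable_EFinP; exact: measurable_normal_pdf.
  - by move=> x _; rewrite lee_fin normal_pdf_ge0.
  - by rewrite lee_fin mulr_ge0 ?sqr_ge0.
apply: ge0_le_integral => //.
- by move=> x _; rewrite mule_ge0// lee_fin ?normal_pdf_ge0// exprn_even_ge0.
- apply: emeasurable_funM; first by apply/measurable_EFinP; exact: measurable_funX.
  by apply/measurable_EFinP; exact: measurable_normal_pdf.
- apply: emeasurable_funM => //.
  by apply/measurable_EFinP; exact: measurable_normal_pdf.
move=> x _; rewrite -!EFinM lee_fin !normal_pdfE ?gt_eqF//.
rewrite /normal_fun subr0 !sqr_sqrtr ?(ltW v0) ?mulr_ge0 ?(ltW v0)//.
have peak : normal_peak (Num.sqrt v) <= 2 * normal_peak (Num.sqrt (2 * v)).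
  rewrite /normal_peak !sqr_sqrtr ?(ltW v0) ?mulr_ge0 ?(ltW v0)//.
  set a := Num.sqrt (v * pi *+ 2); set b := Num.sqrt (2 * v * pi *+ 2).
  have vpi : 0 < v * pi by rewrite mulr_gt0// pi_gt0.
  have a0 : 0 < a by rewrite sqrtr_gt0 pmulrn_lgt0.
  have b0 : 0 < b by rewrite sqrtr_gt0 pmulrn_lgt0// -mulrA mulr_gt0.
  rewrite -[leLHS]mul1r ler_pdivrMr// mulrAC ler_pdivlMr// mul1r.
  rewrite -[2 in leRHS]ger0_norm// -sqrtr_sqr -sqrtrM ?sqr_ge0//.
  by rewrite ler_sqrt ?mulr_ge0 ?sqr_ge0 ?mulrn_wge0 ?(ltW vpi)//; lra.
have e0 : 0 <= x ^+ 2 / (4 * v) by rewrite divr_ge0 ?sqr_ge0// mulr_ge0// ltW.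
have e2 : x ^+ 4 <= 32 * v ^+ 2 * expR (x ^+ 2 / (4 * v)).
  have := expR_ge_sqr e0.
  rewrite (_ : (x ^+ 2 / (4 * v)) ^+ 2 / 2 = x ^+ 4 / (32 * v ^+ 2)); last by field; rewrite gt_eqF.
  by rewrite ler_pdivrMr ?mulr_gt0 ?exprn_gt0// mulrC.
rewrite (_ : - x ^+ 2 / (v *+ 2) = - (x ^+ 2 / (4 * v)) + - x ^+ 2 / (2 * v *+ 2)); last first.
  by field; rewrite gt_eqF.
rewrite expRD; set E := expR (- x ^+ 2 / _).
have E0 : 0 <= E by exact: expR_ge0.
have h : x ^+ 4 * expR (- (x ^+ 2 / (4 * v))) <= 32 * v ^+ 2.
  have ee : expR (x ^+ 2 / (4 * v)) * expR (- (x ^+ 2 / (4 * v))) = 1.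
    by rewrite -expRD subrr expR0.
  rewrite (_ : 32 * v ^+ 2 = 32 * v ^+ 2 * expR (x ^+ 2 / (4 * v)) *
    expR (- (x ^+ 2 / (4 * v)))); last by rewrite -mulrA ee mulr1.
  by rewrite ler_wpM2r ?expR_ge0.
have pk : 0 <= normal_peak (Num.sqrt v) by exact: normal_peak_ge0.
rewrite (_ : x ^+ 4 * _ = normal_peak (Num.sqrt v) * E * (x ^+ 4 * expR (- (x ^+ 2 / (4 * v))))); last by ring.
apply: (@le_trans _ _ (normal_peak (Num.sqrt v) * E * (32 * v ^+ 2))).
  by rewrite ler_wpM2l// mulr_ge0.
rewrite (_ : 64 * v ^+ 2 * _ = 2 * normal_peak (Num.sqrt (2 * v)) * (E * (32 * v ^+ 2))); last by ring.
by rewrite -[leLHS]mulrA ler_wpM2r// mulr_ge0// mulr_ge0// sqr_ge0.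
Qed.

End normal_fourth_moment.

Section law_transfer.
Context {R : realType} {dT dE : measure_display}.
Context {T : measurableType dT} {E : measurableType dE}.

Lemma ge0_integral_law (mu : {measure set T -> \bar R}) (nu : {measure set E -> \bar R})
    (f : T -> E) (g : E -> \bar R) :
  measurable_fun setT f -> (forall C, measurable C -> mu (f @^-1` C) = nu C) ->
  (forall x, 0 <= g x)%E -> measurable_fun setT g ->
  (\int[mu]_w g (f w) = \int[nu]_x g x)%E.
Proof.
move=> mf law g0 mg.
pose mixin := isMeasurableFun.Build _ _ _ _ _ mf.
pose pack : {mfun T >-> E} := HB.pack f mixin.
rewrite -(@eq_measure_integral _ _ _ setT nu (pushforward mu pack) g).
  by rewrite (ge0_integral_pushforward mf)// => x _.
by move=> C mC _; rewrite -law.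
Qed.

Lemma sumr_cst (I : finType) (x : R) : \sum_(i : I) x = #|I|%:R * x.
Proof.
rewrite sumr_const; set y := #|I|%:R * x; rewrite (_ : y = x *+ #|I|).
  by congr (_ *+ _); exact: eq_card.
by rewrite /y mulr_natl.
Qed.

End law_transfer.

Section generated_sigma_algebras.
Context {R : realType} {dT : measure_display} {T : measurableType dT}.

Lemma g_sigma_measurable_sys (G : set (set T)) : measurable_sys G ->
  measurable_sys <<s G >>.
Proof. by move=> mG A; apply: smallest_sub => //; exact: sigma_algebra_measurable. Qed.

Lemma sigma_algebraT (G : set (set T)) : sigma_algebra setT G -> G setT.
Proof. by move=> [G0 GC _]; rewrite -(setD0 setT); exact: GC. Qed.

Lemma setI_closed_sigma (G : set (set T)) : sigma_algebra setT G -> setI_closed G.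
Proof.
move=> sG A B GA GB; rewrite -(sigma_algebra_id sG) in GA GB *.
by apply: (@measurableI _ (g_sigma_algebraType G)).
Qed.

(** A pi-system that generates the join of the first [N] systems when these are pi-systems
    containing [setT]. *)
Definition capsys N (G : nat -> set (set T)) : set (set T) :=
  [set A | exists A' : nat -> set T, (forall i, (i < N)%N -> G i (A' i)) /\
    A = \bigcap_(i in `I_N) A' i].

Lemma capsysI N G : (forall i, (i < N)%N -> setI_closed (G i)) -> setI_closed (capsys N G).
Proof.
move=> GI A B [A' [GA ->]] [B' [GB ->]]; exists (fun i => A' i `&` B' i); split.
  by move=> i iN; apply: GI => //; [exact: GA|exact: GB].
by rewrite bigcapI.
Qed.

Lemma capsys_measurable N G : (forall i, (i < N)%N -> measurable_sys (G i)) ->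
  measurable_sys (capsys N G).
Proof.
move=> mG A [A' [GA ->]]; apply: bigcap_measurableType => i iN.
exact: mG (GA _ _).
Qed.

Lemma sub_capsys N (G : nat -> set (set T)) i A : (i < N)%N ->
  (forall j, G j setT) -> G i A -> capsys N G A.
Proof.
move=> iN GT GA; exists (fun j => if j == i then A else setT); split.
  by move=> j _; case: eqP => [->|].
apply/seteqP; split => w /=; first by move=> Aw j _; case: eqP.
by move=> /(_ i iN); rewrite eqxx.
Qed.

End generated_sigma_algebras.

Section brownian_independence.
Context {R : realType} {d : nat} {dT : measure_display} {T : measurableType dT}.
Variables (P : probability T R) (F : R -> set (set T)).
Variables (B : nat -> R -> T -> 'rV[R]_d) (N : nat).
Hypothesis filF : filtration F.
Hypothesis BM : forall i, brownian_motion P F (B i).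
Hypothesis indB : independent_sigma P (fun i => sigma_process (B i)).

Let sF t : 0 <= t -> sigma_algebra setT (F t).
Proof. by move=> t0; have [h _] := filF; have [] := h _ t0. Qed.

Let mF t : 0 <= t -> measurable_sys (F t).
Proof. by move=> t0; have [h _] := filF; have [] := h _ t0. Qed.

Lemma measurable_brownian i s : 0 <= s -> measurable_fun setT (B i s : T -> Rd R d).
Proof.
move=> s0 _ C mC; rewrite setTI; have [h _ _ _] := BM i.
exact: mF (h _ s0 _ mC).
Qed.

Let b (c : 'I_N * 'I_d) s w : R := B c.1 s w 0 c.2.

Let mb c s : 0 <= s -> measurable_fun setT (b c s).
Proof.
move=> s0; exact: (measurableT_comp (measurable_coord c.2) (measurable_brownian c.1 s0)).
Qed.

Let Bpast i r := <<s [set A | exists q (C : set (Rd R d)),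
  [/\ 0 <= q <= r, measurable C & A = B i q @^-1` C]] >>.

(** Boxes only: the law of an increment and its independence from the past are given on boxes, which
    form a pi-system. *)
Let Bbox i r s := [set A | exists C : 'I_d -> set R, (forall k, measurable (C k)) /\
  A = [set w | forall k, C k (B i s w 0 k - B i r w 0 k)]].

Let pr_box i r s A C : 0 <= r -> r < s -> F r A -> Bbox i r s C ->
  pr P (A `&` C) = pr P A * pr P C.
Proof.
move=> r0 rs FA [C' [mC' ->]]; have [_ _ _ h] := BM i.
have FT := sigma_algebraT (sF r0).
have e1 := h r s r0 rs A FA C' mC'.
have := h r s r0 rs setT FT C' mC'.
rewrite setTI [X in (X * _)%E]probability_setT mul1e => e2.
by rewrite /pr e1 e2 fineM// fin_num_measure//; exact: mF FA.
Qed.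

Let Bpast_F i r : 0 <= r -> Bpast i r `<=` F r.
Proof.
move=> r0; apply: smallest_sub; first exact: sF.
move=> _ [q [C [/andP[q0 qr] mC ->]]].
have [_ mono] := filF; apply: (mono q r q0 qr).
by have [h _ _ _] := BM i; exact: h.
Qed.

Let Bpast_sigma i r : Bpast i r `<=` sigma_process (B i).
Proof.
apply: sub_sigma_algebra2 => _ [q [C [/andP[q0 _] mC ->]]].
by exists q, C.
Qed.

Let wrt_incr (G : set (set T)) i r s k : sigma_algebra setT G ->
  (forall C : set (Rd R d), measurable C -> G (B i r @^-1` C)) ->
  (forall C : set (Rd R d), measurable C -> G (B i s @^-1` C)) ->
  measurable_wrt G (fun w => B i s w 0 k - B i r w 0 k).
Proof.
move=> sG h1 h2; apply/measurable_wrtP => //.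
have m1 : measurable_fun (setT : set (g_sigma_algebraType G)) (B i r : _ -> Rd R d).
  exact/measurable_wrtP.
have m2 : measurable_fun (setT : set (g_sigma_algebraType G)) (B i s : _ -> Rd R d).
  exact/measurable_wrtP.
apply: measurable_funB.
- exact: (measurableT_comp (measurable_coord k) m2).
- exact: (measurableT_comp (measurable_coord k) m1).
Qed.

Let sP i : sigma_algebra setT (sigma_process (B i)).
Proof. exact: smallest_sigma_algebra. Qed.

Let sigmaB i q C : 0 <= q -> measurable C -> sigma_process (B i) (B i q @^-1` (C : set (Rd R d))).
Proof. by move=> q0 mC; apply: sub_sigma_algebra; exists q, C. Qed.

Lemma sigma_process_measurable i : measurable_sys (sigma_process (B i)).
Proof.
apply: g_sigma_measurable_sys => _ [q [C [q0 mC ->]]].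
by have := measurable_brownian i q0 measurableT mC; rewrite setTI.
Qed.

Let Bbox_sigma i r s : 0 <= r -> r <= s -> Bbox i r s `<=` sigma_process (B i).
Proof.
move=> r0 rs _ [C [mC ->]]; have s0 := le_trans r0 rs.
have -> : [set w | forall k, C k (B i s w 0 k - B i r w 0 k)] =
    \bigcap_(k : 'I_d) ((fun w => B i s w 0 k - B i r w 0 k) @^-1` (C k)).
  by apply/seteqP; split => w /= h; [move=> k _; exact: h|move=> k; exact: h].
rewrite -(sigma_algebra_id (sP i)).
apply: (@fin_bigcap_measurable _ (g_sigma_algebraType (sigma_process (B i)))) => // k _.
rewrite /measurable/= (sigma_algebra_id (sP i)).
by apply: (wrt_incr k (sP i)) => // C' mC'; exact: sigmaB.
Qed.

Let prod_pr (A : nat -> set T) : (forall i, (i < N)%N -> sigma_process (B i) (A i)) ->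
  pr P (\bigcap_(i in `I_N) A i) = \prod_(i < N) pr P (A i).
Proof. by move=> h; rewrite /pr indB. Qed.

Let BboxI i r s : setI_closed (Bbox i r s).
Proof.
move=> _ _ [C [mC ->]] [D [mD ->]]; exists (fun k => C k `&` D k); split.
  by move=> k; exact: measurableI.
by apply/seteqP; split => w /=; [move=> [h1 h2] k|move=> h; split=> k; have [] := h k].
Qed.

Let Past r := <<s capsys N (Bpast ^~ r) >>.
Let Fut r s := <<s capsys N (fun i => Bbox i r s) >>.

Let mpast_sys r : measurable_sys (capsys N (Bpast ^~ r)).
Proof.
by apply: capsys_measurable => i _ A /Bpast_sigma; exact: sigma_process_measurable.
Qed.

Let mfut_sys r s : 0 <= r -> r <= s -> measurable_sys (capsys N (fun i => Bbox i r s)).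
Proof.
move=> r0 rs; apply: capsys_measurable => i _ A /(Bbox_sigma r0 rs).
exact: sigma_process_measurable.
Qed.

(** On the generators, mutual independence of the motions factorises everything over [i]; each
    factor then splits by independence of the increment of [B i] from [F r]. *)
Let indep_past_fut r s : 0 <= r -> r < s -> indep2 P (Past r) (Fut r s).
Proof.
move=> r0 rs; apply: indep2_sigma2.
- by apply: capsysI => i _; apply: setI_closed_sigma; exact: smallest_sigma_algebra.
- exact: mpast_sys.
- by apply: capsysI => i _; exact: BboxI.
- exact: mfut_sys (ltW rs).
move=> _ _ [A [hA ->]] [C [hC ->]].
have sA i : (i < N)%N -> sigma_process (B i) (A i) by move=> iN; exact: Bpast_sigma (hA _ iN).
have sC i : (i < N)%N -> sigma_process (B i) (C i).
  by move=> iN; exact: Bbox_sigma r0 (ltW rs) _ (hC _ iN).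
rewrite -bigcapI prod_pr; last first.
  by move=> i iN; apply: (setI_closed_sigma (sP i)); [exact: sA|exact: sC].
rewrite !prod_pr// -big_split/=; apply: eq_bigr => i _.
by apply: (pr_box r0 rs); [apply: Bpast_F => //; exact: hA|exact: hC].
Qed.

Section grid.
Variable t : R.
Hypothesis t0 : 0 < t.

Let pt (n k : nat) : R := k%:R * (t / n%:R).

Let pt_ge0 n k : 0 <= pt n k.
Proof. by rewrite mulr_ge0 ?divr_ge0 ?(ltW t0). Qed.

Definition incr n k (c : 'I_N * 'I_d) w : R := b c (pt n k.+1) w - b c (pt n k) w.

Definition incr_sys : set (set T) := [set A | exists n k c (C : set R),
  [/\ (k < n)%N, measurable C & A = incr n k c @^-1` C]].

Definition incr_sys1 (i : 'I_N) : set (set T) := [set A | exists n k l (C : set R),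
  [/\ (k < n)%N, measurable C & A = incr n k (i, l) @^-1` C]].

Lemma measurable_incr n k (c : 'I_N * 'I_d) : measurable_fun setT (incr n k c).
Proof. by apply: measurable_funB; exact: mb. Qed.

Lemma incr_sys1_sigma i : incr_sys1 i `<=` sigma_process (B i).
Proof.
move=> _ [n [k [l [C [kn mC ->]]]]].
by apply: (wrt_incr l (sP i)) => // C' mC'; exact: sigmaB.
Qed.

Let pt_lt n k : (0 < n)%N -> pt n k < pt n k.+1.
Proof. by move=> n0; rewrite ltr_pM2r ?divr_gt0 ?ltr0n// ltr_nat. Qed.

Let pt_le n j k : (j <= k)%N -> pt n j <= pt n k.
Proof. by move=> jk; rewrite ler_wpM2r ?divr_ge0 ?(ltW t0)// ler_nat. Qed.

Let ptB n k : pt n k.+1 - pt n k = t / n%:R.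
Proof. by rewrite /pt -natr1; ring. Qed.

Let incr_box n k (c : 'I_N * 'I_d) (C : set R) : measurable C ->
  Bbox c.1 (pt n k) (pt n k.+1) (incr n k c @^-1` C).
Proof.
move=> mC; exists (fun l => if l == c.2 then C else setT); split.
  by move=> l; case: ifP.
apply/seteqP; split => w /=.
  by move=> Cw l; case: eqP => [->|].
by move=> /(_ c.2); rewrite eqxx.
Qed.

Let incr_law n k (c : 'I_N * 'I_d) (C : set R) : (0 < n)%N -> measurable C ->
  P (incr n k c @^-1` C) = normal_prob 0 (Num.sqrt (t / n%:R)) C.
Proof.
move=> n0 mC; have [_ _ _ h] := BM c.1.
have FT := sigma_algebraT (sF (pt_ge0 n k)).
have := h _ _ (pt_ge0 n k) (pt_lt k n0) setT FT (fun l => if l == c.2 then C else setT) _.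
rewrite setTI [X in (X * _)%E]probability_setT mul1e ptB.
rewrite (bigD1 c.2)//= eqxx big1 ?mulr1; last first.
  by move=> l /negbTE ->; rewrite [X in fine X]probability_setT.
rewrite fineK ?fin_num_measure//.
set S := [set w | _]; have -> : S = incr n k c @^-1` C.
  apply/seteqP; split => w /=; last by move=> Cw l; case: eqP => [->|].
  by move=> /(_ c.2); rewrite eqxx.
by apply=> l; case: ifP.
Qed.

Let incr4 n k (c : 'I_N * 'I_d) : (0 < n)%N ->
  (\int[P]_w (incr n k c w ^+ 4)%:E <= (64 * (t / n%:R) ^+ 2)%:E)%E.
Proof.
move=> n0; apply: le_trans (normal_moment4 _); last by rewrite divr_gt0// ltr0n.
have m4 : measurable_fun setT (fun x : R => (x ^+ 4)%:E).
  by apply/measurable_EFinP; exact: measurable_funX.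
rewrite (@ge0_integral_law _ _ _ _ _ P (normal_prob 0 (Num.sqrt (t / n%:R)))
  (incr n k c) (fun x : R => (x ^+ 4)%:E))//.
- exact: measurable_incr.
- by move=> C mC; exact: incr_law.
- by move=> x; rewrite lee_fin exprn_even_ge0.
Qed.

Let incr4_Ex n k f : (0 < n)%N -> bdm f ->
  (forall w, 0 <= f w <= \sum_c incr n k c w ^+ 4) ->
  Ex P f <= #|{: 'I_N * 'I_d}|%:R * (64 * (t / n%:R) ^+ 2).
Proof.
move=> n0 bf hf.
have i4 c : measurable_fun setT (fun w => (incr n k c w ^+ 4)%:E).
  by apply/measurable_EFinP; apply: measurable_funX; exact: measurable_incr.
have p4 c w : (0 <= (incr n k c w ^+ 4)%:E)%E by rewrite lee_fin exprn_even_ge0.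
rewrite -lee_fin /Ex /Rintegral fineK; last first.
  by apply: integrable_fin_num => //; exact: bdm_integrable.
apply: (@le_trans _ _ (\int[P]_w (\sum_c (incr n k c w ^+ 4)%:E))%E).
  apply: ge0_le_integral => //.
  - by move=> w _; rewrite lee_fin; have /andP[] := hf w.
  - by apply/measurable_EFinP; case: bf.
  - exact: emeasurable_sum.
  - by move=> w _; rewrite sumEFin lee_fin; have /andP[] := hf w.
rewrite ge0_integral_sum//.
apply: (@le_trans _ _ (\sum_(c : 'I_N * 'I_d) (64 * (t / n%:R) ^+ 2)%:E)%E).
  by apply: lee_sum => c _; exact: incr4.
by rewrite sumEFin sumr_cst.
Qed.

Definition incr_sum n (u : nat -> 'I_N * 'I_d -> R) w : R :=
  \sum_(k < n) \sum_c u k c * incr n k c w.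

Lemma measurable_incr_sum n u : measurable_fun setT (incr_sum n u).
Proof.
apply: measurable_sum => k; apply: measurable_sum => c.
by apply: measurable_funM => //; exact: measurable_incr.
Qed.

(** Weights constant on blocks of length [m] leave the sum unchanged on the finer grid. A fixed sum
    can thus be estimated on arbitrarily fine grids, and two sums can be put on a common grid. *)
Lemma incr_sum_refine n m u w : (0 < n)%N -> (0 < m)%N ->
  incr_sum n u w = incr_sum (n * m) (fun k => u (k %/ m)%N) w.
Proof.
move=> n0 m0; rewrite /incr_sum.
have mm (g : nat -> R) j : \sum_(k < j * m) g k = \sum_(i < j) \sum_(l < m) g (i * m + l)%N.
  elim: j => [|j IH]; first by rewrite mul0n !big_ord0.
  rewrite big_ord_recr/= -IH mulSn addnC.
  rewrite -(big_mkord xpredT g) (big_cat_nat (n := (j * m)%N))//= ?leq_addr//.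
  rewrite big_mkord; congr (_ + _).
  by rewrite -{1}[(j * m)%N]add0n big_addn addKn big_mkord; apply: eq_bigr => l _; rewrite addnC.
rewrite (mm (fun k => \sum_c u (k %/ m)%N c * incr (n * m) k c w)).
apply: eq_bigr => i _.
rewrite exchange_big/=; apply: eq_bigr => c _.
rewrite (eq_bigr (fun l : 'I_m => u i c * incr (n * m) (i * m + l) c w)); last first.
  by move=> l _; rewrite divnMDl// divn_small ?addn0.
rewrite -mulr_sumr; congr (_ * _).
rewrite -(big_mkord xpredT (fun l => incr (n * m) (i * m + l) c w)) /incr.
rewrite (eq_bigr (fun l => b c (pt (n * m) (i * m + l.+1)) w - b c (pt (n * m) (i * m + l)) w)); last first.
  by move=> l _; rewrite addnS.
rewrite (telescope_sumr (fun l => b c (pt (n * m) (i * m + l)) w))// addn0.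
have e j : pt (n * m) (j * m) = pt n j.
  by rewrite /pt !natrM; field; rewrite !pnatr_eq0 -!lt0n m0 n0.
by rewrite -e mulSn addnC e.
Qed.

Variable A : set T.
Hypothesis mA : measurable A.
Hypothesis augA : forall s, 0 < s -> aug P (F s) A.

Let Fut1 n k (c : 'I_N * 'I_d) := preimage_set_system setT (incr n k c) measurable.

Let sFut1 n k c : sigma_algebra setT (Fut1 n k c).
Proof. by apply: sigma_algebra_preimage; exact: sigma_algebra_measurable. Qed.

Let mFut1 n k c : measurable_sys (Fut1 n k c).
Proof. by move=> _ [C mC <-]; exact: measurable_incr. Qed.

Let indep_F_incr n k c : (0 < n)%N -> indep2 P (F (pt n k)) (Fut1 n k c).
Proof.
move=> n0 A' _ FA' [C mC <-]; rewrite setTI.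
apply: pr_box FA' _; [exact: pt_ge0|exact: pt_lt|exact: incr_box].
Qed.

Let past_incr n j k (c : 'I_N * 'I_d) : (j < k)%N ->
  measurable_wrt (Past (pt n k)) (incr n j c).
Proof.
move=> jk; have sPast : sigma_algebra setT (Past (pt n k)) by exact: smallest_sigma_algebra.
have h q C : 0 <= q <= pt n k -> measurable C -> Past (pt n k) (B c.1 q @^-1` (C : set (Rd R d))).
  move=> hq mC; apply: sub_sigma_algebra; apply: (sub_capsys (i := c.1)) => //.
    by move=> i; apply: sigma_algebraT; exact: smallest_sigma_algebra.
  by apply: sub_sigma_algebra; exists q, C.
apply: wrt_incr => // C mC; apply: h => //; rewrite pt_ge0/= pt_le//.
exact: ltnW.
Qed.

Let fut_incr n k (c : 'I_N * 'I_d) : measurable_wrt (Fut (pt n k) (pt n k.+1)) (incr n k c).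
Proof.
move=> C mC; apply: sub_sigma_algebra; apply: (sub_capsys (i := c.1)) => //.
  move=> i; exists (fun=> setT); split=> //.
  by apply/seteqP; split.
exact: incr_box.
Qed.

Let F_incr n j k (c : 'I_N * 'I_d) : (j < k)%N ->
  measurable_wrt (aug P (F (pt n k))) (incr n j c).
Proof.
move=> jk; apply: wrt_incr; first by apply: aug_sigma_algebra; apply: sF; exact: pt_ge0.
- move=> C mC; apply: sub_aug; first exact: mF.
  have [_ mono] := filF; apply: (mono (pt n j)) => //; first by apply: pt_le; exact: ltnW.
  by have [h _ _ _] := BM c.1; exact: h.
- move=> C mC; apply: sub_aug; first exact: mF.
  have [_ mono] := filF; apply: (mono (pt n j.+1)) => //; first by apply: pt_le.
  by have [h _ _ _] := BM c.1; exact: h.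
Qed.

(** Of order [n^-2] per step, so that the orthogonal terms of [n] steps have a total second moment
    of order [1 / n]. *)
Let kappa n := #|{: 'I_N * 'I_d}|%:R * (64 * (t / n%:R) ^+ 2).
Let K0 (U : R) := (#|{: 'I_N * 'I_d}|%:R + 1) ^+ 3 * U ^+ 4.

Let levy_bound n u (U psi eta : R) : (0 < n)%N -> 0 <= U -> (forall k c, `|u k c| <= U) ->
  0 < eta ->
  `|Ex P (fun w => (\1_A w - pr P A) * cos (incr_sum n u w + psi))| <=
  (eta + n%:R * (16 * (K0 U * kappa n)) / eta) / 2 +
  4 * \sum_c Ex P (fun w => `|sin (u 0%N c * incr n 0 c w)|).
Proof.
move=> n0 U0 uU eta0.
apply: (@levy_telescoping _ _ _ P _ n (incr n) u (fun k => Past (pt n k))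
  (fun k => Fut (pt n k) (pt n k.+1)) (fun k => aug P (F (pt n k))) (Fut1 n) A U (kappa n)) => //.
- by move=> k c; exact: measurable_incr.
- by move=> k; exact: smallest_sigma_algebra.
- by move=> k; exact: smallest_sigma_algebra.
- by move=> k; apply: aug_sigma_algebra; apply: sF; exact: pt_ge0.
- by move=> k; apply: g_sigma_measurable_sys; exact: mpast_sys.
- by move=> k; apply: g_sigma_measurable_sys; apply: mfut_sys; [exact: pt_ge0|exact: pt_le].
- by move=> k; exact: aug_measurable.
- by move=> j k c jk _; exact: past_incr.
- by move=> j k c jk _; exact: F_incr.
- by move=> k c _ C mC; exists C => //; rewrite setTI.
- by move=> k _; apply: indep_past_fut; [exact: pt_ge0|exact: pt_lt].
- move=> k c _; apply: indep2_aug; [|exact: mFut1|exact: indep_F_incr].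
  by apply: mF; exact: pt_ge0.
- by move=> k /andP[k0 _]; apply: augA; rewrite /pt mulr_gt0 ?divr_gt0 ?ltr0n.
- by move=> k f _; exact: incr4_Ex.
Qed.

(** The sine is either at most [eta] or at most its fourth power divided by [eta^3], and the fourth
    moment of one increment is small. *)
Let sin_bound n u (U eta : R) c : (0 < n)%N -> 0 <= U -> (forall k c, `|u k c| <= U) ->
  0 < eta ->
  Ex P (fun w => `|sin (u 0%N c * incr n 0 c w)|) <= eta + U ^+ 4 * kappa n / eta ^+ 3.
Proof.
move=> n0 U0 uU eta0.
have bs : bdm (fun w => sin (u 0%N c * incr n 0 c w)).
  by apply: bdm_sin; apply: measurable_funM => //; exact: measurable_incr.
pose s w := sin (u 0%N c * incr n 0 c w).
have b4 : bdm (fun w => s w ^+ 4).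
  rewrite (_ : (fun w => _) = fun w => (s w ^+ 2) ^+ 2); last by apply/funext => w; rewrite -exprM.
  by apply: bdm_sqr; exact: bdm_sqr.
have sle (x : R) : `|sin x| <= `|x|.
  have [->|x0] := eqVneq x 0; first by rewrite sin0.
  wlog xp : x x0 / 0 < x.
    move=> h; have [|] := ltP 0 x; first exact: h.
    rewrite le_eqVlt (negbTE x0)/= => xn; rewrite -normrN -sinN -(normrN x).
    by apply: h; rewrite ?oppr_eq0 ?oppr_gt0.
  have [c' _] := @MVT R sin cos 0 x xp (fun y _ => is_derive_sin y)
    (continuous_subspaceT (@continuous_sin R)).
  rewrite sin0 !subr0 => ->; rewrite normrM ler_piMl//.
  by rewrite ler_norml cos_geN1 cos_le1.
have E4 : Ex P (fun w => s w ^+ 4) <= U ^+ 4 * kappa n.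
  have [U00|Un0] := eqVneq U 0.
    rewrite (@eq_Ex _ _ _ _ _ (cst 0)) ?Ex_cst ?U00 ?expr0n ?mul0r//.
    move=> w; have := uU 0%N c; rewrite U00 normr_le0 => /eqP uE.
    by rewrite /s uE mul0r sin0 expr0n.
  have Up : 0 < U ^+ 4 by rewrite exprn_gt0// lt_neqAle eq_sym Un0.
  rewrite -ler_pdivrMl// -ExZ//; apply: (incr4_Ex (k := 0)) => //; first exact: bdmZ.
  move=> w; rewrite mulr_ge0 ?invr_ge0 ?(ltW Up) ?exprn_even_ge0//= ler_pdivrMl//.
  rewrite (bigD1 c)//= mulrDr (le_trans (y := U ^+ 4 * incr n 0 c w ^+ 4))//; last first.
    rewrite lerDl mulr_ge0 ?(ltW Up)//; apply: sumr_ge0 => c' _.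
    by rewrite exprn_even_ge0.
  have h : `|s w| <= U * `|incr n 0 c w|.
    by rewrite (le_trans (sle _))// normrM ler_wpM2r.
  have e4 (x : R) : x ^+ 4 = `|x| ^+ 4 by rewrite -normrX ger0_norm// exprn_even_ge0.
  by rewrite e4 (e4 (incr _ _ _ _)) -exprMn ler_pXn2r ?nnegrE// mulr_ge0.
apply: (@le_trans _ _ (Ex P (fun w => cst eta w + (eta ^+ 3)^-1 * s w ^+ 4))).
  apply: Ex_le; first exact: bdm_norm.
    by apply: bdmD; [exact: bdm_cst|exact: bdmZ].
  move=> w; rewrite -/(s w) /=.
  have e4 : s w ^+ 4 = `|s w| ^+ 4 by rewrite -normrX ger0_norm// exprn_even_ge0.
  have [h|h] := leP `|s w| eta.
    by rewrite (le_trans h)// lerDl e4 mulr_ge0 ?invr_ge0 ?exprn_ge0 ?(ltW eta0).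
  rewrite (le_trans (y := (eta ^+ 3)^-1 * s w ^+ 4))//; last by rewrite lerDr ltW.
  have h3 : eta ^+ 3 * `|s w| <= s w ^+ 4.
    rewrite e4 [leRHS]exprSr ler_wpM2r//.
    by rewrite ler_pXn2r ?nnegrE ?(ltW eta0)// ltW.
  by rewrite ler_pdivlMl ?exprn_gt0.
rewrite ExD; [|exact: bdm_cst|exact: bdmZ].
by rewrite Ex_cst ExZ// lerD2l mulrC ler_wpM2r ?invr_ge0 ?exprn_ge0 ?(ltW eta0).
Qed.

(** The left-hand side does not change under refinement, whereas the bound becomes a multiple of
    [eta] plus a term of order [1 / m], with [eta] arbitrary. *)
Lemma levy_cos n u psi : (0 < n)%N ->
  Ex P (fun w => (\1_A w - pr P A) * cos (incr_sum n u w + psi)) = 0.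
Proof.
move=> n0.
(* Weights beyond the grid are set to zero, to have a bound uniform in [k]. *)
pose u0 k c := if (k < n)%N then u k c else 0.
have -> : incr_sum n u = incr_sum n u0.
  by apply/funext => w; apply: eq_bigr => k _; apply: eq_bigr => c _; rewrite /u0 ltn_ord.
pose U := \sum_(k < n) \sum_c `|u k c|.
have U0 : 0 <= U by apply: sumr_ge0 => k _; exact: sumr_ge0.
have uU k c : `|u0 k c| <= U.
  rewrite /u0; case: ifP => kn; last by rewrite normr0.
  rewrite /U (bigD1 (Ordinal kn))//= (bigD1 c)//= -addrA lerDl.
  by rewrite addr_ge0//; apply: sumr_ge0 => i _ //; exact: sumr_ge0.
set CC : R := #|{: 'I_N * 'I_d}|%:R.
have CC0 : 0 <= CC by [].
pose a := CC * 64 * t ^+ 2.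
have a0 : 0 <= a by rewrite /a mulr_ge0 ?sqr_ge0// mulr_ge0.
have bound m eta : (0 < m)%N -> 0 < eta ->
    `|Ex P (fun w => (\1_A w - pr P A) * cos (incr_sum n u0 w + psi))| <=
    eta * (1 / 2 + 4 * CC) + m%:R^-1 * (8 * K0 U * a / eta + 4 * CC * (U ^+ 4 * a / eta ^+ 3)).
  move=> m0 eta0.
  have nm0 : (0 < n * m)%N by rewrite muln_gt0 n0.
  have nmR : 0 < (n * m)%:R :> R by rewrite ltr0n.
  have mR : 0 < m%:R :> R by rewrite ltr0n.
  have mnm : m%:R <= (n * m)%:R :> R by rewrite ler_nat leq_pmull.
  have iv : (n * m)%:R^-1 <= m%:R^-1 :> R by rewrite lef_pV2.
  have km : kappa (n * m) = a / (n * m)%:R ^+ 2.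
    by rewrite /kappa /a -/CC expr_div_n; ring.
  have k1 : (n * m)%:R * kappa (n * m) <= a / m%:R.
    rewrite km; move: (n * m)%:R iv nmR => q iv q0.
    rewrite (_ : q * (a / _) = a / q); last by field; rewrite gt_eqF.
    by rewrite ler_wpM2l.
  have k2 : kappa (n * m) <= a / m%:R.
    rewrite (le_trans _ k1)// -[leLHS]mul1r ler_wpM2r ?ler1n//.
    by rewrite km divr_ge0 ?sqr_ge0.
  have -> : incr_sum n u0 = incr_sum (n * m) (fun k => u0 (k %/ m)%N).
    by apply/funext => w; exact: incr_sum_refine.
  apply: (le_trans (levy_bound psi nm0 U0 _ eta0)); first by move=> k c; exact: uU.
  have K00 : 0 <= K0 U by rewrite /K0 mulr_ge0 ?exprn_ge0// addr_ge0.
  have h1 : (n * m)%:R * (16 * (K0 U * kappa (n * m))) / eta <= m%:R^-1 * (16 * K0 U * a / eta).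
    rewrite (_ : _ * _ / eta = (16 * K0 U / eta) * ((n * m)%:R * kappa (n * m))); last by ring.
    rewrite (_ : m%:R^-1 * _ = (16 * K0 U / eta) * (a / m%:R)); last by ring.
    by rewrite ler_wpM2l// !mulr_ge0// invr_ge0 ltW.
  have h2 : \sum_c Ex P (fun w => `|sin (u0 (0 %/ m)%N c * incr (n * m) 0 c w)|) <=
      CC * (eta + U ^+ 4 * (a / m%:R) / eta ^+ 3).
    apply: (@le_trans _ _ (\sum_(c : 'I_N * 'I_d) (eta + U ^+ 4 * (a / m%:R) / eta ^+ 3))).
      apply: ler_sum => c _.
      apply: (le_trans (sin_bound (u := fun k => u0 (k %/ m)%N) c nm0 U0 _ eta0)).
        by move=> k c'; exact: uU.
      by rewrite lerD2l ler_wpM2r ?invr_ge0 ?exprn_ge0 ?(ltW eta0)// ler_wpM2l ?exprn_ge0.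
    by rewrite sumr_cst.
  rewrite (_ : m%:R^-1 * _ = m%:R^-1 * (16 * K0 U * a / eta) / 2 +
    4 * (CC * (U ^+ 4 * (a / m%:R) / eta ^+ 3))); last by field; rewrite !gt_eqF.
  rewrite mulrDr in h2; lra.
apply/eqP; rewrite -normr_le0; apply/ler_addgt0Pl => e e0; rewrite addr0.
(* Makes the first term of the bound equal to [e / 2]; the fineness [m] then brings the second below
   [e / 2]. *)
pose eta := e / (1 + 8 * CC).
have eta0 : 0 < eta by rewrite divr_gt0// ltr_pwDl// mulr_ge0.
pose G := 8 * K0 U * a / eta + 4 * CC * (U ^+ 4 * a / eta ^+ 3).
pose m := (Num.truncn (2 * G / e)).+1.
have mG : 2 * G / e < m%:R by rewrite truncnS_gt// num_real.
apply: (le_trans (bound m eta _ eta0)) => //; rewrite -/G.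
have -> : eta * (1 / 2 + 4 * CC) = e / 2 by rewrite /eta; field; rewrite gt_eqF// ltr_pwDl// mulr_ge0.
have : m%:R^-1 * G <= e / 2.
  rewrite ler_pdivrMl ?ltr0n//; move: mG; rewrite ltr_pdivrMr//; lra.
lra.
Qed.

(** The phase [psi] covers sines as well. Products are again in the span: the two sums are written
    on a common grid and the product-to-sum formula is applied. *)
Inductive trig_span : (T -> R) -> Prop :=
| trig_cos n u psi : (0 < n)%N -> trig_span (fun w => cos (incr_sum n u w + psi))
| trig_add f g : trig_span f -> trig_span g -> trig_span (fun w => f w + g w)
| trig_scale c f : trig_span f -> trig_span (fun w => c * f w).

Let trig_eq f g : trig_span f -> (forall w, f w = g w) -> trig_span g.
Proof. by move=> tf fg; rewrite (_ : g = f)//; apply/funext => w. Qed.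

Let trig_bdm f : trig_span f -> bdm f.
Proof.
elim=> [n u psi _|f' g _ bf _ bg|c f' _ bf]; [|exact: bdmD|exact: bdmZ].
apply: bdm_cos; apply: measurable_funD => //; exact: measurable_incr_sum.
Qed.

Let trig_mul f g : trig_span f -> trig_span g -> trig_span (fun w => f w * g w).
Proof.
elim=> [n u p n0|f1 f2 _ IH1 _ IH2|c f1 _ IH] tg; last 2 first.
- by apply: (trig_eq (trig_add (IH1 tg) (IH2 tg))) => w; ring.
- by apply: (trig_eq (trig_scale c (IH tg))) => w; ring.
elim: tg => [m v q m0|g1 g2 _ IH1 _ IH2|c g1 _ IH]; last 2 first.
- by apply: (trig_eq (trig_add IH1 IH2)) => w; ring.
- by apply: (trig_eq (trig_scale c IH)) => w; ring.
have nm0 : (0 < n * m)%N by rewrite muln_gt0 n0.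
pose up k c := u (k %/ m)%N c + v (k %/ n)%N c.
pose um k c := u (k %/ m)%N c - v (k %/ n)%N c.
apply: (trig_eq (trig_scale 2^-1 (trig_add (trig_cos up (p + q) nm0) (trig_cos um (p - q) nm0)))) => w.
have e1 := incr_sum_refine u w n0 m0.
have e2 := incr_sum_refine v w m0 n0; rewrite mulnC in e2.
have -> : incr_sum (n * m) up w = incr_sum n u w + incr_sum m v w.
  rewrite e1 e2 /incr_sum -big_split/=; apply: eq_bigr => k _.
  by rewrite -big_split/=; apply: eq_bigr => c _; rewrite /up mulrDl.
have -> : incr_sum (n * m) um w = incr_sum n u w - incr_sum m v w.
  rewrite e1 e2 /incr_sum -sumrB/=; apply: eq_bigr => k _.
  by rewrite -sumrB/=; apply: eq_bigr => c _; rewrite /um mulrBl.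
set x := incr_sum n u w + p; set y := incr_sum m v w + q.
rewrite (_ : _ + (p + q) = x + y); last by rewrite /x /y; ring.
rewrite (_ : _ + (p - q) = x - y); last by rewrite /x /y; ring.
by rewrite cosD cosB; field.
Qed.

Let trig_one : trig_span (cst 1).
Proof.
apply: (trig_eq (trig_cos (fun _ _ => 0) 0 (ltn0Sn 0))) => w.
by rewrite /incr_sum big1 ?addr0 ?cos0// => k _; rewrite big1// => c _; rewrite mul0r.
Qed.

Let G := lim_sets trig_span.

(** An increment [x] is unbounded, so it is reached as the limit of [m sin (x / m)], where the sine
    is a cosine of phase [- pi / 2]. *)
Let incr_G n k c : (k < n)%N -> measurable_fun (setT : set (g_sigma_algebraType G)) (incr n k c).
Proof.
move=> kn; have n0 : (0 < n)%N by exact: leq_trans kn.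
pose u (m : nat) k' c' : R := if (k' == k) && (c' == c) then m.+1%:R^-1 else 0.
have uE m w : incr_sum n (u m) w = m.+1%:R^-1 * incr n k c w.
  rewrite /incr_sum (bigD1 (Ordinal kn))//= (bigD1 c)//= /u !eqxx/=.
  rewrite !big1 ?addr0// => [k' /negbTE k'k|c' /negbTE ->].
    rewrite big1// => c' _; rewrite (_ : (k' == k :> nat) = false) ?mul0r//.
  by rewrite mul0r.
pose f (m : nat) w := m.+1%:R * cos (incr_sum n (u m) w + (- (pi / 2))).
have tf m : trig_span (f m) by apply: trig_scale; exact: trig_cos.
apply: (@measurable_fun_cvg _ (g_sigma_algebraType G) R setT f).
  move=> m; apply: (measurability (RGenOInfty.G (R := R))).
    exact: RGenOInfty.measurableE.
  move=> _ [_ [x ->] <-]; rewrite setTI; apply: sub_sigma_algebra.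
  have -> : f m @^-1` `]x, +oo[ = [set w | x < f m w].
    by apply/seteqP; split => w /=; rewrite in_itv/= andbT.
  exact: (lim_sets_gt trig_bdm trig_one trig_add trig_mul trig_scale x (tf m)).
move=> w _; rewrite /f; set x := incr n k c w.
have e m : `|m.+1%:R * cos (incr_sum n (u m) w + (- (pi / 2))) - x| <= x ^+ 2 / m.+1%:R.
  have m0 : 0 < m.+1%:R :> R by rewrite ltr0n.
  rewrite uE cosBpihalf -/x.
  rewrite (_ : _ - x = m.+1%:R * (sin (m.+1%:R^-1 * x) - m.+1%:R^-1 * x)); last by field; rewrite gt_eqF.
  rewrite normrM gtr0_norm//.
  rewrite (_ : x ^+ 2 / _ = m.+1%:R * (m.+1%:R^-1 * x) ^+ 2); last by field; rewrite gt_eqF.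
  by rewrite ler_pM2l// sin_subx_le.
apply/cvgrPdist_le => eps eps0; near=> m.
rewrite distrC (le_trans (e m))// ler_pdivrMr ?ltr0n// -ler_pdivrMl//.
have : (Num.truncn (eps^-1 * x ^+ 2) <= m)%N by near: m; exact: nbhs_infty_ge.
rewrite -ltnS -(ler_nat R) => h; rewrite ltW// (lt_le_trans _ h)//.
by rewrite truncnS_gt// num_real.
Unshelve. all: by end_near.
Qed.

Theorem levy_indep : indep2 P <<s incr_sys >> [set A].
Proof.
have iG : indep2 P <<s G >> [set A].
  apply: (multiplicative_system trig_bdm trig_mul mA) => f tf.
  elim: tf => [n u psi n0|f1 f2 t1 IH1 t2 IH2|c f1 t1 IH].
  - by rewrite -[RHS](levy_cos u psi n0); apply: eq_Ex => w; ring.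
  - have bA : bdm (fun w => \1_A w - pr P A) by apply: bdmBc; exact: bdm_indic.
    rewrite (@eq_Ex _ _ _ _ _ (fun x => f1 x * (\1_A x - pr P A) + f2 x * (\1_A x - pr P A))); last by move=> x; ring.
    by rewrite ExD ?IH1 ?IH2 ?addr0//; apply: bdmM => //; exact: trig_bdm.
  - have bA : bdm (fun w => \1_A w - pr P A) by apply: bdmBc; exact: bdm_indic.
    rewrite (@eq_Ex _ _ _ _ _ (fun x => c * (f1 x * (\1_A x - pr P A)))); last by move=> x; ring.
    by rewrite ExZ ?IH ?mulr0//; apply: bdmM => //; exact: trig_bdm.
apply: indep2_sub iG => //.
apply: smallest_sub; first exact: smallest_sigma_algebra.
move=> _ [n [k [c [C [kn mC ->]]]]].
by have := incr_G c kn measurableT mC; rewrite setTI.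
Qed.

End grid.
End brownian_independence.

(** * Independence of finite families of set systems *)

Section family_independence.
Context {R : realType} {dT : measure_display} {T : measurableType dT}.
Variables (P : probability T R) (N : nat).
Implicit Types (G H : 'I_N -> set (set T)).

Lemma bigsetIP (I : finType) (p : pred I) (A : I -> set T) w :
  (\big[setI/setT]_(i | p i) A i) w <-> forall i, p i -> A i w.
Proof.
suff h (s : seq I) : (\big[setI/setT]_(i <- s | p i) A i) w <->
    forall i, i \in s -> p i -> A i w.
  split => [/h hA i pi|hA]; first exact: hA (mem_index_enum i) pi.
  by apply/h => i _; exact: hA.
elim: s => [|j s IH]; first by rewrite big_nil; split.
rewrite big_cons; case: ifPn => pj; split.
- by move=> [Aj /IH hs] i /[1!inE] /predU1P[->//|]; exact: hs.
- by move=> h; split; [apply: h; rewrite ?mem_head|apply/IH => i si; apply: h; rewrite inE si orbT].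
- by move=> /IH hs i /[1!inE] /predU1P[->|]; [rewrite (negPf pj)|exact: hs].
- by move=> h; apply/IH => i si; apply: h; rewrite inE si orbT.
Qed.

(** Full intersections only; subfamilies are reached by taking [setT] for the other indices. *)
Definition indepN G := forall A : 'I_N -> set T, (forall i, G i (A i)) ->
  pr P (\big[setI/setT]_i A i) = \prod_i pr P (A i).

Lemma indepN_sub G H : (forall i, G i `<=` H i) -> indepN H -> indepN G.
Proof. by move=> GH iH A GA; apply: iH => i; exact: GH. Qed.

Lemma indepN_upd G A i0 C : indepN G -> (forall i, i != i0 -> G i (A i)) ->
  G i0 C -> G i0 setT ->
  pr P (C `&` \big[setI/setT]_(i | i != i0) A i) =
  pr P C * pr P (\big[setI/setT]_(i | i != i0) A i).
Proof.
move=> iG GA GC GT.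
have key D : G i0 D -> pr P (D `&` \big[setI/setT]_(i | i != i0) A i) =
    pr P D * \prod_(i | i != i0) pr P (A i).
  move=> GD; have := iG (fun i => if i == i0 then D else A i) _.
  rewrite (bigD1 i0)//= eqxx (bigD1 (op := *%R) i0)//= eqxx.
  rewrite (eq_bigr A); last by move=> i /negPf ->.
  rewrite (eq_bigr (fun i => pr P (A i))); last by move=> i /negPf ->.
  by apply => i; case: (eqVneq i i0) => [->|] //; exact: GA.
rewrite key//; have := key _ GT; rewrite setTI prT mul1r => ->.
by [].
Qed.

(** The systems are enlarged one index at a time; at each stage the intersection of the events at
    the other indices is a single event independent of the pi-system being enlarged. *)
Lemma indepN_sigma G : (forall i, setI_closed (G i)) ->
  (forall i, measurable_sys (G i)) -> (forall i, G i setT) -> indepN G ->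
  indepN (fun i => <<s G i >>).
Proof.
move=> IG mG GT iG.
have mS i : measurable_sys <<s G i >> by exact: g_sigma_measurable_sys.
have ST i : <<s G i >> setT by apply: sub_gen_smallest; exact: GT.
suff h k : indepN (fun i => if (i < k)%N then <<s G i >> else G i).
  by move=> A GA; apply: (h N) => i; rewrite ltn_ord; exact: GA.
elim: k => [|k IH]; first by move=> A GA; apply: iG => i; exact: GA.
have [kN|kN] := ltnP k N; last first.
  by move=> A GA; apply: IH => i; rewrite (leq_trans _ kN)//; have := GA i; rewrite (leq_trans _ (leqW kN)).
pose i0 := Ordinal kN.
move=> A GA.
have GA' i : i != i0 -> (if (i < k)%N then <<s G i >> else G i) (A i).
  move=> ii0; have := GA i; rewrite ltnS leq_eqVlt.
  by rewrite (_ : (i == k :> nat) = false)//; apply/negbTE; move: ii0; rewrite -val_eqE.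
have mA i : measurable (A i).
  by have := GA i; case: ifP => _; [exact: mS|exact: mG].
pose D := \big[setI/setT]_(i | i != i0) A i.
have mD : measurable D by exact: bigsetI_measurable.
have iD : indep2 P (G i0) [set D].
  move=> C _ GC ->; apply: (indepN_upd IH) => //; rewrite /= ltnn; [exact: GC|exact: GT].
have GA0 : <<s G i0 >> (A i0) by have := GA i0; rewrite /= ltnSn.
have mDs : measurable_sys [set D] by move=> _ ->.
have e1 := indep2_sigma (IG i0) (mG i0) mDs iD GA0 (erefl D).
rewrite (bigD1 i0)//= -/D e1 (bigD1 (op := *%R) i0)//=; congr (_ * _).
have := IH (fun i => if i == i0 then setT else A i).
rewrite (bigD1 i0)//= eqxx (bigD1 (op := *%R) i0)//= eqxx prT mul1r setTI.
rewrite (eq_bigr A); last by move=> i /negPf ->.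
rewrite (eq_bigr (fun i => pr P (A i))); last by move=> i /negPf ->.
apply => i; case: (eqVneq i i0) => [->|]; last exact: GA'.
by rewrite /= ltnn; exact: GT.
Qed.

(** Intersections of an event of [G i] with one of [G j] form a generating pi-system; the case
    [i = j] is allowed. *)
Lemma indepN_pair G (i j k : 'I_N) : (forall i, setI_closed (G i)) ->
  (forall i, measurable_sys (G i)) -> (forall i, G i setT) -> indepN G ->
  k != i -> k != j -> indep2 P <<s G i `|` G j >> (G k).
Proof.
move=> IG mG GT iG ki kj.
pose Q := [set D | exists A A', [/\ G i A, G j A' & D = A `&` A']].
have IQ : setI_closed Q.
  move=> _ _ [A [A' [GA GA' ->]]] [C [C' [GC GC' ->]]].
  by exists (A `&` C), (A' `&` C'); split; [exact: IG|exact: IG|rewrite setIACA].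
have mQ : measurable_sys Q.
  by move=> _ [A [A' [GA GA' ->]]]; apply: measurableI; [exact: mG GA|exact: mG GA'].
have iQ : indep2 P Q (G k).
  move=> _ C [A [A' [GA GA' ->]]] GC.
  pose F l := (if l == i then A else setT) `&` (if l == j then A' else setT).
  have GF l : G l (F l).
    by apply: IG; [case: (eqVneq l i) => [->|]|case: (eqVneq l j) => [->|]].
  have E : \big[setI/setT]_(l | l != k) F l = A `&` A'.
    apply/seteqP; split => [w /bigsetIP h|w [wA wA']].
      have := h i; rewrite eq_sym ki => /(_ isT); rewrite /F eqxx => -[wA _].
      by have := h j; rewrite eq_sym kj => /(_ isT); rewrite /F eqxx => -[_ wA'].
    by apply/bigsetIP => l _; rewrite /F; split; case: ifP.
  by have := indepN_upd iG (fun l _ => GF l) GC (GT k); rewrite E setIC [RHS]mulrC.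
apply: indep2_sub (indep2_sigma IQ mQ (mG k) iQ) => //.
apply: sub_sigma_algebra2 => A [GA|GA].
  by exists A, setT; split; rewrite ?setIT.
by exists setT, A; split; rewrite ?setTI.
Qed.

(** Serves for the retraction onto a set of full measure, which preserves [P]. *)
Lemma indepN_preimage (f : T -> T) G : measurable_fun setT f ->
  (forall i, measurable_sys (G i)) ->
  (forall A, measurable A -> P (f @^-1` A) = P A) -> indepN G ->
  indepN (fun i => preimage_set_system setT f (G i)).
Proof.
move=> mf mG Pf iG A GA.
have /choice[C hC] : forall i, exists C, G i C /\ A i = f @^-1` C.
  by move=> i; have [C GC] := GA i; rewrite setTI => <-; exists C.
have -> : \big[setI/setT]_i A i = f @^-1` (\big[setI/setT]_i C i).
  apply/seteqP; split => w /bigsetIP h; apply/bigsetIP => i _.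
    by have := h i isT; have [_ ->] := hC i.
  by have [_ ->] := hC i; exact: h.
rewrite /pr Pf; last by apply: bigsetI_measurable => i _; apply: mG; exact: (hC i).1.
rewrite -[LHS]/(pr P _) iG; last by move=> i; exact: (hC i).1.
apply: eq_bigr => i _; have [GC ->] := hC i.
by rewrite /pr Pf//; exact: mG GC.
Qed.

End family_independence.

Section initial_increments.
Context {R : realType} {d : nat} {dT : measure_display} {T : measurableType dT}.

(** A pi-system for everything that drives particle [i] up to time [t]: its initial value and the
    increments of its own Brownian motion on regular grids. *)
Definition init_incr_sys {N} (x0 : 'I_N -> T -> 'rV[R]_d) (B : nat -> R -> T -> 'rV[R]_d)
    (t : R) (i : 'I_N) : set (set T) :=
  [set A | exists (C : set (Rd R d)) D, [/\ measurable C, <<s incr_sys1 B t i >> D &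
     A = x0 i @^-1` C `&` D]].

Lemma init_incr_sys_setT {N} (x0 : 'I_N -> T -> 'rV[R]_d) B t i : init_incr_sys x0 B t i setT.
Proof.
exists setT, setT; split => //; last by rewrite preimage_setT setIT.
exact: sigma_algebraT (smallest_sigma_algebra _ _).
Qed.

Lemma init_incr_sysI {N} (x0 : 'I_N -> T -> 'rV[R]_d) B t i : setI_closed (init_incr_sys x0 B t i).
Proof.
move=> _ _ [C [D [mC sD ->]]] [C' [D' [mC' sD' ->]]].
exists (C `&` C'), (D `&` D'); split; [exact: measurableI| |by rewrite preimage_setI setIACA].
exact: (setI_closed_sigma (smallest_sigma_algebra _ _) sD sD').
Qed.

Lemma init_incr_sys_comp {N} (x0 : 'I_N -> T -> 'rV[R]_d) B t i (f : T -> T) :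
  init_incr_sys (fun i => x0 i \o f) (fun i s => B i s \o f) t i `<=`
  preimage_set_system setT f (init_incr_sys x0 B t i).
Proof.
move=> _ [C [D [mC sD ->]]].
have : preimage_set_system setT f <<s incr_sys1 B t i >> D.
  move: sD; apply: smallest_sub.
    by apply: sigma_algebra_preimage; exact: smallest_sigma_algebra.
  move=> A [n [k [l [C' [kn mC' ->]]]]].
  eexists; first by apply: sub_sigma_algebra; exists n, k, l, C'; split.
  by rewrite setTI.
move=> [D' sD' <-]; exists (x0 i @^-1` C `&` D'); last by rewrite !setTI.
by exists C, D'.
Qed.

Variables (P : probability T R) (F : R -> set (set T)).
Variables (B : nat -> R -> T -> 'rV[R]_d) (N : nat) (x0 : 'I_N -> T -> 'rV[R]_d).
Hypothesis filF : filtration F.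
Hypothesis BM : forall i, brownian_motion P F (B i).
Hypothesis indB : independent_sigma P (fun i => sigma_process (B i)).
Hypothesis mx0 : forall i, measurable_fun setT (x0 i : T -> Rd R d).
Hypothesis augx0 : forall i (C : set (Rd R d)), measurable C ->
  forall s, 0 < s -> aug P (F s) (x0 i @^-1` C).
Hypothesis indx0 : indepN P (fun i => [set A | exists2 C : set (Rd R d), measurable C & A = x0 i @^-1` C]).
Variable t : R.
Hypothesis t0 : 0 < t.

Let sub1 (i : 'I_N) : <<s incr_sys1 B t i >> `<=` sigma_process (B i).
Proof. by apply: smallest_sub; [exact: smallest_sigma_algebra|exact: incr_sys1_sigma]. Qed.

Let sub2 (i : 'I_N) : <<s incr_sys1 B t i >> `<=` <<s incr_sys B N t >>.
Proof.
apply: sub_sigma_algebra2 => A [n [k [l [C [kn mC ->]]]]].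
by exists n, k, (i, l), C.
Qed.

Let mpre i (C : set (Rd R d)) : measurable C -> measurable (x0 i @^-1` C).
Proof. by move=> mC; rewrite -[X in measurable X]setTI; exact: mx0. Qed.

Let mincr (i : 'I_N) D : <<s incr_sys1 B t i >> D -> measurable D.
Proof. by move=> /sub1; exact: (sigma_process_measurable filF BM). Qed.

Lemma init_incr_sys_measurable i : measurable_sys (init_incr_sys x0 B t i).
Proof.
by move=> _ [C [D [mC sD ->]]]; apply: measurableI; [exact: mpre|exact: mincr sD].
Qed.

(** [levy_indep] separates all increments from all initial values, after which each group factorises
    by its own hypothesis. A second use of [levy_indep], for a single index, recombines the two
    factors belonging to [i]. *)
Lemma init_incr_sys_indep : indepN P (init_incr_sys x0 B t).
Proof.
move=> A /choice[C /choice[D hCD]].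
have mC i : measurable (C i) by have [] := hCD i.
have sD i : <<s incr_sys1 B t i >> (D i) by have [] := hCD i.
have AE i : A i = x0 i @^-1` C i `&` D i by have [] := hCD i.
pose U := \big[setI/setT]_i (x0 i @^-1` C i).
have -> : \big[setI/setT]_i A i = \big[setI/setT]_i D i `&` U.
  by under eq_bigr do rewrite AE; rewrite big_split/= setIC.
have sT : sigma_algebra setT <<s incr_sys B N t >> by exact: smallest_sigma_algebra.
have sDD : <<s incr_sys B N t >> (\big[setI/setT]_i D i).
  apply: (big_ind <<s incr_sys B N t >>).
  - exact: sigma_algebraT.
  - exact: setI_closed_sigma.
  - by move=> i _; apply: sub2.
have levy (V : set T) : measurable V -> (forall s, 0 < s -> aug P (F s) V) ->
    indep2 P <<s incr_sys B N t >> [set V].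
  exact: (levy_indep filF BM indB t0).
have sF s : 0 < s -> sigma_algebra setT (aug P (F s)).
  by move=> s0; apply: aug_sigma_algebra; have [h _] := filF; have [] := h s (ltW s0).
have augU s : 0 < s -> aug P (F s) U.
  move=> s0; apply: (big_ind (aug P (F s))).
  - exact: sigma_algebraT (sF _ s0).
  - exact: (setI_closed_sigma (sF _ s0)).
  - by move=> i _; exact: augx0.
have mU : measurable U by apply: bigsetI_measurable => i _; exact: mpre.
have hU : pr P U = \prod_i pr P (x0 i @^-1` C i) by apply: indx0 => i; exists (C i).
rewrite (levy U mU augU _ _ sDD (erefl U)) hU.
have -> : pr P (\big[setI/setT]_i D i) = \prod_i pr P (D i).
  (* [independent_sigma] is indexed by [nat]; indices beyond [N] receive [setT]. *)
  pose D' n := if insub n is Some i then D i else setT.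
  have D'E (i : 'I_N) : D' i = D i by rewrite /D' valK.
  have := indB (n := N) (A := D') _; rewrite bigcap_mkord /pr.
  rewrite (eq_bigr _ (fun i _ => D'E i)) (eq_bigr (fun i => fine (P (D i)))); last by move=> i _; rewrite D'E.
  move=> h; rewrite h//= => i iN.
  by rewrite -[D' i]/(D' (Ordinal iN)) D'E; exact: (sub1 (sD (Ordinal iN))).
rewrite -big_split/=; apply: eq_bigr => i _; rewrite AE setIC.
by rewrite (levy _ (@mpre i _ (mC i)) (@augx0 i _ (mC i)) _ _ (sub2 (sD i)) erefl).
Qed.

End initial_increments.

(** * Energy estimates and the Euler scheme *)

Section primitives.
Context {R : realType}.
Notation mu := (@lebesgue_measure R).
Implicit Types (f : R -> R) (a b x : R).

Definition pint a b f : R := \int[mu]_(s in `[a, b]) f s.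

Lemma continuous_integrable f a b : continuous f ->
  mu.-integrable `[a, b] (EFin \o f).
Proof.
move=> cf; apply: continuous_compact_integrable; first exact: segment_compact.
exact: continuous_subspaceT.
Qed.

Lemma pint0 a f : pint a a f = 0.
Proof. by rewrite /pint set_itv1 Rintegral_set1. Qed.

Lemma pint_derive f a x : continuous f -> a < x ->
  is_derive x 1 (fun t => pint a t f) (f x).
Proof.
move=> cf ax; have xu : x < x + 1 by rewrite ltrDl.
have [d1 d2] := continuous_FTC1_closed xu (@continuous_integrable f a (x + 1) cf) ax (cf x).
apply: DeriveDef; first exact: d1.
by rewrite -derive1E.
Qed.

Lemma pint_continuous f a b : continuous f -> a <= b ->
  {within `[a, b], continuous (fun t => pint a t f)}.
Proof.
by move=> cf ab; apply: parameterized_integral_continuous => //; exact: continuous_integrable.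
Qed.

Lemma le_pint f g a b : continuous f -> continuous g ->
  (forall s, a <= s <= b -> f s <= g s) -> pint a b f <= pint a b g.
Proof.
move=> cf cg fg; apply: le_Rintegral; [by []|exact: continuous_integrable|exact: continuous_integrable|].
by move=> s /=; rewrite in_itv/=; exact: fg.
Qed.

Lemma pint_ge0 f a b : (forall s, a <= s <= b -> 0 <= f s) -> 0 <= pint a b f.
Proof. by move=> f0; apply: Rintegral_ge0 => s /=; rewrite in_itv/=; exact: f0. Qed.

Lemma derive_nincr (f df : R -> R) a b : a <= b ->
  (forall x, a < x < b -> is_derive x 1 f (df x)) ->
  (forall x, a < x < b -> df x <= 0) ->
  {within `[a, b], continuous f} -> f b <= f a.
Proof.
move=> ab fdf df0 cf; apply: (ler0_derive1_nincr (a := a) (b := b)) => //.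
- by move=> x; rewrite in_itv/= => h; have [] := fdf x h.
- move=> x; rewrite in_itv/= => h; have [_ e] := fdf x h.
  by rewrite derive1E e; exact: df0.
Qed.

Lemma within_continuousD (A : set R) (f g : R -> R) :
  {within A, continuous f} -> {within A, continuous g} ->
  {within A, continuous (fun x => f x + g x)}.
Proof. by move=> cf cg x; exact: (@continuousD _ R^o (subspace A) f g x (cf x) (cg x)). Qed.

Lemma within_continuousM (A : set R) (f g : R -> R) :
  {within A, continuous f} -> {within A, continuous g} ->
  {within A, continuous (fun x => f x * g x)}.
Proof. by move=> cf cg x; exact: (@continuousM _ (subspace A) f g x (cf x) (cg x)). Qed.

Lemma within_continuous_sum (A : set R) (I : Type) (s : seq I) (F : I -> R -> R) :
  (forall i, {within A, continuous (F i)}) ->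
  {within A, continuous (fun x => \sum_(i <- s) F i x)}.
Proof.
move=> cF; elim: s => [|i s IH].
  by under eq_fun do rewrite big_nil; move=> x; exact: cst_continuous.
by under eq_fun do rewrite big_cons; exact: within_continuousD.
Qed.

Lemma continuous_sum (T : topologicalType) (I : Type) (s : seq I) (F : I -> T -> R) :
  (forall i, continuous (F i)) -> continuous (fun x : T => \sum_(i <- s) F i x).
Proof.
move=> cF x; elim: s => [|i s IH].
  by under eq_fun do rewrite big_nil; exact: cvg_cst.
by under eq_fun do rewrite big_cons; apply: cvgD => //; exact: cF.
Qed.

Lemma is_derive1M (f g : R -> R) x df dg : is_derive x 1 f df -> is_derive x 1 g dg ->
  is_derive x 1 (fun t => f t * g t) (f x * dg + g x * df).
Proof. exact: is_deriveM. Qed.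

Lemma is_derive1D (f g : R -> R) x df dg : is_derive x 1 f df -> is_derive x 1 g dg ->
  is_derive x 1 (fun t => f t + g t) (df + dg).
Proof. exact: is_deriveD. Qed.

Lemma is_derive1B (f g : R -> R) x df dg : is_derive x 1 f df -> is_derive x 1 g dg ->
  is_derive x 1 (fun t => f t - g t) (df - dg).
Proof. exact: is_deriveB. Qed.

Lemma is_derive1V (f : R -> R) x df : f x != 0 -> is_derive x 1 f df ->
  is_derive x 1 (fun t => (f t)^-1) (- f x ^- 2 * df).
Proof. exact: is_deriveV. Qed.

Lemma within_continuousV (A : set R) (f : R -> R) : (forall x, f x != 0) ->
  {within A, continuous f} -> {within A, continuous (fun x => (f x)^-1)}.
Proof. by move=> f0 cf x; apply: cvgV; [exact: f0|exact: cf]. Qed.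

Lemma within_continuousB (A : set R) (f g : R -> R) :
  {within A, continuous f} -> {within A, continuous g} ->
  {within A, continuous (fun x => f x - g x)}.
Proof. by move=> cf cg x; exact: (@continuousB _ R^o (subspace A) f g x (cf x) (cg x)). Qed.

Lemma is_derive_sum_seq (I : Type) (s : seq I) (F dF : I -> R -> R) x :
  (forall i, is_derive x 1 (F i) (dF i x)) ->
  is_derive x 1 (fun t => \sum_(i <- s) F i t) (\sum_(i <- s) dF i x).
Proof.
move=> h; elim: s => [|i s IH].
  rewrite big_nil; under eq_fun do rewrite big_nil; exact: is_derive_cst.
rewrite big_cons; under eq_fun do rewrite big_cons.
exact: is_deriveD.
Qed.

Lemma is_derive_expRM (l a x : R) :
  is_derive x 1 (fun t => expR (l * (t - a))) (l * expR (l * (x - a))).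
Proof.
have h : is_derive x 1 (fun t : R => l * (t - a)) l.
  apply: is_derive_eq.
  by rewrite subr0 -[_ *: _]/(_ * _) mulr1.
by rewrite mulrC; exact: (is_derive1_comp (is_derive_expR _) h).
Qed.

Lemma continuous_expRM (l a : R) : continuous (fun t => expR (l * (t - a))).
Proof.
move=> x; apply: (@continuous_comp _ _ _ (fun t => l * (t - a)) expR); last exact: continuous_expR.
by apply: cvgM; [exact: cvg_cst|apply: cvgB; [exact: cvg_id|exact: cvg_cst]].
Qed.

Section energy.
Context {I : finType}.
Variables (r g : I -> R -> R) (a b : R).
Hypothesis ab : a <= b.
Hypothesis cg : forall k, continuous (g k).
Hypothesis rE : forall k t, a <= t <= b -> r k t = r k a + pint a t (g k).

Let rr k t := r k a + pint a t (g k).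
Let q t := \sum_k rr k t * rr k t.

Let qE t : a <= t <= b -> \sum_k r k t * r k t = q t.
Proof. by move=> h; apply: eq_bigr => k _; rewrite rE. Qed.

Let drr k x : a < x -> is_derive x 1 (rr k) (g k x).
Proof.
move=> ax; have := is_derive1D (is_derive_cst (r k a) x 1) (@pint_derive (g k) a x (@cg k) ax).
by rewrite add0r.
Qed.

Let dq x : a < x -> is_derive x 1 q (2 * \sum_k rr k x * g k x).
Proof.
move=> ax; apply: is_derive_eq.
  apply: (@is_derive_sum_seq _ _ (fun k t => rr k t * rr k t)
    (fun k t => rr k t * g k t + rr k t * g k t)) => k.
  exact: (is_derive1M (drr k ax) (drr k ax)).
by rewrite mulr_sumr; apply: eq_bigr => k _; ring.
Qed.

Let crr k : {within `[a, b], continuous (rr k)}.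
Proof.
by apply: within_continuousD; [move=> x; exact: cst_continuous|exact: pint_continuous].
Qed.

Let cq : {within `[a, b], continuous q}.
Proof. by apply: within_continuous_sum => k; exact: within_continuousM. Qed.

Lemma energy_bound (l : R) (f : R -> R) : continuous f ->
  (forall s, a <= s <= b ->
    2 * \sum_k r k s * g k s <= - l * (\sum_k r k s * r k s) + f s) ->
  expR (l * (b - a)) * (\sum_k r k b * r k b) <=
  \sum_k r k a * r k a + pint a b (fun s => expR (l * (s - a)) * f s).
Proof.
move=> cf h; rewrite !qE ?lexx ?ab//.
pose F s := expR (l * (s - a)) * f s.
have cF : continuous F by move=> x; apply: cvgM; [exact: continuous_expRM|exact: cf].
pose Phi t := expR (l * (t - a)) * q t - pint a t F.
rewrite -lerBlDr -[leLHS]/(Phi b) (_ : q a = Phi a); last first.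
  by rewrite /Phi subrr mulr0 expR0 mul1r pint0 subr0.
apply: (@derive_nincr _ (fun x => (expR (l * (x - a)) * (2 * \sum_k rr k x * g k x) + q x * (l * expR (l * (x - a)))) - F x)); first exact: ab.
- move=> x /andP[ax _].
  exact: is_derive1B (is_derive1M (is_derive_expRM l a x) (dq ax)) (pint_derive cF ax).
- move=> x /andP[ax xb]; have xab : a <= x <= b by rewrite !ltW.
  have := h x xab; rewrite qE//.
  under eq_bigr do rewrite rE//; rewrite -/(rr _ _).
  rewrite (_ : _ - F x = expR (l * (x - a)) * (2 * \sum_k rr k x * g k x + l * q x - f x)); last by rewrite /F; ring.
  move=> h1; rewrite pmulr_rle0 ?expR_gt0//.
  by rewrite /rr; lra.
- apply: within_continuousB; last exact: pint_continuous.
  by apply: within_continuousM => //; apply: continuous_subspaceT; exact: continuous_expRM.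
Qed.

(** The square root is not differentiable at zero. Instead of differentiating it, the weighted
    energy [G] is compared with the square of the claimed bound [Y]: [G / Y - Y] is nonincreasing
    and initially nonpositive. A small [eta] keeps [Y] positive. *)
Lemma energy_sqrt_bound (l : R) (e : R -> R) : continuous e ->
  (forall s, 0 <= e s) ->
  (forall s, a <= s <= b -> \sum_k r k s * g k s <=
    - l * (\sum_k r k s * r k s) + Num.sqrt (\sum_k r k s * r k s) * e s) ->
  expR (l * (b - a)) * Num.sqrt (\sum_k r k b * r k b) <=
  Num.sqrt (\sum_k r k a * r k a) + pint a b (fun s => expR (l * (s - a)) * e s).
Proof.
move=> ce e0 h; rewrite !qE ?lexx ?ab//.
pose F s := expR (l * (s - a)) * e s.
have cF : continuous F by move=> x; apply: cvgM; [exact: continuous_expRM|exact: ce].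
rewrite -/(pint a b F).
have q0 t : 0 <= q t by apply: sumr_ge0 => k _; rewrite -expr2 sqr_ge0.
apply/ler_addgt0Pr => eta eta0.
pose Y t := (Num.sqrt (q a) + eta) + pint a t F.
have Y0 t : 0 < Y t.
  rewrite /Y ltr_pwDl ?ltr_wpDl ?sqrtr_ge0//.
  by apply: pint_ge0 => s _; apply: mulr_ge0; [exact: expR_ge0|exact: e0].
pose z t := expR (l * (t - a)) * Num.sqrt (q t) / Y t.
pose G t := (expR (l * (t - a)) * expR (l * (t - a))) * q t.
pose H t := G t * (Y t)^-1 - Y t.
have dY x : a < x -> is_derive x 1 Y (F x).
  by move=> ax; have := is_derive1D (is_derive_cst (Num.sqrt (q a) + eta) x 1) (@pint_derive F a x cF ax); rewrite add0r.
have cY : {within `[a, b], continuous Y}.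
  by apply: within_continuousD; [move=> x; exact: cst_continuous|exact: pint_continuous].
have ceR : {within `[a, b], continuous (fun t => expR (l * (t - a)))}.
  by apply: continuous_subspaceT; exact: continuous_expRM.
have cYV : {within `[a, b], continuous (fun x => (Y x)^-1)}.
  by apply: within_continuousV => // x; rewrite gt_eqF.
have Hba : H b <= H a.
  pose dE x := l * expR (l * (x - a)).
  pose dG x := (expR (l * (x - a)) * expR (l * (x - a))) * (2 * \sum_k rr k x * g k x) +
     q x * (expR (l * (x - a)) * dE x + expR (l * (x - a)) * dE x).
  apply: (@derive_nincr _ (fun x => (G x * (- (Y x) ^- 2 * F x) + (Y x)^-1 * dG x) - F x)); first exact: ab.
  - move=> x /andP[ax xb]; have xab : a <= x <= b by rewrite !ltW.
    have d1 := is_derive1M (is_derive_expRM l a x) (is_derive_expRM l a x).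
    have Yx0 : Y x != 0 by rewrite gt_eqF// Y0.
    exact: is_derive1B (is_derive1M (is_derive1M d1 (dq ax)) (is_derive1V Yx0 (dY x ax))) (dY x ax).
  - move=> x /andP[ax xb]; have xab : a <= x <= b by rewrite !ltW.
    have Yx := Y0 x; have := h x xab; rewrite qE//.
    under eq_bigr do rewrite rE//; rewrite -/(rr _ _) -[X in X <= _]/(\sum_k rr k x * g k x).
    set S := \sum_k _; set sq := Num.sqrt _ => hS.
    have sqE : q x = sq * sq by rewrite -expr2 sqr_sqrtr.
    rewrite /G /dG /dE /F; set E := expR _.
    have E0 : 0 < E by exact: expR_gt0.
    have ex : 0 <= e x by exact: e0.
    rewrite -subr_ge0.
    (* Completing the square: minus the derivative is a square plus a positive multiple of the slack
       in the differential hypothesis. *)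
    have -> : 0 - (E * E * q x * (- Y x ^- 2 * (E * e x)) + (Y x)^-1 * (E * E * (2 * S) + q x * (E * (l * E) + E * (l * E))) - E * e x) =
      E * e x * (1 - E * sq / Y x) ^+ 2 + 2 * E * E / Y x * (- l * q x + sq * e x - S).
      by rewrite sqE; field; rewrite gt_eqF.
    apply: addr_ge0; first by apply: mulr_ge0; [apply: mulr_ge0 => //; exact: ltW|exact: sqr_ge0].
    apply: mulr_ge0; last by rewrite subr_ge0.
    by rewrite divr_ge0 ?(ltW Yx)// !mulr_ge0// ltW.
  - by apply: within_continuousB => //; do 3 apply: within_continuousM => //.
have Ha : H a <= 0.
  have sq0 := sqrtr_ge0 (q a).
  rewrite /H /G subrr mulr0 expR0 !mul1r /Y pint0 addr0 subr_le0 ler_pdivrMr; last by lra.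
  by rewrite -[leLHS]sqr_sqrtr// -expr2 ler_pXn2r// ?nnegrE; lra.
have : G b <= Y b ^+ 2.
  have := le_trans Hba Ha; rewrite /H subr_le0 ler_pdivrMr ?Y0// -expr2.
have Yb : 0 <= Y b by apply/ltW/Y0.
rewrite addrAC -/(Y b) => GY.
rewrite -(@ler_pXn2r _ 2)// ?nnegrE ?mulr_ge0 ?expR_ge0 ?sqrtr_ge0//.
by rewrite exprMn sqr_sqrtr// (expr2 (expR _)).
Qed.

End energy.

(** [expR (- L (t - a))] times the integral of [f], minus the integral of [g], is nonincreasing. *)
Lemma gronwall (f g : R -> R) (a b L : R) : a <= b -> 0 <= L -> continuous f -> continuous g ->
  (forall t, a <= t <= b -> 0 <= g t) ->
  (forall t, a <= t <= b -> f t <= g t + L * pint a t f) ->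
  f b <= g b + L * expR (L * (b - a)) * pint a b g.
Proof.
move=> ab L0 cf cg g0 h.
pose H t := expR (- L * (t - a)) * pint a t f - pint a t g.
have : H b <= H a.
  apply: (@derive_nincr _ (fun x => (expR (- L * (x - a)) * f x +
     pint a x f * (- L * expR (- L * (x - a)))) - g x)); first exact: ab.
  - move=> x /andP[ax xb].
    exact: is_derive1B (is_derive1M (is_derive_expRM (- L) a x) (@pint_derive f a x cf ax)) (@pint_derive g a x cg ax).
  - move=> x /andP[ax xb]; have xab : a <= x <= b by rewrite !ltW.
    have e1 : expR (- L * (x - a)) <= 1.
      by rewrite -expR0 ler_expR; nra.
    have e0 := expR_ge0 (- L * (x - a)); have gx := g0 x xab.
    rewrite (_ : _ - _ = expR (- L * (x - a)) * (f x - L * pint a x f) - g x); last by ring.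
    rewrite subr_le0; apply: le_trans (_ : expR (- L * (x - a)) * g x <= _).
      by rewrite ler_wpM2l// lerBlDr h.
    by rewrite ler_piMl.
  - apply: within_continuousB; last exact: pint_continuous.
    apply: within_continuousM; last exact: pint_continuous.
    by apply: continuous_subspaceT; exact: continuous_expRM.
rewrite /H !pint0 mulr0 subr0 subr_le0 mulNr expRN => hb.
have fb := h b; rewrite ab lexx in fb; apply: le_trans (fb isT) _.
rewrite lerD2l -mulrA ler_wpM2l//.
by rewrite -ler_pdivrMl ?expR_gt0.
Qed.

Lemma segment_unif_continuous (f : R -> R) (a b eps : R) : continuous f -> 0 < eps ->
  \forall dlt \near 0^'+, forall s r, a <= s <= b -> `|s - r| < dlt -> `|f s - f r| <= eps.
Proof.
move=> cf eps0.
have := (compact_near_coveringP `[a, b]).1 (@segment_compact R a b) R 0^'+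
  (fun dlt s => forall r, `|s - r| < dlt -> `|f s - f r| <= eps) _.
have h : forall x, `[a, b]%classic x -> \forall x' \near x & i \near 0^'+,
    forall r : R, `|x' - r| < i -> `|f x' - f r| <= eps.
  move=> x _; have e2 : 0 < eps / 2 by rewrite divr_gt0.
  have /(@cvgrPdist_lt _ R^o) /(_ _ e2) := cf x.
  move=> [rho /= rho0 hrho]; have r2 : 0 < rho / 2 by rewrite divr_gt0.
  exists (ball x (rho / 2), [set dlt : R | dlt < rho / 2]) => /=.
    split; first exact: nbhsx_ballx.
    exact: nbhs_right_lt.
  move=> [x' dlt] /= [bx dr] r rx.
  have b1 : `|x - x'| < rho / 2 by [].
  have := hrho x' _; have := hrho r _.
  rewrite /ball_/= => h1 h2.
  have h3 : `|x - r| < rho.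
    rewrite (_ : x - r = (x - x') + (x' - r)); last by ring.
    by apply: le_lt_trans (ler_normD _ _) _; lra.
  have h4 : `|x - x'| < rho by lra.
  have := h1 h3; have := h2 h4 => h5 h6.
  rewrite (_ : f x' - f r = (f x - f r) - (f x - f x')); last by ring.
  by apply: le_trans (ler_normB _ _) _; lra.
move=> /(_ _ h); apply: filterS => dlt hd s r sab sr.
by apply: hd => //=; rewrite in_itv.
Qed.

Lemma pint_diff_le (f : R -> R) (o a b M : R) : continuous f -> o <= a -> a <= b ->
  (forall s, a <= s <= b -> f s <= M) -> pint o b f - pint o a f <= M * (b - a).
Proof.
move=> cf a0 ab fM.
have : pint o b f - M * b <= pint o a f - M * a.
  have dM x : is_derive x 1 (fun t : R => M * t) M.
    apply: is_derive_eq.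
    by rewrite -[_ *: _]/(_ * _) mulr1.
  apply: (@derive_nincr (fun t => pint o t f - M * t) (fun x => f x - M)) => //.
  - move=> x /andP[ax xb].
    exact: is_derive1B (@pint_derive f o x cf (le_lt_trans a0 ax)) (dM x).
  - by move=> x /andP[ax xb]; rewrite subr_le0 fM// !ltW.
  - apply: within_continuousB.
      apply: continuous_subspaceW (pint_continuous cf (le_trans a0 ab)).
      by apply: subset_itvr; rewrite bnd_simp.
    apply: continuous_subspaceT => x.
    by apply: cvgM; [exact: cvg_cst|exact: cvg_id].
by lra.
Qed.

Lemma pintN (f : R -> R) a b : continuous f -> pint a b (fun s => - f s) = - pint a b f.
Proof.
move=> cf; rewrite -mulN1r -RintegralZl//; last exact: continuous_integrable.
by apply: eq_Rintegral => r _; rewrite mulN1r.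
Qed.

Lemma pint_diff_norm (f : R -> R) (o a b c M : R) : continuous f -> o <= a -> a <= b ->
  (forall s, a <= s <= b -> `|f s - c| <= M) ->
  `|pint o b f - pint o a f - c * (b - a)| <= M * (b - a).
Proof.
move=> cf a0 ab fM.
have h1 : pint o b f - pint o a f <= (c + M) * (b - a).
  apply: pint_diff_le => // s /fM; rewrite ler_norml => /andP[_]; lra.
have h2 : - (pint o b f - pint o a f) <= (M - c) * (b - a).
  have cN : continuous (fun s => - f s) by move=> x; apply: cvgN; exact: cf.
  have := @pint_diff_le _ o a b (M - c) cN a0 ab.
  rewrite !pintN//.
  have -> : - pint o b f - - pint o a f = - (pint o b f - pint o a f) by ring.
  by apply=> s /fM; rewrite ler_norml => /andP[+ _]; lra.
by rewrite ler_norml; apply/andP; split; lra.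
Qed.

Lemma riemann_sum_cvg (f : R -> R) (a b : R) : continuous f -> a <= b ->
  \sum_(k < n) f (a + k%:R * ((b - a) / n%:R)) * ((b - a) / n%:R) @[n --> \oo] --> pint a b f.
Proof.
rewrite le_eqVlt => cf /predU1P[<-|ab].
  rewrite pint0 [X in X @ _](_ : _ = fun=> 0); first exact: cvg_cst.
  by apply/funext => n; rewrite big1// => i _; rewrite subrr mul0r mulr0.
apply/cvgrPdist_le => eps eps0.
have ba0 : 0 < b - a by rewrite subr_gt0.
have e0 : 0 < eps / (b - a) by rewrite divr_gt0.
near (0 : R)^'+ => dlt.
have dlt0 : 0 < dlt by near: dlt; exact: nbhs_right_gt.
have hd : forall s r, a <= s <= b -> `|s - r| < dlt -> `|f s - f r| <= eps / (b - a).
  by near: dlt; exact: segment_unif_continuous.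
near=> n.
have n0 : (0 < n)%N by near: n; exact: nbhs_infty_gt.
have hdlt : (b - a) / n%:R < dlt.
  rewrite ltr_pdivrMr ?ltr0n// mulrC -ltr_pdivrMr//.
  by near: n; exact: nbhs_infty_gtr.
set h := (b - a) / n%:R in hdlt *.
have h0 : 0 < h by rewrite divr_gt0// ltr0n.
have nh : n%:R * h = b - a by rewrite /h mulrC divfK// pnatr_eq0 -lt0n.
have step k : (k <= n)%N ->
    `|pint a (a + k%:R * h) f - \sum_(j < k) f (a + j%:R * h) * h| <= k%:R * (eps / (b - a) * h).
  elim: k => [|k IH] kn; first by rewrite big_ord0 !mul0r addr0 pint0 subrr normr0.
  have khS : a + k%:R * h <= a + k.+1%:R * h by rewrite lerD2l ler_wpM2r ?ler_nat// ltW.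
  have akh : a <= a + k%:R * h by rewrite lerDl mulr_ge0// ltW.
  have kb : a + k.+1%:R * h <= b.
    by rewrite -lerBrDl -nh ler_wpM2r ?ler_nat// ltW.
  have dh : (a + k.+1%:R * h) - (a + k%:R * h) = h by rewrite -natr1; ring.
  have := @pint_diff_norm f a (a + k%:R * h) (a + k.+1%:R * h) (f (a + k%:R * h)) (eps / (b - a)) cf akh khS.
  rewrite dh => /(_ _) H; have {}H := H _.
  rewrite big_ord_recr/=.
  rewrite (_ : pint a (a + k.+1%:R * h) f - _ =
    (pint a (a + k%:R * h) f - \sum_(j < k) f (a + j%:R * h) * h) +
    (pint a (a + k.+1%:R * h) f - pint a (a + k%:R * h) f - f (a + k%:R * h) * h)); last by ring.
  rewrite (_ : k.+1%:R * (eps / (b - a) * h) = k%:R * (eps / (b - a) * h) + eps / (b - a) * h); last first.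
    by rewrite -natr1 mulrDl mul1r.
  apply: le_trans (ler_normD _ _) _; apply: lerD; first exact: IH (ltnW kn).
  apply: H => s /andP[s1 s2]; apply: hd.
    by rewrite (le_trans akh)//= (le_trans s2).
  by rewrite ger0_norm ?subr_ge0//; apply: le_lt_trans hdlt; lra.
have := step n (leqnn n); rewrite nh (addrC a) subrK => /le_trans; apply.
by rewrite mulrCA nh divfK// gt_eqF.
Unshelve. all: by end_near. Qed.

(** Integrates [(f - c)^2 >= 0] with [c] the mean of [f] over the interval. *)
Lemma pint_sqr_le (f : R -> R) (a b : R) : continuous f -> a <= b ->
  pint a b f ^+ 2 <= (b - a) * pint a b (fun s => f s ^+ 2).
Proof.
move=> cf; rewrite le_eqVlt => /predU1P[<-|ab]; first by rewrite !pint0 mulr0 expr0n.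
have cf2 : continuous (fun s => f s ^+ 2) by move=> x; apply: cvgM; exact: cf.
have ba0 : 0 < b - a by rewrite subr_gt0.
set F := pint a b f; set F2 := pint a b _.
pose c := F / (b - a).
have : F2 >= 2 * c * F - c ^+ 2 * (b - a).
  have ccf : continuous (fun s : R => 2 * c * f s).
    by move=> x; apply: cvgM; [exact: cvg_cst|exact: cf].
  have e1 : 2 * c * F = pint a b (fun s => 2 * c * f s).
    by rewrite /F /pint -RintegralZl//; exact: continuous_integrable.
  have ccc : continuous (fun s : R => c ^+ 2) by move=> x; exact: cvg_cst.
  have e2 : c ^+ 2 * (b - a) = pint a b (fun=> c ^+ 2).
    rewrite /pint Rintegral_cst//= lebesgue_measure_itv/= lte_fin ab.
    by rewrite -EFinB.
  rewrite e1 e2 -RintegralB//; try exact: continuous_integrable.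
  apply: le_pint => //.
    by move=> x; apply: cvgB; [exact: ccf|exact: ccc].
  by move=> s _; have := sqr_ge0 (f s - c); lra.
rewrite (_ : 2 * c * F - _ = F ^+ 2 / (b - a)); last by rewrite /c; field; rewrite gt_eqF.
by rewrite ler_pdivrMr// mulrC.
Qed.

Lemma mx_norm_coord {n} (x : 'rV[R]_n) i : `|x 0 i| <= `|x|.
Proof.
rewrite /Num.norm/= mx_normrE.
exact: (le_bigmax _ (fun k : 'I_1 * 'I_n => `|x k.1 k.2|) (0, i)).
Qed.

Lemma mx_norm_le {n} (x : 'rV[R]_n) M : 0 <= M -> (forall i, `|x 0 i| <= M) -> `|x| <= M.
Proof.
move=> M0 h; rewrite /Num.norm/= mx_normrE; apply: bigmax_le => // -[i j] _ /=.
by rewrite ord1.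
Qed.

(** * Euler schemes with additive noise *)

Section euler.
Context {d : nat}.

Fixpoint euler (b : R -> 'rV[R]_d -> 'rV[R]_d) (h : R) (x0 : 'rV[R]_d) (dz : nat -> 'rV[R]_d) (k : nat) : 'rV[R]_d :=
  if k is k'.+1 then
    euler b h x0 dz k' + h *: b (k'%:R * h) (euler b h x0 dz k') + dz k'
  else x0.

(** The noise increments cancel exactly between path and scheme. The local error is [h] times the
    modulus of continuity of the drift along the solution, so convergence holds for a drift merely
    continuous in time. *)
Lemma euler_cvg (b : R -> 'rV[R]_d -> 'rV[R]_d) (L t : R) (x z : R -> 'rV[R]_d) : 0 <= L -> 0 < t ->
  (forall s u v, 0 <= s -> `|b s u - b s v| <= L * `|u - v|) ->
  (forall k, continuous (fun s => b s (x s) 0 k)) ->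
  (forall s k, 0 <= s -> x s 0 k = x 0 0 k + pint 0 s (fun r => b r (x r) 0 k) + z s 0 k) ->
  euler b (t / n%:R) (x 0)
    (fun k => z (k.+1%:R * (t / n%:R)) - z (k%:R * (t / n%:R))) n @[n --> \oo] --> x t.
Proof.
move=> L0 t0 bL cb xE.
pose Z n := euler b (t / n%:R) (x 0)
  (fun k => z (k.+1%:R * (t / n%:R)) - z (k%:R * (t / n%:R))).
suff : Z n n @[n --> \oo] --> x t by [].
apply/cvgrPdist_le => eps eps0.
(* Amplification over [[0, t]]: local errors [h eps / C] add up to at most [eps]. *)
pose C := t * expR (L * t).
have C0 : 0 < C by rewrite mulr_gt0 ?expR_gt0.
have [dlt [dlt0 hd]] : exists dlt : R, 0 < dlt /\
    forall s r k, 0 <= s <= t -> `|s - r| < dlt -> `|b s (x s) 0 k - b r (x r) 0 k| <= eps / C.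
  have : \forall dlt \near 0^'+, forall k s r, 0 <= s <= t -> `|s - r| < dlt -> `|b s (x s) 0 k - b r (x r) 0 k| <= eps / C.
    apply: filter_forall => k; apply: segment_unif_continuous; first exact: cb.
    by rewrite divr_gt0.
  move=> H; near (0 : R)^'+ => dlt; exists dlt; split; first by near: dlt; exact: nbhs_right_gt.
  by move=> s r k; apply: (near H dlt).
near=> n.
have n0 : (0 < n)%N by near: n; exact: nbhs_infty_gt.
have hdlt : t / n%:R < dlt.
  rewrite ltr_pdivrMr ?ltr0n// mulrC -ltr_pdivrMr//.
  by near: n; exact: nbhs_infty_gtr.
set h := t / n%:R in hdlt *.
have h0 : 0 < h by rewrite divr_gt0// ltr0n.
have nh : n%:R * h = t by rewrite /h mulrC divfK// pnatr_eq0 -lt0n.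
have step k : (k < n)%N -> `|x (k.+1%:R * h) - Z n k.+1| <=
    (1 + L * h) * `|x (k%:R * h) - Z n k| + h * (eps / C).
  move=> kn; have kh0 : 0 <= k%:R * h by rewrite mulr_ge0// ltW.
  have khS : k%:R * h <= k.+1%:R * h by rewrite ler_wpM2r ?ler_nat// ltW.
  have kht : k.+1%:R * h <= t by rewrite -nh ler_wpM2r ?ler_nat// ltW.
  have dh : k.+1%:R * h - k%:R * h = h by rewrite -natr1; ring.
  have bnd0 : 0 <= (1 + L * h) * `|x (k%:R * h) - Z n k| + h * (eps / C).
    apply: addr_ge0; apply: mulr_ge0 => //; first by rewrite addr_ge0// mulr_ge0// ltW.
      exact: ltW.
    by rewrite divr_ge0// ltW.
  have ZS : Z n k.+1 = Z n k + h *: b (k%:R * h) (Z n k) + (z (k.+1%:R * h) - z (k%:R * h)) by [].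
  apply: mx_norm_le => // j; rewrite ZS !mxE.
  rewrite (xE (k.+1%:R * h))//; last exact: le_trans khS.
  have e1 : `|(x (k%:R * h) - Z n k) 0 j| <= `|x (k%:R * h) - Z n k| by exact: mx_norm_coord.
  have e2 := @pint_diff_norm (fun r => b r (x r) 0 j) 0 (k%:R * h) (k.+1%:R * h)
    (b (k%:R * h) (Z n k) 0 j) (eps / C + L * `|x (k%:R * h) - Z n k|) (cb j) kh0 khS.
  have e3 : forall s, k%:R * h <= s <= k.+1%:R * h ->
      `|b s (x s) 0 j - b (k%:R * h) (Z n k) 0 j| <= eps / C + L * `|x (k%:R * h) - Z n k|.
    move=> s /andP[s1 s2].
    rewrite (_ : b s (x s) 0 j - _ = (b s (x s) 0 j - b (k%:R * h) (x (k%:R * h)) 0 j) +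
      (b (k%:R * h) (x (k%:R * h)) - b (k%:R * h) (Z n k)) 0 j); last by rewrite !mxE; ring.
    apply: le_trans (ler_normD _ _) _; apply: lerD.
      apply: hd; first by rewrite (le_trans kh0)//= (le_trans s2).
      by rewrite ger0_norm ?subr_ge0//; apply: le_lt_trans hdlt; lra.
    by apply: le_trans (mx_norm_coord _ _) (bL _ _ _ kh0).
  have := e2 e3; rewrite dh => {e2 e3} e2.
  rewrite (_ : _ - _ = (x (k%:R * h) - Z n k) 0 j +
    (pint 0 (k.+1%:R * h) (fun r => b r (x r) 0 j) - pint 0 (k%:R * h) (fun r => b r (x r) 0 j)
     - b (k%:R * h) (Z n k) 0 j * h)); last first.
    by rewrite !mxE (xE (k%:R * h))// ?mxE; ring.
  apply: le_trans (ler_normD _ _) _.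
  by apply: le_trans (lerD e1 e2) _; rewrite le_eqVlt; apply/orP; left; apply/eqP; ring.
have acc k : (k <= n)%N -> `|x (k%:R * h) - Z n k| <= k%:R * h * (eps / C) * expR (L * (k%:R * h)).
  elim: k => [|k IH] kn; first by rewrite /= !mul0r subrr normr0.
  apply: le_trans (step k kn) _.
  have := IH (ltnW kn); set e := `|_| => he.
  have p1 : 1 + L * h <= expR (L * h) by exact: expR_ge1Dx.
  have p0 : 0 <= 1 + L * h by rewrite addr_ge0// mulr_ge0// ltW.
  have -> : expR (L * (k.+1%:R * h)) = expR (L * h) * expR (L * (k%:R * h)).
    by rewrite -expRD -natr1; congr expR; ring.
  set E := expR (L * (k%:R * h)) in he *.
  have ec : 0 <= eps / C by rewrite divr_ge0// ltW.
  have kh0 : 0 <= k%:R * h * (eps / C) by apply: mulr_ge0 => //; rewrite mulr_ge0// ltW.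
  have EE : 1 <= expR (L * h) * E.
    by rewrite -expRD -expR0 ler_expR addr_ge0// ?mulr_ge0// ?mulr_ge0// ltW.
  have -> : k.+1%:R * h * (eps / C) * (expR (L * h) * E) =
    k%:R * h * (eps / C) * (expR (L * h) * E) + h * (eps / C) * (expR (L * h) * E).
    by rewrite -natr1; ring.
  apply: lerD.
    apply: le_trans (ler_wpM2l p0 he) _.
    rewrite [leLHS]mulrC -[leLHS]mulrA ler_wpM2l// mulrC; apply: ler_wpM2r => //; exact: expR_ge0.
  by rewrite ler_peMr// mulr_ge0// ltW.
have := acc n (leqnn n); rewrite nh => /le_trans; apply.
by rewrite le_eqVlt; apply/orP; left; apply/eqP; rewrite /C; field; rewrite !gt_eqF ?expR_gt0.
Unshelve. all: by end_near. Qed.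

End euler.
End primitives.

(** * Euclidean gradients *)

Lemma cauchy_schwarz_sum {R : realType} {I : finType} (a b : I -> R) :
  \sum_i a i * b i <= Num.sqrt (\sum_i a i * a i) * Num.sqrt (\sum_i b i * b i).
Proof.
have s0 (c : I -> R) : 0 <= \sum_i c i * c i.
  by apply: sumr_ge0 => i _; rewrite -expr2 sqr_ge0.
have z (c : I -> R) : \sum_i c i * c i = 0 -> forall i, c i = 0.
  move=> h i; have : \sum_i c i * c i == 0 by rewrite h.
  rewrite psumr_eq0; last by move=> j _; rewrite -expr2 sqr_ge0.
  by move=> /allP/(_ i (mem_index_enum _)) /=; rewrite mulf_eq0 orbb => /eqP.
have [/z a0|a0] := eqVneq (\sum_i a i * a i) 0.
  by rewrite big1 ?mulr_ge0 ?sqrtr_ge0// => i _; rewrite a0 mul0r.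
have [/z b0|b0] := eqVneq (\sum_i b i * b i) 0.
  by rewrite big1 ?mulr_ge0 ?sqrtr_ge0// => i _; rewrite b0 mulr0.
set A := Num.sqrt _; set B := Num.sqrt _.
have A0 : 0 < A by rewrite sqrtr_gt0 lt_neqAle eq_sym a0 s0.
have B0 : 0 < B by rewrite sqrtr_gt0 lt_neqAle eq_sym b0 s0.
have EA : \sum_i a i * a i = A * A by rewrite -expr2 sqr_sqrtr.
have EB : \sum_i b i * b i = B * B by rewrite -expr2 sqr_sqrtr.
have : \sum_i a i * b i <= \sum_i ((B / A) / 2 * (a i * a i) + (A / B) / 2 * (b i * b i)).
  apply: ler_sum => i _.
  have := sqr_ge0 (B * a i - A * b i) => h.
  rewrite -subr_ge0 (_ : _ - _ = (B * a i - A * b i) ^+ 2 / (2 * A * B)); last first.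
    by field; rewrite !gt_eqF.
  by rewrite divr_ge0// !mulr_ge0// ltW.
rewrite big_split/= -!mulr_sumr EA EB.
suff -> : B / A / 2 * (A * A) + A / B / 2 * (B * B) = A * B by [].
by field; rewrite !gt_eqF.
Qed.

Section euclidean_algebra.
Context {R : realType} {d : nat}.
Implicit Types (u v w : 'rV[R]_d) (c : R).

Lemma dotE u v : dot u v = \sum_k u 0 k * v 0 k.
Proof. by rewrite /dot mxE; apply: eq_bigr => k _; rewrite mxE. Qed.

Lemma dotC u v : dot u v = dot v u.
Proof. by rewrite !dotE; apply: eq_bigr => k _; rewrite mulrC. Qed.

Lemma dotDl u v w : dot (u + v) w = dot u w + dot v w.
Proof. by rewrite /dot mulmxDl mxE. Qed.

Lemma dotNl u v : dot (- u) v = - dot u v.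
Proof. by rewrite /dot mulNmx mxE. Qed.

Lemma dotZl c u v : dot (c *: u) v = c * dot u v.
Proof. by rewrite /dot -scalemxAl mxE. Qed.

Lemma dotBl u v w : dot (u - v) w = dot u w - dot v w.
Proof. by rewrite dotDl dotNl. Qed.

Lemma dotDr u v w : dot w (u + v) = dot w u + dot w v.
Proof. by rewrite !(dotC w) dotDl. Qed.

Lemma dotNr u v : dot u (- v) = - dot u v.
Proof. by rewrite !(dotC u) dotNl. Qed.

Lemma dotBr u v w : dot w (u - v) = dot w u - dot w v.
Proof. by rewrite dotDr dotNr. Qed.

Lemma dotZr c u v : dot u (c *: v) = c * dot u v.
Proof. by rewrite !(dotC u) dotZl. Qed.

Lemma dot_suml (I : Type) (s : seq I) (F : I -> 'rV[R]_d) v :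
  dot (\sum_(i <- s) F i) v = \sum_(i <- s) dot (F i) v.
Proof.
elim: s => [|i s IH]; first by rewrite !big_nil dotE big1// => k _; rewrite mxE mul0r.
by rewrite !big_cons dotDl IH.
Qed.

Lemma dot_ge0 u : 0 <= dot u u.
Proof. by rewrite dotE; apply: sumr_ge0 => k _; rewrite -expr2 sqr_ge0. Qed.

Lemma dot_le_amgm u v c : 0 < c -> 2 * dot u v <= c * dot u u + c^-1 * dot v v.
Proof.
move=> c0; have := dot_ge0 (c *: u - v).
rewrite !(dotBl, dotBr, dotZl, dotZr) (dotC v u) => h.
rewrite -(ler_pM2l c0).
have -> : c * (c * dot u u + c^-1 * dot v v) = c * (c * dot u u) + dot v v.
  by field; rewrite gt_eqF.
lra.
Qed.

Lemma sqr_eucl_norm u : eucl_norm u ^+ 2 = dot u u.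
Proof. by rewrite sqr_sqrtr// dot_ge0. Qed.

Lemma eucl_norm_ge0 u : 0 <= eucl_norm u.
Proof. exact: sqrtr_ge0. Qed.

Lemma dotN2 u : dot (- u) (- u) = dot u u.
Proof. by rewrite dotNl dotNr opprK. Qed.

Lemma dotD_le u v : dot (u + v) (u + v) <= 2 * dot u u + 2 * dot v v.
Proof.
have := dot_ge0 (u - v); rewrite !(dotBl, dotBr, dotDl, dotDr) (dotC v u); lra.
Qed.

Lemma dotB_le u v : dot (u - v) (u - v) <= 2 * dot u u + 2 * dot v v.
Proof. by apply: le_trans (dotD_le _ _) _; rewrite dotN2. Qed.

Lemma normr_sqr_le_dot u : `|u| ^+ 2 <= dot u u.
Proof.
rewrite -sqr_eucl_norm ler_pXn2r ?nnegrE ?eucl_norm_ge0//.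
apply: mx_norm_le => [|k]; first exact: eucl_norm_ge0.
rewrite -sqrtr_sqr ler_wsqrtr// dotE (bigD1 k)//= -expr2 lerDl.
by apply: sumr_ge0 => j _; rewrite -expr2 sqr_ge0.
Qed.

Lemma dot_le_normr_sqr u : dot u u <= d%:R * `|u| ^+ 2.
Proof.
rewrite dotE; apply: le_trans (_ : \sum_(k < d) `|u| ^+ 2 <= _).
  by apply: ler_sum => k _; rewrite -expr2 -real_normK ?num_real// ler_pXn2r ?nnegrE// mx_norm_coord.
by rewrite sumr_const card_ord mulr_natl.
Qed.

Lemma coord_le_eucl_norm u k : `|u 0 k| <= eucl_norm u.
Proof.
rewrite -(@ler_pXn2r _ 2)// ?nnegrE ?eucl_norm_ge0// sqr_eucl_norm.
apply: le_trans (normr_sqr_le_dot u).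
by rewrite ler_pXn2r ?nnegrE// mx_norm_coord.
Qed.

Definition sup_lip (L : R) (F : 'rV[R]_d -> 'rV[R]_d) :=
  forall x y, `|F x - F y| <= L * `|x - y|.

(** [sqrt d] compares the Euclidean norm with the sup norm of the library, and [Num.max L 0] gives a
    nonnegative constant whatever the sign of [L]. *)
Lemma eucl_lipschitz_sup L F : eucl_lipschitz L F ->
  sup_lip (Num.max L 0 * Num.sqrt d%:R) F.
Proof.
move=> hF x y; apply: mx_norm_le => [|k].
  by rewrite !mulr_ge0// ?sqrtr_ge0// le_max lexx orbT.
apply: le_trans (coord_le_eucl_norm _ k) _; apply: le_trans (hF x y) _.
rewrite -mulrA; apply: le_trans (_ : Num.max L 0 * eucl_norm (x - y) <= _).
  by rewrite ler_wpM2r ?eucl_norm_ge0// le_max lexx.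
rewrite ler_wpM2l ?le_max ?lexx ?orbT//.
rewrite -[X in _ * X]ger0_norm// -sqrtr_sqr -sqrtrM// ler_wsqrtr//.
exact: dot_le_normr_sqr.
Qed.

Lemma eucl_lipschitz_dot L (F : 'rV[R]_d -> 'rV[R]_d) : eucl_lipschitz L F -> forall x y,
  dot (F x - F y) (F x - F y) <= L ^+ 2 * dot (x - y) (x - y).
Proof.
move=> hF x y; rewrite -!sqr_eucl_norm -exprMn ler_pXn2r ?nnegrE ?eucl_norm_ge0//.
exact: le_trans (eucl_norm_ge0 _) (hF x y).
Qed.

Lemma sup_lip_continuous L F : sup_lip L F -> continuous F.
Proof.
move=> hF x; apply/(@cvgrPdist_le R 'rV[R]_d 'rV[R]_d (nbhs x)) => e e0; near=> y.
apply: le_trans (hF x y) _.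
have L1 : 0 < `|L| + 1 by rewrite ltr_wpDl.
apply: le_trans (_ : (`|L| + 1) * `|x - y| <= _).
  by rewrite ler_wpM2r// (le_trans (ler_norm L))// lerDl.
rewrite -ler_pdivlMl//; near: y.
by apply: cvgr_dist_le; [exact: cvg_id|rewrite mulr_gt0// invr_gt0].
Unshelve. all: by end_near. Qed.

End euclidean_algebra.

Section gradients.
Context {R : realType} {d : nat}.
Implicit Types (x y v w z : 'rV[R]_d) (f : 'rV[R]_d -> R).

Lemma is_derive_line f y w t : derivable f (y + t *: w) w ->
  is_derive t 1 (fun s : R => f (y + s *: w)) ('D_w f (y + t *: w)).
Proof.
have E : (fun h : R => h^-1 *: (f (y + (h *: 1 + t) *: w) - f (y + t *: w))) =
         (fun h : R => h^-1 *: (f (h *: w + (y + t *: w)) - f (y + t *: w))).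
  apply/funext => h; congr (_ *: (f _ - _)).
  by rewrite -[h *: 1]/(h * 1) mulr1 scalerDl addrCA.
move=> df; apply: DeriveDef.
  by rewrite /derivable /= E.
by rewrite /derive /= E.
Qed.

Lemma derive_coord (F : 'rV[R]_d -> 'rV[R]_d) z w k : derivable F z w ->
  is_derive z w (fun u => F u 0 k) (('D_w F z) 0 k).
Proof.
move=> dF.
have h : h^-1 *: (F (h *: w + z) 0 k - F z 0 k) @[h --> 0^'] --> ('D_w F z) 0 k.
  have := cvg_comp (fun h : R => h^-1 *: (F (h *: w + z) - F z)) (fun u : 'rV[R]_d => u 0 k) dF (@coord_continuous _ _ _ 0 k _).
  apply: cvg_trans; apply: near_eq_cvg; near=> h.
  by rewrite /= !mxE.
by apply: DeriveDef; [apply/cvg_ex; exists (('D_w F z) 0 k)|exact/cvg_lim].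
Unshelve. all: by end_near. Qed.

Lemma derive_grad f z v : differentiable f z -> 'D_v f z = dot (grad f z) v.
Proof.
move=> df; rewrite deriveE// {1}(row_sum_delta v) linear_sum dotE.
by apply: eq_bigr => k _; rewrite linearZ/= -deriveE// mulrC mxE.
Qed.

(** On the segment from [y] to [x], the scalar product of the gradient with [w], minus
    [beta |w|^2 t], has nonnegative derivative. *)
Lemma hess_ge_monotone f (beta : R) : twice_differentiable f -> hess_ge f beta ->
  forall x y, beta * dot (x - y) (x - y) <= dot (grad f x - grad f y) (x - y).
Proof.
move=> [_ df2] hf x y; set w := x - y.
pose phi t := \sum_k grad f (y + t *: w) 0 k * w 0 k - beta * dot w w * t.
have dphi (t : R) : is_derive t (1 : R) phi (dot (w *m hess f (y + t *: w)) w - beta * dot w w).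
  have dg : derivable (grad f) (y + t *: w) w by exact: diff_derivable.
  have E : 'D_w (grad f) (y + t *: w) = w *m hess f (y + t *: w) by rewrite deriveEjacobian.
  rewrite dotE -E; apply: is_derive1B.
    apply: (@is_derive_sum_seq _ _ _ (fun k t => grad f (y + t *: w) 0 k * w 0 k)
      (fun k t => ('D_w (grad f) (y + t *: w)) 0 k * w 0 k)) => k.
    have [d1 d2] := derive_coord k dg.
    have d3 := @is_derive_line (fun u => grad f u 0 k) y w t d1.
    rewrite -d2; have := is_derive1M d3 (is_derive_cst (w 0 k) t 1).
    by rewrite mulr0 add0r mulrC.
  apply: is_derive_eq.
  by rewrite -[_ *: _]/(_ * _) mulr1.
have dphi0 t : 0 <= dot (w *m hess f (y + t *: w)) w - beta * dot w w.
  by rewrite subr_ge0 hf.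
have : phi 0 <= phi 1.
  apply: (ger0_derive1_ndecr (a := 0) (b := 1)) => //.
  - by move=> t _; rewrite derive1E; have [_ ->] := dphi t.
  - apply: derivable_within_continuous => t _; by have [] := dphi t.
rewrite /phi scale0r addr0 scale1r mulr0 subr0 mulr1 -!dotE.
have -> : y + w = x by rewrite addrC subrK.
by rewrite dotBl; lra.
Qed.

(** By convexity the right difference quotients along the segment are at most [f x - f y]. *)
Lemma convex_grad_le f : (forall z, differentiable f z) ->
  convex_function [set: convex_lmodType 'rV[R]_d] (f : _ -> R^o) ->
  forall x y, dot (grad f y) (x - y) <= f x - f y.
Proof.
move=> df cf x y; rewrite -derive_grad//.
have dx : derivable f y (x - y) by exact: diff_derivable.
have dx' : h^-1 *: (f (h *: (x - y) + y) - f y) @[h --> 0^'+] --> 'D_(x - y) f y.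
  exact: cvg_dnbhs_at_right dx.
rewrite -(cvg_lim _ dx')//; apply: limr_le; first by apply/cvg_ex; exists ('D_(x - y) f y).
near=> h.
have h0 : 0 < h by near: h; exact: nbhs_right_gt.
have h1 : h <= 1 by near: h; apply: nbhs_right_le.
have h01 : Itv.spec (@Itv.num_sem R) (Itv.Real `[0%Z, 1%Z]) h.
  by rewrite /Itv.spec /Itv.num_sem/= in_itv/= (ltW h0) h1 num_real.
have := @cf (Itv.mk h01) x y (in_setT _) (in_setT _).
have -> : h *: (x - y) + y = h *: x + (1 - h) *: y.
  by apply/rowP => k; rewrite !mxE; ring.
move=> H; have {}H : f (h *: x + (1 - h) *: y) <= h * f x + (1 - h) * f y := H.
rewrite -[_ *: _]/(_ * _) mulrC ler_pdivrMr//; lra.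
Unshelve. all: by end_near. Qed.

Lemma convex_grad_monotone f : (forall z, differentiable f z) ->
  convex_function [set: convex_lmodType 'rV[R]_d] (f : _ -> R^o) ->
  forall x y, 0 <= dot (grad f x - grad f y) (x - y).
Proof.
move=> df cf x y; have := convex_grad_le df cf x y; have := convex_grad_le df cf y x.
by rewrite dotBl -opprB dotNr; lra.
Qed.

Lemma even_grad f : (forall z, differentiable f z) -> (forall x, f x = f (- x)) ->
  forall x, grad f (- x) = - grad f x.
Proof.
move=> df ef x; apply/rowP => k; rewrite !mxE; set v := delta_mx _ _.
have -> : 'D_v f (- x) = 'D_(- v) f x.
  have E : (fun h : R => h^-1 *: (f (h *: v - x) - f (- x))) = (fun h : R => h^-1 *: (f (h *: - v + x) - f x)).
    by apply/funext => h; rewrite [f (- x)]ef opprK [f (_ - x)]ef opprD opprK scalerN.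
  by rewrite /derive /= E.
by rewrite !derive_grad// dotNr.
Qed.

End gradients.

(** * Bounds on means *)

Section clip.
Context {R : realType}.
Implicit Types (M x y : R).

(** Truncation lets second moments give convergence of means: the clipped part is bounded, and the
    rest has mean at most the second moment divided by [M]. *)
Definition clip M y := Num.max (- M) (Num.min y M).

Lemma clip_cases M y : 0 < M -> [\/ M <= y /\ clip M y = M,
  y <= - M /\ clip M y = - M | - M <= y <= M /\ clip M y = y].
Proof.
move=> M0; have NM : - M < M by lra.
rewrite /clip; have [yM|My] := leP y M; last first.
  by apply: Or31; split; [exact: ltW|apply/max_idPr; exact: ltW].
have [h|/ltW h] := lerP y (- M); first by apply: Or32; split => //; exact/max_idPl.
by apply: Or33; rewrite h.
Qed.

Lemma clip_le M y : 0 < M -> `|clip M y| <= M.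
Proof.
move=> M0; case: (clip_cases y M0) => -[h ->].
- by rewrite ger0_norm// ltW.
- by rewrite normrN ger0_norm// ltW.
- by rewrite ler_norml.
Qed.

Lemma clip_err M y : 0 < M -> `|y - clip M y| <= y ^+ 2 / M.
Proof.
move=> M0; rewrite ler_pdivlMr//; case: (clip_cases y M0) => -[h ->].
- by rewrite ger0_norm ?subr_ge0//; nra.
- by rewrite ler0_norm; nra.
- by rewrite subrr normr0 mul0r sqr_ge0.
Qed.

Lemma clip_lip M x y : 0 < M -> `|clip M x - clip M y| <= `|x - y|.
Proof.
move=> M0; wlog xy : x y / x <= y => [H|].
  by have [xy|/ltW yx] := leP x y; [exact: H|rewrite distrC (distrC x); exact: H].
rewrite distrC (distrC x) (@ger0_norm _ (y - x)) ?subr_ge0// ler_norml.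
by case: (clip_cases x M0) => -[h ->]; case: (clip_cases y M0) => -[h' ->]; lra.
Qed.

End clip.

Section mean_bounds.
Context {R : realType} {dT : measure_display} {T : measurableType dT}.
Variable P : probability T R.
Implicit Types (f g : T -> R) (K L : R).

Definition mean_le f K := [/\ measurable_fun setT f, forall w, 0 <= f w &
  (\int[P]_w (f w)%:E <= K%:E)%E].

Lemma mean_le_ge0 f K : mean_le f K -> 0 <= K.
Proof.
move=> [_ f0 fK]; rewrite -lee_fin; apply: le_trans fK.
by apply: integral_ge0 => w _; rewrite lee_fin.
Qed.

Lemma mean_leW f g K : measurable_fun setT f -> (forall w, 0 <= f w <= g w) ->
  mean_le g K -> mean_le f K.
Proof.
move=> mf fg [mg g0 gK]; split => // [w|]; first by have /andP[] := fg w.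
apply: le_trans gK; apply: ge0_le_integral => //.
- by move=> w _; rewrite lee_fin; have /andP[] := fg w.
- exact/measurable_EFinP.
- exact/measurable_EFinP.
- by move=> w _; rewrite lee_fin; have /andP[] := fg w.
Qed.

Lemma mean_le_trans f K L : K <= L -> mean_le f K -> mean_le f L.
Proof. by move=> KL [mf f0 fK]; split => //; apply: le_trans fK _; rewrite lee_fin. Qed.

Lemma mean_leD f g K L : mean_le f K -> mean_le g L -> mean_le (fun w => f w + g w) (K + L).
Proof.
move=> [mf f0 fK] [mg g0 gL]; split; [exact: measurable_funD|by move=> w; rewrite addr_ge0|].
under eq_integral do rewrite EFinD.
rewrite ge0_integralD//; first by rewrite EFinD leeD.
- by move=> w _; rewrite lee_fin.
- exact/measurable_EFinP.
- by move=> w _; rewrite lee_fin.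
- exact/measurable_EFinP.
Qed.

Lemma mean_leZ c f K : 0 <= c -> mean_le f K -> mean_le (fun w => c * f w) (c * K).
Proof.
move=> c0 [mf f0 fK]; split; [exact: measurable_funM|by move=> w; rewrite mulr_ge0|].
under eq_integral do rewrite EFinM.
rewrite ge0_integralZl_EFin//; first by rewrite EFinM lee_wpmul2l.
- by move=> w _; rewrite lee_fin.
- exact/measurable_EFinP.
Qed.

Lemma mean_le_cst c : 0 <= c -> mean_le (fun=> c) c.
Proof.
move=> c0; split => //.
by rewrite integral_cst//= probability_setT mule1.
Qed.

Lemma mean_le_sum (I : Type) (s : seq I) (p : pred I) (F : I -> T -> R) (K : I -> R) :
  (forall i, mean_le (F i) (K i)) ->
  mean_le (fun w => \sum_(i <- s | p i) F i w) (\sum_(i <- s | p i) K i).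
Proof.
move=> h; elim: s => [|i s IH].
  by rewrite big_nil; under eq_fun do rewrite big_nil; exact: mean_le_cst.
rewrite big_cons; under eq_fun do rewrite big_cons.
by case: ifP => // _; exact: mean_leD.
Qed.

(** Fatou's lemma; the shift by [n0] brings all bounds [K n] below [L + e]. *)
Lemma mean_le_lim (F : nat -> T -> R) f (K : nat -> R) L :
  (forall n, mean_le (F n) (K n)) -> (forall w, F n w @[n --> \oo] --> f w) ->
  K n @[n --> \oo] --> L -> mean_le f L.
Proof.
move=> mF Ff KL.
have F0 n w : 0 <= F n w by have [_ ->] := mF n.
have mFn n : measurable_fun setT (F n) by have [] := mF n.
have mf : measurable_fun setT f.
  by apply: (@measurable_fun_cvg _ _ _ setT F) => // w _; exact: Ff.
split => // [w|]; first by rewrite -(cvg_lim _ (Ff w))//; apply: limr_ge; [apply/cvg_ex; exists (f w)|exact: nearW].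
apply/lee_addgt0Pr => e e0; rewrite -EFinD.
have /(@cvgrPdist_lt _ R^o) /(_ _ e0) [n0 _ hn] := KL.
have -> : (\int[P]_w (f w)%:E)%E = (\int[P]_w limn_einf (fun n => (F (n + n0)%N w)%:E))%E.
  apply: eq_integral => w _; apply/esym.
  apply: (@cvg_limn_einf_sup _ (fun n => (F (n + n0)%N w)%:E) (f w)%:E _).1.
  by apply/cvg_EFin; [exact: nearW|rewrite (cvg_shiftn n0 (fun n => F n w)); exact: Ff].
apply: le_trans (fatou _ _ _ _) _ => //.
- by move=> n; apply/measurable_EFinP.
- by move=> n w _; rewrite lee_fin.
rewrite limn_einf_lim; apply: lime_le; first exact: is_cvg_einfs.
apply: nearW => n.
apply: le_trans (_ : (\int[P]_w (F (n + n0)%N w)%:E <= _)%E).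
  by apply: ereal_inf_lbound; exists n => /=.
have [_ _ /le_trans] := mF (n + n0)%N; apply; rewrite lee_fin.
have := hn (n + n0)%N (leq_addl _ _); rewrite distrC => /ltW/(le_trans (ler_norm _)); lra.
Qed.

(** Riemann sums in time followed by Fatou take the place of Tonelli, because continuity in time and
    measurability in [w] are given separately. *)
Lemma mean_le_pint (f : R -> T -> R) (u : R -> R) (a b K : R) : a <= b ->
  continuous u -> (forall s, 0 <= u s) -> (forall w, continuous (fun s => f s w)) ->
  (forall s, a <= s <= b -> mean_le (f s) K) ->
  mean_le (fun w => pint a b (fun s => u s * f s w)) (K * pint a b u).
Proof.
move=> ab cu u0 cf fK.
pose t n k := a + k%:R * ((b - a) / n%:R).
have tab n (k : 'I_n) : a <= t n k <= b.
  rewrite /t lerDl mulr_ge0 ?divr_ge0 ?subr_ge0//= -lerBrDl.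
  rewrite mulrCA ler_piMr ?subr_ge0// ler_pdivrMr ?ltr0n ?(leq_trans _ (ltn_ord k))//.
  by rewrite mul1r ler_nat ltnW.
apply: (@mean_le_lim (fun n w => \sum_(k < n) u (t n k) * f (t n k) w * ((b - a) / n%:R)) _
  (fun n => \sum_(k < n) u (t n k) * ((b - a) / n%:R) * K)).
- move=> n.
  have E : (fun w => \sum_(k < n) u (t n k) * f (t n k) w * ((b - a) / n%:R)) =
      (fun w => \sum_(k < n) (u (t n k) * ((b - a) / n%:R)) * f (t n k) w).
    by apply/funext => w; apply: eq_bigr => k _; ring.
  rewrite E; apply: mean_le_sum => k; apply: mean_leZ; last by apply: fK.
  by rewrite mulr_ge0// divr_ge0// subr_ge0.
- move=> w; apply: riemann_sum_cvg => // x.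
  by apply: cvgM; [exact: cu|exact: cf].
- rewrite mulrC; under eq_cvg do rewrite -mulr_suml.
  by apply: cvgM; [exact: riemann_sum_cvg|exact: cvg_cst].
Qed.

(** Young's inequality [f <= f^2 / (2 c) + c / 2] with [c = sqrt K + e]; the [e] allows division by
    [c] when [K = 0]. *)
Lemma mean_le_sqrt f K : mean_le (fun w => f w ^+ 2) K -> measurable_fun setT f ->
  (forall w, 0 <= f w) -> mean_le f (Num.sqrt K).
Proof.
move=> fK mf f0; have K0 := mean_le_ge0 fK.
have h e : 0 < e -> mean_le f (Num.sqrt K + e).
  move=> e0; set c := Num.sqrt K + e.
  have c0 : 0 < c by rewrite ltr_wpDl// sqrtr_ge0.
  have Kc : K <= c ^+ 2.
    by rewrite -[K]sqr_sqrtr// ler_pXn2r ?nnegrE ?sqrtr_ge0// /c ?lerDl ?ltW// addr_ge0 ?sqrtr_ge0// ltW.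
  have := mean_leD (mean_leZ (c := (2 * c)^-1) _ fK) (mean_le_cst (c := c / 2) _).
  rewrite invr_ge0 mulr_ge0 ?(ltW c0)// divr_ge0 ?(ltW c0)// => /(_ isT isT) h.
  apply: mean_le_trans (mean_leW mf _ h).
    rewrite -subr_ge0 (_ : _ - _ = (c ^+ 2 - K) / (2 * c)); last by field; rewrite gt_eqF.
    by rewrite divr_ge0 ?subr_ge0// mulr_ge0// ltW.
  move=> w; rewrite f0/= -subr_ge0 (_ : _ - _ = (f w - c) ^+ 2 / (2 * c)); last by field; rewrite gt_eqF.
  by rewrite divr_ge0 ?sqr_ge0// mulr_ge0// ltW.
split => //; apply/lee_addgt0Pr => e e0; rewrite -EFinD.
by have [] := h e e0.
Qed.

Lemma mean_le_integrable f K : measurable_fun setT f -> mean_le (fun w => `|f w|) K ->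
  P.-integrable setT (EFin \o f).
Proof.
move=> mf [_ _ fK]; apply/integrableP; split; first exact/measurable_EFinP.
by apply: le_lt_trans fK _; rewrite ltry.
Qed.

Lemma mean_le_norm_Rintegral f K : measurable_fun setT f -> mean_le (fun w => `|f w|) K ->
  `|\int[P]_w f w| <= K.
Proof.
move=> mf h; have fi := mean_le_integrable mf h.
apply: le_trans (le_normr_Rintegral measurableT fi) _.
have [_ _ hK] := h.
by rewrite -lee_fin fineK// ge0_fin_numE ?(le_lt_trans hK) ?ltry//; apply: integral_ge0.
Qed.

(** A local second moment bound yields uniform integrability: clipped means converge by bounded
    convergence along sequences, with an error [K / M] uniform near [r]. *)
Lemma mean_continuous (u : R -> T -> R) (r K : R) :
  (forall s, `|s - r| < 1 -> mean_le (fun w => u s w ^+ 2) K) ->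
  (forall s, measurable_fun setT (u s)) -> (forall w, {for r, continuous (fun s => u s w)}) ->
  {for r, continuous (fun s => \int[P]_w u s w)}.
Proof.
move=> uK mu cu; suff : (fun s => \int[P]_w u s w) s @[s --> r] --> \int[P]_w u r w by [].
apply: (@cvg_nbhsP R R^o (fun s => \int[P]_w u s w) r (\int[P]_w u r w)).2 => s sr.
have tr_bdm M s' : 0 < M -> bdm (fun w => clip M (u s' w)).
  move=> M0; split; first by apply: measurable_maxr => //; apply: measurable_minr.
  by exists M => w; exact: clip_le.
have rr : `|r - r| < 1 by rewrite subrr normr0.
have K0 : 0 <= K := mean_le_ge0 (uK r rr).
have err M s' : 0 < M -> `|s' - r| < 1 -> `|\int[P]_w u s' w - Ex P (fun w => clip M (u s' w))| <= K / M.
  move=> M0 s'r.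
  have e1 : mean_le (fun w => `|u s' w - clip M (u s' w)|) (M^-1 * K).
    apply: mean_leW (mean_leZ (c := M^-1) _ (uK s' s'r)); last by rewrite invr_ge0 ltW.
      apply: measurableT_comp => //; apply: measurable_funB => //.
      by have [] := tr_bdm M s' M0.
    by move=> w; rewrite normr_ge0 mulrC clip_err.
  rewrite /Ex -RintegralB//.
  - by rewrite mulrC; apply: mean_le_norm_Rintegral => //; apply: measurable_funB => //; have [] := tr_bdm M s' M0.
  - apply: (mean_le_integrable (K := 1 + K)) => //.
    apply: mean_leW (mean_leD (mean_le_cst (c := 1) ler01) (uK s' s'r)).
      exact: measurableT_comp.
    by move=> w; rewrite normr_ge0/=; have := sqr_ge0 (`|u s' w| - 1); rewrite -(real_normK (num_real (u s' w))); have := normr_ge0 (u s' w); nra.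
  - by apply: bdm_integrable; exact: tr_bdm.
apply/(@cvgrPdist_le _ R^o) => e e0.
(* Makes each of the two truncation errors at most [e / 3]. *)
pose M := (3 * K + 1) / e.
have M0 : 0 < M by rewrite divr_gt0// ltr_wpDl// mulr_ge0.
have KM : K / M <= e / 3.
  rewrite ler_pdivrMr// /M (_ : e / 3 * _ = K + 1 / 3); last by field; rewrite gt_eqF.
  by lra.
have tr_cvg w : clip M (u (s n) w) @[n --> \oo] --> clip M (u r w).
  apply/(@cvgrPdist_le _ R^o) => e' e'0.
  have /(@cvgrPdist_le _ R^o)/(_ _ e'0) : u (s n) w @[n --> \oo] --> u r w.
    exact: (cvg_comp s (fun s => u s w) sr (cu w)).
  by apply: filterS => n; apply: le_trans; exact: clip_lip.
have [_] := @Ex_lim _ _ _ P (fun n w => clip M (u (s n) w)) (fun w => clip M (u r w)) (cst 1) M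
  (fun n => tr_bdm M (s n) M0) (bdm_cst 1) (fun n w => clip_le _ M0) tr_cvg.
move=> /(@cvgrPdist_le _ R^o) /(_ _ (divr_gt0 e0 (@ltr0n R 3))).
have sr1 : \forall n \near \oo, `|s n - r| < 1.
  by have /(@cvgrPdist_lt _ R^o)/(_ _ ltr01) := sr; apply: filterS => n; rewrite distrC.
move=> h; apply: filterS2 sr1 h => n sn.
rewrite (@eq_Ex _ _ _ P _ (fun w => clip M (u r w))); last by move=> w; rewrite mulr1.
rewrite (@eq_Ex _ _ _ P (fun w => clip M (u (s n) w) * _) (fun w => clip M (u (s n) w))); last by move=> w; rewrite mulr1.
have := err M r M0 rr; have := err M (s n) M0 sn.
set a := Ex P _; set b := Ex P _ => h1 h2 h3.
rewrite (_ : _ - _ = (\int[P]_w u r w - b) + (b - a) - (\int[P]_w u (s n) w - a)); last by ring.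
apply: le_trans (ler_normB _ _) _; apply: le_trans (lerD (ler_normD _ _) (lexx _)) _.
by lra.
Qed.

End mean_bounds.

(** * McKean-Vlasov paths for a frozen common noise *)

Section law_integral.
Context {R : realType} {dT dE : measure_display}.
Context {T : measurableType dT} {E : measurableType dE}.

Lemma integral_law (mu : {measure set T -> \bar R}) (nu : {measure set E -> \bar R})
    (f : T -> E) (g : E -> R) :
  measurable_fun setT f -> (forall C, measurable C -> mu (f @^-1` C) = nu C) ->
  measurable_fun setT g -> mu.-integrable setT (fun w => (g (f w))%:E) ->
  \int[nu]_x g x = \int[mu]_w g (f w).
Proof.
move=> mf law mg gi; rewrite /Rintegral; congr fine.
pose mixin := isMeasurableFun.Build _ _ _ _ _ mf.
pose pack : {mfun T >-> E} := HB.pack f mixin.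
rewrite (@eq_measure_integral _ _ _ setT (pushforward mu pack) nu (fun x => (g x)%:E)).
  rewrite (integral_pushforward mf)//; exact/measurable_EFinP.
by move=> C mC _; rewrite -law.
Qed.

End law_integral.

Lemma continuous_compf {T U V : topologicalType} (f : T -> U) (g : U -> V) :
  continuous f -> continuous g -> continuous (fun x => g (f x)).
Proof. by move=> cf cg x; exact: (continuous_comp (cf x) (cg (f x))). Qed.

Lemma continuous_rV_coord {R : realType} {d : nat} (k : 'I_d) :
  continuous (fun x : 'rV[R]_d => x 0 k).
Proof. by move=> x; exact: coord_continuous. Qed.

Section vectors_on_probability.
Context {R : realType} {d : nat} {dT : measure_display} {T : measurableType dT}.
Implicit Types (Y Z : T -> 'rV[R]_d).

Lemma measurable_RdB Y Z : measurable_fun setT (Y : T -> Rd R d) ->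
  measurable_fun setT (Z : T -> Rd R d) -> measurable_fun setT ((fun w => Y w - Z w) : T -> Rd R d).
Proof.
move=> mY mZ; apply: measurable_Rd => k.
rewrite [X in measurable_fun _ X](_ : _ = fun w => Y w 0 k - Z w 0 k); last first.
  by apply/funext => w; rewrite !mxE.
by apply: measurable_funB; apply: (measurableT_comp (measurable_coord k)).
Qed.

Lemma measurable_Rd_comp (f : 'rV[R]_d -> R) Y : continuous f ->
  measurable_fun setT (Y : T -> Rd R d) -> measurable_fun setT (fun w => f (Y w)).
Proof. by move=> cf mY; exact: (measurableT_comp (continuous_measurable_Rd cf)). Qed.

Lemma continuous_dot : continuous (fun x : 'rV[R]_d => dot x x).
Proof.
rewrite (_ : (fun x => _) = fun x : 'rV[R]_d => \sum_k x 0 k * x 0 k); last first.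
  by apply/funext => x; rewrite dotE.
apply: continuous_sum => k x.
exact: (@continuousM R 'rV[R]_d _ _ x (@continuous_rV_coord R d k x) (@continuous_rV_coord R d k x)).
Qed.

Lemma measurable_dot Y : measurable_fun setT (Y : T -> Rd R d) ->
  measurable_fun setT (fun w => dot (Y w) (Y w)).
Proof. exact: (measurable_Rd_comp continuous_dot). Qed.

Lemma measurable_normRd Y : measurable_fun setT (Y : T -> Rd R d) ->
  measurable_fun setT (fun w => `|Y w|).
Proof. by apply: measurable_Rd_comp => x; exact: norm_continuous. Qed.

End vectors_on_probability.

Section mckean_vlasov_path.
Context {R : realType} {d : nat} {dT : measure_display} {T : measurableType dT}.

Definition mv_drift (gV gW : 'rV[R]_d -> 'rV[R]_d) (m : R -> probability (Rd R d) R)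
  (s : R) (x : 'rV[R]_d) : 'rV[R]_d := - gV x - vconv gW (m s) x.

(* Pathwise solutions for one fixed realisation of the common noise, which has
   become the deterministic forcing [c]; processes are constant before time 0. *)
Record mv_solution (P : probability T R) (gV gW : 'rV[R]_d -> 'rV[R]_d)
    (LV LW sigma kB : R) (X B : R -> T -> 'rV[R]_d) (c : R -> 'rV[R]_d)
    (m : R -> probability (Rd R d) R) : Prop := MvSolution {
  mv_LV0 : 0 <= LV;
  mv_LW0 : 0 <= LW;
  mv_lipV : sup_lip LV gV;
  mv_lipW : sup_lip LW gW;
  mv_mX : forall t, measurable_fun setT (X t : T -> Rd R d);
  mv_mB : forall t, measurable_fun setT (B t : T -> Rd R d);
  mv_cX : forall w, continuous (fun t => X t w);
  mv_cB : forall w, continuous (fun t => B t w);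
  mv_Xneg : forall t w, t <= 0 -> X t w = X 0 w;
  mv_B0 : forall w, B 0 w = 0;
  mv_momB : forall s t, 0 <= s -> s <= t ->
    mean_le P (fun w => dot (B t w - B s w) (B t w - B s w)) (kB * (t - s));
  mv_law : forall t (C : set (Rd R d)), measurable C -> P (X t @^-1` C) = m t C;
  mv_fm : forall t, finite_moment2 (E := Rd R d) (@eucl_dist R d) (m t);
  mv_Xeq : forall w t k, 0 <= t ->
    (lebesgue_measure.-integrable `[0, t] (fun s => (mv_drift gV gW m s (X s w) 0 k)%:E)) /\
    X t w 0 k = X 0 w 0 k + pint 0 t (fun s => mv_drift gV gW m s (X s w) 0 k)
      + sigma * B t w 0 k + c t 0 k }.

Variable P : probability T R.
Variables (gV gW : 'rV[R]_d -> 'rV[R]_d) (LV LW sigma kB : R).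
Variables (X B : R -> T -> 'rV[R]_d) (c : R -> 'rV[R]_d).
Variable m : R -> probability (Rd R d) R.
Hypothesis sol : mv_solution P gV gW LV LW sigma kB X B c m.

Let LV0 := mv_LV0 sol.
Let LW0 := mv_LW0 sol.
Let lipV := mv_lipV sol.
Let lipW := mv_lipW sol.
Let mX := mv_mX sol.
Let mB := mv_mB sol.
Let cX := mv_cX sol.
Let cB := mv_cB sol.
Let Xneg := mv_Xneg sol.
Let law := mv_law sol.
Let fm := mv_fm sol.
Let Xeq := mv_Xeq sol.
Notation drift := (mv_drift gV gW m).

Let momB t : 0 <= t -> mean_le P (fun w => dot (B t w) (B t w)) (kB * t).
Proof.
move=> t0; have := mv_momB sol (lexx 0) t0; rewrite subr0.
by under eq_fun do rewrite (mv_B0 sol) subr0.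
Qed.

Lemma finite_moment2_dot (mu : probability (Rd R d) R) : finite_moment2 (E := Rd R d) (@eucl_dist R d) mu ->
  exists K, mean_le mu (fun x : Rd R d => dot x x) K.
Proof.
move=> [x0 hx0].
have mdist : measurable_fun setT (fun x : Rd R d => eucl_dist x0 x ^+ 2).
  rewrite (_ : (fun x => _) = fun x : Rd R d => dot (x0 - x) (x0 - x)); last first.
    by apply/funext => x; rewrite sqr_eucl_norm.
  apply: (@measurable_dot _ _ _ (Rd R d) (fun x => x0 - x)).
  by apply: (@measurable_RdB _ _ _ (Rd R d) (fun=> x0) id) => //; exact: measurable_cst.
pose K0 := fine (\int[mu]_x ((eucl_dist x0 x ^+ 2)%:E))%E.
have h : mean_le mu (fun x : Rd R d => eucl_dist x0 x ^+ 2) K0.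
  split => // [w|]; first exact: sqr_ge0.
  rewrite /K0 fineK// ge0_fin_numE//.
  by apply: integral_ge0 => w _; rewrite lee_fin sqr_ge0.
have h2 := mean_leD (mean_leZ (ler0n R 2) (mean_le_cst mu (dot_ge0 x0))) (mean_leZ (ler0n R 2) h).
eexists; apply: mean_leW h2; first exact: (@measurable_dot _ _ _ (Rd R d) id).
move=> x; rewrite dot_ge0/= sqr_eucl_norm.
by have := dotB_le x0 (x0 - x); rewrite opprB addrC subrK.
Qed.

Lemma mv_sqr_moment t : exists K, mean_le P (fun w => dot (X t w) (X t w)) K.
Proof.
have [K [_ _ hK]] := finite_moment2_dot (fm t).
exists K; split; [exact: measurable_dot|by move=> w; exact: dot_ge0|].
rewrite (ge0_integral_law (nu := m t) (f := X t : T -> Rd R d) (g := fun x => (dot x x)%:E))//.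
- exact: law.
- by move=> x; rewrite lee_fin dot_ge0.
- by apply/measurable_EFinP; exact: (@measurable_dot _ _ _ (Rd R d) id).
Qed.

Let cgW k (x : 'rV[R]_d) : continuous (fun y : 'rV[R]_d => gW (x - y) 0 k).
Proof.
apply: (@continuous_compf _ _ _ (fun y : 'rV[R]_d => gW (x - y)) (fun z : 'rV[R]_d => z 0 k)); last exact: continuous_rV_coord.
apply: (@continuous_compf _ _ _ (fun y : 'rV[R]_d => x - y) gW); last exact: sup_lip_continuous lipW.
by move=> y; apply: (@cvgB R 'rV[R]_d 'rV[R]_d (nbhs y) _ (fun=> x) id x y); [exact: cvg_cst|exact: cvg_id].
Qed.

Lemma mv_gW_measurable k x t : measurable_fun setT (fun w => gW (x - X t w) 0 k).
Proof. exact: (measurable_Rd_comp (@cgW k x)). Qed.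

Let gW_le k x y : `|gW (x - y) 0 k| <= `|gW x| + LW * `|y|.
Proof.
apply: le_trans (mx_norm_coord _ _) _.
rewrite -[gW (x - y)](subrK (gW x)) addrC; apply: le_trans (ler_normD _ _) _.
rewrite lerD2l; apply: le_trans (lipW _ _) _.
by rewrite addrC addKr normrN.
Qed.

Let gW_sqr k x y : gW (x - y) 0 k ^+ 2 <= 2 * `|gW x| ^+ 2 + 2 * LW ^+ 2 * `|y| ^+ 2.
Proof.
have h := gW_le k x y; rewrite -real_normK ?num_real//.
have h2 : `|gW (x - y) 0 k| ^+ 2 <= (`|gW x| + LW * `|y|) ^+ 2.
  by rewrite ler_pXn2r ?nnegrE ?addr_ge0 ?mulr_ge0.
apply: le_trans h2 _; have := sqr_ge0 (`|gW x| - LW * `|y|); nra.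
Qed.

Lemma mv_gW_sqr_mean k x t K : mean_le P (fun w => `|X t w| ^+ 2) K ->
  mean_le P (fun w => gW (x - X t w) 0 k ^+ 2) (2 * `|gW x| ^+ 2 + 2 * LW ^+ 2 * K).
Proof.
move=> hK; apply: mean_leW (mean_leD (mean_le_cst P (c := 2 * `|gW x| ^+ 2) _)
    (mean_leZ (c := 2 * LW ^+ 2) _ hK)).
- by apply: measurable_funX; exact: mv_gW_measurable.
- by move=> w; rewrite sqr_ge0 gW_sqr.
- by rewrite mulr_ge0// sqr_ge0.
- by rewrite mulr_ge0// sqr_ge0.
Qed.

Let sqr_mom t : exists K, mean_le P (fun w => `|X t w| ^+ 2) K.
Proof.
have [K hK] := mv_sqr_moment t; exists K; apply: mean_leW hK.
  by apply: measurable_funX; exact: measurable_normRd.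
by move=> w; rewrite sqr_ge0 normr_sqr_le_dot.
Qed.

Lemma mv_gW_integrable k x t : P.-integrable setT (fun w => (gW (x - X t w) 0 k)%:E).
Proof.
have [K hK] := sqr_mom t.
apply: (mean_le_integrable (K := Num.sqrt (2 * `|gW x| ^+ 2 + 2 * LW ^+ 2 * K))).
  exact: mv_gW_measurable.
apply: mean_le_sqrt => //.
  have := mv_gW_sqr_mean k x hK; apply: mean_leW => [|w].
    by apply: measurable_funX; apply: measurableT_comp => //; exact: mv_gW_measurable.
  by rewrite sqr_ge0/= real_normK ?num_real.
by apply: measurableT_comp => //; exact: mv_gW_measurable.
Qed.

Lemma vconvE k x t : vconv gW (m t) x 0 k = \int[P]_w gW (x - X t w) 0 k.
Proof.
rewrite mxE (integral_law (mu := P) (f := X t : T -> Rd R d))//.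
- exact: law.
- exact: (continuous_measurable_Rd (@cgW k x)).
- exact: mv_gW_integrable.
Qed.

Lemma vconv_lip t : sup_lip LW (vconv gW (m t)).
Proof.
move=> x y; apply: mx_norm_le => [|k]; first by rewrite mulr_ge0.
have -> : (vconv gW (m t) x - vconv gW (m t) y) 0 k =
    \int[P]_w (gW (x - X t w) 0 k - gW (y - X t w) 0 k).
  by rewrite RintegralB//; try exact: mv_gW_integrable; rewrite -!vconvE !mxE.
have mD : measurable_fun setT (fun w => gW (x - X t w) 0 k - gW (y - X t w) 0 k).
  by apply: measurable_funB; exact: mv_gW_measurable.
apply: mean_le_norm_Rintegral => //.
apply: mean_leW (mean_le_cst P _); [exact: measurableT_comp| |by rewrite mulr_ge0].
move=> w; rewrite normr_ge0/=.
have := le_trans (mx_norm_coord _ k) (lipW (x - X t w) (y - X t w)).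
by rewrite !mxE opprB addrA subrK.
Qed.

Lemma mv_drift_lip t : sup_lip (LV + LW) (drift t).
Proof.
move=> x y; rewrite /mv_drift.
have -> : - gV x - vconv gW (m t) x - (- gV y - vconv gW (m t) y) =
  - ((gV x - gV y) + (vconv gW (m t) x - vconv gW (m t) y)).
  by apply/rowP => k; rewrite !mxE; ring.
rewrite normrN mulrDl; apply: le_trans (ler_normD _ _) _.
by apply: lerD; [exact: lipV|exact: vconv_lip].
Qed.

Let cnX w p : continuous (fun t => `|X t w - X t p|).
Proof.
move=> t; apply: (@continuous_comp _ _ _ (fun t => X t w - X t p) (fun z => `|z|)); last exact: norm_continuous.
by apply: cvgB; exact: cX.
Qed.

Let cnB w p : continuous (fun t => `|X 0 w - X 0 p| + `|sigma| * (`|B t w| + `|B t p|)).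
Proof.
move=> t; apply: cvgD; first exact: cvg_cst.
by apply: cvgM; [exact: cvg_cst|apply: cvgD; apply: cvg_norm; exact: cB].
Qed.

(** Two outcomes of the same process share the forcing [c] and the law [m], so the difference is
    controlled by the Lipschitz constants alone. *)
Lemma mv_diff_le w p t : 0 <= t -> `|X t w - X t p| <=
  (`|X 0 w - X 0 p| + `|sigma| * (`|B t w| + `|B t p|)) +
  (LV + LW) * pint 0 t (fun s => `|X s w - X s p|).
Proof.
move=> t0; have L0 : 0 <= LV + LW by rewrite addr_ge0.
have I0 : 0 <= pint 0 t (fun s => `|X s w - X s p|) by apply: pint_ge0.
apply: mx_norm_le => [|k]; first by rewrite !addr_ge0// !mulr_ge0// addr_ge0.
have [i1 e1] := Xeq w k t0; have [i2 e2] := Xeq p k t0.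
have -> : (X t w - X t p) 0 k = ((X 0 w - X 0 p) 0 k + sigma * (B t w 0 k - B t p 0 k)) +
   pint 0 t (fun s => drift s (X s w) 0 k - drift s (X s p) 0 k).
  have hD s : (X s w - X s p) 0 k = X s w 0 k - X s p 0 k by rewrite !mxE.
  rewrite /pint RintegralB// -!/(pint 0 t _) !hD e1 e2.
  by set I1 := pint _ _ _; set I2 := pint _ _ _; clearbody I1 I2; ring.
apply: le_trans (ler_normD _ _) _; apply: lerD.
  apply: le_trans (ler_normD _ _) _; apply: lerD; first exact: mx_norm_coord.
  rewrite normrM ler_wpM2l//; apply: le_trans (ler_normB _ _) _.
  by apply: lerD; exact: mx_norm_coord.
have iD : lebesgue_measure.-integrable `[0, t]
    (fun s => (drift s (X s w) 0 k - drift s (X s p) 0 k)%:E).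
  exact: (integrableB _ i1 i2).
apply: le_trans (le_normr_Rintegral _ iD) _ => //.
rewrite /pint -RintegralZl//; last exact: continuous_integrable.
apply: le_Rintegral => //.
- exact: integrable_norm.
- by apply: (@continuous_integrable _ (fun s => (LV + LW) * `|X s w - X s p|)) => x; apply: cvgM; [exact: cvg_cst|exact: cnX].
move=> s _; apply: le_trans (mv_drift_lip s _ _).
by have := mx_norm_coord (drift s (X s w) - drift s (X s p)) k; rewrite !mxE.
Qed.

Lemma continuous_le_segment (f : R -> R) (a b : R) : continuous f ->
  exists2 K, 0 <= K & forall s, a <= s <= b -> f s <= K.
Proof.
move=> cf; have [ab|ba] := leP a b; last first.
  by exists 0 => // s /andP[h1 h2]; have := le_lt_trans (le_trans h1 h2) ba; rewrite ltxx.
have [x _ hx] := EVT_max ab (continuous_subspaceT cf (A := `[a, b])).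
exists (Num.max 0 (f x)); first by rewrite le_max lexx.
by move=> s sab; rewrite le_max hx ?orbT// in_itv.
Qed.

(** Each law has a finite second moment, but nothing bounds it locally uniformly in time. The path
    of a single outcome [p] is continuous, hence bounded on [[0, t]], and the difference of any path
    to it obeys Gronwall's inequality. *)
Lemma mv_sqr_mean_bound t : exists K, forall s, s <= t -> mean_le P (fun w => `|X s w| ^+ 2) K.
Proof.
wlog t0 : t / 0 <= t => [H|].
  have [t0|/ltW t0] := leP 0 t; first exact: H.
  by have [K hK] := H 0 (lexx _); exists K => s st; apply: hK; exact: le_trans t0.
pose p : T := point; pose L := LV + LW.
have L0 : 0 <= L by rewrite addr_ge0.
have mnX s : measurable_fun setT (fun w => `|X s w - X s p|).
  by apply: measurable_normRd; apply: measurable_RdB => //; exact: measurable_cst.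
have cnorm (Y : R -> T -> 'rV[R]_d) w : continuous (fun t => Y t w) -> continuous (fun t => `|Y t w| ^+ 2).
  by move=> cY x; apply: cvgM; apply: cvg_norm; exact: cY.
have [KB KB0 hKB] := continuous_le_segment 0 t (cnorm B p (@cB p)).
have [KX KX0 hKX] := continuous_le_segment 0 t (cnorm X p (@cX p)).
have [K0 hK0] := sqr_mom 0.
pose a s w := `|X 0 w - X 0 p| + `|sigma| * (`|B s w| + `|B s p|).
have ca w : continuous (fun s => 2 * a s w ^+ 2).
  by move=> x; apply: cvgM; [exact: cvg_cst|apply: cvgM; exact: cnB].
have a0 s w : 0 <= a s w by rewrite addr_ge0// mulr_ge0// addr_ge0.
pose Ka := 2 * (3 * (2 * K0 + 2 * KX) + 3 * sigma ^+ 2 * (kB * t) + 3 * sigma ^+ 2 * KB).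
have ma s : 0 <= s <= t -> mean_le P (fun w => 2 * a s w ^+ 2) Ka.
  move=> /andP[s0 st]; apply: mean_leZ => //.
  have kB0 : 0 <= kB by have := mean_le_ge0 (momB ler01); rewrite mulr1.
  have h1 : mean_le P (fun w => `|B s w| ^+ 2) (kB * t).
    apply: mean_le_trans (_ : kB * s <= _) _; first by rewrite ler_wpM2l.
    apply: mean_leW (momB s0); first by apply: measurable_funX; exact: measurable_normRd.
    by move=> w; rewrite sqr_ge0 normr_sqr_le_dot.
  have h2 := mean_leD (mean_leZ (ler0n R 2) hK0) (mean_leZ (ler0n R 2) (mean_le_cst P KX0)).
  have s2 : 0 <= 3 * sigma ^+ 2 by rewrite mulr_ge0// sqr_ge0.
  apply: mean_leW (mean_leD (mean_leD (mean_leZ (ler0n R 3) h2) (mean_leZ s2 h1)) (mean_leZ s2 (mean_le_cst P KB0))).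
    apply: measurable_funX; apply: measurable_funD => //; apply: measurable_funM => //.
    by apply: measurable_funD => //; exact: measurable_normRd.
  move=> w; rewrite sqr_ge0/=.
  have k1 : `|B s p| ^+ 2 <= KB by apply: hKB; rewrite s0.
  have k2 : `|X 0 p| ^+ 2 <= KX by apply: hKX; rewrite lexx.
  have k3 := ler_normB (X 0 w) (X 0 p).
  have k4 : `|X 0 w - X 0 p| ^+ 2 <= 2 * `|X 0 w| ^+ 2 + 2 * KX.
    apply: le_trans (_ : (`|X 0 w| + `|X 0 p|) ^+ 2 <= _); first by rewrite ler_pXn2r ?nnegrE ?addr_ge0.
    have := sqr_ge0 (`|X 0 w| - `|X 0 p|); nra.
  rewrite /a; rewrite -(real_normK (num_real sigma)).
  set u := `|X 0 w - X 0 p| in k4 *; set S := `|sigma|; set v := `|B s w|; set v' := `|B s p| in k1 *.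
  have e : (u + S * (v + v')) ^+ 2 <= 3 * u ^+ 2 + 3 * S ^+ 2 * v ^+ 2 + 3 * S ^+ 2 * v' ^+ 2.
    rewrite -subr_ge0 (_ : _ - _ = (u - S * v) ^+ 2 + (u - S * v') ^+ 2 + (S * v - S * v') ^+ 2); last by ring.
    by rewrite !addr_ge0 ?sqr_ge0.
  apply: le_trans e _; apply: lerD; last by rewrite ler_wpM2l// mulr_ge0// sqr_ge0.
  by rewrite lerD2r; lra.
(* Squaring before Gronwall keeps the bound linear in second moments; the weight 1 is the form
   expected by [mean_le_pint]. *)
have key s w : 0 <= s <= t -> `|X s w - X s p| ^+ 2 <= 2 * a s w ^+ 2 +
    2 * L ^+ 2 * t * expR (2 * L ^+ 2 * t * t) * pint 0 s (fun r => 1 * (2 * a r w ^+ 2)).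
  move=> /andP[s0 st]; have L2 : 0 <= 2 * L ^+ 2 * t by rewrite !mulr_ge0.
  have cf2 : continuous (fun r => `|X r w - X r p| ^+ 2) by move=> x; apply: cvgM; exact: cnX.
  have := @gronwall R (fun r => `|X r w - X r p| ^+ 2) (fun r => 2 * a r w ^+ 2) 0 s (2 * L ^+ 2 * t) s0 L2 cf2 (ca w) _ _.
  under [pint 0 s (fun r => 1 * _)]eq_Rintegral do rewrite mul1r.
  move=> h; apply: le_trans (h _ _) _ => [r _|r /andP[r0 rs]|].
  - by rewrite mulr_ge0// sqr_ge0.
  - have := mv_diff_le w p r0; rewrite -/(a r w) -/L; set I := pint 0 r _ => hI.
    have I0 : 0 <= I by exact: pint_ge0.
    have hI2 : I ^+ 2 <= t * pint 0 r (fun r => `|X r w - X r p| ^+ 2).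
      have := pint_sqr_le (@cnX w p) r0; rewrite subr0 => /le_trans; apply.
      rewrite ler_wpM2r ?(le_trans rs)//; apply: pint_ge0 => q _; exact: sqr_ge0.
    apply: le_trans (_ : (a r w + L * I) ^+ 2 <= _).
      by rewrite ler_pXn2r ?nnegrE// addr_ge0// mulr_ge0.
    apply: le_trans (_ : 2 * a r w ^+ 2 + 2 * L ^+ 2 * I ^+ 2 <= _).
      by have := sqr_ge0 (a r w - L * I); nra.
    by rewrite lerD2l -!mulrA !ler_wpM2l// sqr_ge0.
  - rewrite lerD2l subr0; apply: ler_wpM2r; first by apply: pint_ge0 => r _; rewrite mulr_ge0// sqr_ge0.
    by rewrite ler_wpM2l// ler_expR ler_wpM2l.
set G := 2 * L ^+ 2 * t * expR (2 * L ^+ 2 * t * t) in key.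
have G0 : 0 <= G by rewrite !mulr_ge0// expR_ge0.
exists (2 * (Ka + G * (Ka * t)) + 2 * KX).
have H s : 0 <= s <= t -> mean_le P (fun w => `|X s w| ^+ 2) (2 * (Ka + G * (Ka * t)) + 2 * KX).
  move=> /andP[s0 st].
  have Ka0 : 0 <= Ka by apply: (mean_le_ge0 (ma s _)); rewrite s0.
  have h1 : mean_le P (fun w => pint 0 s (fun r => 1 * (2 * a r w ^+ 2))) (Ka * t).
    have c1 : continuous (fun _ : R => 1 : R) by move=> x; exact: cvg_cst.
    apply: mean_le_trans (mean_le_pint s0 c1 (fun=> ler01) ca _); last first.
      by move=> r /andP[r0 rs]; apply: ma; rewrite r0 (le_trans rs).
    by rewrite ler_wpM2l// /pint Rintegral_cst//= lebesgue_measure_itv/= lte_fin; case: ifP => //=; lra.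
  have h2 : mean_le P (fun w => `|X s w - X s p| ^+ 2) (Ka + G * (Ka * t)).
    apply: mean_leW (mean_leD (ma s _) (mean_leZ G0 h1)); last by rewrite s0.
      exact: measurable_funX.
    by move=> w; rewrite sqr_ge0/= key// s0.
  apply: mean_leW (mean_leD (mean_leZ (ler0n R 2) h2) (mean_leZ (ler0n R 2) (mean_le_cst P KX0))).
    by apply: measurable_funX; exact: measurable_normRd.
  move=> w; rewrite sqr_ge0/=; have k2 : `|X s p| ^+ 2 <= KX by apply: hKX; rewrite s0.
  have := ler_normD (X s w - X s p) (X s p); rewrite subrK => k3.
  apply: le_trans (_ : (`|X s w - X s p| + `|X s p|) ^+ 2 <= _); first by rewrite ler_pXn2r ?nnegrE ?addr_ge0.
  have := sqr_ge0 (`|X s w - X s p| - `|X s p|); nra.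
move=> s st; have [s0|/ltW s0] := leP 0 s; first by apply: H; rewrite s0.
by rewrite (_ : (fun w => _) = fun w => `|X 0 w| ^+ 2); [apply: H; rewrite lexx|apply/funext => w; rewrite Xneg].
Qed.

Lemma vconv_continuous x k : continuous (fun t => vconv gW (m t) x 0 k).
Proof.
move=> r; have [K hK] := mv_sqr_mean_bound (r + 1).
rewrite (_ : (fun t => _) = fun t => \int[P]_w gW (x - X t w) 0 k); last by apply/funext => t; exact: vconvE.
apply: (@mean_continuous _ _ _ P (fun t w => gW (x - X t w) 0 k) r (2 * `|gW x| ^+ 2 + 2 * LW ^+ 2 * K)).
- move=> s rs; apply: mv_gW_sqr_mean; apply: hK.
  by move: rs; rewrite ltr_norml => /andP[_]; lra.
- by move=> s; exact: mv_gW_measurable.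
- move=> w; apply: (@continuous_comp _ _ _ (fun t => X t w) (fun y => gW (x - y) 0 k)); [exact: cX|exact: cgW].
Qed.

(** The variation of the convolution is split into a change of point, Lipschitz uniformly in time,
    and a change of law at the fixed point [x r]. *)
Lemma mv_drift_continuous (x : R -> 'rV[R]_d) k : continuous x ->
  continuous (fun s => drift s (x s) 0 k).
Proof.
move=> cx r.
rewrite (_ : (fun s => _) = fun s => - gV (x s) 0 k - vconv gW (m s) (x s) 0 k); last by apply/funext => s; rewrite !mxE.
apply: cvgB.
  apply: cvgN; apply: (@continuous_compf _ _ _ (fun s => gV (x s)) (fun z : 'rV[R]_d => z 0 k)); last exact: continuous_rV_coord.
  by apply: continuous_compf => //; exact: sup_lip_continuous lipV.
rewrite (_ : (fun s => _) = fun s => (vconv gW (m s) (x s) 0 k - vconv gW (m s) (x r) 0 k) + vconv gW (m s) (x r) 0 k); last by apply/funext => s; rewrite subrK.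
rewrite -[X in _ --> X]add0r; apply: cvgD; last exact: vconv_continuous.
apply/(@cvgrPdist_le _ R^o) => e e0.
have L1 : 0 < LW + 1 by rewrite ltr_wpDl.
have /(@cvgrPdist_le _ 'rV[R]_d) /(_ _ (divr_gt0 e0 L1)) := cx r.
apply: filterS => s hs; rewrite sub0r normrN.
have := le_trans (mx_norm_coord _ k) (vconv_lip s (x s) (x r)); rewrite !mxE => /le_trans; apply.
apply: le_trans (_ : (LW + 1) * (e / (LW + 1)) <= _); last by rewrite mulrC divfK// gt_eqF.
by rewrite ler_pM// ?lerDl// distrC.
Qed.

End mckean_vlasov_path.

Lemma dotBB {R : realType} {d : nat} (x y : 'rV[R]_d) :
  dot (x - y) (x - y) = dot x x - 2 * dot x y + dot y y.
Proof. by rewrite dotBl !dotBr (dotC y x); ring. Qed.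

Lemma dotDD {R : realType} {d : nat} (x y : 'rV[R]_d) :
  dot (x + y) (x + y) = dot x x + 2 * dot x y + dot y y.
Proof. by rewrite dotDl !dotDr (dotC y x); ring. Qed.

Lemma pint_split {R : realType} (f : R -> R) (o a b : R) : continuous f -> o <= a -> a <= b ->
  pint o b f = pint o a f + pint a b f.
Proof.
move=> cf oa ab.
(* One inequality for [e f]; the values [e = 1] and [e = -1] give both directions. *)
have aux (e : R) : pint o b (fun s => e * f s) - pint a b (fun s => e * f s) <=
    pint o a (fun s => e * f s).
  have cef : continuous (fun s => e * f s) by move=> x; apply: cvgM; [exact: cvg_cst|exact: cf].
  have := @derive_nincr R (fun t => pint o t (fun s => e * f s) - pint a t (fun s => e * f s))
    (fun x => e * f x - e * f x) a b ab.
  rewrite pint0 subr0; apply => [x /andP[ax _]|x _|]; first exact: is_derive1B (pint_derive cef (le_lt_trans oa ax)) (pint_derive cef ax).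
    by rewrite subrr.
  apply: within_continuousB; last exact: pint_continuous.
  by apply: continuous_subspaceW (pint_continuous cef (le_trans oa ab)); apply: subset_itvr; rewrite bnd_simp.
have := aux 1; have := aux (-1).
have E1 x y : pint x y (fun s => -1 * f s) = - pint x y f.
  by rewrite -pintN//; apply: eq_Rintegral => s _; rewrite mulN1r.
have E2 x y : pint x y (fun s => 1 * f s) = pint x y f.
  by apply: eq_Rintegral => s _; rewrite mul1r.
by rewrite !E1 !E2; lra.
Qed.

Section sum_integral.
Context {R : realType} {dT : measure_display} {T : measurableType dT}.
Variable P : probability T R.

Lemma integrable_sumZ (I : finType) (f : I -> T -> R) (a : I -> R) :
  (forall k, P.-integrable setT (fun w => (f k w)%:E)) ->
  P.-integrable setT (fun w => (\sum_k f k w * a k)%:E).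
Proof.
move=> fi; rewrite (_ : (fun w => _) = (fun w => \sum_k ((f k w)%:E * (a k)%:E))%E); last first.
  by apply/funext => w; rewrite -sumEFin.
by apply: integrable_sum => // k _; exact: integrableZr.
Qed.

Lemma Rintegral_sumZ (I : finType) (f : I -> T -> R) (a : I -> R) :
  (forall k, P.-integrable setT (fun w => (f k w)%:E)) ->
  \int[P]_w (\sum_k f k w * a k) = \sum_k (\int[P]_w f k w) * a k.
Proof.
move=> fi.
have ik k : P.-integrable setT (fun w => (f k w * a k)%:E).
  by under eq_fun do rewrite EFinM; exact: integrableZr.
have -> : \int[P]_w (\sum_k f k w * a k) = \sum_k \int[P]_w (f k w * a k).
  rewrite /Rintegral.
  under eq_integral do rewrite -sumEFin.
  by rewrite integral_sum// -sum_fine// => k _; apply: integrable_fin_num.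
by apply: eq_bigr => k _; rewrite RintegralZr//; exact: fi.
Qed.

Lemma mean_le_Rintegral (g h : T -> R) (K : R) : P.-integrable setT (EFin \o g) ->
  (forall w, g w <= h w) -> mean_le P h K -> \int[P]_w g w <= K.
Proof.
move=> gi gh hK; have [mh h0 hle] := hK.
have hi : P.-integrable setT (EFin \o h).
  apply: (mean_le_integrable (K := K)) => //.
  by rewrite (_ : (fun w => _) = h)//; apply/funext => w; rewrite ger0_norm.
apply: le_trans (le_Rintegral _ gi hi (fun w _ => gh w)) _ => //.
by rewrite -lee_fin fineK// integrable_fin_num.
Qed.

End sum_integral.

(** * Adaptedness and monotonicity for a frozen common noise *)

Section measurable_flow.
Context {R : realType} {d : nat} {dT : measure_display} {T : measurableType dT}.
Variable P : probability T R.
Variables (gV gW : 'rV[R]_d -> 'rV[R]_d) (LV LW sigma kB : R).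
Variables (X B : R -> T -> 'rV[R]_d) (c : R -> 'rV[R]_d).
Variable m : R -> probability (Rd R d) R.
Hypothesis sol : mv_solution P gV gW LV LW sigma kB X B c m.

(** The forcing [c] and the law [m] are deterministic, so every Euler step depends on the initial
    value and grid increments only; the limit inherits measurability. *)
Lemma mv_measurable_wrt (G : set (set T)) (t : R) : sigma_algebra setT G -> 0 < t ->
  measurable_wrt G (X 0 : T -> Rd R d) ->
  (forall n k l, (k < n)%N -> forall C : set R, measurable C ->
    G ((fun w => B (k.+1%:R * (t / n%:R)) w 0 l - B (k%:R * (t / n%:R)) w 0 l) @^-1` C)) ->
  measurable_wrt G (X t : T -> Rd R d).
Proof.
move=> sG t0 GX0 GB.
pose TG := g_sigma_algebraType G.
have mX0 : measurable_fun (setT : set TG) (X 0 : TG -> Rd R d) by apply/measurable_wrtP.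
have mBk n k l : (k < n)%N -> measurable_fun (setT : set TG)
    (fun w : TG => B (k.+1%:R * (t / n%:R)) w 0 l - B (k%:R * (t / n%:R)) w 0 l).
  by move=> kn _ C mC; rewrite setTI; apply: sub_sigma_algebra; exact: GB.
pose z w s := sigma *: B s w + c s.
pose drift := mv_drift gV gW m.
pose Z n (w : T) := euler drift (t / n%:R) (X 0 w)
    (fun k => z w (k.+1%:R * (t / n%:R)) - z w (k%:R * (t / n%:R))).
have cdrift s k : continuous (fun x => drift s x 0 k).
  have L0 : sup_lip (LV + LW) (drift s) by exact: (mv_drift_lip sol).
  by apply: (@continuous_compf _ _ _ (drift s) (fun z : 'rV[R]_d => z 0 k)); [exact: sup_lip_continuous L0|exact: continuous_rV_coord].
have mZ n k : (k <= n)%N -> measurable_fun (setT : set TG) ((fun w => Z n w k) : TG -> Rd R d).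
  elim: k => [|k IH] kn; first exact: mX0.
  have mk := IH (ltnW kn).
  apply: measurable_Rd => l.
  rewrite [X in measurable_fun _ X](_ : _ = fun w : TG => (Z n w k 0 l + (t / n%:R) * drift (k%:R * (t / n%:R)) (Z n w k) 0 l) +
    (sigma * (B (k.+1%:R * (t / n%:R)) w 0 l - B (k%:R * (t / n%:R)) w 0 l) + (c (k.+1%:R * (t / n%:R)) 0 l - c (k%:R * (t / n%:R)) 0 l))); last first.
    by apply/funext => w; rewrite /Z /= /z !mxE; ring.
  apply: measurable_funD; apply: measurable_funD.
  - exact: (measurableT_comp (measurable_coord l) mk).
  - apply: measurable_funM => //.
    exact: (measurableT_comp (continuous_measurable_Rd (cdrift (k%:R * (t / n%:R)) l)) mk).
  - by apply: measurable_funM => //; exact: mBk.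
  - by [].
apply/measurable_wrtP => //.
apply: measurable_Rd => l.
apply: (@measurable_fun_cvg _ TG R setT (fun n w => Z n w n 0 l)).
  by move=> n; exact: (measurableT_comp (measurable_coord l) (mZ n n (leqnn n))).
move=> w _.
have : Z n w n @[n --> \oo] --> X t w.
  apply: (@euler_cvg R d drift (LV + LW) t (fun s => X s w) (z w)) => //.
  - by rewrite addr_ge0 ?(mv_LV0 sol) ?(mv_LW0 sol).
  - by move=> s u v _; exact: (mv_drift_lip sol).
  - by move=> k; apply: (mv_drift_continuous sol); exact: (mv_cX sol).
  - move=> s k s0; rewrite ((mv_Xeq sol w k s0).2) /z mxE.
    by rewrite [in RHS]mxE addrA.
by move=> h; exact: (cvg_comp _ _ h (@continuous_rV_coord R d l (X t w))).
Qed.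

(** Averaging preserves monotonicity, as both points are shifted by the same [X t w]. *)
Lemma vconv_monotone t : (forall x y, 0 <= dot (gW x - gW y) (x - y)) ->
  forall x y, 0 <= dot (vconv gW (m t) x - vconv gW (m t) y) (x - y).
Proof.
move=> gWmon x y.
pose f k w := gW (x - X t w) 0 k - gW (y - X t w) 0 k.
have fi k : P.-integrable setT (fun w => (f k w)%:E).
  exact: (integrableB _ (mv_gW_integrable sol k x t) (mv_gW_integrable sol k y t)).
have -> : dot (vconv gW (m t) x - vconv gW (m t) y) (x - y) =
    \int[P]_w (\sum_k f k w * (x - y) 0 k).
  rewrite dotE.
  rewrite (Rintegral_sumZ (fun k => (x - y) 0 k) fi); apply: eq_bigr => k _.
  congr (_ * _); rewrite /f RintegralB//; try exact: (mv_gW_integrable sol).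
  by rewrite -!(vconvE sol) !mxE.
apply: Rintegral_ge0 => w _.
have := gWmon (x - X t w) (y - X t w); rewrite dotE opprB addrA subrK.
by under eq_bigr do rewrite !mxE; under [in X in _ -> X]eq_bigr do rewrite !mxE.
Qed.

End measurable_flow.

(** * Bounds uniform in time for the difference of two copies *)

Section difference_bound.
Context {R : realType} {d : nat} {dT : measure_display} {T : measurableType dT}.
Variable P : probability T R.
Variables (gV gW : 'rV[R]_d -> 'rV[R]_d) (LV LW sigma kB beta : R).
Variables (X1 B1 X2 B2 : R -> T -> 'rV[R]_d) (c : R -> 'rV[R]_d).
Variable m : R -> probability (Rd R d) R.
Hypothesis sol1 : mv_solution P gV gW LV LW sigma kB X1 B1 c m.
Hypothesis sol2 : mv_solution P gV gW LV LW sigma kB X2 B2 c m.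
Hypothesis beta0 : 0 < beta.
Hypothesis gVmon : forall x y, beta * dot (x - y) (x - y) <= dot (gV x - gV y) (x - y).
Hypothesis gWmon : forall x y, 0 <= dot (gW x - gW y) (x - y).

Let D t w := X1 t w - X2 t w.
Let b w := fun s => B1 s w - B2 s w.
(** [Lb] is the squared Lipschitz constant of the drift in Euclidean norm, with [+ 1] to allow
    division. [C] collects the errors of [mv_step_path]. [U] bounds the mean square of
    [sigma (b s - b s0)] over at most unit time: two motions and the inequality for the square of a
    difference give the 4. *)
Let Lb : R := d%:R * (LV + LW) ^+ 2 + 1.
Let C : R := 2 * Lb / beta + 3 * beta.
Let U : R := 4 * sigma ^+ 2 * kB.

Lemma mv_drift_monotone t x y : dot (mv_drift gV gW m t x - mv_drift gV gW m t y) (x - y) <=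
  - beta * dot (x - y) (x - y).
Proof.
have -> : mv_drift gV gW m t x - mv_drift gV gW m t y = - ((gV x - gV y) + (vconv gW (m t) x - vconv gW (m t) y)).
  by rewrite /mv_drift; apply/rowP => k; rewrite !mxE; ring.
rewrite dotNl dotDl mulNr lerN2.
by have := gVmon x y; have := vconv_monotone sol1 t gWmon x y; lra.
Qed.

Lemma mv_drift_dot_lip t x y :
  dot (mv_drift gV gW m t x - mv_drift gV gW m t y) (mv_drift gV gW m t x - mv_drift gV gW m t y) <=
  Lb * dot (x - y) (x - y).
Proof.
apply: le_trans (dot_le_normr_sqr _) _.
have h := mv_drift_lip sol1 t x y; have L0 : 0 <= LV + LW by rewrite addr_ge0 ?(mv_LV0 sol1) ?(mv_LW0 sol1).
have h2 : `|mv_drift gV gW m t x - mv_drift gV gW m t y| ^+ 2 <= (LV + LW) ^+ 2 * dot (x - y) (x - y).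
  apply: le_trans (_ : ((LV + LW) * `|x - y|) ^+ 2 <= _).
    by rewrite ler_pXn2r ?nnegrE// mulr_ge0.
  by rewrite exprMn ler_wpM2l ?sqr_ge0// normr_sqr_le_dot.
apply: le_trans (_ : d%:R * ((LV + LW) ^+ 2 * dot (x - y) (x - y)) <= _); first by rewrite ler_wpM2l.
by rewrite mulrA ler_wpM2r ?dot_ge0// lerDl.
Qed.

Let cb w : continuous (b w).
Proof. by move=> s; apply: cvgB; [exact: (mv_cB sol1)|exact: (mv_cB sol2)]. Qed.

(** Write [u] for the noise increment and [G] for the drift difference. The dissipation
    [- 2 beta |D|^2] pays [beta / 2 |D|^2] for the cross term of [u] with [G], at the cost
    [(2 Lb / beta) |u|^2]. The remaining [3 / 2 beta |D|^2] dominates [beta |D - u|^2] up to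
    [3 beta |u|^2]. *)
Lemma mv_step_path w s0 t : 0 <= s0 -> s0 <= t ->
  expR (beta * (t - s0)) *
    dot (D t w - sigma *: (b w t - b w s0)) (D t w - sigma *: (b w t - b w s0)) <=
  dot (D s0 w) (D s0 w) + pint s0 t (fun s => expR (beta * (s - s0)) *
     (C * dot (sigma *: (b w s - b w s0)) (sigma *: (b w s - b w s0)))).
Proof.
move=> s00 s0t.
pose g k s := mv_drift gV gW m s (X1 s w) 0 k - mv_drift gV gW m s (X2 s w) 0 k.
pose u s := sigma *: (b w s - b w s0).
pose r k s := (D s w - u s) 0 k.
have cg k : continuous (g k).
  move=> s; apply: cvgB.
    by apply: (mv_drift_continuous sol1); exact: (mv_cX sol1).
  by apply: (mv_drift_continuous sol1); exact: (mv_cX sol2).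
have cu : continuous u.
  by move=> s; apply: cvgZr; apply: cvgB; [exact: cb|exact: cvg_cst].
have us0 : u s0 = 0 by rewrite /u subrr scaler0.
have DE s k : 0 <= s -> D s w 0 k = D 0 w 0 k + pint 0 s (g k) + sigma * b w s 0 k.
  move=> s_ge0; have [i1 e1] := mv_Xeq sol1 w k s_ge0; have [i2 e2] := mv_Xeq sol2 w k s_ge0.
  have hD q : D q w 0 k = X1 q w 0 k - X2 q w 0 k by rewrite !mxE.
  have hb : b w s 0 k = B1 s w 0 k - B2 s w 0 k by rewrite !mxE.
  rewrite !hD hb e1 e2 /g /pint RintegralB// -!/(pint 0 s _).
  by set I1 := pint _ _ _; set I2 := pint _ _ _; clearbody I1 I2; ring.
have rE k s : s0 <= s <= t -> r k s = r k s0 + pint s0 s (g k).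
  move=> /andP[s0s st]; have s_ge0 := le_trans s00 s0s.
  have hr q : r k q = D q w 0 k - sigma * (b w q 0 k - b w s0 0 k) by rewrite /r /u !mxE.
  rewrite !hr (DE s)// (DE s0)// (pint_split (@cg k) s00 s0s).
  by set I1 := pint _ _ _; set I2 := pint _ _ _; clearbody I1 I2; ring.
have rdot s : \sum_k r k s * r k s = dot (D s w - u s) (D s w - u s) by rewrite dotE.
have cF : continuous (fun s => C * dot (u s) (u s)).
  move=> s; apply: cvgM; first exact: cvg_cst.
  by apply: (@continuous_compf _ _ _ u (fun x => dot x x)) => //; exact: continuous_dot.
have := @energy_bound R 'I_d r g s0 t s0t cg rE beta (fun s => C * dot (u s) (u s)) cF.
rewrite !rdot us0 subr0; apply => s /andP[s0s st]; rewrite rdot.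
pose G := mv_drift gV gW m s (X1 s w) - mv_drift gV gW m s (X2 s w).
have -> : \sum_k r k s * g k s = dot (D s w) G - dot (u s) G.
  by rewrite -dotBl dotE; apply: eq_bigr => k _; rewrite /r /g !mxE.
have h1 : dot (D s w) G <= - beta * dot (D s w) (D s w) by rewrite dotC; exact: mv_drift_monotone.
have h2 : dot G G <= Lb * dot (D s w) (D s w) by exact: mv_drift_dot_lip.
have Lb0 : 0 < Lb by rewrite ltr_wpDl// mulr_ge0// sqr_ge0.
have h3 : - (2 * dot (u s) G) <= 2 * Lb / beta * dot (u s) (u s) + beta / (2 * Lb) * dot G G.
  have c0 : 0 < 2 * Lb / beta by rewrite divr_gt0// mulr_gt0.
  have := dot_le_amgm (- u s) G c0; rewrite dotNl dotN2 invf_div => h; lra.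
have h4 : beta / (2 * Lb) * dot G G <= beta / 2 * dot (D s w) (D s w).
  have -> : beta / 2 * dot (D s w) (D s w) = beta / (2 * Lb) * (Lb * dot (D s w) (D s w)).
    by field; rewrite gt_eqF.
  by rewrite ler_wpM2l// divr_ge0 ?mulr_ge0// ltW.
have h5 : dot (D s w - u s) (D s w - u s) <= 3 / 2 * dot (D s w) (D s w) + 3 * dot (u s) (u s).
  have := dot_le_amgm (D s w) (- u s) (c := 1 / 2) _; rewrite divr_gt0// => /(_ isT).
  rewrite dotNr dotN2 (dotBB (D s w) (u s)) invf_div divr1; lra.
have hC : C * dot (u s) (u s) = 2 * Lb / beta * dot (u s) (u s) + 3 * beta * dot (u s) (u s).
  by rewrite /C mulrDl.
rewrite hC; have := dot_ge0 (D s w); have := dot_ge0 (u s); move: h1 h2 h3 h4 h5.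
set dd := dot (D s w) (D s w); set uu := dot (u s) (u s); set rr := dot (D s w - u s) (D s w - u s).
set x1 := dot (D s w) G; set x2 := dot (u s) G; set gg := dot G G => h1 h2 h3 h4 h5 uu0 dd0.
have h6 : beta * rr <= beta * (3 / 2 * dd + 3 * uu) by rewrite ler_wpM2l// ltW.
by move: h1 h3 h4 h6; set q := 2 * Lb / beta * uu; lra.
Qed.

Let mD t : measurable_fun setT (D t : T -> Rd R d).
Proof. by apply: measurable_RdB; [exact: (mv_mX sol1)|exact: (mv_mX sol2)]. Qed.

Let kB0 : 0 <= kB.
Proof. by have := mean_le_ge0 (mv_momB sol1 (lexx 0) ler01); rewrite subr0 mulr1. Qed.

Let Lb0 : 0 < Lb.
Proof. by rewrite ltr_wpDl// mulr_ge0// sqr_ge0. Qed.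

Let C0 : 0 <= C.
Proof. by rewrite addr_ge0 ?divr_ge0 ?mulr_ge0// ltW. Qed.

Let U0 : 0 <= U.
Proof. by apply: mulr_ge0 => //; rewrite mulr_ge0// sqr_ge0. Qed.

Let cdot (u : R -> 'rV[R]_d) : continuous u -> continuous (fun s => dot (u s) (u s)).
Proof. by move=> cu; apply: (@continuous_compf _ _ _ u (fun x => dot x x)) => //; exact: continuous_dot. Qed.

Let u s0 s w := sigma *: (b w s - b w s0).

Let mu s0 s : measurable_fun setT (u s0 s : T -> Rd R d).
Proof.
apply: measurable_Rd => k.
rewrite [X in measurable_fun _ X](_ : _ = fun w => sigma * ((B1 s w 0 k - B2 s w 0 k) - (B1 s0 w 0 k - B2 s0 w 0 k))); last first.
  by apply/funext => w; rewrite /u /b !mxE.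
have m1 q : measurable_fun setT (fun w => B1 q w 0 k) by exact: (measurableT_comp (measurable_coord k) (mv_mB sol1 q)).
have m2 q : measurable_fun setT (fun w => B2 q w 0 k) by exact: (measurableT_comp (measurable_coord k) (mv_mB sol2 q)).
by apply: measurable_funM => //; apply: measurable_funB; apply: measurable_funB.
Qed.

Let mean_u s0 s : 0 <= s0 -> s0 <= s -> s <= s0 + 1 ->
  mean_le P (fun w => dot (u s0 s w) (u s0 s w)) U.
Proof.
move=> s00 s0s s1.
have h := mean_leD (mv_momB sol1 s00 s0s) (mv_momB sol2 s00 s0s).
have s2 : 0 <= 2 * sigma ^+ 2 by rewrite mulr_ge0// sqr_ge0.
apply: mean_le_trans (mean_leW _ _ (mean_leZ s2 h)).
- rewrite /U; have : kB * (s - s0) <= kB * 1 by rewrite ler_wpM2l//; lra.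
  by have := sqr_ge0 sigma; nra.
- exact: measurable_dot.
move=> w; rewrite dot_ge0/=.
have -> : u s0 s w = sigma *: ((B1 s w - B1 s0 w) - (B2 s w - B2 s0 w)).
  by rewrite /u /b; apply/rowP => k; rewrite !mxE; ring.
rewrite dotZl dotZr mulrA -expr2.
have := dotB_le (B1 s w - B1 s0 w) (B2 s w - B2 s0 w); have := sqr_ge0 sigma; nra.
Qed.

(** The step has length at most one, so the integral of the exponential is at most its final value,
    which the decay factor cancels. The weight [eta] separates [D - u] from the noise increment
    [u]. *)
Lemma mv_step_mean s0 t K eta : 0 <= s0 -> s0 <= t -> t <= s0 + 1 -> 0 < eta ->
  mean_le P (fun w => dot (D s0 w) (D s0 w)) K ->
  mean_le P (fun w => dot (D t w) (D t w))
    ((1 + eta) * (expR (- beta * (t - s0)) * K + C * U) + (1 + eta^-1) * U).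
Proof.
move=> s00 s0t ts1 eta0 hK; have eV0 : 0 < eta^-1 by rewrite invr_gt0.
have h1 : mean_le P (fun w => pint s0 t (fun s => expR (beta * (s - s0)) * (C * dot (u s0 s w) (u s0 s w))))
    (C * U * pint s0 t (fun s => expR (beta * (s - s0)))).
  apply: mean_le_pint => //.
  - exact: continuous_expRM.
  - move=> w x; apply: cvgM; first exact: cvg_cst.
    apply: cdot => y; apply: cvgZr; apply: cvgB; [exact: cb|exact: cvg_cst].
  - move=> s /andP[s0s st]; apply: mean_leZ => //; apply: mean_u => //; exact: le_trans ts1.
have I1 : pint s0 t (fun s => expR (beta * (s - s0))) <= expR (beta * (t - s0)).
  apply: le_trans (_ : pint s0 t (fun=> expR (beta * (t - s0))) <= _).
    apply: le_pint; [exact: continuous_expRM|by move=> x; exact: cvg_cst|].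
    by move=> s /andP[_ st]; rewrite ler_expR ler_wpM2l ?(ltW beta0)// lerD2r.
  have e0 := expR_ge0 (beta * (t - s0)).
  rewrite /pint Rintegral_cst//= lebesgue_measure_itv/= lte_fin; case: ifP => _ /=; last by rewrite mulr0.
  by rewrite ler_piMr//; lra.
have h2 := mean_leZ (expR_ge0 (- beta * (t - s0))) (mean_leD hK h1).
have h3 : mean_le P (fun w => dot (D t w - u s0 t w) (D t w - u s0 t w)) (expR (- beta * (t - s0)) * K + C * U).
  apply: mean_le_trans (mean_leW _ _ h2).
  - rewrite mulrDr lerD2l.
    apply: le_trans (_ : expR (- beta * (t - s0)) * (C * U * expR (beta * (t - s0))) <= _).
      by rewrite ler_wpM2l ?expR_ge0// ler_wpM2l// mulr_ge0.
    by rewrite mulrCA -expRD mulNr addNr expR0 mulr1.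
  - by apply: measurable_dot; apply: measurable_RdB.
  move=> w; rewrite dot_ge0/= mulNr expRN -ler_pdivrMl ?invr_gt0 ?expR_gt0// invrK.
  exact: mv_step_path.
have e1 : 0 <= 1 + eta by rewrite addr_ge0// ltW.
have e2 : 0 <= 1 + eta^-1 by rewrite addr_ge0// ltW.
apply: mean_leW (mean_leD (mean_leZ e1 h3) (mean_leZ e2 (mean_u s00 s0t ts1))).
  exact: measurable_dot.
move=> w; rewrite dot_ge0/=; set x := D t w - u s0 t w; set v := u s0 t w.
have -> : D t w = x + v by rewrite subrK.
have := dot_le_amgm x v eta0; have -> : dot (x + v) (x + v) = dot x x + 2 * dot x v + dot v v.
  exact: dotDD.
by rewrite !mulrDl !mul1r; lra.
Qed.

(** With [eta = expR (beta / 2) - 1], a full unit step maps a bound [K] to [rho K + K1], where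
    [rho = expR (- beta / 2)] and [K1] is the numerator here; the geometric series sums to
    [K1 / (1 - rho)]. *)
Definition mv_diff_const : R :=
  (expR (beta / 2) * (2 * (d%:R * (LV + LW) ^+ 2 + 1) / beta + 3 * beta) * (4 * sigma ^+ 2 * kB)
   + (1 + (expR (beta / 2) - 1)^-1) * (4 * sigma ^+ 2 * kB)) / (1 - expR (- beta / 2)).

(** Induction over unit intervals: the bound [M] is stable, since [rho M + K1 <= M]. The factor
    [expR (beta / 2)] in front of [K] covers a first step shorter than one, whose decay may not
    compensate [1 + eta]. *)
Lemma mv_diff_mean_le t K : 0 <= t -> mean_le P (fun w => dot (D 0 w) (D 0 w)) K ->
  mean_le P (fun w => dot (D t w) (D t w))
    (expR (beta / 2) * K + mv_diff_const).
Proof.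
rewrite /mv_diff_const -[2 * _ / beta + _]/C -[4 * _ * _]/U.
move=> t0 hK; have K0 := mean_le_ge0 hK.
pose eta := expR (beta / 2) - 1.
have eta0 : 0 < eta by rewrite subr_gt0 -expR0 ltr_expR divr_gt0.
pose K1 := expR (beta / 2) * C * U + (1 + eta^-1) * U.
have K10 : 0 <= K1.
  apply: addr_ge0; apply: mulr_ge0 => //; first by rewrite mulr_ge0 ?expR_ge0.
  by rewrite addr_ge0// invr_ge0 ltW.
pose rho := expR (- beta / 2).
have rho0 : 0 < rho by exact: expR_gt0.
have rho1 : rho < 1 by rewrite -expR0 ltr_expR ltr_pdivrMr// mul0r oppr_lt0.
pose M := expR (beta / 2) * K + K1 / (1 - rho).
rewrite -/eta -/K1 -/rho -/M.
have ee : 1 + eta = expR (beta / 2) by rewrite /eta addrC subrK.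
have step s0 t' K' : 0 <= s0 -> s0 <= t' -> t' <= s0 + 1 ->
    mean_le P (fun w => dot (D s0 w) (D s0 w)) K' ->
    mean_le P (fun w => dot (D t' w) (D t' w)) (expR (beta / 2) * (expR (- beta * (t' - s0)) * K') + K1).
  move=> h1 h2 h3 h4; have := mv_step_mean h1 h2 h3 eta0 h4.
  by rewrite ee /K1 mulrDr !mulrA addrA.
have KM : K1 <= K1 / (1 - rho) by rewrite ler_pdivlMr ?subr_gt0// ler_piMr// gerBl ltW.
have M0 : 0 <= M.
  by apply: addr_ge0; [rewrite mulr_ge0// expR_ge0|rewrite divr_ge0// subr_ge0 ltW].
suff H n : forall t, 0 <= t <= n%:R -> mean_le P (fun w => dot (D t w) (D t w)) M.
  have [n hn] : exists n : nat, t <= n%:R.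
    by exists (Num.truncn t).+1; rewrite ltW// truncnS_gt.
  by apply: (H n); rewrite t0.
elim: n => [t'|n IH t'] /andP[t'0 t'n].
  have -> : t' = 0 by apply/le_anti; rewrite t'0 t'n.
  apply: mean_le_trans hK; rewrite /M; apply: le_trans (_ : expR (beta / 2) * K <= _).
    by rewrite ler_peMl// -expR0 ler_expR divr_ge0// ltW.
  by rewrite lerDl divr_ge0// subr_ge0 ltW.
have [t1|t1] := leP t' 1.
  have := step 0 t' K (lexx 0) t'0 _ hK; rewrite add0r => /(_ t1); apply: mean_le_trans.
  apply: lerD => //; rewrite ler_wpM2l ?expR_ge0// ler_piMl//.
  by rewrite -expR0 ler_expR mulNr subr0 oppr_le0 mulr_ge0// ltW.
have h1 : 0 <= t' - 1 by rewrite subr_ge0 ltW.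
have h2 : t' - 1 <= t' by lra.
have h3 : t' <= t' - 1 + 1 by lra.
have h4 : 0 <= t' - 1 <= n%:R by rewrite h1 lerBlDr natr1.
have := step (t' - 1) t' M h1 h2 h3 (IH _ h4).
apply: mean_le_trans.
rewrite (_ : t' - (t' - 1) = 1); last by ring.
rewrite mulr1 mulrA -expRD (_ : beta / 2 - beta = - beta / 2); last by lra.
rewrite -/rho -lerBrDl -{1}[M]mul1r -mulrBl.
have h5 : K1 <= (1 - rho) * (K1 / (1 - rho)) by rewrite mulrC divfK// gt_eqF// subr_gt0.
apply: le_trans h5 _; rewrite ler_wpM2l ?subr_ge0 ?(ltW rho1)// /M lerDr mulr_ge0// expR_ge0.
Qed.

End difference_bound.

(** * Fluctuations of the interaction *)

Section nonmeasurable_integrals.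
Context {R : realType} {dT : measure_display} {T : measurableType dT}.
Import HBNNSimple.

(* The integral of a nonnegative function is a supremum over simple functions
   below it, hence is monotone without any measurability. *)
Lemma ge0_le_integralT (mu : {measure set T -> \bar R}) (f g : T -> \bar R) :
  (forall x, 0 <= f x)%E -> (forall x, f x <= g x)%E ->
  (\int[mu]_x f x <= \int[mu]_x g x)%E.
Proof.
move=> f0 fg; rewrite !ge0_integralTE//; last by move=> x; exact: le_trans (fg x).
by apply: le_ereal_sup => _ [h /= hf <-]; exists h => // x; exact: le_trans (hf x) (fg x).
Qed.

End nonmeasurable_integrals.

(** * Replacing an independent variable by an independent copy *)

Section independent_pairs.
Context {R : realType} {dT d1 d2 : measure_display} {T : measurableType dT}.
Context {E1 : measurableType d1} {E2 : measurableType d2}.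
Variables (P : probability T R) (G H : set (set T)) (U : T -> E1) (Z : T -> E2).
Hypothesis mG : measurable_sys G.
Hypothesis mH : measurable_sys H.
Hypothesis GH : indep2 P G H.
Hypothesis GU : measurable_wrt G U.
Hypothesis HZ : measurable_wrt H Z.

Let mU : measurable_fun setT U.
Proof. by move=> _ C mC; rewrite setTI; exact/mG/GU. Qed.

Let mZ : measurable_fun setT Z.
Proof. by move=> _ C mC; rewrite setTI; exact/mH/HZ. Qed.

Let mUZ : measurable_fun setT (fun w => (U w, Z w)).
Proof. exact: measurable_fun_pair. Qed.

Let mUZ2 : measurable_fun setT (fun z : T * T => (U z.1, Z z.2)).
Proof. by apply: measurable_fun_pair; apply: measurableT_comp. Qed.

Let packU : {mfun T >-> E1} := HB.pack U (isMeasurableFun.Build _ _ _ _ _ mU).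
Let packZ : {mfun T >-> E2} := HB.pack Z (isMeasurableFun.Build _ _ _ _ _ mZ).
Let packUZ : {mfun T >-> (E1 * E2)%type} := HB.pack (fun w => (U w, Z w)) (isMeasurableFun.Build _ _ _ _ _ mUZ).
Let packUZ2 : {mfun (T * T)%type >-> (E1 * E2)%type} :=
  HB.pack (fun z : T * T => (U z.1, Z z.2)) (isMeasurableFun.Build _ _ _ _ _ mUZ2).

Let nu := (distribution P packU \x distribution P packZ)%E.

Let lawUZ C : measurable C -> P ((fun w => (U w, Z w)) @^-1` C) = nu C.
Proof.
move=> mC; rewrite /nu (@product_measure_unique _ _ _ _ _ _ _ (pushforward P packUZ))// => A B mA mB.
have GA : G (U @^-1` A) by exact: GU.
have HB : H (Z @^-1` B) by exact: HZ.
rewrite /pushforward /= /distribution /pushforward /=.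
rewrite -[packUZ @^-1` _]/(U @^-1` A `&` Z @^-1` B) !(prE P)//; try by [exact: mG|exact: mH|apply: measurableI; [exact: mG|exact: mH]].
by rewrite (GH GA HB) EFinM.
Qed.

Let lawUZ2 C : measurable C -> (P \x P)%E ((fun z : T * T => (U z.1, Z z.2)) @^-1` C) = nu C.
Proof.
move=> mC; rewrite /nu (@product_measure_unique _ _ _ _ _ _ _ (pushforward (P \x P)%E packUZ2))// => A B mA mB.
have GA : G (U @^-1` A) by exact: GU.
have HB : H (Z @^-1` B) by exact: HZ.
rewrite /pushforward /= /distribution /pushforward /=.
rewrite -[packUZ2 @^-1` _]/(U @^-1` A `*` Z @^-1` B) product_measure1E//.
- exact: mG.
- exact: mH.
Qed.

(** By independence the pair [(U, Z)] under [P] and the pair [(U z.1, Z z.2)] under [P \x P] have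
    the same law, to which Tonelli applies. *)
Lemma indep_integral_ge0 (f : E1 * E2 -> \bar R) : measurable_fun setT f ->
  (forall z, 0 <= f z)%E ->
  (\int[P]_w f (U w, Z w) = \int[P]_w \int[P]_w' f (U w, Z w'))%E.
Proof.
move=> mf f0; rewrite (ge0_integral_law (nu := nu) (f := fun w => (U w, Z w)))//.
rewrite -(ge0_integral_law (mu := (P \x P)%E) (nu := nu) (f := fun z : T * T => (U z.1, Z z.2)))//.
by rewrite fubini_tonelli1//; exact: measurableT_comp.
Qed.

(** Integrability is first transported to the product space through the common law, then Fubini
    integrates the second variable to zero. *)
Lemma indep_integral_eq0 (f : E1 * E2 -> R) : measurable_fun setT f ->
  P.-integrable setT (fun w => (f (U w, Z w))%:E) ->
  (forall w, \int[P]_w' (f (U w, Z w'))%:E = 0)%E ->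
  \int[P]_w f (U w, Z w) = 0.
Proof.
move=> mf fi f0.
have i2 : (P \x P)%E.-integrable setT (fun z : T * T => (f (U z.1, Z z.2))%:E).
  apply/integrableP; split; first by apply/measurable_EFinP; exact: measurableT_comp.
  have mnf : measurable_fun setT (fun z : E1 * E2 => `|(f z)%:E|)%E.
    by apply: measurableT_comp => //; exact/measurable_EFinP.
  rewrite (ge0_integral_law (nu := nu) (f := fun z : T * T => (U z.1, Z z.2)) (g := fun z => `|(f z)%:E|%E))//.
  rewrite -(ge0_integral_law (mu := P) (nu := nu) (f := fun w => (U w, Z w)))//.
  by have /integrableP[] := fi.
rewrite -(integral_law (mu := P) (nu := nu) (f := fun w => (U w, Z w)))//.
rewrite (integral_law (mu := (P \x P)%E) (nu := nu) (f := fun z : T * T => (U z.1, Z z.2)))//.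
rewrite /Rintegral -fubini1// /fubini_F integral0_eq// => w _; exact: f0.
Qed.

End independent_pairs.

Section fluctuation.
Context {R : realType} {d : nat} {dT : measure_display} {T : measurableType dT}.
Variables (P : probability T R) (N : nat).
Variables (gV gW : 'rV[R]_d -> 'rV[R]_d) (LV LW sigma kB : R).
Variables (X : 'I_N -> R -> T -> 'rV[R]_d) (B : 'I_N -> R -> T -> 'rV[R]_d) (c : R -> 'rV[R]_d).
Variable m : R -> probability (Rd R d) R.
Hypothesis sol : forall i, mv_solution P gV gW LV LW sigma kB (X i) (B i) c m.
Variables (t : R) (G : 'I_N -> set (set T)).
Hypothesis sG : forall i, sigma_algebra setT (G i).
Hypothesis mG : forall i, measurable_sys (G i).
Hypothesis iG : indepN P G.
Hypothesis GX : forall i, measurable_wrt (G i) (X i t : T -> Rd R d).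
Variables (LE K : R).
Hypothesis lipE : forall x y, dot (gW x - gW y) (gW x - gW y) <= LE * dot (x - y) (x - y).
Hypothesis LE0 : 0 <= LE.
Hypothesis meanK : forall i j, mean_le P (fun w => dot (X i t w - X j t w) (X i t w - X j t w)) K.
Hypothesis N2 : (2 <= N)%N.

Let Y i w := X i t w.
Let vc := vconv gW (m t).
(** The deviation of one interaction term from its mean: centred in [y] under [m t] for every fixed
    [x]. *)
Let a (x y : 'rV[R]_d) := vc x - gW (x - y).

Let mY i : measurable_fun setT (Y i : T -> Rd R d).
Proof. exact: (mv_mX (sol i)). Qed.

Let IG i : setI_closed (G i).
Proof. exact: setI_closed_sigma. Qed.

Let GT i : G i setT.
Proof. exact: sigma_algebraT. Qed.

Let i0 : 'I_N := Ordinal (leq_trans (isT : (0 < 2)%N) N2).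

Let vcE i k x : vc x 0 k = \int[P]_w gW (x - Y i w) 0 k.
Proof. exact: (vconvE (sol i)). Qed.

Let gWi i k x : P.-integrable setT (fun w => (gW (x - Y i w) 0 k)%:E).
Proof. exact: (mv_gW_integrable (sol i)). Qed.

Let cgW : continuous gW.
Proof. exact: sup_lip_continuous (mv_lipW (sol i0)). Qed.

Let cvc : continuous vc.
Proof. exact: (sup_lip_continuous (vconv_lip (sol i0) t)). Qed.

Let ma k : measurable_fun setT (fun z : Rd R d * Rd R d => a z.1 z.2 0 k).
Proof.
rewrite [X in measurable_fun _ X](_ : _ = fun z : Rd R d * Rd R d => vc z.1 0 k - gW (z.1 - z.2) 0 k); last first.
  by apply/funext => z; rewrite !mxE.
have c1 : continuous (fun x => vc x 0 k) by apply: (@continuous_compf _ _ _ vc (fun x : 'rV[R]_d => x 0 k)) => //; exact: continuous_rV_coord.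
have c2 : continuous (fun x => gW x 0 k) by apply: (@continuous_compf _ _ _ gW (fun x : 'rV[R]_d => x 0 k)) => //; exact: continuous_rV_coord.
apply: measurable_funB; first exact: (measurableT_comp (continuous_measurable_Rd c1)).
by apply: (@measurable_Rd_comp _ _ _ (Rd R d * Rd R d)%type _ (fun z => z.1 - z.2) c2); exact: measurable_RdB.
Qed.

Let a0E x y k l : a x y 0 k = \int[P]_w (gW (x - Y l w) 0 k - gW (x - y) 0 k).
Proof.
rewrite RintegralB//; [|exact: gWi|exact: finite_measure_integrable_cst].
rewrite Rintegral_cst//= probability_setT/= mulr1 -(vcE l).
by rewrite !mxE.
Qed.

(* Jensen's inequality, as [a x y] is the mean of [gW (x - Y) - gW (x - y)]. *)
Let a_le x y l K' : mean_le P (fun w => LE * dot (Y l w - y) (Y l w - y)) K' ->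
  dot (a x y) (a x y) <= K'.
Proof.
move=> hK'.
pose F w := gW (x - Y l w) - gW (x - y).
have fi k : P.-integrable setT (fun w => (F w 0 k)%:E).
  rewrite (_ : (fun w => _) = (fun w => (gW (x - Y l w) 0 k)%:E - (gW (x - y) 0 k)%:E)%E); last first.
    by apply/funext => w; rewrite !mxE.
  by apply: integrableB => //; exact: finite_measure_integrable_cst.
have hF : mean_le P (fun w => 2^-1 * (LE * dot (Y l w - y) (Y l w - y) + dot (a x y) (a x y)))
    (2^-1 * (K' + dot (a x y) (a x y))).
  by apply: mean_leZ => //; apply: mean_leD => //; apply: mean_le_cst; exact: dot_ge0.
have e : dot (a x y) (a x y) = \int[P]_w (\sum_k F w 0 k * a x y 0 k).
  rewrite (Rintegral_sumZ (fun k => a x y 0 k) fi) {1}dotE; apply: eq_bigr => k _.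
  by congr (_ * _); rewrite (a0E x y k l); apply: eq_Rintegral => w _; rewrite !mxE.
have : dot (a x y) (a x y) <= 2^-1 * (K' + dot (a x y) (a x y)).
  rewrite [leLHS]e; apply: (mean_le_Rintegral (integrable_sumZ (fun k => a x y 0 k) fi) _ hF) => w.
  rewrite -dotE.
  have h1 := dot_le_amgm (F w) (a x y) (@ltr01 R).
  have h2 := lipE (x - Y l w) (x - y).
  have h3 : dot (x - Y l w - (x - y)) (x - Y l w - (x - y)) = dot (Y l w - y) (Y l w - y).
    by rewrite -dotN2; congr (dot _ _); apply/rowP => k; rewrite !mxE; ring.
  rewrite h3 -/(F w) in h2; rewrite invr1 !mul1r in h1.
  by move: h1 h2; set A := dot (F w) (a x y); set A2 := dot (F w) (F w); set A3 := dot (a x y) _; set A4 := dot _ _; lra.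
by lra.
Qed.

Let other (j : 'I_N) : exists l : 'I_N, l != j.
Proof.
case: (eqVneq j i0) => [->|ji]; last by exists i0; rewrite eq_sym.
by exists (Ordinal N2).
Qed.

Let mdotB (l : 'I_N) y : measurable_fun setT (fun w => dot (Y l w - y) (Y l w - y)).
Proof. by apply: measurable_dot; apply: measurable_RdB => //; exact: measurable_cst. Qed.

Let mal i j l : measurable_fun setT (fun w => a (Y i w) (Y j w) 0 l).
Proof. by have := measurableT_comp (@ma l) (measurable_fun_pair (@mY i) (@mY j)); exact. Qed.

Let maa i j k : measurable_fun setT (fun w => dot (a (Y i w) (Y j w)) (a (Y i w) (Y k w))).
Proof.
rewrite (_ : (fun w => _) = fun w => \sum_l a (Y i w) (Y j w) 0 l * a (Y i w) (Y k w) 0 l); last first.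
  by apply/funext => w; rewrite dotE.
by apply: measurable_sum => l; apply: measurable_funM; exact: mal.
Qed.

(** The bound [a_le] is uniform in [x], so it applies with [x = Y i] even when [i = j]. A third
    index [l] different from [j] supplies an independent copy, and the mean over it is controlled by
    [meanK]. *)
Let mean_aa i j : mean_le P (fun w => dot (a (Y i w) (Y j w)) (a (Y i w) (Y j w))) (LE * K).
Proof.
have [l lj] := other j.
split; [exact: maa|by move=> w; exact: dot_ge0|].
have hind : indep2 P (G j) (G l).
  apply: indep2_sub (indepN_pair IG mG GT iG lj lj) => // A GA.
  by apply: sub_sigma_algebra; left.
have := @indep_integral_ge0 R dT _ _ T (Rd R d) (Rd R d) P (G j) (G l) (Y j) (Y l) (@mG j) (@mG l) hind (@GX j) (@GX l)
  (fun z => (LE * dot (z.2 - z.1) (z.2 - z.1))%:E) _ _.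
move=> H; have {}H := H _ _.
apply: le_trans (_ : \int[P]_w \int[P]_w' (LE * dot (Y l w' - Y j w) (Y l w' - Y j w))%:E <= _)%E.
  apply: ge0_le_integralT => w; first by rewrite lee_fin dot_ge0.
  set I := (\int[P]_w' _)%E.
  have I0 : (0 <= I)%E by apply: integral_ge0 => w' _; rewrite lee_fin mulr_ge0// dot_ge0.
  have [/eqP -> |Ioo] := boolP (I == +oo%E); first exact: leey.
  have If : I \is a fin_num by rewrite ge0_fin_numE// ltey.
  rewrite -(fineK If) lee_fin; apply: (@a_le (Y i w) (Y j w) l).
  split; [by apply: measurable_funM => //; exact: mdotB|by move=> w'; rewrite mulr_ge0// dot_ge0|].
  by rewrite fineK.
rewrite -H.
- by have [_ _] := mean_leZ LE0 (meanK l j).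
- apply/measurable_EFinP; apply: measurable_funM => //.
  by apply: (@measurable_dot _ _ _ (Rd R d * Rd R d)%type (fun z => z.2 - z.1)); exact: measurable_RdB.
- by move=> z; rewrite lee_fin mulr_ge0// dot_ge0.
Qed.

Let measurable_pair_wrt i j : measurable_wrt <<s G i `|` G j >>
  ((fun w => (Y i w, Y j w)) : T -> (Rd R d * Rd R d)%type).
Proof.
move=> C mC.
pose TG := g_sigma_algebraType (G i `|` G j).
have mi : measurable_fun (setT : set TG) (Y i : TG -> Rd R d).
  by move=> _ D mD; rewrite setTI; apply: sub_sigma_algebra; left; exact: GX.
have mj : measurable_fun (setT : set TG) (Y j : TG -> Rd R d).
  by move=> _ D mD; rewrite setTI; apply: sub_sigma_algebra; right; exact: GX.
by have := measurable_fun_pair mi mj measurableT mC; rewrite setTI.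
Qed.

Let iaa i j k : P.-integrable setT (fun w => (dot (a (Y i w) (Y j w)) (a (Y i w) (Y k w)))%:E).
Proof.
apply: (mean_le_integrable (K := 2^-1 * (LE * K + LE * K))); first exact: maa.
apply: mean_leW (mean_leZ (c := 2^-1) _ (mean_leD (mean_aa i j) (mean_aa i k))) => //.
  by apply: measurableT_comp => //; exact: maa.
move=> w; rewrite normr_ge0/=; set x := a _ _; set y := a _ _.
have h1 := dot_le_amgm x y (@ltr01 R); have h2 := dot_le_amgm (- x) y (@ltr01 R).
rewrite dotN2 dotNl invr1 !mul1r in h2; rewrite invr1 !mul1r in h1.
rewrite ler_norml; apply/andP; split; lra.
Qed.

(** Given [Y i] and [Y j], the factor [a (Y i) (Y k)] has mean zero, as [k] differs from both. *)
Let cross0 i j k : k != i -> k != j ->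
  \int[P]_w dot (a (Y i w) (Y j w)) (a (Y i w) (Y k w)) = 0.
Proof.
move=> ki kj.
have mGs : measurable_sys <<s G i `|` G j >>.
  by apply: g_sigma_measurable_sys => A [|]; exact: mG.
have := @indep_integral_eq0 R dT _ _ T (Rd R d * Rd R d)%type (Rd R d) P _ (G k)
  (fun w => (Y i w, Y j w)) (Y k) mGs (@mG k) (indepN_pair IG mG GT iG ki kj)
  (@measurable_pair_wrt i j) (@GX k) (fun z => dot (a z.1.1 z.1.2) (a z.1.1 z.2)).
apply.
- rewrite (_ : (fun w => _) = fun z : Rd R d * Rd R d * Rd R d => \sum_l a z.1.1 z.1.2 0 l * a z.1.1 z.2 0 l); last first.
    by apply/funext => w; rewrite dotE.
  apply: measurable_sum => l; apply: measurable_funM.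
    exact: (measurableT_comp (@ma l) measurable_fst).
  have m1 : measurable_fun setT (fun z : Rd R d * Rd R d * Rd R d => z.1.1).
    exact: (measurableT_comp measurable_fst measurable_fst).
  by have := measurableT_comp (@ma l) (measurable_fun_pair m1 measurable_snd); exact.
- exact: iaa.
move=> w /=; set x := Y i w; set y := Y j w.
pose F l w' := a x (Y k w') 0 l.
have fi l : P.-integrable setT (fun w => (F l w)%:E).
  rewrite (_ : (fun w => _) = (fun w => (vc x 0 l)%:E - (gW (x - Y k w) 0 l)%:E)%E); last first.
    by apply/funext => w'; rewrite /F !mxE.
  by apply: integrableB => //; exact: finite_measure_integrable_cst.
have E w' : dot (a x y) (a x (Y k w')) = \sum_l F l w' * a x y 0 l by rewrite dotC dotE.
under eq_integral do rewrite E.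
have := Rintegral_sumZ (fun l => a x y 0 l) fi.
rewrite [X in _ = X]big1.
  move=> h; rewrite -[LHS]fineK; last by apply: integrable_fin_num => //; exact: integrable_sumZ.
  by rewrite -[fine _]/(\int[P]_w _) h.
move=> l _; suff -> : \int[P]_w F l w = 0 by rewrite mul0r.
rewrite (_ : F l = fun w => vc x 0 l - gW (x - Y k w) 0 l); last by apply/funext => w'; rewrite /F !mxE.
rewrite RintegralB//; [|exact: finite_measure_integrable_cst|exact: gWi].
by rewrite Rintegral_cst//= probability_setT/= mulr1 (vcE k) subrr.
Qed.

Definition mv_fluct (i : 'I_N) (w : T) : 'rV[R]_d :=
  vconv gW (m t) (X i t w) - N%:R^-1 *: \sum_(j < N) gW (X i t w - X j t w).

(** Among the [N^2] products in the expanded square only the [N] diagonal ones have nonzero mean. *)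
Lemma mv_fluct_mean i : mean_le P (fun w => dot (mv_fluct i w) (mv_fluct i w)) (LE * K / N%:R).
Proof.
have N0 : (N%:R : R) != 0 by rewrite pnatr_eq0 -lt0n (leq_trans _ N2).
have eE w : mv_fluct i w = N%:R^-1 *: \sum_(j < N) a (Y i w) (Y j w).
  rewrite /mv_fluct /a sumrB scalerBr sumr_const card_ord; congr (_ - _).
  by rewrite -[X in _ *: X]scaler_nat scalerA mulVf// scale1r.
pose F (p : 'I_N * 'I_N) w := dot (a (Y i w) (Y p.1 w)) (a (Y i w) (Y p.2 w)).
have dE w : dot (mv_fluct i w) (mv_fluct i w) = \sum_p F p w * N%:R^-2.
  rewrite eE dotZl dotZr dot_suml.
  under eq_bigr do rewrite dotC dot_suml.
  rewrite pair_big/= mulrA -[X in X * _]expr2 mulr_sumr -exprVn; apply: eq_bigr => p _.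
  by rewrite /F dotC mulrC.
have iF p : P.-integrable setT (fun w => (F p w)%:E) by exact: iaa.
have iD : P.-integrable setT (fun w => (dot (mv_fluct i w) (mv_fluct i w))%:E).
  rewrite (_ : (fun w => _) = fun w => (\sum_p F p w * N%:R^-2)%:E); last by apply/funext => w; rewrite dE.
  exact: (integrable_sumZ (fun=> N%:R^-2) iF).
split.
- by have /integrableP[/measurable_EFinP] := iD.
- by move=> w; exact: dot_ge0.
rewrite -[leLHS]fineK ?integrable_fin_num// lee_fin -[leLHS]/(\int[P]_w _).
under eq_Rintegral do rewrite dE.
rewrite (Rintegral_sumZ (fun=> N%:R^-2) iF) -mulr_suml.
have -> : LE * K / N%:R = (LE * K * N%:R) * N%:R^-2 by field.
rewrite ler_wpM2r ?invr_ge0 ?exprn_ge0//.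
rewrite -(pair_big xpredT xpredT (fun j k => \int[P]_w F (j, k) w))/=.
have -> : LE * K * N%:R = \sum_(j < N) LE * K by rewrite sumr_const card_ord mulr_natr.
apply: ler_sum => j _; rewrite (bigD1 j)//= big1 ?addr0.
  apply: (mean_le_Rintegral (iF (j, j))) (mean_aa i j) => w.
  exact: lexx.
(* If [k = i], then [j] differs from both [i] and [k], and the two factors are exchanged. *)
move=> k kj; have [ki|ki] := eqVneq k i; last exact: cross0.
rewrite /F /=; under eq_Rintegral do rewrite dotC.
by apply: cross0 => //; rewrite eq_sym -?ki.
Qed.

End fluctuation.

(** * Synchronous coupling *)

Lemma continuous_sum_rV {R : realType} {d : nat} {I : Type} (F : I -> R -> 'rV[R]_d) (s : seq I) :
  (forall i, continuous (F i)) -> continuous (fun x => \sum_(i <- s) F i x).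
Proof.
move=> cF x; elim: s => [|i s IH].
  by under eq_fun do rewrite big_nil; exact: cvg_cst.
by under eq_fun do rewrite big_cons; apply: cvgD => //; exact: cF.
Qed.

Section coupling.
Context {R : realType} {d : nat} {dT : measure_display} {T : measurableType dT}.
Variables (P : probability T R) (N : nat).
Variables (gV gW : 'rV[R]_d -> 'rV[R]_d) (LV LW sigma kB beta : R).
Variables (X XN B : 'I_N -> R -> T -> 'rV[R]_d) (c : R -> 'rV[R]_d).
Variable m : R -> probability (Rd R d) R.
Hypothesis sol : forall i, mv_solution P gV gW LV LW sigma kB (X i) (B i) c m.

Definition pdrift (i : 'I_N) (s : R) (w : T) : 'rV[R]_d :=
  - gV (XN i s w) - N%:R^-1 *: \sum_(j < N) gW (XN i s w - XN j s w).

Hypothesis mXN : forall i t, measurable_fun setT (XN i t : T -> Rd R d).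
Hypothesis cXN : forall i w, continuous (fun t => XN i t w).
Hypothesis XNeq : forall i w t k, 0 <= t ->
  (lebesgue_measure.-integrable `[0, t] (fun s => (pdrift i s w 0 k)%:E)) /\
  XN i t w 0 k = XN i 0 w 0 k + pint 0 t (fun s => pdrift i s w 0 k)
    + sigma * B i t w 0 k + c t 0 k.
Hypothesis beta0 : 0 < beta.
Hypothesis gVmon : forall x y, beta * dot (x - y) (x - y) <= dot (gV x - gV y) (x - y).
Hypothesis gWmon : forall x y, 0 <= dot (gW x - gW y) (x - y).
Hypothesis gWodd : forall x, gW (- x) = - gW x.
Hypothesis N2 : (2 <= N)%N.

Let i0 : 'I_N := Ordinal (leq_trans (isT : (0 < 2)%N) N2).

Let N0 : 0 < N%:R :> R.
Proof. by rewrite ltr0n (leq_trans _ N2). Qed.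

Let D i s w := X i s w - XN i s w.
Let q s w := \sum_i dot (D i s w) (D i s w).
Let eps s i w := mv_fluct gW X m s i w.
Let e s w := Num.sqrt (\sum_i dot (eps s i w) (eps s i w)).

(** Exchanging [i] and [j] and using that [gW] is odd replaces [D i] by half of [D i - D j], which
    is the difference of the two arguments of the monotone [gW]. *)
Lemma interaction_dissipative s w : 0 <= \sum_i \sum_j
  dot (D i s w) (gW (X i s w - X j s w) - gW (XN i s w - XN j s w)).
Proof.
set h := fun i j => gW (X i s w - X j s w) - gW (XN i s w - XN j s w).
have hN i j : h j i = - h i j.
  by rewrite /h -[X j s w - _]opprB -[XN j s w - _]opprB !gWodd opprB opprK addrC.
have E : \sum_i \sum_j dot (D i s w) (h i j) = \sum_i \sum_j - dot (D j s w) (h i j).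
  rewrite exchange_big; apply: eq_bigr => i _; apply: eq_bigr => j _.
  by rewrite hN dotNr.
have : 0 <= \sum_i \sum_j dot (D i s w) (h i j) + \sum_i \sum_j - dot (D j s w) (h i j).
  rewrite -big_split/=; apply: sumr_ge0 => i _; rewrite -big_split/=; apply: sumr_ge0 => j _.
  rewrite -dotBl dotC.
  have -> : D i s w - D j s w = (X i s w - X j s w) - (XN i s w - XN j s w).
    by rewrite /D; apply/rowP => k; rewrite !mxE; ring.
  exact: gWmon.
by rewrite -E; lra.
Qed.

Let g i s w := mv_drift gV gW m s (X i s w) - pdrift i s w.

(** The fluctuation is taken along the independent [X]; what remains compares two interactions of
    the same empirical form. Cauchy-Schwarz over all particles and coordinates produces the square
    root required by [energy_sqrt_bound]. *)
Lemma coupling_dissipative s w : \sum_i dot (D i s w) (g i s w) <=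
  - beta * q s w + Num.sqrt (q s w) * e s w.
Proof.
have gE i : g i s w = - (gV (X i s w) - gV (XN i s w)) + - eps s i w
    - N%:R^-1 *: \sum_j (gW (X i s w - X j s w) - gW (XN i s w - XN j s w)).
  rewrite /g /pdrift /mv_drift /eps /mv_fluct sumrB scalerBr.
  by apply/rowP => k; rewrite !mxE; ring.
have h1 i : dot (D i s w) (g i s w) <= - beta * dot (D i s w) (D i s w) + dot (- D i s w) (eps s i w)
    - N%:R^-1 * \sum_j dot (D i s w) (gW (X i s w - X j s w) - gW (XN i s w - XN j s w)).
  rewrite gE dotBr dotDr !dotNr dotZr dotNl.
  have -> : dot (D i s w) (\sum_j (gW (X i s w - X j s w) - gW (XN i s w - XN j s w))) =
    \sum_j dot (D i s w) (gW (X i s w - X j s w) - gW (XN i s w - XN j s w)).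
    by rewrite dotC dot_suml; apply: eq_bigr => j _; rewrite dotC.
  rewrite lerD2r lerD2r mulNr lerN2 dotC; exact: gVmon.
apply: le_trans (ler_sum _ (fun i _ => h1 i)) _.
rewrite sumrB big_split/= -!mulr_sumr.
have h2 : \sum_i dot (- D i s w) (eps s i w) <= Num.sqrt (q s w) * e s w.
  pose a (p : 'I_N * 'I_d) := (- D p.1 s w) 0 p.2.
  pose b (p : 'I_N * 'I_d) := eps s p.1 w 0 p.2.
  have := cauchy_schwarz_sum a b.
  have F (u v : 'I_N -> 'rV[R]_d) : \sum_(p : 'I_N * 'I_d) u p.1 0 p.2 * v p.1 0 p.2 = \sum_i dot (u i) (v i).
    by rewrite -(pair_big xpredT xpredT (fun i k => u i 0 k * v i 0 k))/=; apply: eq_bigr => i _; rewrite dotE.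
  rewrite (F (fun i => - D i s w) (fun i => eps s i w)) (F (fun i => - D i s w) (fun i => - D i s w)) (F (fun i => eps s i w) (fun i => eps s i w)).
  by under [X in Num.sqrt X * _]eq_bigr do rewrite dotN2.
have h3 : 0 <= N%:R^-1 * \sum_i \sum_j dot (D i s w) (gW (X i s w - X j s w) - gW (XN i s w - XN j s w)).
  by rewrite mulr_ge0 ?invr_ge0 ?(ltW N0)// interaction_dissipative.
by rewrite -/(q s w); lra.
Qed.

Let cgV : continuous gV := sup_lip_continuous (mv_lipV (sol i0)).
Let cgW : continuous gW := sup_lip_continuous (mv_lipW (sol i0)).

Let ccoord (u : R -> 'rV[R]_d) k : continuous u -> continuous (fun s => u s 0 k).
Proof. by move=> cu; apply: (@continuous_compf _ _ _ u (fun x : 'rV[R]_d => x 0 k)) => //; exact: continuous_rV_coord. Qed.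

Let cinter (Z : 'I_N -> R -> T -> 'rV[R]_d) i w : (forall j, continuous (fun t => Z j t w)) ->
  continuous (fun s => N%:R^-1 *: \sum_(j < N) gW (Z i s w - Z j s w)).
Proof.
move=> cZ s; apply: cvgZr.
apply: (@continuous_sum_rV R d 'I_N (fun j s => gW (Z i s w - Z j s w))) => j.
apply: (@continuous_compf _ _ _ (fun s => Z i s w - Z j s w) gW) => //.
by move=> s'; apply: cvgB; exact: cZ.
Qed.

Let cg i w k : continuous (fun s => g i s w 0 k).
Proof.
rewrite (_ : (fun s => _) = fun s => mv_drift gV gW m s (X i s w) 0 k -
   (- gV (XN i s w) - N%:R^-1 *: \sum_(j < N) gW (XN i s w - XN j s w)) 0 k); last first.
  by apply/funext => s; rewrite /g /pdrift !mxE.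
move=> s; apply: cvgB.
  by apply: (mv_drift_continuous (sol i0)); exact: (mv_cX (sol i)).
apply: (@ccoord (fun s => - gV (XN i s w) - N%:R^-1 *: \sum_(j < N) gW (XN i s w - XN j s w))) => s'.
apply: cvgB; last by apply: cinter.
by apply: cvgN; apply: (@continuous_compf _ _ _ (fun s => XN i s w) gV).
Qed.

Let ceps i w k : continuous (fun s => eps s i w 0 k).
Proof.
rewrite (_ : (fun s => _) = fun s => - mv_drift gV gW m s (X i s w) 0 k - gV (X i s w) 0 k -
   (N%:R^-1 *: \sum_(j < N) gW (X i s w - X j s w)) 0 k); last first.
  by apply/funext => s; rewrite /eps /mv_fluct /mv_drift !mxE; ring.
move=> s; apply: cvgB; first apply: cvgB.
- by apply: cvgN; apply: (mv_drift_continuous (sol i0)); exact: (mv_cX (sol i)).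
- by apply: (@ccoord (fun s => gV (X i s w))); apply: (@continuous_compf _ _ _ (fun s => X i s w) gV) => //; exact: (mv_cX (sol i)).
- apply: (@ccoord (fun s => N%:R^-1 *: \sum_(j < N) gW (X i s w - X j s w))).
  by apply: cinter => j; exact: (mv_cX (sol j)).
Qed.

Let ce w : continuous (fun s => e s w).
Proof.
rewrite /e; apply: (@continuous_compf _ _ _ _ Num.sqrt); last by move=> x; exact: sqrt_continuous.
apply: continuous_sum => i.
rewrite (_ : (fun s => _) = fun s => \sum_k eps s i w 0 k * eps s i w 0 k); last by apply/funext => s; rewrite dotE.
by apply: continuous_sum => k s; apply: cvgM; exact: ceps.
Qed.

Lemma coupling_path w t : 0 <= t -> expR (beta * t) * Num.sqrt (q t w) <=
  Num.sqrt (q 0 w) + pint 0 t (fun s => expR (beta * (s - 0)) * e s w).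
Proof.
move=> t0.
pose r (p : 'I_N * 'I_d) s := D p.1 s w 0 p.2.
pose G (p : 'I_N * 'I_d) s := g p.1 s w 0 p.2.
have F (u v : 'I_N -> 'rV[R]_d) : \sum_(p : 'I_N * 'I_d) u p.1 0 p.2 * v p.1 0 p.2 = \sum_i dot (u i) (v i).
  by rewrite -(pair_big xpredT xpredT (fun i k => u i 0 k * v i 0 k))/=; apply: eq_bigr => i _; rewrite dotE.
have rE p s : 0 <= s <= t -> r p s = r p 0 + pint 0 s (G p).
  move: p => [i k] /andP[s0 st]; rewrite /r /G /=.
  have hD q' : D i q' w 0 k = X i q' w 0 k - XN i q' w 0 k by rewrite !mxE.
  have hg q' : g i q' w 0 k = mv_drift gV gW m q' (X i q' w) 0 k - pdrift i q' w 0 k by rewrite !mxE.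
  have [i1 e1] := mv_Xeq (sol i) w k s0; have [i2 e2] := XNeq i w k s0.
  rewrite !hD e1 e2; under [pint 0 s (fun s => g i s w 0 k)]eq_Rintegral do rewrite hg.
  rewrite RintegralB// -!/(pint 0 s _).
  by set I1 := pint _ _ _; set I2 := pint _ _ _; clearbody I1 I2; ring.
have := @energy_sqrt_bound R ('I_N * 'I_d)%type r G 0 t t0 (fun p => @cg p.1 w p.2) rE beta (e ^~ w) (@ce w)
  (fun s => sqrtr_ge0 _).
rewrite (F (fun i => D i 0 w) (fun i => D i 0 w)) (F (fun i => D i t w) (fun i => D i t w)) subr0; apply => s _.
rewrite (F (fun i => D i s w) (fun i => D i s w)) (F (fun i => D i s w) (fun i => g i s w)).
exact: coupling_dissipative.
Qed.

Lemma pint_expR_le t : 0 <= t -> pint 0 t (fun s => expR (beta * (s - 0))) <= expR (beta * t) / beta.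
Proof.
move=> t0.
pose H s := pint 0 s (fun s => expR (beta * (s - 0))) - beta^-1 * expR (beta * (s - 0)).
have ceR := @continuous_expRM R beta 0.
have : H t <= H 0.
  apply: (@derive_nincr R H (fun x => expR (beta * (x - 0)) - (beta^-1 * (beta * expR (beta * (x - 0))) + expR (beta * (x - 0)) * 0))) => //.
  - move=> x /andP[x0 _].
    exact: is_derive1B (pint_derive ceR x0) (is_derive1M (is_derive_cst beta^-1 x 1) (is_derive_expRM beta 0 x)).
  - by move=> x _; rewrite mulr0 addr0 mulKf ?gt_eqF// subrr.
  - apply: within_continuousB; first exact: pint_continuous.
    by apply: within_continuousM; [move=> x; exact: cst_continuous|exact: continuous_subspaceT].
rewrite /H pint0 !subr0 mulr0 expR0 mulr1 sub0r => h.
have b0 : 0 < beta^-1 by rewrite invr_gt0.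
by rewrite mulrC; lra.
Qed.

Variables (LE K M : R).
Hypothesis LE0 : 0 <= LE.
Hypothesis lipE : forall x y, dot (gW x - gW y) (gW x - gW y) <= LE * dot (x - y) (x - y).
Hypothesis meanK : forall i j s, 0 <= s ->
  mean_le P (fun w => dot (X i s w - X j s w) (X i s w - X j s w)) K.
Hypothesis meanM : forall i, mean_le P (fun w => dot (X i 0 w - XN i 0 w) (X i 0 w - XN i 0 w)) M.
(** The sigma-algebras may change with the time, since fluctuations are bounded at each time
    separately. *)
Hypothesis indG : forall s, 0 <= s -> exists G : 'I_N -> set (set T),
  [/\ forall i, sigma_algebra setT (G i), forall i, measurable_sys (G i), indepN P G &
      forall i, measurable_wrt (G i) (X i s : T -> Rd R d)].

(** The squared fluctuations sum to [N (LE K / N) = LE K]; the normalisation by [N] leaves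
    [1 / sqrt N], and the exponential weight integrates to at most [1 / beta] after rescaling. *)
Lemma coupling_mean t : 0 <= t -> mean_le P
  (fun w => Num.sqrt (N%:R^-1 * \sum_i dot (X i t w - XN i t w) (X i t w - XN i t w)))
  (expR (- beta * t) * Num.sqrt M + Num.sqrt (LE * K) / (beta * Num.sqrt N%:R)).
Proof.
move=> t0.
have mD i s : measurable_fun setT (D i s : T -> Rd R d).
  by apply: measurable_RdB => //; exact: (mv_mX (sol i)).
have mq s : measurable_fun setT (q s).
  by apply: measurable_sum => i; exact: measurable_dot.
have msqrt (f : T -> R) : measurable_fun setT f -> measurable_fun setT (fun w => Num.sqrt (f w)).
  move=> mf; apply: (measurableT_comp _ mf); apply: continuous_measurable_fun => x; exact: sqrt_continuous.
have e_mean s : 0 <= s -> mean_le P (e s) (Num.sqrt (LE * K)).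
  move=> s0; have [G [sG mG iG GX]] := indG s0.
  have h i := mv_fluct_mean sol sG mG iG GX lipE LE0 (fun i j => meanK i j s0) N2 i.
  have hs := mean_le_sum (index_enum 'I_N) xpredT h.
  have hK : \sum_(i < N) LE * K / N%:R = LE * K.
    by rewrite sumr_const card_ord -[LHS]mulr_natr divfK// gt_eqF.
  rewrite hK in hs; have [mS _ _] := hs.
  apply: mean_le_sqrt; last by move=> w; exact: sqrtr_ge0.
    rewrite (_ : (fun w => _) = fun w => \sum_i dot (eps s i w) (eps s i w))//.
    by apply/funext => w; rewrite sqr_sqrtr// sumr_ge0// => i _; exact: dot_ge0.
  exact: msqrt.
have sN : 0 < Num.sqrt N%:R :> R by rewrite sqrtr_gt0.
have q0_mean : mean_le P (fun w => Num.sqrt (q 0 w)) (Num.sqrt (N%:R * M)).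
  apply: mean_le_sqrt; last by move=> w; exact: sqrtr_ge0.
    rewrite (_ : (fun w => _) = fun w => \sum_i dot (D i 0 w) (D i 0 w)); last first.
      by apply/funext => w; rewrite sqr_sqrtr// sumr_ge0// => i _; exact: dot_ge0.
    have := mean_le_sum (index_enum 'I_N) xpredT meanM.
    by rewrite sumr_const card_ord -[M *+ N]mulr_natl.
  exact: msqrt.
have I_mean : mean_le P (fun w => pint 0 t (fun s => expR (beta * (s - 0)) * e s w))
    (Num.sqrt (LE * K) * pint 0 t (fun s => expR (beta * (s - 0)))).
  apply: mean_le_pint => //; first exact: continuous_expRM.
  by move=> s /andP[s0 _]; exact: e_mean.
have c0 : 0 <= expR (- beta * t) / Num.sqrt N%:R by rewrite divr_ge0 ?expR_ge0// ltW.
have M0 : 0 <= M := mean_le_ge0 (meanM i0).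
apply: mean_le_trans (mean_leW _ _ (mean_leZ c0 (mean_leD q0_mean I_mean))).
- rewrite mulrDr; apply: lerD.
    by rewrite sqrtrM ?(ltW N0)// mulrA divfK// gt_eqF.
  apply: le_trans (_ : expR (- beta * t) / Num.sqrt N%:R * (Num.sqrt (LE * K) * (expR (beta * t) / beta)) <= _).
    by rewrite ler_wpM2l// ler_wpM2l ?sqrtr_ge0// pint_expR_le.
  rewrite le_eqVlt; apply/orP; left; apply/eqP.
  by rewrite mulNr expRN; field; rewrite !gt_eqF ?expR_gt0.
- by apply: msqrt; apply: measurable_funM => //; exact: mq.
move=> w; rewrite sqrtr_ge0/= sqrtrM ?invr_ge0 ?(ltW N0)// sqrtrV ?(ltW N0)//.
rewrite mulrC -[X in X * _]/(Num.sqrt (q t w)) mulNr expRN.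
have := coupling_path w t0; rewrite -ler_pdivlMl ?expR_gt0// => h.
rewrite mulrAC ler_wpM2r ?invr_ge0 ?(ltW sN)//.
Qed.

End coupling.

(** * Completed product spaces *)

Section completion_theory.
Context {R : realType} {dT : measure_display} {T : measurableType dT}.
Variable mu : probability T R.

Lemma measurable_completed (A : set T) : measurable A ->
  measurable (A : set (completed_type mu)).
Proof. exact: caratheodory_measurable_mu_ext. Qed.

Lemma completedE (A : set T) : measurable A -> completed mu A = mu A.
Proof. exact: measurable_mu_extE. Qed.

Lemma measurable_fun_completed {dE} {E : measurableType dE} (f : T -> E) :
  measurable_fun setT f -> measurable_fun setT (f : completed_type mu -> E).
Proof.
by move=> mf _ C mC; rewrite setTI; apply: measurable_completed; rewrite -[X in measurable X]setTI; exact: mf.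
Qed.

Lemma ge0_integral_completed (f : T -> \bar R) : measurable_fun setT f ->
  (forall x, 0 <= f x)%E -> (\int[completed mu]_x f x = \int[mu]_x f x)%E.
Proof.
move=> mf f0.
apply: (@ge0_integral_law _ _ _ (completed_type mu) T (completed mu) mu id f) => //.
- exact: measurable_fun_completed.
- by move=> C mC; exact: (completedE mC).
Qed.

(** A countable intersection of covers whose excess over the outer measure is at most
    [1 / (n + 1)]. *)
Lemma outer_hull (A : set T) : exists B, [/\ measurable B, A `<=` B & mu B = (mu^*)%mu A].
Proof.
have A1 : ((mu^*)%mu A <= 1)%E.
  apply: le_trans (le_mu_ext mu (@subsetT _ A)) _.
  by rewrite measurable_mu_extE//= probability_setT.
have Afin : (mu^*)%mu A \is a fin_num.
  by rewrite ge0_fin_numE ?mu_ext_ge0// (le_lt_trans A1) ?ltry.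
have h n : exists B, [/\ measurable B, A `<=` B & (mu B <= (mu^*)%mu A + (n.+1%:R^-1)%:E)%E].
  have := @lb_ereal_inf_adherent _ _ (n.+1%:R^-1) _ Afin.
  rewrite invr_gt0 ltr0n => /(_ isT) [_ [F [mF AF] <-] hF].
  have mB : measurable (\bigcup_k F k) by apply: bigcup_measurable => k _; exact: mF.
  exists (\bigcup_k F k); split => //.
  apply: le_trans (ltW hF).
  exact: measure_sigma_subadditive.
have /choice[B hB] := h.
have mB n : measurable (B n) by have [] := hB n.
exists (\bigcap_n B n); split.
- exact: bigcap_measurable.
- by move=> x Ax n _; have [_ AB _] := hB n; exact: AB.
apply/eqP; rewrite eq_le; apply/andP; split.
  apply/lee_addgt0Pr => e e0.
  have [n hn] : exists n : nat, n.+1%:R^-1 < e.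
    by have [n _ hn] := near_infty_natSinv_lt (PosNum e0); exists n; exact: (hn n (leqnn n)).
  have [_ _ h1] := hB n.
  apply: le_trans (_ : (mu (B n) <= _)%E).
    by apply: le_measure; rewrite ?inE//; [exact: bigcap_measurable|move=> x; exact].
  by apply: le_trans h1 _; rewrite leeD2l// lee_fin ltW.
rewrite -[leRHS](@measurable_mu_extE _ _ _ mu)//; last exact: bigcap_measurable.
apply: le_mu_ext => x Ax n _; have [_ AB _] := hB n; exact: AB.
Qed.

Lemma completed_negligible (A : set T) : (completed mu).-negligible A -> mu.-negligible A.
Proof.
move=> [B [mB B0 AB]]; have [C [mC BC EC]] := outer_hull B.
exists C; split => //; last exact: subset_trans BC.
by rewrite EC -[LHS]/(completed mu B).
Qed.

Lemma negligible_completed (A : set T) : mu.-negligible A -> (completed mu).-negligible A.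
Proof.
move=> [B [mB B0 AB]]; exists B; split => //; first exact: measurable_completed.
by rewrite completedE.
Qed.

Lemma completed_complete (A : set T) : (completed mu).-negligible A ->
  measurable (A : set (completed_type mu)).
Proof.
move=> [B [mB B0 AB]].
by apply: (@measure_is_complete_caratheodory R T (mu^*)%mu); exists B.
Qed.

(** The complement of an outer hull of the complement. *)
Lemma inner_kernel (A : set (completed_type mu)) : measurable A ->
  exists B : set T, [/\ measurable B, B `<=` A & mu B = completed mu A].
Proof.
move=> mA; have [C [mC AC EC]] := outer_hull (~` A).
exists (~` C); split; [exact: measurableC|by move=> x Cx; apply: contrapT => /AC|].
have mcA : measurable (~` A : set (completed_type mu)) by exact: measurableC.
rewrite probability_setC// EC.
have -> : (mu^*)%mu (~` A) = completed mu (~` A) by [].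
have -> : completed mu (~` A) = (1 - completed mu A)%E by exact: probability_setC.
by rewrite (prE (completed mu) mA) -!EFinB subKr.
Qed.

End completion_theory.

Section product_completion.
Context {R : realType} {d0 d1 : measure_display}.
Context {T0 : measurableType d0} {T1 : measurableType d1}.
Variables (P0 : probability T0 R) (P1 : probability T1 R).
Local Notation P := (product_prob P0 P1).

Lemma negligible_section (A : set (T0 * T1)) : P.-negligible A ->
  {ae P0, forall w0, P1.-negligible (xsection A w0)}.
Proof.
move=> [B [mB B0 AB]].
have mx : measurable_fun setT (fun x => P1 (xsection B x)) by exact: measurable_fun_xsection.
have : (\int[P0]_x P1 (xsection B x) = 0)%E by [].
move=> e0; have /(ae_eq_integral_abs P0 measurableT mx) : (\int[P0]_x `|P1 (xsection B x)| = 0)%E.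
  by under eq_integral do rewrite gee0_abs//.
apply: filterS => x /= /(_ I) hx; exists (xsection B x); split => //.
  exact: measurable_xsection.
by move=> y /mem_set; rewrite /xsection/= inE /= => /set_mem; rewrite !inE => /AB.
Qed.

Lemma completed_ae_section (Q : T0 * T1 -> Prop) :
  {ae product_completed P0 P1, forall w, Q w} ->
  {ae P0, forall w0, {ae completed P1, forall w1, Q (w0, w1)}}.
Proof.
move=> /completed_negligible/negligible_section; apply: filterS => w0.
move=> /negligible_completed; apply: negligibleS => w1 /= h.
by rewrite /xsection/= inE.
Qed.

Import HBNNSimple.

(** The integral is a supremum over simple functions below [f]. Shrinking their level sets to
    product-measurable kernels of equal mass gives minorants to which Tonelli applies, which covers
    an [f] of unknown measurability. *)
Lemma integral_product_completed_le (f : T0 * T1 -> \bar R) (F : T0 -> \bar R) :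
  (forall w, 0 <= f w)%E -> (forall w, 0 <= F w)%E ->
  {ae P0, forall w0, \int[completed P1]_w1 f (w0, w1) <= F w0}%E ->
  measurable_fun setT F ->
  (\int[product_completed P0 P1]_w f w <= \int[P0]_w0 F w0)%E.
Proof.
move=> f0 F0 fF mF; rewrite ge0_integralTE//; apply: ge_ereal_sup => _ [h /= hf <-].
have /choice[A hA] : forall r : R, exists B : set (T0 * T1), [/\ measurable B,
    B `<=` h @^-1` [set r] & P B = product_completed P0 P1 (h @^-1` [set r])].
  by move=> r; apply: inner_kernel.
have mA r : measurable (A r) by have [] := hA r.
have Ah r : A r `<=` h @^-1` [set r] by have [] := hA r.
have PA r : P (A r) = product_completed P0 P1 (h @^-1` [set r]) by have [] := hA r.
pose fs := fset_set (range h).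
pose s : seq R := finmap.enum_fset fs.
have sE r : (r \in s) = (r \in range h).
  exact: (@in_fset_set _ (range h) (@fimfunP _ _ h) r).
have sP r : r \in s -> 0 <= r.
  by rewrite sE inE => -[w _ <-]; exact: fun_ge0.
pose g w : R := \sum_(r <- s) `|r| * \1_(A r) w.
have g0 w : 0 <= g w by apply: sumr_ge0 => r _; rewrite mulr_ge0.
have gh w : g w <= h w.
  have hs : h w \in s by rewrite sE inE; exists w.
  rewrite /g (bigD1_seq (h w))//= ?finmap.fset_uniq// big1 ?addr0.
    by rewrite ger0_norm ?sP// ler_piMr ?sP// indicE; case: (_ \in _).
  move=> r rh; rewrite indicE memNset ?mulr0// => /Ah /= e.
  by rewrite e eqxx in rh.
have mg : measurable_fun setT g.
  by apply: measurable_sum => r; apply: measurable_funM => //; exact: measurable_indic.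
have -> : sintegral (product_completed P0 P1) h = (\int[P]_w (g w)%:E)%E.
  rewrite sintegralE fsbig_finite//= -/fs -/s.
  under eq_integral do rewrite /g -sumEFin.
  rewrite ge0_integral_sum//.
  - rewrite big_seq [RHS]big_seq; apply: eq_bigr => r rs.
    under eq_integral do rewrite EFinM.
    rewrite ge0_integralZl_EFin//; last by apply/measurable_EFinP; exact: measurable_indic.
    by rewrite integral_indic// setIT ger0_norm ?sP//; congr (_ * _)%E; exact/esym/PA.
  - by move=> r; apply/measurable_EFinP; apply: measurable_funM => //; exact: measurable_indic.
have mgE : measurable_fun setT (EFin \o g) by exact/measurable_EFinP.
have g0E w : (0 <= (EFin \o g) w)%E by rewrite lee_fin.
rewrite -[leLHS]/(\int[(P0 \x P1)]_w (EFin \o g) w)%E fubini_tonelli1//.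
apply: ae_ge0_le_integral => //.
- by move=> w0 _; apply: integral_ge0 => w1 _; exact: g0E.
- exact: measurable_fun_fubini_tonelli_F.
apply: filterS fF => w0 h0 _; apply: le_trans h0; rewrite /fubini_F.
rewrite -ge0_integral_completed//; last exact: (measurableT_comp mgE (measurable_pair1 w0)).
apply: ge0_le_integralT => w1; first exact: g0E.
by apply: le_trans (hf (w0, w1)); rewrite lee_fin.
Qed.

(** The events with this property form a sigma-algebra, as countable unions of null sets of [w0] are
    null; it contains the rectangles and the negligible sets. The strict [t < s] reflects the right
    limit in [augmented_filtration]. *)
Lemma section_aug (F0 : R -> set (set T0)) (F1 : R -> set (set T1)) (t s : R)
    (A : set (T0 * T1)) : filtration F0 -> filtration F1 -> 0 <= t -> t < s ->
  augmented_filtration P0 P1 F0 F1 t A ->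
  {ae P0, forall w0, aug (completed P1) (F1 s) [set w1 | A (w0, w1)]}.
Proof.
move=> [fF0 _] [fF1 _] t0 ts; have s0 := le_trans t0 (ltW ts).
have [sF1 mF1] := fF1 s s0; have [sF0 mF0] := fF0 s s0.
have sF1' : sigma_algebra (setT : set (completed_type P1)) (F1 s) by exact: sF1.
have sa : sigma_algebra setT (aug (completed P1) (F1 s)) by exact: aug_sigma_algebra.
have mF1' : measurable_sys (F1 s : set (set (completed_type P1))).
  by move=> B FB; apply: measurable_completed; exact: mF1.
pose S := [set A : set (T0 * T1) |
  {ae P0, forall w0, aug (completed P1) (F1 s) [set w1 | A (w0, w1)]}].
move=> /(_ s); rewrite /= in_itv/= ts andbT => /(_ isT) hsig; apply: (hsig S); split.
  split.
  - by rewrite /S /=; apply: nearW => w0; have [h _ _] := sa; exact: h.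
  - move=> B; rewrite /S /=; apply: filterS => w0 hB; have [_ hC _] := sa.
    exact: (hC _ hB).
  - move=> B SB; rewrite /S /=; have : {ae P0, forall w0 k, aug (completed P1) (F1 s) [set w1 | B k (w0, w1)]}.
      by apply: ae_foralln => k; exact: SB.
    apply: filterS => w0 hB; have [_ _ hU] := sa.
    rewrite (_ : [set w1 | _] = \bigcup_k [set w1 | B k (w0, w1)]); first exact: hU.
    by apply/seteqP; split.
move=> {hsig}A [[A0 FA0 [B FB <-]]|nA].
  rewrite /S /=; apply: nearW => w0; have [wA|wA] := pselect (A0 w0).
    rewrite (_ : [set w1 | _] = B); first exact: sub_aug.
    by apply/seteqP; split => [w1 []|w1 /= ?].
  rewrite (_ : [set w1 | _] = set0); first by have [h _ _] := sa.
  by apply/seteqP; split => [w1 []|].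
rewrite /S /=; apply: filterS (negligible_section nA) => w0 nx.
have nx' : (completed P1).-negligible [set w1 | A (w0, w1)].
  apply: negligible_completed; apply: negligibleS nx => w1 /= Aw.
  by rewrite /xsection/= inE.
split; first exact: completed_complete.
exists set0; first by have [h _ _] := sF1.
by rewrite /aeq setD0 set0D setU0.
Qed.

End product_completion.

Section completed_brownian.
Context {R : realType} {d : nat} {dT : measure_display} {T : measurableType dT}.

(** Each second moment is bounded by the root of the fourth, hence [8 = sqrt 64] per coordinate. *)
Lemma brownian_incr_moment (P : probability T R) (F : R -> set (set T)) (B : R -> T -> 'rV[R]_d) s t :
  filtration F -> brownian_motion P F B -> 0 <= s -> s <= t ->
  mean_le P (fun w => dot (B t w - B s w) (B t w - B s w)) (8 * d%:R * (t - s)).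
Proof.
move=> filF BM s0; rewrite le_eqVlt => /predU1P[<-|st].
  rewrite subrr mulr0; under eq_fun do rewrite subrr dotE.
  rewrite (_ : (fun=> _) = fun=> 0); first exact: mean_le_cst.
  by apply/funext => w; rewrite big1// => k _; rewrite mxE mul0r.
have mB q : 0 <= q -> measurable_fun setT (B q : T -> Rd R d).
  by move=> q0; exact: (measurable_brownian (B := fun=> B) filF (fun=> BM) 0 q0).
pose f k w := B t w 0 k - B s w 0 k.
have mf k : measurable_fun setT (f k).
  by apply: measurable_funB; apply: (measurableT_comp (measurable_coord k)); apply: mB => //; exact: le_trans (ltW st).
have v0 : 0 < t - s by rewrite subr_gt0.
have law k (C : set R) : measurable C -> P (f k @^-1` C) = normal_prob 0 (Num.sqrt (t - s)) C.
  move=> mC; have [_ _ _ h] := BM.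
  have FT : F s setT by have [h' _] := filF; have [sF _] := h' s s0; exact: sigma_algebraT.
  pose C' j := if j == k then C else setT.
  have mC' j : measurable (C' j) by rewrite /C'; case: ifP.
  have := h s t s0 st setT FT C' mC'.
  rewrite setTI [X in (X * _)%E]probability_setT mul1e (bigD1 k)//= {2}/C' eqxx big1 ?mulr1; last first.
    by move=> j /negPf jk; rewrite /C' jk probability_setT.
  rewrite fineK ?fin_num_measure// => <-; congr (P _); apply/seteqP; split => w /=.
    by move=> Cf j; rewrite /C'; case: eqP => [->|].
  by move=> /(_ k); rewrite /C' eqxx.
have m4 k : mean_le P (fun w => f k w ^+ 4) (64 * (t - s) ^+ 2).
  split; [exact: measurable_funX|by move=> w; rewrite (exprM _ 2 2) sqr_ge0|].
  apply: le_trans (normal_moment4 v0).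
  rewrite (ge0_integral_law (nu := normal_prob 0 (Num.sqrt (t - s))) (f := f k) (g := fun x => (x ^+ 4)%:E))//.
  - exact: mf.
  - exact: law.
  - by move=> x; rewrite lee_fin (exprM _ 2 2) sqr_ge0.
  - by apply/measurable_EFinP; exact: measurable_funX.
have m2 k : mean_le P (fun w => f k w ^+ 2) (8 * (t - s)).
  have -> : 8 * (t - s) = Num.sqrt (64 * (t - s) ^+ 2).
    rewrite (_ : 64 * (t - s) ^+ 2 = (8 * (t - s)) ^+ 2); last by ring.
    by rewrite sqrtr_sqr ger0_norm// mulr_ge0// ltW.
  apply: mean_le_sqrt; [|exact: measurable_funX|by move=> w; exact: sqr_ge0].
  rewrite (_ : (fun w => _) = fun w => f k w ^+ 4); first exact: m4.
  by apply/funext => w; rewrite -exprM.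
have := mean_le_sum (index_enum 'I_d) xpredT m2.
rewrite sumr_const card_ord -[X in mean_le _ _ X]mulr_natr mulrAC.
congr (mean_le P _ _); apply/funext => w; rewrite dotE; apply: eq_bigr => k _.
by rewrite /f !mxE expr2.
Qed.

Variable P : probability T R.

Lemma completed_filtration (F : R -> set (set T)) : filtration F ->
  filtration (F : R -> set (set (completed_type P))).
Proof.
move=> [h1 h2]; split => // t t0; have [sF mF] := h1 t t0; split => // A FA.
by apply: measurable_completed; exact: mF.
Qed.

Lemma completed_brownian (F : R -> set (set T)) (B : R -> T -> 'rV[R]_d) :
  filtration F -> brownian_motion P F B ->
  brownian_motion (completed P) (F : R -> set (set (completed_type P)))
    (B : R -> completed_type P -> 'rV[R]_d).
Proof.
move=> filF BM; have [h1 h2 h3 h4] := BM; split => //.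
- exact: negligible_completed.
- exact: negligible_completed.
move=> s t s0 st A FA C mC.
have mA : measurable (A : set T) by have [h _] := filF; have [_ mF] := h s s0; exact: mF.
have mB q k : 0 <= q -> measurable_fun setT (fun w => B q w 0 k).
  move=> q0; apply: (measurableT_comp (measurable_coord k)).
  exact: (measurable_brownian (B := fun=> B) filF (fun=> BM) 0 q0).
have mbox : measurable ([set w | forall k, C k (B t w 0 k - B s w 0 k)] : set T).
  rewrite (_ : [set w | _] = \bigcap_(k : 'I_d) ((fun w => B t w 0 k - B s w 0 k) @^-1` (C k))); last first.
    by apply/seteqP; split => w /= h; [move=> k _; exact: h|move=> k; exact: h].
  apply: fin_bigcap_measurable => // k _; rewrite -[X in measurable X]setTI.
  by apply: measurable_funB => //; apply: mB => //; exact: le_trans (ltW st).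
apply: etrans (completedE P (measurableI _ _ mA mbox)) _; apply: etrans (h4 s t s0 st A FA C mC) _.
by congr (_ * _)%E; apply: esym; exact: (completedE P mA).
Qed.

Lemma completed_independent (F : R -> set (set T)) (B : nat -> R -> T -> 'rV[R]_d) :
  filtration F -> (forall i, brownian_motion P F (B i)) ->
  independent_sigma P (fun i => sigma_process (B i)) ->
  independent_sigma (completed P)
    (fun i => sigma_process (B i : R -> completed_type P -> 'rV[R]_d)).
Proof.
move=> filF BM ind n A hA.
have mA i : (i < n)%N -> measurable (A i : set T).
  by move=> i_n; exact: (sigma_process_measurable filF BM (hA i i_n)).
have mI : measurable (\bigcap_(i in `I_n) A i : set T) by exact: bigcap_measurableType.
apply: etrans (completedE P mI) _; apply: etrans (ind n A hA) _.
congr EFin; apply: eq_bigr => i _; congr fine.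
by apply: esym; exact: (completedE P (mA _ (ltn_ord i))).
Qed.

End completed_brownian.

(** * From almost sure to sure statements *)

Lemma maxr0E {R : realType} (s : R) : Num.max s 0 = (s + `|s|) / 2.
Proof. by have [s0|s0] := leP 0 s; [rewrite ger0_norm//|rewrite ltr0_norm//]; lra. Qed.

(** Freezing a path before time 0 makes it continuous on the whole line, the form used by the
    primitives. *)
Lemma continuous_maxr0 {R : realType} {V : topologicalType} (f : R -> V) :
  {within `[0, +oo[, continuous f} -> continuous (fun t : R => f (Num.max t 0)).
Proof.
move=> cf t.
have t0 : `[(0 : R), +oo[%classic (Num.max t 0) by rewrite /= in_itv/= andbT le_max lexx orbT.
have /subspace_continuousP/(_ _ t0) h := cf.
apply: (cvg_trans _ h) => U /= hU.
have cm : Num.max s 0 @[s --> t] --> Num.max t 0.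
  rewrite maxr0E (_ : (fun s : R => Num.max s 0) = (fun s => (s + `|s|) / 2)); last by apply/funext => s; exact: maxr0E.
  by apply: cvgMl; apply: cvgD; [exact: cvg_id|apply: cvg_norm; exact: cvg_id].
have h2 := cm _ hU; apply: (@filterS _ (nbhs t) _ _ _ _ h2) => s /= hs; apply: hs.
by rewrite in_itv/= andbT le_max lexx orbT.
Qed.

Section rational_sections.
Context {R : realType} {d : nat} {dT : measure_display} {T : measurableType dT}.

Lemma measurable_fun_rat (f : T -> R) :
  (forall q : rat, measurable [set w | ratr q < f w]) -> measurable_fun setT f.
Proof.
move=> h; apply: (measurability (@RGenOInfty.G R)); first exact: RGenOInfty.measurableE.
move=> _ [_ [y ->] <-]; rewrite setTI.
rewrite (_ : f @^-1` _ = \bigcup_(q : rat) (if y <= ratr q then [set w | ratr q < f w] else set0)).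
  by apply: bigcupT_measurable_rat => q; case: ifP.
apply/seteqP; split => w /=.
  rewrite in_itv/= andbT => /rat_in_itvoo[q]; rewrite in_itv/= => /andP[yq qf].
  by exists q => //; rewrite (ltW yq).
move=> [q _]; case: ifP => // yq /= qf; rewrite in_itv/= andbT; exact: le_lt_trans qf.
Qed.

Import HBNNSimple.

(** The comparison passes through the simple functions below [f], which covers an [f] of unknown
    measurability. *)
Lemma ge0_le_integral_on (P : probability T R) (G : set T) (f g : T -> \bar R) :
  measurable G -> P (~` G) = 0%E -> (forall w, 0 <= f w)%E -> (forall w, 0 <= g w)%E ->
  measurable_fun setT g -> (forall w, G w -> f w <= g w)%E ->
  (\int[P]_w f w <= \int[P]_w g w)%E.
Proof.
move=> mG PG f0 g0 mg fg; rewrite ge0_integralTE//; apply: ge_ereal_sup => _ [h /= hf <-].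
rewrite -integralT_nnsfun; apply: ae_ge0_le_integral => //.
  by move=> w _; rewrite lee_fin; exact: fun_ge0.
  by apply/measurable_EFinP.
exists (~` G); split => //; first exact: measurableC.
move=> w /= hw Gw; apply: hw => _; exact: le_trans (fg w Gw).
Qed.

End rational_sections.

Section regularisation.
Context {R : realType} {dT : measure_display} {T : measurableType dT}.
Variables (P : probability T R) (G : set T) (p : T).
Hypothesis Pcomplete : forall A, P.-negligible A -> measurable A.
Hypothesis PG : P.-negligible (~` G).

(* Composing with [retract] turns almost sure properties into sure ones without
   changing any law. *)
Definition retract (w : T) : T := if `[< G w >] then w else p.

Let mG : measurable G.
Proof. by rewrite -[G]setCK; apply: measurableC; exact: Pcomplete. Qed.

Lemma retract_in : G p -> forall w, G (retract w).
Proof. by move=> Gp w; rewrite /retract; case: asboolP. Qed.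

Lemma retract_id w : G w -> retract w = w.
Proof. by rewrite /retract; case: asboolP. Qed.

Let aeq_retract (D : set T) : aeq P (retract @^-1` D) D.
Proof.
apply: negligibleS PG => w /= [[]|[]]; rewrite /retract; case: asboolP => //.
Qed.

Lemma measurable_retract : measurable_fun setT retract.
Proof.
move=> _ D mD; rewrite setTI.
have -> : retract @^-1` D = (D `&` G) `|` (if `[< D p >] then ~` G else set0).
  apply/seteqP; split => w; rewrite /retract /=.
    by case: asboolP => // Gw Dw; [left|right; rewrite asboolT].
  by case: asboolP => [Gw [[//]|]|nG [[//]|]]; case: asboolP.
by apply: measurableU; [exact: measurableI|case: ifP => // _; exact: measurableC].
Qed.

Lemma measurable_preimage_retract (D : set T) : measurable (retract @^-1` D) -> measurable D.
Proof.
move=> mD; have -> : D = (retract @^-1` D `&` G) `|` (D `&` ~` G).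
  apply/seteqP; split => w /=.
    by move=> Dw; have [Gw|nG] := pselect (G w); [left; rewrite retract_id|right].
  by move=> [[]|[]//]; rewrite /retract; case: asboolP.
apply: measurableU; first exact: measurableI.
by apply: Pcomplete; apply: negligibleS PG => w [].
Qed.

Lemma retract_law (D : set T) : measurable (retract @^-1` D) -> P (retract @^-1` D) = P D.
Proof.
move=> mD; have mD' := measurable_preimage_retract mD.
by rewrite [LHS](prE _ mD) [RHS](prE _ mD') (pr_aeq mD mD' (@aeq_retract D)).
Qed.

End regularisation.

Lemma init_incr_sys_eq {R : realType} {d : nat} {dT : measure_display} {T : measurableType dT}
    {N : nat} (x0 : 'I_N -> T -> 'rV[R]_d) (B B' : nat -> R -> T -> 'rV[R]_d) (t : R) (i : 'I_N) :
  0 < t -> (forall s, 0 <= s -> B i s = B' i s) ->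
  init_incr_sys x0 B t i = init_incr_sys x0 B' t i.
Proof.
move=> t0 e; have E n k l : incr B t n k (i, l) = incr B' t n k (i, l).
  have h k' : 0 <= k'%:R * (t / n%:R) by rewrite mulr_ge0// divr_ge0// ltW.
  by apply/funext => w; rewrite /incr /= !e.
rewrite /init_incr_sys (_ : incr_sys1 B t i = incr_sys1 B' t i)//.
by apply/seteqP; split => A [n [k [l [C [kn mC ->]]]]]; exists n, k, l, C; rewrite E.
Qed.

Section fixed_common_noise.
Context {R : realType} {d : nat} {dT : measure_display} {T : measurableType dT}.
Variables (P : probability T R) (F : R -> set (set T)) (B : nat -> R -> T -> 'rV[R]_d).
Hypothesis Pcomplete : forall A, P.-negligible A -> measurable A.
Hypothesis filF : filtration F.
Hypothesis BM : forall i, brownian_motion P F (B i).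
Hypothesis indB : independent_sigma P (fun i => sigma_process (B i)).
Variables (N : nat) (gV gW : 'rV[R]_d -> 'rV[R]_d) (LV LW sigma beta : R).
Hypothesis N2 : (2 <= N)%N.
Hypothesis LV0 : 0 <= LV.
Hypothesis LW0 : 0 <= LW.
Hypothesis lipV : sup_lip LV gV.
Hypothesis lipW : sup_lip LW gW.
Hypothesis beta0 : 0 < beta.
Hypothesis gVmon : forall x y, beta * dot (x - y) (x - y) <= dot (gV x - gV y) (x - y).
Hypothesis gWmon : forall x y, 0 <= dot (gW x - gW y) (x - y).
Hypothesis gWodd : forall x, gW (- x) = - gW x.
Variable LE : R.
Hypothesis LE0 : 0 <= LE.
Hypothesis lipE : forall x y, dot (gW x - gW y) (gW x - gW y) <= LE * dot (x - y) (x - y).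
Variables (x xn : 'I_N -> R -> T -> 'rV[R]_d) (c : R -> 'rV[R]_d).
Variables (m : R -> P2Rd R d) (mu nu : probability (Rd R d) R).

Let solves_path (b : R -> 'rV[R]_d) (y : R -> 'rV[R]_d) (B : R -> 'rV[R]_d) :=
  forall t, 0 <= t ->
   (forall k, lebesgue_measure.-integrable `[0, t] (fun s => (b s 0 k)%:E)) /\
   y t = y 0 + \row_k \int[lebesgue_measure]_(s in `[0, t]) b s 0 k + sigma *: B t + c t.

(* Rational times only: the null set of common noises to discard depends on the time. *)
Hypothesis mx : forall i (a b : nat), measurable_fun setT (x i (a%:R / b.+1%:R) : T -> Rd R d).
Hypothesis mxn : forall i (a b : nat), measurable_fun setT (xn i (a%:R / b.+1%:R) : T -> Rd R d).
Hypothesis cont_path : {ae P, forall w i,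
  {within `[0, +oo[, continuous (fun t => x i t w)} /\
  {within `[0, +oo[, continuous (fun t => xn i t w)}}.
Hypothesis eq_path : {ae P, forall w i,
  solves_path (fun s => mv_drift gV gW (fun s => P2_prob (m s)) s (x i s w)) (fun s => x i s w) (fun s => B i s w) /\
  solves_path (fun s => pdrift gV gW xn i s w) (fun s => xn i s w) (fun s => B i s w)}.
Hypothesis law : forall i t, 0 <= t -> forall C : set (Rd R d), measurable C ->
  P (x i t @^-1` C) = P2_prob (m t) C.
Hypothesis augx0 : forall i (C : set (Rd R d)), measurable C ->
  forall s, 0 < s -> aug P (F s) (x i 0 @^-1` C).
Hypothesis iidx : forall C : 'I_N -> set (Rd R d), (forall i, measurable (C i)) ->
  P [set w | forall i, C i (x i 0 w)] = (\prod_(i < N) fine (mu (C i)))%:E.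
Hypothesis iidxn : forall C : 'I_N -> set (Rd R d), (forall i, measurable (C i)) ->
  P [set w | forall i, C i (xn i 0 w)] = (\prod_(i < N) fine (nu (C i)))%:E.
Variables (Mx Mn : R).
Hypothesis meanx : mean_le mu (fun y : Rd R d => dot y y) Mx.
Hypothesis meann : mean_le nu (fun y : Rd R d => dot y y) Mn.

Let good : set T := [set w |
  [/\ forall i, {within `[0, +oo[, continuous (fun t => x i t w)} /\
        {within `[0, +oo[, continuous (fun t => xn i t w)},
      forall i, solves_path (fun s => mv_drift gV gW (fun s => P2_prob (m s)) s (x i s w)) (fun s => x i s w) (fun s => B i s w) /\
        solves_path (fun s => pdrift gV gW xn i s w) (fun s => xn i s w) (fun s => B i s w) &
      forall i, B i 0 w = 0 /\ {within `[0, +oo[, continuous (fun t => B i t w)}]].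

Let ae_good : P.-negligible (~` good).
Proof.
have hB : {ae P, forall w i, B i 0 w = 0 /\ {within `[0, +oo[, continuous (fun t => B i t w)}}.
  apply: ae_foralln => i; have [_ h1 h2 _] := BM i.
  by apply: filterS2 h1 h2.
have h : {ae P, forall w, good w}.
  by apply: filterS3 cont_path eq_path hB => w h1 h2 h3; split.
exact: h.
Qed.

Let mgood : measurable good.
Proof. by rewrite -[good]setCK; apply: measurableC; exact: Pcomplete. Qed.

Let Pgood : P (~` good) = 0%E.
Proof. by apply/negligibleP => //; exact: measurableC. Qed.

Let ex_good : exists p, good p.
Proof.
apply: contrapT => /forallNP h.
have : P (~` good) = 1%E.
  by rewrite (_ : ~` good = setT) ?probability_setT//; apply/seteqP; split => // w _; exact: h.
by rewrite Pgood => /eqP; rewrite eq_sym onee_eq0.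
Qed.

Let p := sval (cid ex_good).
Let pr_good : good p := svalP (cid ex_good).
Let r := retract good p.
Let good_r w : good (r w). Proof. exact: retract_in. Qed.
Let mr : measurable_fun setT r. Proof. exact: (measurable_retract p Pcomplete ae_good). Qed.

Let coordE (a b e : 'rV[R]_d) (f : 'I_d -> R) k :
  (a + \row_k f k + sigma *: b + e) 0 k = a 0 k + f k + sigma * b 0 k + e 0 k.
Proof. by rewrite !mxE. Qed.

Let tau (t : R) := Num.max t 0.
Let tau_ge0 t : 0 <= tau t. Proof. by rewrite /tau le_max lexx orbT. Qed.
Let tauE t : 0 <= t -> tau t = t. Proof. by move=> t0; exact/max_idPl. Qed.

(** Sure versions: the time is cut at 0 and the outcome is retracted to [good], where every almost
    sure property holds. *)
Let X i t w := x i (tau t) (r w).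
Let XN i t w := xn i (tau t) (r w).
Let Br (i : nat) t w := B i (tau t) (r w).
Let m' t := P2_prob (m (tau t)).

Let cX i w : continuous (fun t => X i t w).
Proof. by apply: (continuous_maxr0 (f := fun t => x i t (r w))); have [/(_ i)[]] := good_r w. Qed.

Let cXN i w : continuous (fun t => XN i t w).
Proof. by apply: (continuous_maxr0 (f := fun t => xn i t (r w))); have [/(_ i)[]] := good_r w. Qed.

Let cBr i w : continuous (fun t => Br i t w).
Proof. by apply: (continuous_maxr0 (f := fun t => B i t (r w))); have [_ _ /(_ i)[]] := good_r w. Qed.

(** The times [floor (t (n + 1)) / (n + 1)] have the fractional form for which measurability is
    given, and path continuity passes to the limit. *)
Let measurable_path (y : 'I_N -> R -> T -> 'rV[R]_d) i t :
  (forall i (a b : nat), measurable_fun setT (y i (a%:R / b.+1%:R) : T -> Rd R d)) ->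
  (forall w, continuous (fun t => y i (tau t) (r w))) ->
  measurable_fun setT (fun w => y i (tau t) (r w) : Rd R d).
Proof.
move=> my cy; apply: measurable_Rd => k.
pose q n : R := (Num.truncn (tau t * n.+1%:R))%:R / n.+1%:R.
have q0 n : 0 <= q n by rewrite divr_ge0.
have qt : q n @[n --> \oo] --> tau t.
  apply/cvgrPdist_le => /= e e0; near=> n.
  have n0 : 0 < n.+1%:R :> R by rewrite ltr0n.
  have h0 : 0 <= tau t * n.+1%:R by rewrite mulr_ge0.
  have /andP[h1 h2] := truncn_itv h0.
  have -> : tau t - q n = (tau t * n.+1%:R - (Num.truncn (tau t * n.+1%:R))%:R) / n.+1%:R.
    by rewrite /q mulrBl mulfK// gt_eqF.
  rewrite ger0_norm ?divr_ge0 ?subr_ge0//.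
  apply: le_trans (_ : n.+1%:R^-1 <= _).
    rewrite ler_pdivrMr// mulVf ?gt_eqF// lerBlDr addrC natr1; exact: ltW.
  by apply: ltW; near: n; exact: (near_infty_natSinv_lt (PosNum e0)).
apply: (@measurable_fun_cvg _ _ _ setT (fun n w => y i (q n) (r w) 0 k)).
  move=> n; apply: (measurableT_comp (measurable_coord k)).
  exact: (measurableT_comp (my i _ n) mr).
move=> w _; rewrite /=.
have h : y i (tau (q n)) (r w) @[n --> \oo] --> y i (tau (tau t)) (r w) by exact: (cvg_comp _ _ qt (cy w (tau t))).
have e n : tau (q n) = q n by exact: tauE.
move: h; rewrite tauE//; under eq_fun do rewrite e.
by move=> h; exact: (cvg_comp _ _ h (@continuous_rV_coord R d k _)).
Unshelve. all: by end_near.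
Qed.

Let mX i t : measurable_fun setT (X i t : T -> Rd R d).
Proof. by apply: measurable_path => // w; exact: cX. Qed.

Let mXN i t : measurable_fun setT (XN i t : T -> Rd R d).
Proof. by apply: measurable_path => // w; exact: cXN. Qed.

Let mB i t : 0 <= t -> measurable_fun setT (B i t : T -> Rd R d).
Proof. exact: (measurable_brownian filF BM). Qed.

Let mBr i t : measurable_fun setT (Br i t : T -> Rd R d).
Proof. exact: (measurableT_comp (mB i (tau_ge0 t)) mr). Qed.

Let r_law (D : set T) : measurable (r @^-1` D) -> P (r @^-1` D) = P D.
Proof. exact: (retract_law Pcomplete ae_good). Qed.

Let mean_r (f : T -> R) K : mean_le P f K -> mean_le P (fun w => f (r w)) K.
Proof.
move=> [mf f0 hf]; split => //; first exact: measurableT_comp.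
rewrite (ge0_integral_law (mu := P) (nu := P) (f := r) (g := fun w => (f w)%:E))//.
- by move=> C mC; apply: r_law; rewrite -[X in measurable X]setTI; exact: mr.
- exact/measurable_EFinP.
Qed.

Let x_law i (C : set (Rd R d)) : measurable C -> P (X i 0 @^-1` C) = P (x i 0 @^-1` C).
Proof.
move=> mC; have -> : X i 0 @^-1` C = r @^-1` (x i 0 @^-1` C) by rewrite /X tauE.
by apply: r_law; have := mX i 0 measurableT mC; rewrite setTI /X tauE.
Qed.

Let xn_law i (C : set (Rd R d)) : measurable C -> P (XN i 0 @^-1` C) = P (xn i 0 @^-1` C).
Proof.
move=> mC; have -> : XN i 0 @^-1` C = r @^-1` (xn i 0 @^-1` C) by rewrite /XN tauE.
by apply: r_law; have := mXN i 0 measurableT mC; rewrite setTI /XN tauE.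
Qed.

Let marginal (y : 'I_N -> T -> 'rV[R]_d) (rho : probability (Rd R d) R) i (C : set (Rd R d)) :
  (forall C : 'I_N -> set (Rd R d), (forall i, measurable (C i)) ->
    P [set w | forall i, C i (y i w)] = (\prod_(i < N) fine (rho (C i)))%:E) ->
  measurable C -> P (y i @^-1` C) = rho C.
Proof.
move=> h mC; pose D j := if j == i then C else setT.
have Di : D i = C by rewrite /D eqxx.
have := h D; rewrite (bigD1 i)//= Di big1 ?mulr1; last first.
  by move=> j /negPf ji; rewrite /D ji probability_setT.
rewrite fineK ?fin_num_measure// => <-; last by move=> j; rewrite /D; case: ifP.
congr (P _); apply/seteqP; split => w /=.
  by move=> Cy j; rewrite /D; case: eqP => [->|].
by move=> /(_ i); rewrite /D eqxx.
Qed.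

Let mean_init (y : T -> 'rV[R]_d) (rho : probability (Rd R d) R) M :
  measurable_fun setT (y : T -> Rd R d) ->
  (forall C : set (Rd R d), measurable C -> P (y @^-1` C) = rho C) ->
  mean_le rho (fun z : Rd R d => dot z z) M -> mean_le P (fun w => dot (y w) (y w)) M.
Proof.
move=> my hy [_ _ hM]; split; [exact: measurable_dot|by move=> w; exact: dot_ge0|].
rewrite (ge0_integral_law (nu := rho) (f := y : T -> Rd R d) (g := fun z => (dot z z)%:E))//.
- by move=> z; rewrite lee_fin dot_ge0.
- by apply/measurable_EFinP; exact: (@measurable_dot _ _ _ (Rd R d) id).
Qed.

Let sol i : mv_solution P gV gW LV LW sigma (8 * d%:R) (X i) (Br i) c m'.
Proof.
split => //.
- by move=> t w t0; rewrite /X /tau (max_idPr t0) maxxx.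
- by move=> w; rewrite /Br tauE//; have [_ _ /(_ i)[]] := good_r w.
- move=> s t s0 st; rewrite /Br (tauE s0) (tauE (le_trans s0 st)).
  exact: (mean_r (brownian_incr_moment filF (BM i) s0 st)).
- move=> t C mC; rewrite -(law i (tau_ge0 t) mC).
  apply: (r_law (D := x i (tau t) @^-1` C)).
  by have := mX i t measurableT mC; rewrite setTI.
- by move=> t; exact: P2_moment.
move=> w t k t0; have [_ /(_ i)[/(_ t t0)[h1 h2] _] _] := good_r w.
have E s : `[0, t]%classic s -> mv_drift gV gW m' s (X i s w) =
    mv_drift gV gW (fun s => P2_prob (m s)) s (x i s (r w)).
  by rewrite /= in_itv/= => /andP[s0 _]; rewrite /mv_drift /m' /X tauE.
split.
  by apply: eq_integrable (h1 k) => // s; rewrite inE => hs; rewrite E.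
have XE q : 0 <= q -> X i q w = x i q (r w) by move=> q0; rewrite /X tauE.
have -> : Br i t w = B i t (r w) by rewrite /Br tauE.
have EI : pint 0 t (fun s => mv_drift gV gW m' s (X i s w) 0 k) = pint 0 t (fun s => mv_drift gV gW (fun s => P2_prob (m s)) s (x i s (r w)) 0 k).
  by apply: eq_Rintegral => s; rewrite inE => hs; rewrite -E.
rewrite EI; move: h2; rewrite -(XE _ t0) -(XE _ (lexx 0)) => ->; exact: coordE.
Qed.

Let XNeq i w t k : 0 <= t ->
  (lebesgue_measure.-integrable `[0, t] (fun s => (pdrift gV gW XN i s w 0 k)%:E)) /\
  XN i t w 0 k = XN i 0 w 0 k + pint 0 t (fun s => pdrift gV gW XN i s w 0 k)
    + sigma * Br i t w 0 k + c t 0 k.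
Proof.
move=> t0; have [_ /(_ i)[_ /(_ t t0)[h1 h2]] _] := good_r w.
have E s : `[0, t]%classic s -> pdrift gV gW XN i s w = pdrift gV gW xn i s (r w).
  rewrite /= in_itv/= => /andP[s0 _]; rewrite /pdrift /XN tauE//.
split.
  by apply: eq_integrable (h1 k) => // s; rewrite inE => hs; rewrite E.
have XE q : 0 <= q -> XN i q w = xn i q (r w) by move=> q0; rewrite /XN tauE.
have -> : Br i t w = B i t (r w) by rewrite /Br tauE.
have EI : pint 0 t (fun s => pdrift gV gW XN i s w 0 k) = pint 0 t (fun s => pdrift gV gW xn i s (r w) 0 k).
  by apply: eq_Rintegral => s; rewrite inE => hs; rewrite -E.
rewrite EI; move: h2; rewrite -(XE _ t0) -(XE _ (lexx 0)) => ->; exact: coordE.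
Qed.

Let mx0 i : measurable_fun setT (x i 0 : T -> Rd R d).
Proof. by have := mx i 0%N 0%N; rewrite mul0r. Qed.

Let indx0 : indepN P (fun i => [set A | exists2 C : set (Rd R d), measurable C & A = x i 0 @^-1` C]).
Proof.
move=> A hA; have /choice[C hC] : forall i, exists C : set (Rd R d), measurable C /\ A i = x i 0 @^-1` C.
  by move=> i; have [C mC ->] := hA i; exists C.
have mC i := (hC i).1; have AE i := (hC i).2.
have -> : \big[setI/setT]_i A i = [set w | forall i, C i (x i 0 w)].
  apply/seteqP; split => w => [/bigsetIP h i|h].
    by have := h i isT; rewrite AE.
  by apply/bigsetIP => i _; rewrite AE; exact: h.
rewrite /pr iidx//=; apply: eq_bigr => i _; rewrite AE.
by rewrite (marginal (y := fun i w => x i 0 w) i iidx).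
Qed.

(** The systems of the retracted processes lie in preimages of the original ones under the
    law-preserving retraction, which transports independence. *)
Let indG s : 0 <= s -> exists G : 'I_N -> set (set T),
  [/\ forall i, sigma_algebra setT (G i), forall i, measurable_sys (G i), indepN P G &
      forall i, measurable_wrt (G i) (X i s : T -> Rd R d)].
Proof.
(* Grids need a positive horizon; at time 0 any horizon will do. *)
move=> s0; pose t := if s == 0 then 1 else s.
have t0 : 0 < t by rewrite /t; case: eqP => // /eqP sN0; rewrite lt_neqAle eq_sym sN0.
pose S i := init_incr_sys (fun i => X i 0) Br t i.
have SE i : S i = init_incr_sys (fun i => x i 0 \o r) (fun i s => B i s \o r) t i.
  rewrite /S (_ : (fun i => X i 0) = fun i => x i 0 \o r); last by apply/funext => j; rewrite /X tauE.
  by apply: init_incr_sys_eq => // q q0; rewrite /Br tauE.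
have Spre i : S i `<=` preimage_set_system setT r (init_incr_sys (fun i => x i 0) B t i).
  by rewrite SE; exact: init_incr_sys_comp.
have mI i : measurable_sys (init_incr_sys (fun i => x i 0) B t i).
  exact: (init_incr_sys_measurable filF BM mx0).
have mS i : measurable_sys (S i).
  by move=> A /Spre[C /mI mC <-]; exact: mr.
exists (fun i => <<s S i >>); split.
- by move=> i; exact: smallest_sigma_algebra.
- by move=> i; exact: g_sigma_measurable_sys.
- apply: indepN_sigma => //.
  + by move=> i; exact: init_incr_sysI.
  + by move=> i; exact: init_incr_sys_setT.
  apply: indepN_sub Spre _; apply: indepN_preimage => //.
    by move=> A mA; apply: r_law; rewrite -[X in measurable X]setTI; exact: mr.
  exact: (init_incr_sys_indep filF BM indB mx0 augx0 indx0 t0).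
move=> i; have G0 : measurable_wrt <<s S i >> (X i 0 : T -> Rd R d).
  move=> C mC; apply: sub_sigma_algebra; exists C, setT; split; rewrite ?setIT//.
  exact: sigma_algebraT (smallest_sigma_algebra _ _).
have [e|sN0] := eqVneq s 0; first by rewrite e.
have ts : t = s by rewrite /t (negPf sN0).
have {}s0 : 0 < s by rewrite -ts.
apply: (mv_measurable_wrt (sol i) (smallest_sigma_algebra _ _) s0 G0).
move=> n k l kn C mC; apply: sub_sigma_algebra; rewrite /S ts.
exists setT; eexists; split; [exact: measurableT| |by rewrite preimage_setT setTI].
by apply: sub_sigma_algebra; exists n, k, l, C.
Qed.

(** [2 Mx + 2 Mn] and [4 Mx] bound the initial mean squares of [X i - XN i] and of [X i - X j];
    [8 d] is the constant of [brownian_incr_moment]. The function [h] will be the Wasserstein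
    distance, used through its upper bound. *)
Lemma fixed_noise_bound t (h : T -> R) : 0 <= t -> (forall w, 0 <= h w) ->
  (forall w, h w <= Num.sqrt (N%:R^-1 * \sum_i dot (x i t w - xn i t w) (x i t w - xn i t w))) ->
  (\int[P]_w (h w)%:E <=
   (expR (- beta * t) * Num.sqrt (2 * Mx + 2 * Mn) +
    Num.sqrt (LE * (expR (beta / 2) * (4 * Mx) + @mv_diff_const R d LV LW sigma (8 * d%:R) beta)) /
      (beta * Num.sqrt N%:R))%:E)%E.
Proof.
move=> t0 h0 hh.
have mX0 i : mean_le P (fun w => dot (X i 0 w) (X i 0 w)) Mx.
  apply: (mean_init (rho := mu)) => // C mC; rewrite x_law//.
  exact: (marginal (y := fun i w => x i 0 w)).
have mXN0 i : mean_le P (fun w => dot (XN i 0 w) (XN i 0 w)) Mn.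
  apply: (mean_init (rho := nu)) => // C mC; rewrite xn_law//.
  exact: (marginal (y := fun i w => xn i 0 w)).
have meanK i j s : 0 <= s -> mean_le P (fun w => dot (X i s w - X j s w) (X i s w - X j s w))
    (expR (beta / 2) * (4 * Mx) + @mv_diff_const R d LV LW sigma (8 * d%:R) beta).
  move=> s0; apply: (mv_diff_mean_le (sol i) (sol j)) => //=.
  rewrite (_ : 4 * Mx = 2 * Mx + 2 * Mx); last by ring.
  apply: mean_leW (mean_leD (mean_leZ (ler0n R 2) (mX0 i)) (mean_leZ (ler0n R 2) (mX0 j))).
    by apply: measurable_dot; exact: measurable_RdB.
  by move=> w; rewrite dot_ge0 dotB_le.
have meanM i : mean_le P (fun w => dot (X i 0 w - XN i 0 w) (X i 0 w - XN i 0 w)) (2 * Mx + 2 * Mn).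
  apply: mean_leW (mean_leD (mean_leZ (ler0n R 2) (mX0 i)) (mean_leZ (ler0n R 2) (mXN0 i))).
    by apply: measurable_dot; exact: measurable_RdB.
  by move=> w; rewrite dot_ge0 dotB_le.
have [mq q0 hq] := coupling_mean sol mXN cXN XNeq beta0 gVmon gWmon gWodd N2 LE0 lipE meanK meanM indG t0.
apply: le_trans hq; apply: (ge0_le_integral_on mgood Pgood) => //; first exact/measurable_EFinP.
move=> w Gw; rewrite lee_fin; apply: le_trans (hh w) _.
by rewrite /X /XN tauE// /r retract_id.
Qed.

End fixed_common_noise.

(** * Wasserstein distances and second moments *)

Section empirical_coupling.
Context {R : realType} {dE : measure_display} {E : measurableType dE}.
Import HBNNSimple.
Local Open Scope ereal_scope.

Lemma integral_empirical_le {N : nat} (y : 'I_N -> E) (f : E -> \bar R) :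
  (forall x, 0 <= f x) -> \int[empirical y]_x f x <= (N%:R^-1)%:E * \sum_(i < N) f (y i).
Proof.
move=> f0; rewrite ge0_integralTE//; apply: ge_ereal_sup => _ [h /= hf <-].
have mh : measurable_fun setT (fun x => (h x)%:E) by apply/measurable_EFinP.
rewrite -integralT_nnsfun (eq_measure_integral
  (mscale (N%:R^-1%:nng : {nonneg R})%R (msum (fun i => \d_(oapp y point (insub i))) N))); last first.
  move=> A _ _; rewrite /= /mscale/= /msum /empirical; congr (_ * _).
  by apply: eq_bigr => i _; rewrite valK.
rewrite ge0_integral_mscale//; last by move=> x _; rewrite lee_fin.
rewrite integral_measure_sum_nnsfun//=; apply: lee_wpmul2l; first by rewrite lee_fin.
apply: lee_sum => i _; rewrite valK/= integral_dirac//=.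
by rewrite diracT mul1e; exact: hf.
Qed.

Lemma empirical_setT {N : nat} (y : 'I_N -> E) : (0 < N)%N ->
  (empirical y : set E -> \bar R) setT = 1.
Proof.
move=> N0; rewrite /empirical; under eq_bigr do rewrite diracT.
by rewrite sumEFin -EFinM sumr_const card_ord -mulr_natr mul1r mulVf// pnatr_eq0 -lt0n.
Qed.

Lemma wasserstein2_le (dist : E -> E -> R) (mu nu : {measure set E -> \bar R})
    (pi : probability (E * E)%type R) (K : R) :
  couplings mu nu pi -> \int[pi]_z ((dist z.1 z.2) ^+ 2)%:E <= K%:E ->
  (wasserstein2 dist mu nu <= Num.sqrt K)%R.
Proof.
move=> hpi hK; rewrite /wasserstein2; set I := ereal_inf _.
have IK : I <= K%:E by apply: ge_ereal_inf; eexists; [exists pi|exact: hK].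
have I0 : 0 <= I.
  apply: le_ereal_inf_tmp => _ [rho _ <-].
  by apply: integral_ge0 => z _; rewrite lee_fin sqr_ge0.
apply: ler_wsqrtr; rewrite -lee_fin fineK// ge0_fin_numE//.
exact: le_lt_trans IK (ltry _).
Qed.

End empirical_coupling.

Section empirical_probability.
Context {R : realType} {dE : measure_display} {E : measurableType dE}.
Context {N : nat} (N0 : (0 < N)%N) (y : 'I_N -> E).

(** The dummy [let] keeps [N0] among the arguments, so that the unit mass can be attached to the
    measure. *)
Definition empirical_probability : set E -> \bar R := let _ := N0 in empirical y.

HB.instance Definition _ := Measure.copy empirical_probability (empirical y).
HB.instance Definition _ :=
  Measure_isProbability.Build _ _ _ empirical_probability (empirical_setT y N0).

End empirical_probability.

(** Particles of equal index are coupled: the empirical measure of the pairs has the two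
    marginals. *)
Lemma wasserstein2_empirical_le {R : realType} {dE : measure_display} {E : measurableType dE}
    {N : nat} (dist : E -> E -> R) (x y : 'I_N -> E) : (0 < N)%N ->
  wasserstein2 dist (empirical x) (empirical y) <=
  Num.sqrt (N%:R^-1 * \sum_(i < N) dist (x i) (y i) ^+ 2).
Proof.
move=> N0; pose z i := (x i, y i).
apply: (wasserstein2_le (pi := empirical_probability N0 z)).
  move=> A mA; rewrite /= /empirical_probability /empirical; split; congr (_ * _)%E; apply: eq_bigr => i _;
    rewrite !diracE; congr (_%:R%:E); congr (nat_of_bool _); apply/idP/idP; rewrite !inE /=; tauto.
apply: le_trans (integral_empirical_le z _) _; first by move=> w; rewrite lee_fin sqr_ge0.
by rewrite sumEFin -EFinM.
Qed.

(** * The second moment as a function on the Wasserstein space *)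

Section second_moment.
Context {R : realType} {d : nat}.
Local Notation P2R := (P2Rd R d).
Implicit Types mu nu : P2R.

Definition second_moment mu : R := fine (\int[P2_prob mu]_(x in setT) (dot (x : 'rV[R]_d) x)%:E)%E.

Lemma second_momentP mu : mean_le (P2_prob mu) (fun x : Rd R d => dot x x) (second_moment mu).
Proof.
have [K [mf f0 hK]] := finite_moment2_dot (P2_moment mu); split => //.
rewrite /second_moment fineK// ge0_fin_numE; first exact: le_lt_trans hK (ltry _).
by apply: integral_ge0 => x _; rewrite lee_fin dot_ge0.
Qed.

Lemma second_moment_ge0 mu : 0 <= second_moment mu.
Proof. exact: mean_le_ge0 (second_momentP mu). Qed.

Let mean_fst (pi : probability (Rd R d * Rd R d)%type R) mu nu : couplings (P2_prob mu) (P2_prob nu) pi ->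
  mean_le pi (fun z : Rd R d * Rd R d => dot z.1 z.1) (second_moment mu).
Proof.
move=> hpi; have [mf f0 hf] := second_momentP mu; split.
- exact: (measurableT_comp mf measurable_fst).
- by move=> z; exact: dot_ge0.
apply: le_trans hf; rewrite (ge0_integral_law (nu := P2_prob mu) (f := fst) (g := fun x : Rd R d => (dot x x)%:E))//.
- move=> C mC; have [<- _] := hpi C mC; congr (pi _); apply/seteqP; split => z /=; tauto.
- exact/measurable_EFinP.
Qed.

Let mean_snd (pi : probability (Rd R d * Rd R d)%type R) mu nu : couplings (P2_prob mu) (P2_prob nu) pi ->
  mean_le pi (fun z : Rd R d * Rd R d => dot z.2 z.2) (second_moment nu).
Proof.
move=> hpi; have [mf f0 hf] := second_momentP nu; split.
- exact: (measurableT_comp mf measurable_snd).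
- by move=> z; exact: dot_ge0.
apply: le_trans hf; rewrite (ge0_integral_law (nu := P2_prob nu) (f := snd) (g := fun x : Rd R d => (dot x x)%:E))//.
- move=> C mC; have [_ <-] := hpi C mC; congr (pi _); apply/seteqP; split => z /=; tauto.
- exact/measurable_EFinP.
Qed.

Let le_mean_snd (pi : probability (Rd R d * Rd R d)%type R) mu nu K : couplings (P2_prob mu) (P2_prob nu) pi ->
  mean_le pi (fun z : Rd R d * Rd R d => dot z.2 z.2) K -> second_moment nu <= K.
Proof.
move=> hpi [_ _ hK]; have [mf f0 hf] := second_momentP nu.
rewrite -lee_fin /second_moment fineK; last first.
  rewrite ge0_fin_numE; first exact: le_lt_trans hf (ltry _).
  by apply: integral_ge0 => x _; rewrite lee_fin dot_ge0.
apply: le_trans hK; rewrite (ge0_integral_law (nu := P2_prob nu) (f := snd) (g := fun x : Rd R d => (dot x x)%:E))//.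
- move=> C mC; have [_ <-] := hpi C mC; congr (pi _); apply/seteqP; split => z /=; tauto.
- exact/measurable_EFinP.
Qed.

Let mdist : measurable_fun setT (fun z : Rd R d * Rd R d => eucl_dist z.1 z.2 ^+ 2).
Proof.
rewrite (_ : (fun z => _) = fun z : Rd R d * Rd R d => dot (z.1 - z.2) (z.1 - z.2)); last first.
  by apply/funext => z; rewrite sqr_eucl_norm.
by apply: measurable_dot; apply: measurable_RdB.
Qed.

(** The second coordinate is the first minus their difference, and the square is split with weight
    [eta]. A small [eta] brings the coefficient of the first moment close to 1. *)
Let coupling_le (pi : probability (Rd R d * Rd R d)%type R) mu nu (eta : R) : 0 < eta ->
  couplings (P2_prob mu) (P2_prob nu) pi ->
  ((second_moment nu)%:E <= ((1 + eta) * second_moment mu)%:E +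
    (1 + eta^-1)%:E * \int[pi]_z ((eucl_dist z.1 z.2) ^+ 2)%:E)%E.
Proof.
move=> eta0 hpi; have e0 : 0 < eta^-1 by rewrite invr_gt0.
set I := (\int[pi]_z _)%E.
have I0 : (0 <= I)%E by apply: integral_ge0 => z _; rewrite lee_fin sqr_ge0.
have [If|] := boolP (I \is a fin_num); last first.
  by rewrite ge0_fin_numE// ltey negbK => /eqP ->; rewrite gt0_muley ?addey ?leey// lte_fin; lra.
have hI : mean_le pi (fun z : Rd R d * Rd R d => eucl_dist z.1 z.2 ^+ 2) (fine I).
  by split => // [z|]; [exact: sqr_ge0|rewrite fineK].
have h1 : 0 <= 1 + eta by lra.
have h2 : 0 <= 1 + eta^-1 by lra.
rewrite -(fineK If) -EFinM -EFinD lee_fin; apply: (le_mean_snd hpi).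
apply: mean_leW (mean_leD (mean_leZ h1 (mean_fst hpi)) (mean_leZ h2 hI)).
  exact: (measurable_dot (T := (Rd R d * Rd R d)%type) (Y := snd)).
move=> z; rewrite dot_ge0/= sqr_eucl_norm.
have := dot_le_amgm z.1 (- (z.1 - z.2)) eta0; rewrite dotN2 => h.
have := dotDD z.1 (- (z.1 - z.2)); rewrite dotN2 opprB [z.1 + _]addrC subrK => ->.
by rewrite opprB in h; lra.
Qed.

Let couplings_prod mu nu : couplings (P2_prob mu) (P2_prob nu) (P2_prob mu \x P2_prob nu)%E.
Proof.
move=> A mA; split.
  by apply: etrans (product_measure1E _ _ mA measurableT) _; rewrite [X in (_ * X)%E]probability_setT mule1.
by apply: etrans (product_measure1E _ _ measurableT mA) _; rewrite [X in (X * _)%E]probability_setT mul1e.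
Qed.

(* The infimum defining [d2] is finite, so that [fine] does not destroy it. *)
Lemma second_moment_le_d2 mu nu (eta : R) : 0 < eta ->
  second_moment nu <= (1 + eta) * second_moment mu + (1 + eta^-1) * d2 mu nu ^+ 2.
Proof.
move=> eta0; have e0 : 0 < eta^-1 by rewrite invr_gt0.
rewrite /d2 /wasserstein2; set S := [set _ | _ in _].
have I0 : (0 <= ereal_inf S)%E.
  apply: le_ereal_inf_tmp => _ [rho _ <-].
  by apply: integral_ge0 => z _; rewrite lee_fin sqr_ge0.
have If : ereal_inf S \is a fin_num.
  pose pi : probability (Rd R d * Rd R d)%type R := (P2_prob mu \x P2_prob nu)%E.
  have hpi : couplings (P2_prob mu) (P2_prob nu) pi := couplings_prod mu nu.
  have [_ _ h] : mean_le pi (fun z : Rd R d * Rd R d => eucl_dist z.1 z.2 ^+ 2) (2 * second_moment mu + 2 * second_moment nu).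
    apply: mean_leW (mean_leD (mean_leZ (ler0n R 2) (mean_fst hpi)) (mean_leZ (ler0n R 2) (mean_snd hpi))) => // z.
    by rewrite sqr_ge0/= sqr_eucl_norm dotB_le.
  rewrite ge0_fin_numE//; apply: le_lt_trans (ltry _).
  by apply: le_trans h; apply: ereal_inf_lbound; exists pi.
rewrite sqr_sqrtr ?fine_ge0//.
rewrite -lerBlDl -ler_pdivrMl; last by lra.
rewrite -lee_fin fineK//; apply: le_ereal_inf_tmp => _ [pi hpi <-].
have := coupling_le eta0 hpi; set I := (\int[_]_z _)%E.
rewrite -leeBlDl// -EFinB muleC -lee_pdivrMr; last by lra.
by rewrite -EFinM mulrC.
Qed.

(** Strict sublevel sets are [d2_open], hence among the generators of the sigma-algebra: by
    [second_moment_le_d2] the second moment is upper semicontinuous. *)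
Lemma measurable_second_moment : measurable_fun setT (second_moment : P2R -> R).
Proof.
apply: (measurability (@RGenInftyO.G R)); first exact: RGenInftyO.measurableE.
move=> _ [_ [a ->] <-]; rewrite setTI; apply: sub_sigma_algebra => mu /=.
rewrite in_itv/= => hmu; have s0 := second_moment_ge0 mu.
pose g := a - second_moment mu.
have g0 : 0 < g by rewrite subr_gt0.
(* Half of the gap [g] goes to [eta] times the moment and half to the distance term; [+ 1] keeps the
   denominator positive. *)
pose eta := g / (2 * (second_moment mu + 1)).
have eta0 : 0 < eta by rewrite divr_gt0// mulr_gt0//; lra.
have e0 : 0 < 1 + eta^-1 by rewrite addr_gt0// invr_gt0.
have h1 : eta * second_moment mu <= g / 2.
  rewrite /eta -mulrA invfM -mulrA ler_wpM2l ?(ltW g0)// ler_piMr// mulrC ler_pdivrMr; lra.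
exists (Num.sqrt (g / (2 * (1 + eta^-1)))); first by rewrite sqrtr_gt0 divr_gt0// mulr_gt0.
move=> nu hnu /=; rewrite in_itv/=.
apply: le_lt_trans (second_moment_le_d2 mu nu eta0) _.
have : d2 mu nu ^+ 2 < g / (2 * (1 + eta^-1)).
  have d0 : 0 <= d2 mu nu by exact: sqrtr_ge0.
  by rewrite -[ltRHS]sqr_sqrtr ?ltr_pXn2r ?nnegrE ?sqrtr_ge0// divr_ge0 ?mulr_ge0// ltW.
rewrite -(ltr_pM2l e0) => h2.
have h3 (z u : R) : 0 < z -> z * (u / (2 * z)) = u / 2 by move=> z0; field; rewrite gt_eqF.
by rewrite (h3 _ _ e0) in h2; rewrite /g in h1 h2; lra.
Qed.

(** By the case [eta = 1] of [second_moment_le_d2], [f] is a measurable minorant of the squared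
    distance to [mu0], whose integral is finite. *)
Lemma mean_second_moment (Q : P2P2Rd R d) : exists K, mean_le (P2_prob Q) (second_moment : P2R -> R) K.
Proof.
have [mu0 h0] := P2_moment Q.
pose f mu := Num.max (second_moment mu / 2 - second_moment mu0) 0.
have mf : measurable_fun setT (f : P2R -> R).
  apply: measurable_maxr => //; apply: measurable_funB => //.
  by apply: measurable_funM => //; exact: measurable_second_moment.
have f0 mu : 0 <= f mu by rewrite /f le_max lexx orbT.
have hf : mean_le (P2_prob Q) f (fine (\int[P2_prob Q]_mu ((d2 mu0 mu) ^+ 2)%:E)%E).
  split => //; rewrite fineK; last first.
    by rewrite ge0_fin_numE//; apply: integral_ge0 => mu _; rewrite lee_fin sqr_ge0.
  apply: ge0_le_integralT => mu; first by rewrite lee_fin.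
  rewrite lee_fin /f ge_max sqr_ge0 andbT.
  by have := second_moment_le_d2 mu0 mu ltr01; rewrite invr1; lra.
have h := mean_leD (mean_le_cst (P2_prob Q) (c := 2 * second_moment mu0) _) (mean_leZ (ler0n R 2) hf).
eexists; apply: mean_leW (h _); first exact: measurable_second_moment.
  move=> mu; rewrite second_moment_ge0/= /f.
  have : second_moment mu / 2 - second_moment mu0 <= Num.max (second_moment mu / 2 - second_moment mu0) 0.
    by rewrite le_max lexx.
  by set M := Num.max _ _; lra.
by rewrite mulr_ge0// second_moment_ge0.
Qed.

End second_moment.

Section sections_of_adapted_processes.
Context {R : realType} {d : nat} {d0 d1 : measure_display}.
Context {T0 : measurableType d0} {T1 : measurableType d1}.
Variables (P0 : probability T0 R) (P1 : probability T1 R).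
Variables (F0 : R -> set (set T0)) (F1 : R -> set (set T1)).
Hypothesis filF0 : filtration F0.
Hypothesis filF1 : filtration F1.

(* Only countably many sets determine measurability, so that the exceptional set
   of [section_aug] can be chosen independently of the set. *)
Lemma section_measurable_wrt (t s : R) (Y : T0 * T1 -> 'rV[R]_d) : 0 <= t -> t < s ->
  measurable_wrt (augmented_filtration P0 P1 F0 F1 t) (Y : T0 * T1 -> Rd R d) ->
  {ae P0, forall w0, measurable_wrt (aug (completed P1) (F1 s))
    ((fun w1 => Y (w0, w1)) : completed_type P1 -> Rd R d)}.
Proof.
move=> t0 ts mY; have s0 : 0 <= s := le_trans t0 (ltW ts).
pose S (c : 'I_d * rat) : set (T0 * T1) := [set w | ratr c.2 < Y w 0 c.1].
have hS c : {ae P0, forall w0, aug (completed P1) (F1 s) [set w1 | S c (w0, w1)]}.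
  apply: (section_aug filF0 filF1 t0 ts).
  have -> : S c = Y @^-1` [set y : Rd R d | ratr c.2 < (y : 'rV[R]_d) 0 c.1] by [].
  apply: mY; have -> : [set y : Rd R d | ratr c.2 < (y : 'rV[R]_d) 0 c.1] =
      setT `&` ((fun y : Rd R d => (y : 'rV[R]_d) 0 c.1) @^-1` `]ratr c.2, +oo[%classic).
    by apply/seteqP; split => y /=; rewrite in_itv/= andbT => // -[].
  exact: measurable_coord.
have : {ae P0, forall w0 n, if unpickle n is Some c then aug (completed P1) (F1 s) [set w1 | S c (w0, w1)] else True}.
  by apply: ae_foralln => n; case: (unpickle n) => [c|]; [exact: hS|exact: nearW].
apply: filterS => w0 h.
have sa : sigma_algebra (setT : set (completed_type P1)) (aug (completed P1) (F1 s)).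
  apply: aug_sigma_algebra; have [h' _] := filF1; have [sF _] := h' s s0; exact: sF.
apply/(measurable_wrtP _ sa); apply: measurable_Rd => k; apply: measurable_fun_rat => q.
apply: sub_sigma_algebra; have := h (pickle (k, q)); rewrite pickleK; exact.
Qed.

End sections_of_adapted_processes.

(** * Integration over the common noise *)

Lemma sqrt_le_1D {R : rcfType} (x y : R) : x <= y -> 0 <= y -> Num.sqrt x <= 1 + y.
Proof.
move=> xy y0; apply: le_trans (ler_wsqrtr xy) _.
have := sqr_sqrtr y0; have := sqr_ge0 (Num.sqrt y - 1); set s := Num.sqrt y => h1 h2.
have := sqrtr_ge0 y; rewrite -/s => s0; nra.
Qed.

Lemma coupling_bound_le {R : realType} (beta n e E L K x y : R) :
  0 < beta -> 1 <= n - 1 -> 0 <= e -> 0 <= E -> 0 <= L -> 0 <= x -> 0 <= y ->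
  e * Num.sqrt (2 * x + 2 * y) + Num.sqrt (L * (E * (4 * x) + K)) / (beta * Num.sqrt n) <=
  (e + 1 / (2 * beta * Num.sqrt (n - 1))) * (3 + 2 * (L * `|K|) + (2 + 8 * (L * E)) * x + 2 * y).
Proof.
move=> beta0 n1 e0 E0 L0 x0 y0.
have LK0 : 0 <= L * `|K| by rewrite mulr_ge0.
have LE0 : 0 <= L * E * x by rewrite !mulr_ge0.
have s1 : Num.sqrt (2 * x + 2 * y) <= 1 + (2 * x + 2 * y) by apply: sqrt_le_1D => //; lra.
have s2 : Num.sqrt (L * (E * (4 * x) + K)) <= 1 + (4 * (L * E * x) + L * `|K|).
  apply: sqrt_le_1D; last lra.
  rewrite mulrDr; apply: lerD; last by rewrite ler_wpM2l// ler_norm.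
  by rewrite le_eqVlt; apply/orP; left; apply/eqP; ring.
have -> : 3 + 2 * (L * `|K|) + (2 + 8 * (L * E)) * x + 2 * y =
  (1 + (2 * x + 2 * y)) + 2 * (1 + (4 * (L * E * x) + L * `|K|)) by ring.
have sn0 : 0 < Num.sqrt (n - 1) by rewrite sqrtr_gt0; exact: lt_le_trans n1.
have D0 : 0 < beta * Num.sqrt (n - 1) by rewrite mulr_gt0.
have sn : Num.sqrt (n - 1) <= Num.sqrt n by apply: ler_wsqrtr; rewrite gerBl.
move: s1 s2; set g1 := 1 + _; set g2 := 1 + _ => s1 s2.
have g10 : 0 <= g1 by rewrite /g1; lra.
have g20 : 0 <= g2 by rewrite /g2; lra.
rewrite [leRHS]mulrDl; apply: lerD; first by rewrite ler_wpM2l//; lra.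
apply: le_trans (_ : g2 / (beta * Num.sqrt (n - 1)) <= _).
  apply: ler_pM => //; rewrite ?sqrtr_ge0 ?invr_ge0 ?mulr_ge0 ?sqrtr_ge0 ?(ltW beta0)//.
  by rewrite lef_pV2 ?posrE// ?ler_pM2l// mulr_gt0// (lt_le_trans sn0).
have -> : 1 / (2 * beta * Num.sqrt (n - 1)) * (g1 + 2 * g2) = (g1 / 2 + g2) / (beta * Num.sqrt (n - 1)).
  by field; rewrite !gt_eqF.
by rewrite ler_pM2r ?invr_gt0//; lra.
Qed.

Theorem theorem1 (R : realType) (d : nat) (d_ge1 : (1 <= d)%N)
  (sigma sigma0 : R) (sigma_ge0 : 0 <= sigma) (sigma0_ge0 : 0 <= sigma0)
  (V W : 'rV[R]_d -> R) (beta LW : R)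
  (V_diff2 : twice_differentiable V) (W_diff2 : twice_differentiable W)
  (beta_gt0 : 0 < beta) (V_convex : hess_ge V beta)
  (gradV_lip : exists LV : R, eucl_lipschitz LV (grad V))
  (W_sym : forall x, W x = W (- x))
  (W_convex : convex_function [set: convex_lmodType 'rV[R]_d] (W : _ -> R^o))
  (gradW_lip : eucl_lipschitz LW (grad W))
  (P Q : P2P2Rd R d) :
  exists2 C : R, 0 < C &
  forall (disp0 disp1 : measure_display)
    (T0 : measurableType disp0) (T1 : measurableType disp1)
    (P0 : probability T0 R) (P1 : probability T1 R)
    (F0 : R -> set (set T0)) (F1 : R -> set (set T1))
    (B0 : R -> T0 -> 'rV[R]_d) (B : nat -> R -> T1 -> 'rV[R]_d),
  filtration F0 -> filtration F1 ->
  brownian_motion P0 F0 B0 ->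
  (forall i, brownian_motion P1 F1 (B i)) ->
  independent_sigma P1 (fun i => sigma_process (B i)) ->
  forall (N : nat), (2 <= N)%N ->
  forall (X XN : 'I_N -> R -> T0 * T1 -> 'rV[R]_d) (m : R -> T0 -> P2Rd R d),
  solves P0 P1 F0 F1 sigma sigma0 B0 (fun i : 'I_N => B i)
    (mckean_vlasov_drift V W m X) X ->
  (forall i, conditional_flow P0 P1 F0 (X i) m) ->
  conditionally_iid P0 P1 (F0 0) (fun i => X i 0) P ->
  solves P0 P1 F0 F1 sigma sigma0 B0 (fun i : 'I_N => B i)
    (particle_drift V W XN) XN ->
  conditionally_iid P0 P1 (F0 0) (fun i => XN i 0) Q ->
  forall t : R, 0 <= t ->
  ('E_(product_completed P0 P1)[fun w =>
      wasserstein2 (E := Rd R d) (@eucl_dist R d)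
        (empirical (fun i => X i t w : Rd R d))
        (empirical (fun i => XN i t w : Rd R d))]
   <= (C * (expR (- beta * t)
            + 1 / (2 * beta * Num.sqrt (N%:R - 1))))%:E)%E.
Proof.
have [L1 lipV1] := gradV_lip.
have lipV := eucl_lipschitz_sup lipV1; have lipW := eucl_lipschitz_sup gradW_lip.
set LVs := _ * _ in lipV; set LWs := _ * _ in lipW.
have max0 (x : R) : 0 <= Num.max x 0 * Num.sqrt d%:R by rewrite mulr_ge0 ?sqrtr_ge0// le_max lexx orbT.
have LVs0 : 0 <= LVs := max0 L1.
have LWs0 : 0 <= LWs := max0 LW.
pose K0 := @mv_diff_const R d LVs LWs sigma (8 * d%:R) beta.
pose E := expR (beta / 2).
have E0 : 0 <= E by exact: expR_ge0.
have L0 : 0 <= LW ^+ 2 by exact: sqr_ge0.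
pose a := 3 + 2 * (LW ^+ 2 * `|K0|).
pose b := 2 + 8 * (LW ^+ 2 * E).
have a0 : 0 < a by rewrite ltr_pwDl// mulr_ge0// mulr_ge0.
have b0 : 0 <= b by rewrite addr_ge0// mulr_ge0// mulr_ge0.
have [KP hKP] := mean_second_moment P; have [KQ hKQ] := mean_second_moment Q.
have KP0 := mean_le_ge0 hKP; have KQ0 := mean_le_ge0 hKQ.
(* [a] and [b] come from the coefficients, [KP] and [KQ] from the second moments under [P] and [Q];
   all are fixed before the probability spaces, [N] and [t]. *)
exists (a + b * KP + 2 * KQ).
  by rewrite -addrA ltr_pwDl// addr_ge0// mulr_ge0.
move=> disp0 disp1 T0 T1 P0 P1 F0 F1 B0 B filF0 filF1 BM0 BM indB N N2 X XN m.
move=> [adX cX eX] flow [mu [mmu lawmu iidX]] [adXN cXN eXN] [nu [mnu lawnu iidXN]] t t0.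
have mean0 (rho : T0 -> P2Rd R d) (Q' : P2P2Rd R d) K : measurable_wrt (F0 0) rho ->
    (forall U, measurable U -> P0 (rho @^-1` U) = P2_prob Q' U) ->
    mean_le (P2_prob Q') (second_moment : P2Rd R d -> R) K -> mean_le P0 (fun w0 => second_moment (rho w0)) K.
  move=> mrho lawrho [ms s0 hs].
  have mrho' : measurable_fun setT rho.
    have [h _] := filF0; have [_ mF] := h 0 (lexx 0).
    by move=> _ U mU; rewrite setTI; apply: mF; exact: mrho.
  split; [exact: measurableT_comp|by move=> w; exact: second_moment_ge0|].
  rewrite (ge0_integral_law (nu := P2_prob Q') (f := rho) (g := fun z => (second_moment z)%:E))//.
  exact/measurable_EFinP.
pose e := expR (- beta * t) + 1 / (2 * beta * Num.sqrt (N%:R - 1)).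
have N1 : 1 <= N%:R - 1 :> R.
  by rewrite lerBrDr -[1 + 1]/(2%:R) ler_nat.
have sN0 : 0 < Num.sqrt (N%:R - 1) :> R by rewrite sqrtr_gt0; exact: lt_le_trans N1.
have e0 : 0 <= e by rewrite addr_ge0 ?expR_ge0// divr_ge0// mulr_ge0 ?ltW// mulr_gt0.
(* The constant for the noise frozen at [w0]; its mean is at most the claimed constant, as [mu] and
   [nu] have laws [P] and [Q]. *)
pose G w0 := a + b * second_moment (mu w0) + 2 * second_moment (nu w0).
have [mG G0 hG] : mean_le P0 (fun w0 => e * G w0) (e * (a + b * KP + 2 * KQ)).
  apply: mean_leZ => //; apply: mean_leD; [apply: mean_leD|]; apply: mean_leZ || apply: mean_le_cst.
  all: rewrite ?(ltW a0)//.
  - exact: mean0 hKP.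
  - exact: mean0 hKQ.
rewrite unlock mulrC; apply: le_trans hG.
(* From here on the common noise is frozen: a bound for almost every [w0] remains. *)
apply: integral_product_completed_le => //.
  by move=> w; rewrite lee_fin sqrtr_ge0.
2: exact/measurable_EFinP.
have rat0 (p q : nat) : 0 <= p%:R / q.+1%:R :> R by rewrite divr_ge0.
(* One null set serves for the countably many times. The shift by 1 picks some later time of the
   filtration, of which only plain measurability is kept. *)
have mrat (Y : 'I_N -> R -> T0 * T1 -> 'rV[R]_d) :
    (forall i t, 0 <= t -> measurable_wrt (augmented_filtration P0 P1 F0 F1 t) (Y i t : T0 * T1 -> Rd R d)) ->
    {ae P0, forall w0 i (p q : nat), measurable_fun setT
      ((fun w1 => Y i (p%:R / q.+1%:R) (w0, w1)) : completed_type P1 -> Rd R d)}.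
  move=> adY; apply: filter_forall => i; apply: ae_foralln => p; apply: ae_foralln => q.
  have lt1 : p%:R / q.+1%:R < p%:R / q.+1%:R + 1 :> R by rewrite ltrDl.
  have := section_measurable_wrt filF0 filF1 (rat0 p q) lt1 (adY i _ (rat0 p q)).
  by apply: filterS => w0 h _ C mC; rewrite setTI; exact: (h C mC).1.
(* The times [1 / (n + 1)] reach all positive times, as the filtration is increasing. *)
have augX : {ae P0, forall w0 i n, measurable_wrt (aug (completed P1) (F1 n.+1%:R^-1))
    ((fun w1 => X i 0 (w0, w1)) : completed_type P1 -> Rd R d)}.
  apply: filter_forall => i; apply: ae_foralln => n.
  by apply: (section_measurable_wrt filF0 filF1 (lexx 0)); [rewrite invr_gt0|exact: adX].
have lawX : {ae P0, forall w0 i s, 0 <= s -> forall C : set (Rd R d), measurable C ->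
    completed P1 ((fun w1 => X i s (w0, w1)) @^-1` C) = P2_prob (m s w0) C}.
  apply: filter_forall => i; have [_] := flow i; apply: filterS => w0 h s s0 C mC.
  rewrite -(h s s0 C mC) /condlaw; congr (completed P1 _).
  by apply/seteqP; split => w1 //= /(_ ord0).
have mrX := mrat X adX; have mrXN := mrat XN adXN.
have pX := completed_ae_section cX; have pXN := completed_ae_section cXN.
have qX := completed_ae_section eX; have qXN := completed_ae_section eXN.
have ae := @filterI _ (almost_everywhere P0) (ae_filter_ringOfSetsType P0).
have := ae _ _ (ae _ _ (ae _ _ mrX mrXN) (ae _ _ augX lawX))
  (ae _ _ (ae _ _ (ae _ _ pX pXN) (ae _ _ qX qXN)) (ae _ _ iidX iidXN)).
apply: filterS => w0 [[[mX mXN] [aX lX]] [[[cw cwN] [ew ewN]] [iX iXN]]].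
have cpath : {ae completed P1, forall w1 i,
    {within `[0, +oo[, continuous (fun t => X i t (w0, w1))} /\
    {within `[0, +oo[, continuous (fun t => XN i t (w0, w1))}}.
  by apply: (@filterS2 _ _ (ae_filter_ringOfSetsType (completed P1)) _ _ _ _ cw cwN) => w1 h1 h2 i; split.
have epath : {ae completed P1, forall w1 i,
    (forall t, 0 <= t -> (forall k, lebesgue_measure.-integrable `[0, t] (fun s =>
        (mv_drift (grad V) (grad W) (fun s => P2_prob (m s w0)) s (X i s (w0, w1)) 0 k)%:E)) /\
      X i t (w0, w1) = X i 0 (w0, w1) + \row_k \int[lebesgue_measure]_(s in `[0, t])
        mv_drift (grad V) (grad W) (fun s => P2_prob (m s w0)) s (X i s (w0, w1)) 0 k
        + sigma *: B i t w1 + sigma0 *: B0 t w0) /\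
    (forall t, 0 <= t -> (forall k, lebesgue_measure.-integrable `[0, t] (fun s =>
        (pdrift (grad V) (grad W) (fun i s w1 => XN i s (w0, w1)) i s w1 0 k)%:E)) /\
      XN i t (w0, w1) = XN i 0 (w0, w1) + \row_k \int[lebesgue_measure]_(s in `[0, t])
        pdrift (grad V) (grad W) (fun i s w1 => XN i s (w0, w1)) i s w1 0 k
        + sigma *: B i t w1 + sigma0 *: B0 t w0)}.
  by apply: (@filterS2 _ _ (ae_filter_ringOfSetsType (completed P1)) _ _ _ _ ew ewN) => w1 h1 h2 i; split; [exact: h1|exact: h2].
have augx i (C : set (Rd R d)) : measurable C -> forall s, 0 < s ->
    aug (completed P1) (F1 s) ((fun w1 => X i 0 (w0, w1)) @^-1` C).
  move=> mC s s0; have [n hn] : exists n, n.+1%:R^-1 < s.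
    by have [n _ hn] := near_infty_natSinv_lt (PosNum s0); exists n; exact: (hn n (leqnn n)).
  have [mA [A FA hA]] := aX i n C mC; split => //; exists A => //.
  by have [_ h] := filF1; apply: (h n.+1%:R^-1 s) => //; exact: ltW.
pose h w1 := wasserstein2 (E := Rd R d) (@eucl_dist R d)
  (empirical (fun i => X i t (w0, w1) : Rd R d)) (empirical (fun i => XN i t (w0, w1) : Rd R d)).
have h0 w1 : 0 <= h w1 by exact: sqrtr_ge0.
have hle w1 : h w1 <= Num.sqrt (N%:R^-1 * \sum_i dot (X i t (w0, w1) - XN i t (w0, w1)) (X i t (w0, w1) - XN i t (w0, w1))).
  apply: le_trans (wasserstein2_empirical_le _ _ _ _) _; first exact: leq_trans N2.
  by under eq_bigr do rewrite sqr_eucl_norm.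
have := fixed_noise_bound (P := completed P1) (F := F1) (B := B)
  (@completed_complete _ _ _ P1) (completed_filtration P1 filF1)
  (fun i => completed_brownian filF1 (BM i)) (completed_independent filF1 BM indB) N2 LVs0 LWs0 lipV lipW
  beta_gt0 (hess_ge_monotone V_diff2 V_convex) (convex_grad_monotone W_diff2.1 W_convex)
  (even_grad W_diff2.1 W_sym) L0 (eucl_lipschitz_dot gradW_lip)
  (x := fun i s w1 => X i s (w0, w1)) (xn := fun i s w1 => XN i s (w0, w1))
  (c := fun s => sigma0 *: B0 s w0) (m := fun s => m s w0) (mu := P2_prob (mu w0)) (nu := P2_prob (nu w0))
  mX mXN cpath epath lX augx iX iXN (second_momentP _) (second_momentP _) t0 h0 hle.
move=> hb; apply: le_trans hb _; rewrite lee_fin -/K0 -/E.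
exact: (coupling_bound_le _ beta_gt0 N1 (expR_ge0 _) E0 L0 (second_moment_ge0 _) (second_moment_ge0 _)).
Qed.
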